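(* Let $m=\{m_\alpha\}$ be $W$-invariant positive integers and $m-1=\{m_\alpha-1\}$. There exists a difference operator $S^-=S_m^-$ in $x$ which intertwines the Macdonald operators $D_m$ and $D_{m-1}$ (with $t=q^{-m}$ and $t=q^{-m+1}$ respectively): $$D_{m-1}\circ S_m^-=S_m^-\circ D_m .$$ It has the form $S^-=\sum_{\tau\in W\varrho^\vee}b_\tau T^\tau+\dots$, where the dots stand for a sum of lower terms $b_\nu T^\nu$ with $\nu\in\varrho^\vee+Q^\vee$ lying inside the convex hull of the orbit $W\varrho^\vee$, and the leading coefficients are $$b_{\varrho^\vee}(x)=(-1)^{|R_+|}q^{-\sum_{\alpha\in R_+}m_\alpha}\,\frac{\Delta_{-m}(x+\varrho^\vee)}{\Delta_{1-m}(x)},\qquad b_{w\varrho^\vee}(x)=b_{\varrho^\vee}(w^{-1}x)\quad(w\in W),$$ where $\varrho^\vee=\frac12\sum_{\alpha\in R_+}\alpha^\vee$ and $\Delta_{-m}(x)=\prod_{\alpha\in R_+}\prod_{j=1}^{m_\alpha}\bigl(q^{-(\alpha,x)}-q^{-2j+(\alpha,x)}\bigr)^{-1}$. Application of $S_m^-$ to the normalized Baker--Akhiezer function $\psi_m$ gives $$S_m^-\psi_m=c_m(z)c_m(-z)\psi_{m-1},\qquad c_m(z)=\prod_{\alpha\in R_+}[m_\alpha-(\alpha^\vee,z)].$$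
   Context: $V=\mathbb R^n$ is a Euclidean space with scalar product $(\cdot,\cdot)$, extended complex-bilinearly to $V\otimes\mathbb C$; variables $x,z$ range over $V\otimes\mathbb C$. $R\subset V$ is a reduced irreducible root system of rank $n$, $R_+$ positive roots, $W$ the Weyl group, $\alpha^\vee=2\alpha/(\alpha,\alpha)$, $Q^\vee$ the lattice generated by the $\alpha^\vee$, $P^\vee=\{\pi:(\pi,\alpha)\in\mathbb Z\ \forall\alpha\in R\}$. $q\in\mathbb C^\times$ is not a root of unity, $\log q$ fixed, $q^a=e^{a\log q}$, $[a]=q^a-q^{-a}$, $(T^vf)(x)=f(x+v)$. A difference operator is a finite sum $\sum_{\nu\in P^\vee}d_\nu(x)T^\nu$. A coweight $\pi\in P^\vee$ is minuscule if $|(\pi,\alpha)|\le1$ for all $\alpha\in R$, quasiminuscule if $\pi\in R^\vee$ and $|(\pi,\alpha)|\le1$ for all $\alpha\in R\setminus\{\pm\pi^\vee\}$, $\pi^\vee=2\pi/(\pi,\pi)$; (quasi)minuscule means nonzero and one of these. For a (quasi)minuscule coweight $\pi$ the Macdonald operator with $t=q^{-m}$ is $$D_m=\sum_{\tau\in W\pi}a_\tau(T^\tau-1)+\sum_{\tau\in W\pi}q^{2(\rho,\tau)},\quad a_\tau(x)=\prod_{\alpha\in R,(\alpha,\tau)>0}\frac{[(\alpha,x)-m_\alpha]}{[(\alpha,x)]}\prod_{\alpha\in R,(\alpha,\tau)=2}\frac{[(\alpha,x)-m_\alpha+1]}{[(\alpha,x)+1]},\quad\rho=\tfrac12\sum_{\alpha\in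 R_+}m_\alpha\alpha.$$ Let $\rho^\vee=\frac12\sum_{\alpha\in R_+}m_\alpha\alpha^\vee$, $\mathcal N=\{\rho^\vee-\sum_{\alpha\in R_+}l_\alpha\alpha^\vee:0\le l_\alpha\le m_\alpha\}$. The normalized Baker--Akhiezer function $\psi_m$ is the unique function $\psi(x,z)=q^{2(x,z)}\sum_{\nu\in\mathcal N\cap P^\vee}\psi_\nu(x)q^{2(\nu,z)}$ such that $\psi(x,z+\frac12s\alpha)=\psi(x,z-\frac12s\alpha)$ whenever $q^{2(\alpha^\vee,z)}=1$, for all $\alpha\in R$, $s=1,\dots,m_\alpha$, and $\psi_{\rho^\vee}(x)=\prod_{\alpha\in R_+}\prod_{j=1}^{m_\alpha}[j-(\alpha,x)]$. *)

(* Defs.v *)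
From HB Require Import structures.
From mathcomp Require Import all_boot all_order all_algebra.
From mathcomp Require Import finmap.
From mathcomp Require Import all_classical all_reals all_analysis.
From mathcomp Require Import complex.

Set Implicit Arguments.
Unset Strict Implicit.
Unset Printing Implicit Defensive.

Import Order.TTheory GRing.Theory Num.Theory.
Import numFieldNormedType.Exports.

Local Open Scope classical_set_scope.
Local Open Scope ring_scope.
Local Open Scope complex_scope.

(* The bare type R[i] has no inferred topology; as a numClosedFieldType it gets
   one, and 'rV[Cplx R]_n becomes a normed space over it, so that
   "differentiable" below means complex-differentiable. *)
Definition Cplx (R : realType) : numClosedFieldType := R[i].

Definition cexp (R : realType) (z : Cplx R) : Cplx R :=
  (expR (complex.Re z))%:C * (cos (complex.Im z) +i* sin (complex.Im z)).

Definition cvec (R : realType) (n : nat) (v : 'rV[R]_n) : 'rV[Cplx R]_n :=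
  map_mx (real_complex R) v.

(* Used both for the scalar product of R^n and for its bilinear (not
   sesquilinear) extension to C^n. *)
Definition dot (K : pzRingType) (n : nat) (u v : 'rV[K]_n) : K :=
  (u *m v^T) 0 0.

Definition coroot (R : realType) (n : nat) (a : 'rV[R]_n) : 'rV[R]_n :=
  (2 / dot a a) *: a.

(* Matrices act on row vectors on the right:
   b *m refl_mx a = b - (b, a^vee) a. *)
Definition refl_mx (R : realType) (n : nat) (a : 'rV[R]_n) : 'M[R]_n :=
  1%:M - (coroot a)^T *m a.

Record reduced_irreducible_root_system (R : realType) (n : nat)
    (Phi : {fset 'rV[R]_n}) : Prop := RootSystem {
  roots_neq0 : 0 \notin Phi;
  roots_span : (<<enum_fset Phi>> = fullv)%VS;
  roots_refl : forall a b, a \in Phi -> b \in Phi -> b *m refl_mx a \in Phi;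
  roots_int : forall a b, a \in Phi -> b \in Phi ->
    dot (coroot a) b \is a Num.int;
  roots_reduced : forall a (c : R), a \in Phi -> c *: a \in Phi ->
    c = 1 \/ c = -1;
  roots_nonempty : Phi <> fset0;
  roots_irreducible : forall A B : {fset 'rV[R]_n}, Phi = (A `|` B)%fset ->
    (forall a b, a \in A -> b \in B -> dot a b = 0) -> A = fset0 \/ B = fset0
}.

Definition positive_roots (R : realType) (n : nat)
    (Phi Rp : {fset 'rV[R]_n}) : Prop :=
  exists h : 'rV[R]_n, (forall a, a \in Phi -> dot a h != 0) /\
    Rp = [fset a in Phi | 0 < dot a h]%fset.

(* Reflections are involutions, so the monoid they generate is a group. *)
Inductive weyl (R : realType) (n : nat) (Phi : {fset 'rV[R]_n}) :
    'M[R]_n -> Prop :=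
| weyl1 : weyl Phi 1%:M
| weylM a w : a \in Phi -> weyl Phi w -> weyl Phi (refl_mx a *m w).

Definition weyl_orbit (R : realType) (n : nat) (Phi : {fset 'rV[R]_n})
    (v : 'rV[R]_n) : set 'rV[R]_n :=
  [set v *m w | w in [set w | weyl Phi w]].

Definition coroot_lattice (R : realType) (n : nat) (Phi : {fset 'rV[R]_n}) :
    set 'rV[R]_n :=
  [set v | exists k : 'rV[R]_n -> int, v = \sum_(a <- Phi) coroot a *~ k a].

Definition coweight_lattice (R : realType) (n : nat) (Phi : {fset 'rV[R]_n}) :
    set 'rV[R]_n :=
  [set v | forall a, a \in Phi -> dot v a \is a Num.int].

Definition minuscule (R : realType) (n : nat) (Phi : {fset 'rV[R]_n})
    (p : 'rV[R]_n) : Prop :=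
  forall a, a \in Phi -> `|dot p a| <= 1.

Definition quasiminuscule (R : realType) (n : nat) (Phi : {fset 'rV[R]_n})
    (p : 'rV[R]_n) : Prop :=
  (exists2 a, a \in Phi & p = coroot a) /\
  (forall a, a \in Phi -> a <> coroot p -> a <> - coroot p ->
    `|dot p a| <= 1).

Definition quasi_or_minuscule (R : realType) (n : nat)
    (Phi : {fset 'rV[R]_n}) (p : 'rV[R]_n) : Prop :=
  [/\ p != 0, coweight_lattice Phi p &
      minuscule Phi p \/ quasiminuscule Phi p].

Definition convex_hull (R : realType) (n : nat) (A : set 'rV[R]_n) :
    set 'rV[R]_n :=
  [set v | exists (k : nat) (t : 'I_k -> R) (p : 'I_k -> 'rV[R]_n),
    [/\ forall i, 0 <= t i, \sum_i t i = 1, forall i, A (p i) &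
        v = \sum_i t i *: p i]].

Definition rho (R : realType) (n : nat) (Rp : {fset 'rV[R]_n})
    (m : 'rV[R]_n -> nat) : 'rV[R]_n :=
  2^-1 *: \sum_(a <- Rp) (m a)%:R *: a.

Definition rho_vee (R : realType) (n : nat) (Rp : {fset 'rV[R]_n})
    (m : 'rV[R]_n -> nat) : 'rV[R]_n :=
  2^-1 *: \sum_(a <- Rp) (m a)%:R *: coroot a.

Definition varrho_vee (R : realType) (n : nat) (Rp : {fset 'rV[R]_n}) :
    'rV[R]_n :=
  2^-1 *: \sum_(a <- Rp) coroot a.

(* Meromorphic functions are represented by total functions with arbitrary
   values on the polar locus; identities between them are required on a dense
   open set only. *)
Definition generically (R : realType) (n : nat) (P : 'rV[Cplx R]_n -> Prop) :
    Prop :=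
  dense (interior [set x | P x]).

Definition holomorphic_on (R : realType) (n : nat) (U : set 'rV[Cplx R]_n)
    (f : 'rV[Cplx R]_n -> Cplx R) : Prop :=
  forall x, U x -> differentiable f x.

Definition meromorphic (R : realType) (n : nat)
    (f : 'rV[Cplx R]_n -> Cplx R) : Prop :=
  forall p, exists (U : set 'rV[Cplx R]_n) (g h : 'rV[Cplx R]_n -> Cplx R),
    [/\ open_nbhs p U, holomorphic_on U g, holomorphic_on U h,
        U `<=` closure [set x | U x /\ h x != 0] &
        forall x, U x -> h x != 0 -> f x = g x / h x].

Definition op_support (R : realType) (n : nat)
    (d : 'rV[R]_n -> 'rV[Cplx R]_n -> Cplx R) : set 'rV[R]_n :=
  [set nu | d nu <> (fun=> 0)].

Record difference_operator (R : realType) (n : nat) (Phi : {fset 'rV[R]_n})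
    (d : 'rV[R]_n -> 'rV[Cplx R]_n -> Cplx R) : Prop := DifferenceOperator {
  op_finite : finite_set (op_support d);
  op_coweight : op_support d `<=` coweight_lattice Phi;
  op_meromorphic : forall nu, meromorphic (d nu)
}.

Definition op_apply (R : realType) (n : nat)
    (d : 'rV[R]_n -> 'rV[Cplx R]_n -> Cplx R)
    (f : 'rV[Cplx R]_n -> Cplx R) (x : 'rV[Cplx R]_n) : Cplx R :=
  \sum_(nu \in op_support d) d nu x * f (x + cvec nu).

(* Since f is arbitrary, A = B at a point x off the poles amounts to equality
   of all the coefficients of A and B at x. *)
Definition op_eq (R : realType) (n : nat)
    (A B : ('rV[Cplx R]_n -> Cplx R) -> ('rV[Cplx R]_n -> Cplx R)) : Prop :=
  generically (fun x => forall f, A f x = B f x).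

(* lq stands for the fixed value of log q. *)
Definition qpow (R : realType) (lq a : Cplx R) : Cplx R := cexp (a * lq).

Definition qnum (R : realType) (lq a : Cplx R) : Cplx R :=
  qpow lq a - qpow lq (- a).

Definition macdonald_coef (R : realType) (n : nat) (lq : Cplx R)
    (Phi : {fset 'rV[R]_n}) (m : 'rV[R]_n -> nat) (tau : 'rV[R]_n)
    (x : 'rV[Cplx R]_n) : Cplx R :=
  (\prod_(a <- Phi | 0 < dot a tau)
     (qnum lq (dot (cvec a) x - (m a)%:R) / qnum lq (dot (cvec a) x))) *
  (\prod_(a <- Phi | dot a tau == 2)
     (qnum lq (dot (cvec a) x - (m a)%:R + 1) /
      qnum lq (dot (cvec a) x + 1))).

Definition macdonald (R : realType) (n : nat) (lq : Cplx R)
    (Phi Rp : {fset 'rV[R]_n}) (p : 'rV[R]_n) (m : 'rV[R]_n -> nat)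
    (f : 'rV[Cplx R]_n -> Cplx R) (x : 'rV[Cplx R]_n) : Cplx R :=
  (\sum_(tau \in weyl_orbit Phi p)
     macdonald_coef lq Phi m tau x * (f (x + cvec tau) - f x)) +
  (\sum_(tau \in weyl_orbit Phi p) qpow lq (2 * (dot (rho Rp m) tau)%:C)) * f x.

(* The l_a are real: this is a polytope, which is then intersected with the
   coweight lattice. *)
Definition BA_polytope (R : realType) (n : nat) (Rp : {fset 'rV[R]_n})
    (m : 'rV[R]_n -> nat) : set 'rV[R]_n :=
  [set v | exists l : 'rV[R]_n -> R,
    (forall a, a \in Rp -> 0 <= l a <= (m a)%:R) /\
    v = rho_vee Rp m - \sum_(a <- Rp) l a *: coroot a].

(* psi is only determined where its leading coefficient is nonzero, hence the
   restriction to generic x; z is arbitrary. *)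
Definition normalized_BA (R : realType) (n : nat) (lq : Cplx R)
    (Phi Rp : {fset 'rV[R]_n}) (m : 'rV[R]_n -> nat)
    (psi : 'rV[Cplx R]_n -> 'rV[Cplx R]_n -> Cplx R) : Prop :=
  exists psi_ : 'rV[R]_n -> 'rV[Cplx R]_n -> Cplx R,
  generically (fun x =>
    [/\ forall z, psi x z = qpow lq (2 * dot x z) *
          \sum_(nu \in BA_polytope Rp m `&` coweight_lattice Phi)
             psi_ nu x * qpow lq (2 * dot (cvec nu) z),
        forall (a : 'rV[R]_n) (s : nat) (z : 'rV[Cplx R]_n),
          a \in Phi -> (1 <= s <= m a)%N ->
          qpow lq (2 * dot (cvec (coroot a)) z) = 1 ->
          psi x (z + (s%:R / 2) *: cvec a) = psi x (z - (s%:R / 2) *: cvec a)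
      & psi_ (rho_vee Rp m) x =
          \prod_(a <- Rp) \prod_(1 <= j < (m a).+1)
             qnum lq (j%:R - dot (cvec a) x)]).

(* Delta_neg m is Delta_{-m}. *)
Definition Delta_neg (R : realType) (n : nat) (lq : Cplx R)
    (Rp : {fset 'rV[R]_n}) (m : 'rV[R]_n -> nat) (x : 'rV[Cplx R]_n) :
    Cplx R :=
  \prod_(a <- Rp) \prod_(1 <= j < (m a).+1)
     (qpow lq (- dot (cvec a) x) - qpow lq (- (2 * j%:R) + dot (cvec a) x))^-1.

Definition c_factor (R : realType) (n : nat) (lq : Cplx R)
    (Rp : {fset 'rV[R]_n}) (m : 'rV[R]_n -> nat) (z : 'rV[Cplx R]_n) :
    Cplx R :=
  \prod_(a <- Rp) qnum lq ((m a)%:R - dot (cvec (coroot a)) z).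

(* Main.v *)
(* For generic x a normalized Baker-Akhiezer function psi is constructed as an
   eigenfunction, in the spectral variable z, of the Macdonald operator attached
   to the orbit of short roots: this operator preserves the quasi-invariance
   conditions and is triangular on quasi-invariant exponential sums. Uniqueness
   rests on a convexity property: for non-resonant x, if the exponent of a
   quasi-invariant sum highest in a generic direction h is v, then v - rho_h + N
   lies in the convex hull of its support, where rho_h is the vertex of N in the
   direction h; this is seen by crossing walls one at a time, since each wall
   crossed forces a full root string of exponents. Hence a quasi-invariant sum
   supported in N that vanishes at one vertex is zero.

   By quasi-invariance, psi(x, z) takes the same value g(x) at all z = (1/2)
   sum_{(a,h)>0} m_a a. On generic lines in x, g is a rational function of q^t
   without poles at finite nonzero q^t and bounded at both ends, hence it is
   constant; it is nonzero because the leading part of psi along the line is a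
   product. The function (D_m - E(z)) psi, with E(z) the orbit sum, is quasi-
   invariant with support in N, so it is B(x) psi for some B; evaluating at the
   point where psi is the constant g gives B = 0.

   The product c_m(z) c_m(-z) psi_{m-1} satisfies the conditions of level m, so
   it is a combination sum_nu b_nu(x) psi_m(x + nu, z): the b_nu are found by
   matching coefficients at the exponents rho^vee + nu, and the difference
   vanishes by convexity. This defines S. Both D_{m-1} S and S D_m act on psi_m
   in the same way, and a difference operator annihilating psi_m(x, z) for all z
   is zero. *)

Require Import Defs.
From HB Require Import structures.
From mathcomp Require Import all_boot all_order all_algebra.
From mathcomp Require Import finmap.
From mathcomp Require Import all_classical all_reals all_analysis.
From mathcomp Require Import complex.
From mathcomp Require Import ring lra zify.

Set Implicit Arguments.
Unset Strict Implicit.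
Unset Printing Implicit Defensive.

Import Order.TTheory GRing.Theory Num.Theory.
Import numFieldNormedType.Exports.

Local Open Scope classical_set_scope.
Local Open Scope ring_scope.

(** Apart from the exponential itself and the final passage to the theorem, the argument runs over
    an abstract closed field with a map [E] in the role of a -> q^a, subject only to the axioms of
    [qexponential]. Genericity of x means there that one exponential sum is nonzero; such sums form
    a domain, so finitely many generic conditions can be imposed at once. The short roots serve
    because they are quasiminuscule coweights of the dual system and exist in every type. The
    obstacle is the constancy of g: psi could have poles in x where two exponents of one string
    become indistinguishable. The polar part would be a quasi-invariant eigenfunction whose
    coefficients at the vertices of N all vanish, since those of psi are products without poles; an
    analysis of the dual spectrum on these hyperplanes excludes it. The level m_a = 0 occurs for m -
    1 and is allowed until the operator is constructed. The level m + 1 appears because N_{m-1} + 2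
    N_1 = N_m + N_1 = N_{m+1}, with N_k the polytope of level k, is the common support of both sides
    of the equation defining S. *)

Module ComplexExponential.

(** * The complex exponential: surjectivity, kernel and complex differentiability *)

Section ComplexExponential.
Context {R : realType}.
Local Notation C := (Cplx R).
Implicit Types (a b z : C) (r s : R).

Local Notation i := ('i%C : C).

Lemma cplxE z : z = (complex.Re z)%:C%C + i * (complex.Im z)%:C%C.
Proof. by case: z => u v; simpc. Qed.

Lemma cexp0 : cexp (0 : C) = 1.
Proof. by rewrite /cexp /= expR0 cos0 sin0; simpc. Qed.

Lemma cexpD a b : cexp (a + b) = cexp a * cexp b.
Proof.
case: a b => [x y] [u v]; rewrite /cexp /= expRD sinD cosD; simpc.
by congr (_ +i* _)%C; ring.
Qed.

Lemma cexp_neq0 a : cexp a != 0.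
Proof.
apply/eqP => h; have := cexpD a (- a); rewrite subrr cexp0 h mul0r.
by move/eqP; rewrite oner_eq0.
Qed.

Lemma cexpN a : cexp (- a) = (cexp a)^-1.
Proof.
apply: (mulfI (cexp_neq0 a)); rewrite -cexpD subrr cexp0 divff //.
exact: cexp_neq0.
Qed.

(** Polar form: the real part of the logarithm is ln |z|; the imaginary part is the arccosine of the
    real part of u = z/|z|, with the sign of Im u. *)
Lemma cexp_surj z : z != 0 -> exists w : C, cexp w = z.
Proof.
move=> z0; set r := complex.Re `|z|.
have rE : `|z| = r%:C%C by rewrite /r normc_def.
have r0 : 0 < r.
  by move: (normr_gt0 z); rewrite z0 rE -[0]/((0:R)%:C%C) ltcR.
have [lr lrE] := expR_total r0.
set u := z / `|z|.
have un : `|u| = 1 by rewrite normrM normfV normr_id divff // normr_eq0.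
have zE : z = `|z| * u by rewrite /u mulrC divfK // normr_eq0.
have u2 : complex.Re u ^+ 2 + complex.Im u ^+ 2 = 1.
  by apply: complexI; rewrite add_Re2_Im2 un expr1n.
have cu : -1 <= complex.Re u <= 1.
  have h : complex.Re u ^+ 2 <= 1 by rewrite -u2 lerDl sqr_ge0.
  by rewrite -ler_norml -(@expr_le1 _ 2)//= real_normK ?num_real.
have [sg|sg] := leP 0 (complex.Im u).
- exists (lr +i* acos (complex.Re u))%C; rewrite /cexp /= lrE acosK; last by rewrite in_itv.
  rewrite sin_acos // -u2 addrAC subrr add0r sqrtr_sqr ger0_norm //.
  by rewrite [RHS]zE rE; case: (u).
- exists (lr +i* (- acos (complex.Re u)))%C; rewrite /cexp /= lrE cosN sinN acosK; last by rewrite in_itv.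
  rewrite sin_acos // -u2 addrAC subrr add0r sqrtr_sqr ltr0_norm // opprK.
  by rewrite [RHS]zE rE; case: (u).
Qed.

(** Periodicity reduces r to its fractional part s in [0, 1), and the cosine is injective on
    [0, pi]: this settles s <= 1/2, and 1 - s takes the place of s beyond it. *)
Lemma cos_eq1_int r : cos (r * (pi *+ 2)) = 1 -> exists k : int, r = k%:~R.
Proof.
set k := Num.floor r => cr.
have rk : k%:~R <= r < (k + 1)%:~R by rewrite ge_floor floorD1_gt.
set s := r - k%:~R.
have cs : cos (s * (pi *+ 2)) = 1.
  rewrite -cr /s; have -> : r * (pi *+ 2) = (r - k%:~R) * (pi *+ 2) + (pi *+ 2) *~ k.
    by rewrite -mulrzl; ring.
  by move: (k) => [j|j]; rewrite ?NegzE ?mulrNz; [have := @periodicn _ _ _ _ (@cosD2pi R) j ((r - j%:~R) * (pi *+ 2)) |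
    have := @periodicn _ _ _ _ (@cosD2pi R) j.+1 ((r - (- j.+1%:Z)%:~R) * (pi *+ 2) - (pi *+ 2) *+ j.+1)];
    rewrite -?pmulrn ?subrK => ->.
have s01 : 0 <= s < 1.
  by move: rk; rewrite /s subr_ge0 rmorphD /= => /andP[-> ?]; rewrite ltrBlDl.
exists k; apply/eqP; rewrite -subr_eq0 -/s; apply/eqP.
have p0 : 0 < (pi : R) by exact: pi_gt0.
have [h|h] := leP s 2^-1.
- have : s * (pi *+ 2) = 0 :> R.
    apply: (@cos_inj R); rewrite ?cs ?cos0 // in_itv /= ?lexx ?pi_ge0 //.
    by apply/andP; case/andP: s01 => s0 s1; rewrite mulr2n; split; nra.
  by move/eqP; rewrite mulf_eq0 mulrn_eq0 /= (gt_eqF p0) orbF => /eqP.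
- have : (1 - s) * (pi *+ 2) = 0 :> R.
    apply: (@cos_inj R); rewrite ?cos0 ?in_itv /= ?lexx ?pi_ge0 //.
      by case/andP: s01 => s0 s1; rewrite mulr2n; apply/andP; split; nra.
    have -> : (1 - s) * (pi *+ 2) = - (s * (pi *+ 2)) + pi *+ 2 by ring.
    by rewrite cosD2pi cosN.
  move/eqP; rewrite mulf_eq0 mulrn_eq0 /= (gt_eqF p0) orbF subr_eq0 => /eqP s1.
  by move: s01; rewrite -s1 ltxx andbF.
Qed.

Definition twopii : C := i * (pi *+ 2)%:C%C.

Lemma twopii_neq0 : twopii != 0.
Proof.
rewrite mulf_neq0 //; first by apply/eqP => -[]; move/eqP; rewrite oner_eq0.
apply/eqP => -[] /eqP; rewrite mulrn_eq0 /= gt_eqF //; exact: pi_gt0.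
Qed.

Lemma cexp_twopii (k : int) : cexp (k%:~R * twopii) = 1.
Proof.
have e1 : cexp twopii = 1.
  by rewrite /twopii /cexp /=; simpc; rewrite /= cos2pi sin2pi expR0; simpc.
have en (j : nat) : cexp (j%:R * twopii) = 1.
  elim: j => [|j IH]; first by rewrite mul0r cexp0.
  by rewrite -natr1 mulrDl mul1r cexpD IH e1 mulr1.
case: k => j; first exact: en.
by rewrite NegzE mulrNz mulNr cexpN en invr1.
Qed.

Lemma cexp_eq1 z : cexp z = 1 -> exists k : int, z = k%:~R * twopii.
Proof.
case: z => x y; rewrite /cexp /=; simpc => -[h1 h2].
have x0 : x = 0.
  apply: expR_inj; rewrite expR0; apply/eqP.
  have h : expR x ^+ 2 = 1.
    rewrite -[LHS]mulr1 -(cos2Dsin2 y) mulrDr -!exprMn h1 h2.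
    by rewrite cos2Dsin2 expr0n addr0 expr1n.
  by rewrite -(@eqrXn2 _ 2) ?expR_ge0 // h expr1n.
move: h1 h2; rewrite x0 expR0 !mul1r => h1 h2.
have p0 : (pi : R) *+ 2 != 0 by rewrite mulrn_eq0 /= gt_eqF // pi_gt0.
have [k kE] : exists k : int, y / (pi *+ 2) = k%:~R.
  by apply: cos_eq1_int; rewrite divfK.
exists k; rewrite /twopii.
have -> : y = k%:~R * (pi *+ 2) by rewrite -kE divfK.
have kC : (k%:~R : C) = (k%:~R : R)%:C%C by rewrite rmorph_int.
by rewrite kC; simpc.
Qed.

Lemma sin_le_norm r : `|sin r| <= `|r|.
Proof.
have aux s : 0 <= s -> `|sin s| <= `|s|.
  move=> s0; have cn : {within `[0, s], continuous (@sin R)}.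
    by apply: continuous_subspaceT => x; exact: continuous_sin.
  have [c _ ] := @MVT_segment R sin cos 0 s s0 (fun x _ => is_derive_sin x) cn.
  rewrite sin0 !subr0 => ->; rewrite normrM ler_piMl //; exact: cos_max.
have [/aux //|r0] := leP 0 r.
by have := aux (- r); rewrite sinN !normrN; apply; rewrite oppr_ge0 ltW.
Qed.

Lemma cos_sub1_norm r : `|cos r - 1| <= r ^+ 2 / 2.
Proof.
have -> : cos r = 1 - 2 * sin (r / 2) ^+ 2.
  by rewrite {1}(_ : r = (r / 2) *+ 2); [rewrite cos_mulr2n cos2sin2; ring | field].
have -> : `|1 - 2 * sin (r / 2) ^+ 2 - 1| = 2 * `|sin (r / 2)| ^+ 2.
  rewrite real_normK ?num_real // (_ : _ - 1 = - (2 * sin (r / 2) ^+ 2)); last by ring.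
  by rewrite normrN ger0_norm // mulr_ge0 // sqr_ge0.
have := sin_le_norm (r / 2).
have h0 := normr_ge0 (sin (r / 2)).
rewrite -(@ler_pXn2r _ 2) ?nnegrE ?normr_ge0 // => h.
apply: (@le_trans _ _ (2 * `|r / 2| ^+ 2)); first by rewrite ler_pM2l.
by rewrite real_normK ?num_real // expr_div_n; lra.
Qed.

Lemma sin_sub_norm r : `|sin r - r| <= `|r| * (r ^+ 2 / 2).
Proof.
have aux s : 0 <= s -> `|sin s - s| <= `|s| * (s ^+ 2 / 2).
  move=> s0; have cn : {within `[0, s], continuous (fun x : R => sin x - x)}.
    apply: continuous_subspaceT => x; apply: continuousB; [exact: continuous_sin|exact: id].
  have dn : forall x, x \in `]0, s[ -> is_derive x 1 (fun x : R => sin x - x) (cos x - 1).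
    by move=> x _; apply: is_deriveB.
  have [c cs] := @MVT_segment R _ _ 0 s s0 dn cn.
  rewrite sin0 !subr0 => ->; rewrite normrM mulrC ler_wpM2l //.
  apply: le_trans (cos_sub1_norm _) _; rewrite ler_pM2r // ler_pXn2r //.
  - by move: cs; rewrite in_itv /= => /andP[].
  - by move: cs; rewrite in_itv /= => /andP[].
have [/aux //|r0] := leP 0 r.
have := aux (- r); rewrite oppr_ge0 ltW // sinN -opprB !opprK normrN sqrrN => /(_ isT).
by rewrite addrC (normrN r).
Qed.

Lemma expR_sub_norm r : `|r| <= 2^-1 -> `|expR r - 1 - r| <= 2 * r ^+ 2.
Proof.
rewrite ler_norml => /andP[r1 r2].
have h1 := expR_ge1Dx r; have h2 := expR_ge1Dx (- r).
have e0 := expR_gt0 r; have := expRxMexpNx_1 r => e1.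
rewrite ger0_norm; last by lra.
have : expR r * (1 - r) <= 1.
  by rewrite -[leRHS]e1 ler_pM2l.
nra.
Qed.

(** Real and imaginary parts are estimated separately, by 3 |z|^2 ([A]) and 5 |z|^2 ([B]), so 12
    leaves ample room. Only the quadratic order matters for differentiability. *)
Lemma cexp_sub_norm z : `|z| <= 2^-1 -> `|cexp z - 1 - z| <= 12 * `|z| ^+ 2.
Proof.
case: z => x y zh; set z := (x +i* y)%C.
have [X XE] : exists X : R, `|z| = X%:C%C by eexists; rewrite normc_def.
have X0 : 0 <= X by rewrite -ler0c -XE normr_ge0.
have X2 : X ^+ 2 = x ^+ 2 + y ^+ 2.
  by apply: complexI; rewrite rmorphXn /= -XE -add_Re2_Im2.
have Xh : X <= 2^-1.
  by move: zh; rewrite -/z XE -lecR (_ : (2^-1%:C)%C = 2^-1) // fmorphV rmorph_nat.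
have xX : `|x| <= X.
  by rewrite -(@ler_pXn2r _ 2) ?nnegrE ?normr_ge0 // real_normK ?num_real // X2 lerDl sqr_ge0.
have yX : `|y| <= X.
  by rewrite -(@ler_pXn2r _ 2) ?nnegrE ?normr_ge0 // real_normK ?num_real // X2 lerDr sqr_ge0.
have tri (w : C) : `|w| <= (`|complex.Re w| + `|complex.Im w|)%:C%C.
  rewrite {1}(cplxE w); apply: le_trans (ler_normD _ _) _; rewrite normrM.
  by rewrite !normc_def /= !expr0n /= ?expr1n !addr0 ?add0r sqrtr1 mul1r !sqrtr_sqr rmorphD.
apply: le_trans (tri _) _; rewrite XE -rmorphXn /=.
have -> : (12 : C) = (12 : R)%:C%C by rewrite rmorph_nat.
rewrite -rmorphM lecR /z /cexp /=; simpc => /=.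
have ex := expR_sub_norm (le_trans xX Xh).
have cy := cos_sub1_norm y; have sy := sin_sub_norm y; have sy' := sin_le_norm y.
have xx : x ^+ 2 <= X ^+ 2 by rewrite X2 lerDl sqr_ge0.
have yy : y ^+ 2 <= X ^+ 2 by rewrite X2 lerDr sqr_ge0.
have sq0 := sqr_ge0 X.
have ex2 : expR x <= 2.
  move: ex; rewrite ler_norml => /andP[_ ex].
  have : x <= 2^-1 by apply: le_trans (ler_norm _) (le_trans xX Xh).
  have : X ^+ 2 <= 4^-1 by nra.
  lra.
have e0 := expR_ge0 x.
have A : `|expR x * cos y - 1 - x| <= 2 * X^+2 + X^+2.
  have -> : expR x * cos y - 1 - x = (expR x - 1 - x) + expR x * (cos y - 1) by ring.
  apply: le_trans (ler_normD _ _) _; rewrite normrM (ger0_norm e0).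
  apply: lerD; first by lra.
  have n0 := normr_ge0 (cos y - 1); nra.
have B : `|expR x * sin y - y| <= 4 * X ^+2 + X ^+ 2.
  have -> : expR x * sin y - y = (expR x - 1 - x) * sin y + x * sin y + (sin y - y) by ring.
  apply: le_trans (ler_normD _ _) _; apply: lerD; last first.
    have n0 := normr_ge0 y; have := sqr_ge0 y; nra.
  apply: le_trans (ler_normD _ _) _; rewrite !normrM.
  have n1 := normr_ge0 (sin y); have n2 := normr_ge0 x; have n3 := normr_ge0 (expR x - 1 - x).
  have n4 := normr_ge0 y.
  have : `|x| * `|sin y| <= X * X by rewrite ler_pM // (le_trans sy').
  have : `|expR x - 1 - x| * `|sin y| <= (2 * X ^+ 2) * 1 by rewrite ler_pM ?sin_max //; lra.
  rewrite expr2; nra.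
lra.
Qed.

Lemma derivable_cexp z : derivable (@cexp R : C -> C) z 1.
Proof.
apply/cvg_ex; exists (cexp z); apply/cvgrPdist_lt => e e0.
have de0 : (0:C) < e / (12 * (`|cexp z| + 1)).
  by rewrite divr_gt0 // mulr_gt0 // ltr_wpDl.
near=> h.
have h0 : h != 0 by near: h; exact: nbhs_dnbhs_neq.
have h1 : `|h| < 2^-1 by near: h; apply: dnbhs0_lt; rewrite invr_gt0.
have h2 : `|h| < e / (12 * (`|cexp z| + 1)) by near: h; exact: dnbhs0_lt.
rewrite /= scaler1 cexpD.
have -> : cexp z - h^-1 *: (cexp h * cexp z - cexp z) = - (cexp z * ((cexp h - 1 - h) / h)).
  by rewrite /GRing.scale /=; field.
rewrite normrN (normrM (cexp z)) (normrM (_ - _)) normfV.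
have := cexp_sub_norm (ltW h1) => B.
have hn : 0 < `|h| by rewrite normr_gt0.
apply: (@le_lt_trans _ _ (`|cexp z| * (12 * `|h|))).
  rewrite ler_wpM2l // ler_pdivrMr //; apply: le_trans B _.
  by rewrite expr2 mulrA.
apply: (@le_lt_trans _ _ ((`|cexp z| + 1) * (12 * `|h|))).
  by rewrite ler_wpM2r ?mulr_ge0 // lerDl.
have c0 : 0 < 12 * (`|cexp z| + 1) by rewrite mulr_gt0 // ltr_wpDl.
move: h2; rewrite ltr_pdivlMr //; congr (_ < _); ring.
Unshelve. all: by end_near.
Qed.

Lemma differentiable_cexp z : differentiable (@cexp R : C -> C) z.
Proof. by apply/derivable1_diffP; exact: derivable_cexp. Qed.

End ComplexExponential.

End ComplexExponential.
Import ComplexExponential.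

(** * Exponential sums in z: independence of characters, strings, division, top coefficients *)

Module ExponentialSums.

Section Dot.
Context {K : comPzRingType} {n : nat}.
Implicit Types (u v w : 'rV[K]_n) (a : K).

Lemma dotE u v : dot u v = \sum_i u 0 i * v 0 i.
Proof. by rewrite /dot mxE; apply: eq_bigr => j _; rewrite mxE. Qed.

Lemma dotC u v : dot u v = dot v u.
Proof. by rewrite !dotE; apply: eq_bigr => j _; rewrite mulrC. Qed.

Lemma dotDl u v w : dot (u + v) w = dot u w + dot v w.
Proof. by rewrite /dot mulmxDl mxE. Qed.

Lemma dotDr u v w : dot u (v + w) = dot u v + dot u w.
Proof. by rewrite !(dotC u) dotDl. Qed.

Lemma dotZl a u v : dot (a *: u) v = a * dot u v.
Proof. by rewrite /dot -scalemxAl mxE. Qed.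

Lemma dotZr a u v : dot u (a *: v) = a * dot u v.
Proof. by rewrite !(dotC u) dotZl. Qed.

Lemma dotNl u v : dot (- u) v = - dot u v.
Proof. by rewrite -scaleN1r dotZl mulN1r. Qed.

Lemma dotNr u v : dot u (- v) = - dot u v.
Proof. by rewrite -scaleN1r dotZr mulN1r. Qed.

Lemma dotBl u v w : dot (u - v) w = dot u w - dot v w.
Proof. by rewrite dotDl dotNl. Qed.

Lemma dotBr u v w : dot u (v - w) = dot u v - dot u w.
Proof. by rewrite dotDr dotNr. Qed.

Lemma dot0l u : dot 0 u = 0.
Proof. by rewrite -(scale0r 0) dotZl mul0r. Qed.

Lemma dot0r u : dot u 0 = 0.
Proof. by rewrite dotC dot0l. Qed.

Lemma dot_suml I (r : seq I) (P : pred I) (F : I -> 'rV[K]_n) u :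
  dot (\sum_(i <- r | P i) F i) u = \sum_(i <- r | P i) dot (F i) u.
Proof. by elim/big_rec2: _ => [|i y1 y2 _ <-]; rewrite ?dot0l ?dotDl. Qed.

Lemma dot_sumr I (r : seq I) (P : pred I) (F : I -> 'rV[K]_n) u :
  dot u (\sum_(i <- r | P i) F i) = \sum_(i <- r | P i) dot u (F i).
Proof. by rewrite dotC dot_suml; apply: eq_bigr => i _; rewrite dotC. Qed.

Lemma dot_mulmxl u v (M : 'M[K]_n) : dot (u *m M) v = dot u (v *m M^T).
Proof. by rewrite /dot trmx_mul trmxK mulmxA. Qed.

End Dot.

Lemma dot_sq_ge0 (R : realDomainType) n (u : 'rV[R]_n) : 0 <= dot u u.
Proof. by rewrite dotE; apply: sumr_ge0 => i _; rewrite -expr2 sqr_ge0. Qed.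

Lemma dot_sq_eq0 (R : realDomainType) n (u : 'rV[R]_n) : (dot u u == 0) = (u == 0).
Proof.
apply/idP/idP => [|/eqP ->]; last by rewrite dot0l.
rewrite dotE psumr_eq0; last by move=> i _; rewrite -expr2 sqr_ge0.
move=> /allP h; apply/eqP/rowP => i; rewrite mxE.
by have := h i (mem_index_enum i); rewrite /= -expr2 sqrf_eq0 => /eqP.
Qed.

Lemma dot_sq_gt0 (R : realDomainType) n (u : 'rV[R]_n) : (0 < dot u u) = (u != 0).
Proof. by rewrite lt_def dot_sq_ge0 andbT dot_sq_eq0. Qed.

Section Complexification.
Context {R : realType} {C : numClosedFieldType} {n : nat} (rc : {rmorphism R -> C}).
Implicit Types u v : 'rV[R]_n.

Definition cv u : 'rV[C]_n := map_mx rc u.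

Lemma dot_cv u v : dot (cv u) (cv v) = rc (dot u v).
Proof.
rewrite !dotE rmorph_sum; apply: eq_bigr => i _ /=.
by rewrite !mxE rmorphM.
Qed.

Lemma cvD u v : cv (u + v) = cv u + cv v.
Proof. exact: map_mxD. Qed.

Lemma cvN u : cv (- u) = - cv u.
Proof. exact: map_mxN. Qed.

Lemma cvB u v : cv (u - v) = cv u - cv v.
Proof. exact: map_mxB. Qed.

Lemma cv0 : cv 0 = 0.
Proof. exact: map_mx0. Qed.

Lemma cvZ a u : cv (a *: u) = rc a *: cv u.
Proof. exact: map_mxZ. Qed.

Lemma cvZint (k : int) u : cv (k%:~R *: u) = k%:~R *: cv u.
Proof. by rewrite cvZ; congr (_ *: _); rewrite rmorph_int. Qed.

Lemma cv_sum I (r : seq I) (P : pred I) (F : I -> 'rV[R]_n) :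
  cv (\sum_(i <- r | P i) F i) = \sum_(i <- r | P i) cv (F i).
Proof. by elim/big_rec2: _ => [|i y1 y2 _ <-]; rewrite ?cv0 ?cvD. Qed.

Lemma cv_inj : injective cv.
Proof. exact: map_mx_inj. Qed.

End Complexification.

Section ExponentialSequences.
Context {F : fieldType}.
Implicit Types (s : seq (F * F)) (k N : nat).

Let sq s k := \sum_(p <- s) p.1 * p.2 ^+ k.

(** The frequencies [p.2] are the roots of the characteristic polynomial, so each summand satisfies
    the recurrence by itself. *)
Lemma expseq_linrec s k :
  \sum_(j < size (\prod_(p <- s) ('X - p.2%:P)))
     (\prod_(p <- s) ('X - p.2%:P))`_j * sq s (k + j) = 0.
Proof.
set P := \prod_(p <- s) _.
transitivity (\sum_(p <- s) p.1 * p.2 ^+ k * P.[p.2]).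
  under eq_bigr do rewrite mulr_sumr.
  rewrite exchange_big /=; apply: eq_bigr => p _.
  rewrite horner_coef mulr_sumr; apply: eq_bigr => j _.
  by rewrite exprD; ring.
rewrite big_seq big1 // => p ps; rewrite /P horner_prod.
by rewrite (big_rem _ ps) /= hornerXsubC subrr mul0r mulr0.
Qed.

(** Nonzero frequencies make the constant coefficient of the recurrence invertible, so the
    recurrence runs backwards and zeros from some index on propagate down to index 0. *)
Lemma expseq_backward s N : (forall p, p \in s -> p.2 != 0) ->
  (forall k, (N <= k)%N -> sq s k = 0) -> sq s 0 = 0.
Proof.
move=> s0; elim: N => [|N IH] hN; first exact: hN.
apply: IH => k; rewrite leq_eqVlt => /orP[/eqP <-|]; last exact: hN.
have := expseq_linrec s N; set P := \prod_(p <- s) _.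
have P0 : P`_0 != 0.
  rewrite -horner_coef0 horner_prod prodf_seq_neq0; apply/allP => p /s0 /=.
  by rewrite hornerXsubC sub0r oppr_eq0.
have [m mE] : exists m, size P = m.+1.
  by exists (size P).-1; rewrite prednK // lt0n size_poly_eq0; apply: contraNneq P0 => ->; rewrite coef0.
rewrite mE big_ord_recl /= addn0 big1 ?addr0 => [|j _].
  by move/eqP; rewrite mulf_eq0 (negPf P0) => /eqP.
by rewrite hN ?mulr0 // /bump /= addnS ltnS leq_addr.
Qed.

(** The characteristic polynomial is monic of degree [size s], so that many initial zeros propagate
    forwards. *)
Lemma expseq_forward s : (forall k, (k < size s)%N -> sq s k = 0) ->
  forall k, sq s k = 0.
Proof.
move=> h k; elim/ltn_ind: k => k IH.
have [/h //|sk] := ltnP k (size s).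
have := expseq_linrec s (k - size s).
rewrite size_prod_XsubC big_ord_recr /= big1 ?add0r => [|j _].
  have -> : (\prod_(p <- s) ('X - (p.2)%:P))`_(size s) = 1.
    have := monicP (monic_prod_XsubC s xpredT snd).
    by rewrite lead_coefE size_prod_XsubC.
  by rewrite mul1r subnK.
by rewrite IH ?mulr0 // -[ltnRHS](subnK sk) ltn_add2l.
Qed.

End ExponentialSequences.

(** The properties of a -> q^a on which the algebra rests. The kernel is infinite cyclic, generated
    by a period [per], and the last field says that q = E 1 is not a root of unity. No continuity is
    asked for. *)
Record qexponential (C : numClosedFieldType) (E : C -> C) : Prop := QExponential {
  qexpD : forall a b, E (a + b) = E a * E b;
  qexp_surj : forall z, z != 0 -> exists a, E a = z;
  qexp_ker : exists2 per, per != 0 & forall a, E a = 1 <-> exists k : int, a = k%:~R * per;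
  qexp_nroot : forall k : int, E k%:~R = 1 -> k = 0
}.

Section QExp.
Context {C : numClosedFieldType} {E : C -> C} (HE : qexponential E).
Implicit Types a b : C.

Let ED := qexpD HE.

Lemma qexp0 : E 0 = 1.
Proof.
have [a aE] := qexp_surj HE (oner_neq0 C).
by rewrite -[LHS]mulr1 -aE -ED add0r.
Qed.

Lemma qexp_neq0 a : E a != 0.
Proof.
apply/eqP => h; have := ED a (- a); rewrite subrr qexp0 h mul0r.
by move/eqP; rewrite oner_eq0.
Qed.

Lemma qexpN a : E (- a) = (E a)^-1.
Proof.
apply: (mulfI (qexp_neq0 a)); rewrite -ED subrr qexp0 divff //.
exact: qexp_neq0.
Qed.

Lemma qexpB a b : E (a - b) = E a / E b.
Proof. by rewrite ED qexpN. Qed.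

Lemma qexpMn k a : E (k%:R * a) = E a ^+ k.
Proof.
elim: k => [|k IH]; first by rewrite mul0r qexp0.
by rewrite -natr1 mulrDl mul1r ED IH exprSr.
Qed.

Lemma qexpMz k a : E (k%:~R * a) = E a ^ k.
Proof.
case: k => k; first exact: qexpMn.
by rewrite NegzE mulrNz mulNr qexpN qexpMn -exprnN.
Qed.

Lemma qexp_int_inj (j k : int) : E j%:~R = E k%:~R -> j = k.
Proof.
move=> h; apply/eqP; rewrite -subr_eq0; apply/eqP; apply: (qexp_nroot HE).
by rewrite rmorphB /= qexpB h divff // qexp_neq0.
Qed.

Definition qn a := E a - E (- a).

Lemma qnN a : qn (- a) = - qn a.
Proof. by rewrite /qn opprK opprB. Qed.

Lemma qn_eq0 a : (qn a == 0) = (E (2 * a) == 1).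
Proof.
rewrite /qn subr_eq0 qexpN -(inj_eq (mulIf (qexp_neq0 a))) mulVf ?qexp_neq0 //.
by rewrite -ED mulr_natl mulr2n.
Qed.

Lemma qn_int_neq0 (k : int) : k != 0 -> qn k%:~R != 0.
Proof.
move=> k0; rewrite qn_eq0; apply/eqP => h.
have : E (2 * k)%:~R = 1 by rewrite rmorphM.
by move/(qexp_nroot HE)/eqP; rewrite mulf_eq0 (negPf k0).
Qed.

End QExp.

Section ExponentialSums.
Context {R : realType} {C : numClosedFieldType} {n : nat} {rc : {rmorphism R -> C}}.
Context {E : C -> C} (HE : qexponential E).
Local Notation V := ('rV[R]_n).
Local Notation VC := ('rV[C]_n).
Local Notation cv := (cv rc).
Implicit Types (x z w : VC) (u v nu gam : V) (f g : VC -> C) (L : set V).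

Definition EE (u z : VC) := E (2 * dot u z).

Lemma EEDl a b z : EE (a + b) z = EE a z * EE b z.
Proof. by rewrite /EE dotDl mulrDr (qexpD HE). Qed.

Lemma EEDr a z w : EE a (z + w) = EE a z * EE a w.
Proof. by rewrite /EE dotDr mulrDr (qexpD HE). Qed.

Lemma EE0l z : EE 0 z = 1.
Proof. by rewrite /EE dot0l mulr0 (qexp0 HE). Qed.

Lemma EE0r a : EE a 0 = 1.
Proof. by rewrite /EE dot0r mulr0 (qexp0 HE). Qed.

Lemma EE_neq0 a z : EE a z != 0.
Proof. exact: (qexp_neq0 HE). Qed.

Lemma EENl a z : EE (- a) z = (EE a z)^-1.
Proof. by rewrite /EE dotNl mulrN (qexpN HE). Qed.

Lemma EEBl a b z : EE (a - b) z = EE a z / EE b z.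
Proof. by rewrite EEDl EENl. Qed.

Lemma EENr a z : EE a (- z) = (EE a z)^-1.
Proof. by rewrite /EE dotNr mulrN (qexpN HE). Qed.

Lemma EEC a z : EE a z = EE z a.
Proof. by rewrite /EE dotC. Qed.

Lemma EEnat k a z : EE a (k%:R *: z) = EE a z ^+ k.
Proof. by rewrite /EE dotZr mulrCA (qexpMn HE). Qed.

Lemma EEint (k : int) a z : EE (k%:~R *: a) z = EE a z ^ k.
Proof. by rewrite /EE dotZl mulrCA (qexpMz HE). Qed.

(** Exponents may repeat in the list, which makes closure under sums, products and shifts immediate;
    [csum] below is the form from which coefficients can be read off. The complex vector x, common
    to all exponents, is kept apart from the real part [p.2], the only part that convexity arguments
    see. *)
Definition bsum x L f := exists s : seq (C * V),
  (forall p, p \in s -> L p.2) /\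
  forall z, f z = \sum_(p <- s) p.1 * EE (x + cv p.2) z.

Lemma bsumS x L L' f : L `<=` L' -> bsum x L f -> bsum x L' f.
Proof. by move=> LL [s [h1 h2]]; exists s; split=> // p /h1 /LL. Qed.

Lemma bsum_ext x L f g : (forall z, f z = g z) -> bsum x L f -> bsum x L g.
Proof. by move=> e [s [h1 h2]]; exists s; split=> // z; rewrite -e. Qed.

Lemma bsum0 x L : bsum x L (fun=> 0).
Proof. by exists [::]; split=> // z; rewrite big_nil. Qed.

Lemma bsum_exp x L (a : C) v : L v -> bsum x L (fun z => a * EE (x + cv v) z).
Proof.
move=> Lv; exists [:: (a, v)]; split=> [p|z]; last by rewrite big_seq1.
by rewrite inE => /eqP ->.
Qed.

Lemma bsumD x L f g : bsum x L f -> bsum x L g -> bsum x L (fun z => f z + g z).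
Proof.
move=> [s [h1 h2]] [t [h3 h4]]; exists (s ++ t); split=> [p|z].
  by rewrite mem_cat => /orP[/h1|/h3].
by rewrite big_cat h2 h4.
Qed.

Lemma bsum_sum x L I (r : seq I) (P : pred I) (F : I -> VC -> C) :
  (forall i, P i -> bsum x L (F i)) -> bsum x L (fun z => \sum_(i <- r | P i) F i z).
Proof.
move=> h; elim: r => [|i r IH]; first by apply: bsum_ext (bsum0 x L) => z; rewrite big_nil.
have [Pi|Pi] := boolP (P i).
  by apply: bsum_ext (bsumD (h i Pi) IH) => z; rewrite big_cons Pi.
by apply: bsum_ext IH => z; rewrite big_cons (negPf Pi).
Qed.

Lemma bsumM x L L1 L2 f g : bsum 0 L1 f -> bsum x L2 g ->
  (forall u v, L1 u -> L2 v -> L (u + v)) -> bsum x L (fun z => f z * g z).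
Proof.
move=> [s [h1 h2]] [t [h3 h4]] LL.
exists [seq (p.1 * r.1, p.2 + r.2) | p <- s, r <- t]; split=> [p|z].
  by move=> /allpairsP [[a b] /= [/h1 ha /h3 hb ->]] /=; exact: LL.
rewrite h2 h4 big_allpairs_dep mulr_suml; apply: eq_bigr => p _.
rewrite mulr_sumr; apply: eq_bigr => r _ /=.
by rewrite add0r cvD !EEDl; ring.
Qed.

Lemma bsumZ x L (a : C) f : bsum x L f -> bsum x L (fun z => a * f z).
Proof.
move=> [s [h1 h2]]; exists [seq (a * p.1, p.2) | p <- s]; split=> [p|z].
  by move=> /mapP [r /h1 hr ->].
by rewrite h2 big_map mulr_sumr; apply: eq_bigr => p _; rewrite mulrA.
Qed.

Lemma bsumN x L f : bsum x L f -> bsum x L (fun z => - f z).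
Proof. by move/(bsumZ (-1)); apply: bsum_ext => z; rewrite mulN1r. Qed.

Lemma bsumB x L f g : bsum x L f -> bsum x L g -> bsum x L (fun z => f z - g z).
Proof. by move=> hf hg; apply: bsumD hf _; exact: bsumN. Qed.

Lemma bsum_const L (a : C) : L 0 -> bsum 0 L (fun=> a).
Proof.
by move=> L0; apply: bsum_ext (bsum_exp 0 a L0) => z; rewrite cv0 addr0 EE0l mulr1.
Qed.

Lemma bsum_shift x L f w : bsum x L f -> bsum x L (fun z => f (z + w)).
Proof.
move=> [s [h1 h2]]; exists [seq (p.1 * EE (x + cv p.2) w, p.2) | p <- s]; split=> [p|z].
  by move=> /mapP [r /h1 hr ->].
by rewrite h2 big_map; apply: eq_bigr => p _ /=; rewrite EEDr; ring.
Qed.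

Lemma bsum_prod L I (r : seq I) (P : pred I) (F : I -> VC -> C) :
  L 0 -> (forall u v, L u -> L v -> L (u + v)) ->
  (forall i, P i -> bsum 0 L (F i)) -> bsum 0 L (fun z => \prod_(i <- r | P i) F i z).
Proof.
move=> L0 LD h; elim: r => [|i r IH].
  by apply: bsum_ext (bsum_const 1 L0) => z; rewrite big_nil.
have [Pi|Pi] := boolP (P i).
  by apply: bsum_ext (bsumM (h i Pi) IH LD) => z; rewrite big_cons Pi.
by apply: bsum_ext IH => z; rewrite big_cons (negPf Pi).
Qed.

(** Along the points z + k w the sum is an exponential sequence with nonzero frequencies, so
    eventual vanishing reaches back to k = 0. This is how zeros at generic points give zeros at all
    points. *)
Lemma bsum_vanish x L f z w (N : nat) : bsum x L f ->
  (forall k, (N <= k)%N -> f (z + k%:R *: w) = 0) -> f z = 0.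
Proof.
move=> [s [_ h2]] h.
set t := [seq (p.1 * EE (x + cv p.2) z, EE (x + cv p.2) w) | p <- s].
have fE k : f (z + k%:R *: w) = \sum_(p <- t) p.1 * p.2 ^+ k.
  by rewrite h2 big_map; apply: eq_bigr => p _ /=; rewrite EEDr EEnat; ring.
have -> : f z = f (z + 0%:R *: w) by rewrite scale0r addr0.
rewrite fE; apply: (@expseq_backward _ t N) => [p /mapP [r _ ->]|k hk].
  exact: EE_neq0.
by rewrite -fE h.
Qed.

(** Dedekind's independence of characters, relative to an additive monoid [G] that separates them:
    shifting by a point where the characters of a and b differ, and subtracting, eliminates a. *)
Lemma dedekind (G : VC -> Prop) (s : seq VC) (d : VC -> C) : G 0 ->
  (forall z w, G z -> G w -> G (z + w)) -> uniq s ->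
  (forall a b, a \in s -> b \in s -> a != b -> exists2 z, G z & EE a z != EE b z) ->
  (forall z, G z -> \sum_(a <- s) d a * EE a z = 0) ->
  forall a, a \in s -> d a = 0.
Proof.
move=> G0 GD; elim: s d => [|a s IH] d //= /andP[as_ us] sep h.
have ds b : b \in s -> d b = 0.
  move=> bs; have ab : b != a by apply: contraNneq as_ => <-.
  have [||z0 Gz0 hz0] := sep b a _ _ ab; rewrite ?mem_head ?inE ?bs ?orbT //.
  have sep' c e : c \in s -> e \in s -> c != e -> exists2 z, G z & EE c z != EE e z.
    by move=> cs es; apply: sep; rewrite inE ?cs ?es orbT.
  have H := IH (fun c => d c * (EE c z0 - EE a z0)) us sep'.
  have /H /(_ b bs)/eqP : forall z, G z -> \sum_(c <- s) d c * (EE c z0 - EE a z0) * EE c z = 0.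
    move=> z Gz; have := h _ (GD _ _ Gz Gz0); have := h z Gz; rewrite !big_cons => h1 h2.
    have : (d a * EE a (z + z0) + \sum_(j <- s) d j * EE j (z + z0)) -
       EE a z0 * (d a * EE a z + \sum_(j <- s) d j * EE j z) = 0 by rewrite h1 h2 mulr0 subr0.
    rewrite mulrDr mulr_sumr EEDr => h3; apply: etrans h3.
    rewrite opprD addrACA -sumrB (_ : d a * (_ * _) - _ = 0) ?add0r; last by ring.
    by apply: eq_bigr => j _; rewrite EEDr; ring.
  by rewrite mulf_eq0 subr_eq0 (negPf hz0) orbF => /eqP.
move=> b; rewrite inE => /orP[/eqP ->|/ds //].
have := h 0 G0; rewrite big_cons big_seq big1 => [|c /ds ->]; last by rewrite mul0r.
by rewrite addr0 EE0r mulr1.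
Qed.

Lemma EE_eq1 (a : VC) : (forall z, EE a z = 1) -> a = 0.
Proof.
move=> h; apply/rowP => i; rewrite mxE.
have [//|ai] := eqVneq (a 0 i) 0; exfalso.
(* At this point the value is E 1, and E 1 = 1 is excluded by [qexp_nroot]. *)
have := h ((2 * a 0 i)^-1 *: delta_mx 0 i); rewrite /EE dotZr dotE (bigD1 i) //= big1.
  rewrite !mxE !eqxx mulr1 addr0 (_ : 2 * _ = (1%:Z)%:~R); first by move/(qexp_nroot HE).
  by field.
by move=> j /negPf ji; rewrite !mxE ji andbF mulr0.
Qed.

Definition Gam gam (z : VC) : Prop := EE (cv gam) z = 1.

Definition str gam u v := exists k : int, v = u + k%:~R *: gam.

Lemma str_refl gam u : str gam u u.
Proof. by exists 0; rewrite scale0r addr0. Qed.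

Lemma str_sym gam u v : str gam u v -> str gam v u.
Proof. by move=> [k ->]; exists (- k); rewrite mulrNz scaleNr addrK. Qed.

Lemma str_trans gam u v nu : str gam u v -> str gam v nu -> str gam u nu.
Proof.
move=> [k ->] [l ->]; exists (k + l).
by rewrite mulrzDr scalerDl addrA.
Qed.

Lemma Gam_str gam u v z : str gam u v -> Gam gam z -> EE (cv v) z = EE (cv u) z.
Proof.
move=> [k ->] Gz; rewrite cvD cvZ EEDl rmorph_int EEint Gz.
by rewrite exp1rz mulr1.
Qed.

(** Testing on the hyperplane orthogonal to [gam] shows that a is a multiple of [gam]; testing at
    the point whose pairing with [gam] is per/2 shows that the multiple is an integer. *)
Lemma Gam_kernel gam (a : VC) : gam != 0 -> (forall z, Gam gam z -> EE a z = 1) ->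
  exists k : int, a = k%:~R *: cv gam.
Proof.
move=> g0 h.
have gg : dot (cv gam) (cv gam) != 0 by rewrite dot_cv fmorph_eq0 dot_sq_eq0.
set c := dot a (cv gam) / dot (cv gam) (cv gam).
have ac : a = c *: cv gam.
  apply/eqP; rewrite -subr_eq0; apply/eqP; apply: EE_eq1 => z.
  set z' := z - (dot (cv gam) z / dot (cv gam) (cv gam)) *: cv gam.
  have gz' : dot (cv gam) z' = 0 by rewrite /z' dotBr dotZr divfK // subrr.
  have := h z'; rewrite /Gam /EE gz' mulr0 (qexp0 HE) => /(_ erefl) h1; apply: etrans h1.
  congr E; congr (_ * _); rewrite /z' dotBr dotBl !dotZl !dotZr /c.
  by field.
have [per per0 perP] := qexp_ker HE.
set z := (per / (2 * dot (cv gam) (cv gam))) *: cv gam.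
have Gz : Gam gam z.
  apply/perP; exists 1; rewrite /z dotZr mul1r; by field.
have /perP[k kE] := h z Gz; exists k.
rewrite ac; congr (_ *: _); move: kE; rewrite /z ac dotZl dotZr.
have -> : 2 * (c * (per / (2 * dot (cv gam) (cv gam)) * dot (cv gam) (cv gam))) = c * per by field.
by move/(mulIf per0).
Qed.

Definition rep gam u := xget 0 [set v | str gam u v].

Lemma rep_str gam u : str gam u (rep gam u).
Proof. by rewrite /rep; by case: xgetP => [v -> //|/(_ u)]; case; exact: str_refl. Qed.

Lemma rep_eq gam u v : str gam u v -> rep gam u = rep gam v.
Proof.
move=> uv; rewrite /rep.
congr xget; apply/seteqP; split=> w /= h; first exact: str_trans (str_sym uv) h.
exact: str_trans uv h.
Qed.

Lemma str_sum_rep gam (S : seq V) (d : V -> C) (F : V -> C) :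
  \sum_(nu <- S) d nu * F (rep gam nu) =
  \sum_(r <- undup (map (rep gam) S)) (\sum_(nu <- S | rep gam nu == r) d nu) * F r.
Proof.
under [RHS]eq_bigr do rewrite big_mkcond mulr_suml.
rewrite exchange_big /= big_seq [RHS]big_seq; apply: eq_bigr => nu nuS.
rewrite (bigD1_seq (rep gam nu)) ?undup_uniq ?mem_undup ?map_f //= eqxx big1 ?addr0 //.
by move=> r /negPf; rewrite eq_sym => ->; rewrite mul0r.
Qed.

Lemma str_rep gam u v : (rep gam u == rep gam v) = `[< str gam u v >].
Proof.
apply/eqP/asboolP => [h|]; last exact: rep_eq.
by apply: str_trans (rep_str gam u) _; rewrite h; exact/str_sym/rep_str.
Qed.

(* Two exponents restrict to the same character of [Gam gam] exactly when they lie on one [gam]-string. *)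
Lemma Gam_str_sum gam (S : seq V) (d : V -> C) : gam != 0 ->
  (forall z, Gam gam z -> \sum_(nu <- S) d nu * EE (cv nu) z = 0) ->
  forall u, \sum_(nu <- S | `[< str gam u nu >]) d nu = 0.
Proof.
move=> g0 h u.
set s := undup (map (rep gam) S).
set D := fun a : VC => \sum_(r <- s | cv r == a) \sum_(nu <- S | rep gam nu == r) d nu.
have DE r : r \in s -> D (cv r) = \sum_(nu <- S | rep gam nu == r) d nu.
  move=> rs; rewrite /D -big_filter (_ : [seq _ <- s | _] = [:: r]) ?big_seq1 //.
  rewrite (eq_filter (a2 := pred1 r)); first by rewrite filter_pred1_uniq // undup_uniq.
  by move=> v /=; rewrite (inj_eq (@cv_inj _ _ _ _)).
have ded : forall a, a \in map cv s -> D a = 0.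
  apply: (@dedekind (Gam gam)).
  - by rewrite /Gam EE0r.
  - by move=> z w; rewrite /Gam EEDr => -> ->; rewrite mulr1.
  - by rewrite map_inj_uniq ?undup_uniq //; exact: cv_inj.
  - move=> a b /mapP [r rs ->] /mapP [t ts ->] rt; apply: contrapT => H.
    have : exists k : int, cv r - cv t = k%:~R *: cv gam.
      apply: Gam_kernel => // z Gz; rewrite EEBl.
      have [->|ne] := eqVneq (EE (cv r) z) (EE (cv t) z); first by rewrite divff // EE_neq0.
      by case: H; exists z.
    move=> [k kE]; have sE : str gam t r.
      exists k; apply: (@cv_inj _ _ _ rc); rewrite cvD cvZ rmorph_int -kE.
      by rewrite addrC subrK.
    move: rs ts rt; rewrite !mem_undup => /mapP[r' _ rE] /mapP[t' _ tE] /eqP[].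
    congr cv; rewrite rE tE; apply/esym/rep_eq.
    apply: str_trans (rep_str gam t') _; rewrite -tE; apply: str_trans sE _.
    by rewrite rE; exact/str_sym/rep_str.
  move=> z Gz; rewrite big_map -[RHS](h z Gz).
  rewrite (_ : \sum_(nu <- S) _ = \sum_(nu <- S) d nu * EE (cv (rep gam nu)) z); last first.
    by apply: eq_bigr => nu _; congr (_ * _); apply: Gam_str Gz; exact/str_sym/rep_str.
  rewrite (str_sum_rep gam S d (fun v => EE (cv v) z)).
  by rewrite big_seq [RHS]big_seq; apply: eq_bigr => r /DE ->.
have [us|us] := boolP (rep gam u \in s).
  have := ded _ (map_f cv us); rewrite DE // => H; rewrite -[RHS]H.
  by apply: eq_bigl => nu; rewrite -str_rep eq_sym.
rewrite big_seq_cond big1 // => nu /andP[nuS]; rewrite -str_rep => /eqP un.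
by move: us; rewrite un mem_undup map_f.
Qed.

Lemma EE_indep (S : seq V) (d : V -> C) : uniq S ->
  (forall z, \sum_(nu <- S) d nu * EE (cv nu) z = 0) -> forall nu, nu \in S -> d nu = 0.
Proof.
move=> us h nu nuS.
have ded : forall a, a \in map cv S -> \sum_(v <- S | cv v == a) d v = 0.
  apply: (@dedekind (fun=> True)) => //.
  - by rewrite map_inj_uniq //; exact: cv_inj.
  - move=> a b /mapP [r rs ->] /mapP [t ts ->] rt; apply: contrapT => H.
    move: rt; rewrite -subr_eq0 => /eqP[]; apply: EE_eq1 => z; rewrite EEBl.
    have [->|ne] := eqVneq (EE (cv r) z) (EE (cv t) z); first by rewrite divff // EE_neq0.
    by case: H; exists z.
  - move=> z _; rewrite big_map -[RHS](h z) big_seq [RHS]big_seq; apply: eq_bigr => r rs.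
    congr (_ * _); rewrite -big_filter (_ : [seq _ <- S | _] = [:: r]) ?big_seq1 //.
    rewrite (eq_filter (a2 := pred1 r)); first by rewrite filter_pred1_uniq.
    by move=> v /=; rewrite (inj_eq (@cv_inj _ _ _ _)).
have := ded _ (map_f cv nuS).
rewrite -big_filter (_ : [seq _ <- S | _] = [:: nu]) ?big_seq1 //.
rewrite (eq_filter (a2 := pred1 nu)); first by rewrite filter_pred1_uniq.
by move=> v /=; rewrite (inj_eq (@cv_inj _ _ _ _)).
Qed.

(* The zero set of [EE gam - k] is a translate of [Gam gam]. *)
Lemma bsum_divide x L gam (k : C) f : gam != 0 -> k != 0 ->
  (forall u (j : int), L u -> L (u + j%:~R *: gam)) -> bsum x L f ->
  (forall z, EE (cv gam) z = k -> f z = 0) ->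
  exists2 g, bsum x L g & forall z, f z = (EE (cv gam) z - k) * g z.
Proof.
move=> g0 k0 Lg [s [sL fE]] fz.
have gg : dot (cv gam) (cv gam) != 0 by rewrite dot_cv fmorph_eq0 dot_sq_eq0.
have [c cE] := qexp_surj HE k0.
have [zc zcE] : exists zc, EE (cv gam) zc = k.
  exists ((c / (2 * dot (cv gam) (cv gam))) *: cv gam); rewrite /EE dotZr -cE.
  by congr E; field.
(* X^j - k^j is divisible by X - k among Laurent polynomials, negative j included, since X and k are
   units. *)
have powdiv (j : int) : exists2 Q, bsum 0 [set v | exists i : int, v = i%:~R *: gam] Q &
    forall z, EE (cv gam) z ^ j - k ^ j = (EE (cv gam) z - k) * Q z.
  have nn (i : nat) : exists2 Q, bsum 0 [set v | exists i : int, v = i%:~R *: gam] Q &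
    forall z, EE (cv gam) z ^+ i - k ^+ i = (EE (cv gam) z - k) * Q z.
    elim: i => [|i [Q bQ QE]].
      by exists (fun=> 0); [exact: bsum0|move=> z; rewrite !expr0 subrr mulr0].
    exists (fun z => (1 * EE (0 + cv gam) z) * Q z + k ^+ i).
      apply: bsumD; last by apply: bsum_const; exists 0; rewrite scale0r.
      apply: (bsumM (L1 := [set v | exists i : int, v = i%:~R *: gam]) _ bQ).
        by apply: bsum_exp; exists 1; rewrite scale1r.
      by move=> u v [a ->] [b ->]; exists (a + b); rewrite mulrzDr scalerDl.
    move=> z; rewrite add0r !exprS; have := QE z => h.
    rewrite mulrDr mul1r mulrCA -h; ring.
  case: j => i; first exact: nn.
  have [Q bQ QE] := nn i.+1.
  exists (fun z => (- k ^- i.+1 * EE (0 + cv (- i.+1%:R *: gam)) z) * Q z).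
    apply: (bsumM (L1 := [set v | exists i : int, v = i%:~R *: gam]) _ bQ).
      by apply: bsum_exp; exists (- i.+1%:Z); rewrite rmorphN.
    by move=> u v [a ->] [b ->]; exists (a + b); rewrite mulrzDr scalerDl.
  move=> z; rewrite NegzE -!exprnN add0r.
  have -> : EE (cv (- i.+1%:R *: gam)) z = (EE (cv gam) z ^+ i.+1)^-1.
    rewrite cvZ rmorphN rmorph_nat scaleNr EENl; congr (_^-1).
    exact: (EEint i.+1).
  have := QE z => h; rewrite mulrCA -h.
  have e0 := expf_neq0 i.+1 (EE_neq0 (cv gam) z); have k1 := expf_neq0 i.+1 k0.
  by field; rewrite e0 k1.
have strint u : exists j : int, u = rep gam u + j%:~R *: gam.
  by have [j jE] := str_sym (rep_str gam u); exists j.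
pose J u := projT1 (cid (strint u)).
have JE u : u = rep gam u + (J u)%:~R *: gam by exact: (projT2 (cid (strint u))).
pose Q j := projT1 (cid2 (powdiv j)).
have [bQ QE] : (forall j, bsum 0 [set v | exists i : int, v = i%:~R *: gam] (Q j)) /\
   (forall j z, EE (cv gam) z ^ j - k ^ j = (EE (cv gam) z - k) * Q j z).
  by split=> j; rewrite /Q; case: (cid2 _).
have EEJ v w : EE (x + cv v) w = EE (x + cv (rep gam v)) w * EE (cv gam) w ^ J v.
  by rewrite {1}(JE v) cvD cvZint addrA (EEDl (x + _)) EEint.
exists (fun z => \sum_(p <- s) Q (J p.2) z * (p.1 * EE (x + cv (rep gam p.2)) z)).
  rewrite /= (_ : (fun z => _) = (fun z => \sum_(p <- s | p \in s) Q (J p.2) z * (p.1 * EE (x + cv (rep gam p.2)) z))); last first.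
    by apply/funext => z; rewrite big_seq.
  apply: bsum_sum => p ps; apply: (bsumM (bQ _) (L2 := [set v | L v])).
    apply: bsum_exp => /=; rewrite (_ : rep gam p.2 = p.2 + (- J p.2)%:~R *: gam).
      exact/Lg/sL.
    by rewrite {2}(JE p.2) mulrNz scaleNr addrK.
  by move=> u v [i ->] Lv; rewrite addrC; exact: Lg.
move=> z; rewrite mulr_sumr.
(* Replacing the power [EE (cv gam) z ^ J] by k^J in each term gives an expression determined by the
   restriction of f to the level set, hence zero. Subtracting it from f leaves multiples of X^J -
   k^J with X = [EE (cv gam) z]. *)
have key : \sum_(p <- s) p.1 * (k ^ J p.2 * EE (x + cv (rep gam p.2)) z) = 0.
  have fzw w : Gam gam w -> \sum_(p <- s) p.1 * EE (x + cv p.2) zc * EE (cv p.2) w = 0.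
    move=> Gw; have := fz (w + zc); rewrite EEDr zcE Gw mul1r => /(_ erefl).
    rewrite fE => h; apply: (mulfI (EE_neq0 x w)); rewrite mulr0 -[RHS]h mulr_sumr.
    by apply: eq_bigr => p _; rewrite (EEDr _ w) [EE (x + _) w]EEDl; ring.
  have gs := Gam_str_sum g0 (S := [seq p.2 | p <- s]).
  pose d v := \sum_(p <- s | p.2 == v) p.1 * EE (x + cv p.2) zc.
  set S := undup [seq p.2 | p <- s].
  have collect (F : V -> C) :
    \sum_(p <- s) p.1 * EE (x + cv p.2) zc * F p.2 = \sum_(v <- S) d v * F v.
    rewrite /d; under [RHS]eq_bigr do rewrite big_mkcond mulr_suml.
    rewrite exchange_big /= big_seq [RHS]big_seq; apply: eq_bigr => p ps.
    rewrite (bigD1_seq p.2) ?undup_uniq ?mem_undup ?map_f //= eqxx big1 ?addr0 //.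
    by move=> r /negPf; rewrite eq_sym => ->; rewrite mul0r.
  have {}gs : forall u, \sum_(v <- S | `[< str gam u v >]) d v = 0.
    by apply: (Gam_str_sum g0) => w Gw; rewrite -(collect (fun v => EE (cv v) w)) fzw.
  transitivity (\sum_(v <- S) d v * (EE (x + cv (rep gam v)) z / EE (x + cv (rep gam v)) zc)).
    rewrite -(collect (fun v => EE (x + cv (rep gam v)) z / EE (x + cv (rep gam v)) zc)).
    apply: eq_bigr => p _; rewrite (EEJ p.2 zc) zcE.
    have := EE_neq0 (x + cv (rep gam p.2)) zc.
    by move: (EE (x + cv (rep gam p.2)) zc) (EE (x + cv (rep gam p.2)) z) (k ^ J p.2) => A B K A0; field.
  rewrite (str_sum_rep gam S d (fun v => EE (x + cv v) z / EE (x + cv v) zc)).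
  rewrite big_seq big1 // => r; rewrite mem_undup => /mapP [v _ ->].
  rewrite (eq_bigl (fun nu => `[< str gam v nu >])) ?gs ?mul0r // => nu.
  by rewrite -str_rep eq_sym.
rewrite -[LHS]subr0 -{1}key fE -sumrB; apply: eq_bigr => p _.
rewrite mulrA -QE (EEJ p.2 z).
by move: (EE (x + _) z) (EE (cv gam) z ^ J p.2) (k ^ J p.2) => A B K; ring.
Qed.

Definition csum x (S : seq V) (c : V -> C) z := \sum_(nu <- S) c nu * EE (x + cv nu) z.

Lemma csumE x S c z : csum x S c z = EE x z * \sum_(nu <- S) c nu * EE (cv nu) z.
Proof. by rewrite mulr_sumr; apply: eq_bigr => nu _; rewrite EEDl; ring. Qed.

Lemma csum_bsum x L S c : (forall nu, nu \in S -> L nu) -> bsum x L (csum x S c).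
Proof.
move=> h; exists [seq (c nu, nu) | nu <- S]; split=> [p|z].
  by move=> /mapP [nu /h Ln ->].
by rewrite big_map.
Qed.

Lemma bsum_csum x L f : bsum x L f -> exists S c,
  [/\ uniq S, forall nu, nu \in S -> L nu, forall nu, nu \notin S -> c nu = 0 &
   forall z, f z = csum x S c z].
Proof.
move=> [s [sL fE]]; set S := undup [seq p.2 | p <- s].
exists S, (fun v => \sum_(p <- s | p.2 == v) p.1); split.
- exact: undup_uniq.
- by move=> nu; rewrite mem_undup => /mapP [p /sL Lp ->].
- move=> nu; rewrite mem_undup => h; rewrite big_seq_cond big1 // => p /andP[ps /eqP pn].
  by move: h; rewrite -pn map_f.
- move=> z; rewrite fE /csum.
  under [RHS]eq_bigr do rewrite big_mkcond mulr_suml.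
  rewrite exchange_big /= big_seq [RHS]big_seq; apply: eq_bigr => p ps.
  rewrite (bigD1_seq p.2) ?undup_uniq ?mem_undup ?map_f //= eqxx big1 ?addr0 //.
  by move=> r /negPf; rewrite eq_sym => ->; rewrite mul0r.
Qed.

Lemma csum_eq0 x S c : uniq S -> (forall z, csum x S c z = 0) ->
  forall nu, nu \in S -> c nu = 0.
Proof.
move=> us h; apply: EE_indep => // z; apply: (mulfI (EE_neq0 x z)).
by rewrite -csumE h mulr0.
Qed.

(* The exponent at [v] dominates in the direction [h]; [a = 0] is allowed. *)
Definition topc (h : V) x f v (a : C) := exists2 g,
  bsum x [set u | dot u h < dot v h] g & forall z, f z = a * EE (x + cv v) z + g z.

Lemma topc_ext h x f g v a : (forall z, f z = g z) -> topc h x f v a -> topc h x g v a.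
Proof. by move=> e [k bk kE]; exists k => // z; rewrite -e. Qed.

Lemma topc_below h x f v : bsum x [set u | dot u h < dot v h] f -> topc h x f v 0.
Proof. by move=> b; exists f => // z; rewrite mul0r add0r. Qed.

Lemma topc_exp h x v a : topc h x (fun z => a * EE (x + cv v) z) v a.
Proof. by exists (fun=> 0); [exact: bsum0|move=> z; rewrite addr0]. Qed.

Lemma topcD h x f g v a b : topc h x f v a -> topc h x g v b ->
  topc h x (fun z => f z + g z) v (a + b).
Proof.
move=> [k bk kE] [l bl lE]; exists (fun z => k z + l z); first exact: bsumD.
by move=> z; rewrite kE lE; ring.
Qed.

Lemma topcZ h x f v a b : topc h x f v a -> topc h x (fun z => b * f z) v (b * a).
Proof.
move=> [k bk kE]; exists (fun z => b * k z); first exact: bsumZ.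
by move=> z; rewrite kE; ring.
Qed.

Lemma topc_sum h x v I (r : seq I) (P : pred I) (F : I -> VC -> C) (a : I -> C) :
  (forall i, P i -> topc h x (F i) v (a i)) ->
  topc h x (fun z => \sum_(i <- r | P i) F i z) v (\sum_(i <- r | P i) a i).
Proof.
move=> H; elim: r => [|i r IH].
  rewrite big_nil; apply: topc_below; apply: bsum_ext (bsum0 _ _) => z.
  by rewrite big_nil.
rewrite big_cons; case: ifP => Pi; last first.
  by apply: topc_ext IH => z; rewrite big_cons Pi.
by apply: topc_ext (topcD (H i Pi) IH) => z; rewrite big_cons Pi.
Qed.

Lemma topcM h x f g v u a b : topc h 0 f v a -> topc h x g u b ->
  topc h x (fun z => f z * g z) (v + u) (a * b).
Proof.
move=> [k bk kE] [l bl lE].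
exists (fun z => (a * EE (0 + cv v) z) * l z + (k z * (b * EE (x + cv u) z) + k z * l z)).
  apply: bsumD; last apply: bsumD.
  - apply: (bsumM (L1 := [set v]) _ bl) => [|u1 u2 /= ->]; first exact: bsum_exp.
    by rewrite !dotDl ltrD2l.
  - apply: (bsumM (L2 := [set u]) bk) => [|u1 u2 /= ? ->]; first exact: bsum_exp.
    by rewrite !dotDl ltrD2r.
  - apply: (bsumM bk bl) => u1 u2 /= h1 h2; by rewrite !dotDl ltrD.
by move=> z; rewrite kE lE add0r cvD addrCA !EEDl; ring.
Qed.

Lemma topc_const h (a : C) : topc h 0 (fun=> a) 0 a.
Proof.
by apply: topc_ext (topc_exp h 0 0 a) => z; rewrite cv0 addr0 EE0l mulr1.
Qed.

Lemma topc_prod h I (r : seq I) (P : pred I) (F : I -> VC -> C) (v : I -> V) (a : I -> C) :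
  (forall i, P i -> topc h 0 (F i) (v i) (a i)) ->
  topc h 0 (fun z => \prod_(i <- r | P i) F i z)
    (\sum_(i <- r | P i) v i) (\prod_(i <- r | P i) a i).
Proof.
move=> H; elim: r => [|i r IH].
  by rewrite !big_nil; apply: topc_ext (topc_const h 1) => z; rewrite big_nil.
rewrite !big_cons; case: ifP => Pi; last first.
  by apply: topc_ext IH => z; rewrite big_cons Pi.
by apply: topc_ext (topcM (H i Pi) IH) => z; rewrite big_cons Pi.
Qed.

Lemma topc_shift h x f v a w : topc h x f v a ->
  topc h x (fun z => f (z + w)) v (a * EE (x + cv v) w).
Proof.
move=> [k bk kE]; exists (fun z => k (z + w)); first exact: bsum_shift.
by move=> z; rewrite kE EEDr; ring.
Qed.

Lemma topc_eq0 h x f v a : topc h x f v a -> (forall z, f z = 0) -> a = 0.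
Proof.
move=> [k /bsum_csum [S [c [uS SL c0 kE]]] fE] f0.
have vS : v \notin S by apply/negP => /SL /=; rewrite ltxx.
pose d u := if u == v then a else c u.
have := @csum_eq0 x (v :: S) d; rewrite /= vS => /(_ uS) H.
have := H _ v (mem_head _ _); rewrite /d eqxx; apply => z.
rewrite -(f0 z) fE kE /csum big_cons /d eqxx; congr (_ + _).
rewrite big_seq [RHS]big_seq; apply: eq_bigr => u uS'; case: eqP => // uv.
by move: vS; rewrite -uv uS'.
Qed.

Lemma topcW h x f v a nu : topc h x f v a -> dot v h < dot nu h -> topc h x f nu 0.
Proof.
move=> [k bk kE] vw; apply: topc_below; apply: bsum_ext (bsumD (bsum_exp x a _) (bsumS _ bk)).
- by move=> z; rewrite kE.
- exact: vw.
- by move=> u /=; move/lt_trans; apply.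
Qed.

Lemma topc_inj h x f v a b : topc h x f v a -> topc h x f v b -> a = b.
Proof.
move=> ta tb; apply/eqP; rewrite -subr_eq0; apply/eqP.
rewrite -[- b]mulN1r; apply: (topc_eq0 (topcD ta (topcZ (-1) tb))) => z; ring.
Qed.

Lemma topc_csum h x S c v : uniq S -> (forall nu, nu \notin S -> c nu = 0) ->
  (forall nu, nu \in S -> c nu != 0 -> nu != v -> dot nu h < dot v h) ->
  topc h x (csum x S c) v (c v).
Proof.
move=> uS c0 H.
exists (csum x [seq nu <- S | (c nu != 0) && (nu != v)] c).
  by apply: csum_bsum => nu; rewrite mem_filter => /andP[/andP[h1 h2] h3]; exact: H.
move=> z; rewrite /csum big_filter.
have [vS|vS] := boolP (v \in S); last first.
  rewrite c0 // mul0r add0r [RHS]big_mkcond; apply: eq_big_seq => nu nuS.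
  case: eqVneq => [->|_] /=; first by rewrite mul0r.
  by have -> : nu != v by apply: contraNneq vS => <-.
rewrite (bigD1_seq v) //=; congr (_ + _); rewrite big_mkcond [RHS]big_mkcond /=.
apply: eq_bigr => nu _; case: (nu != v); rewrite ?andbT ?andbF //.
by case: eqVneq => // ->; rewrite mul0r.
Qed.

Lemma csum_top h (S : seq V) (c : V -> C) : uniq S ->
  {in S &, injective (fun nu => dot nu h)} -> (exists2 nu, nu \in S & c nu != 0) ->
  exists v, [/\ v \in S, c v != 0 &
    forall nu, nu \in S -> c nu != 0 -> nu != v -> dot nu h < dot v h].
Proof.
move=> uS inj [w wS cw].
have [v vT vmax] : exists2 v, v \in [seq nu <- S | c nu != 0] &
   forall nu, nu \in [seq nu <- S | c nu != 0] -> dot nu h <= dot v h.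
  have : w \in [seq nu <- S | c nu != 0] by rewrite mem_filter cw.
  elim: [seq nu <- S | c nu != 0] w {wS cw} => // a s IH w _.
  case: s IH => [|b s] IH; first by exists a; rewrite ?mem_head // => nu; rewrite inE => /eqP ->.
  have [v vs vmax] := IH b (mem_head _ _).
  have [av|va] := leP (dot a h) (dot v h).
    exists v; first by rewrite inE vs orbT.
    by move=> nu; rewrite inE => /orP[/eqP -> //|/vmax].
  exists a; first exact: mem_head.
  by move=> nu; rewrite inE => /orP[/eqP -> //|/vmax /le_trans]; apply; exact: ltW.
move: vT; rewrite mem_filter => /andP[cv vS]; exists v; split=> // nu nuS cnu nv.
rewrite lt_neqAle vmax ?mem_filter ?cnu // andbT.
by apply: contraNneq nv => /inj ->.
Qed.

End ExponentialSums.

End ExponentialSums.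
Import ExponentialSums.

(** * Root systems: chambers, walls, the polytope N and the convexity property *)

Module RootSystems.

Lemma seq_argmax {R : realDomainType} {T : eqType} (f : T -> R) (s : seq T) (x : T) : x \in s ->
  exists2 y, y \in s & forall z, z \in s -> f z <= f y.
Proof.
elim: s x => // a s IH x _; case: s IH => [|b s] IH.
  by exists a; rewrite ?mem_head // => z; rewrite inE => /eqP ->.
have [y ys ymax] := IH b (mem_head _ _).
have [ay|ya] := leP (f a) (f y).
  exists y; first by rewrite in_cons ys orbT.
  by move=> z; rewrite inE => /orP[/eqP ->|/ymax].
exists a; first exact: mem_head.
by move=> z; rewrite inE => /orP[/eqP -> //|/ymax /le_trans]; apply; exact: ltW.
Qed.

Lemma seq_argmin {R : realDomainType} {T : eqType} (f : T -> R) (s : seq T) (x : T) : x \in s ->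
  exists2 y, y \in s & forall z, z \in s -> f y <= f z.
Proof.
move=> /(seq_argmax (fun z => - f z)) [y ys ymax]; exists y => // z /ymax.
by rewrite lerN2.
Qed.

Lemma int_sq_lt4 (k : int) : k ^+ 2 < 4 -> (k == 1) || (k == 0) || (k == -1).
Proof.
move=> h; have k2 : k < 2 by rewrite ltNge; apply/negP => ?; nia.
have k3 : - 2 < k by rewrite ltNge; apply/negP => ?; nia.
lia.
Qed.

Section Perturbation.
Context {R : realType} {n : nat}.
Local Notation V := ('rV[R]_n).
Implicit Types (h g u v : V) (us vs : seq V).

Lemma poly_nonroot_near (P : {poly R}) (d : R) : P != 0 -> 0 < d ->
  exists t, [/\ 0 < t, t < d & P.[t] != 0].
Proof.
move=> P0 d0; apply: contrapT => H.
(* More candidates in (0, d) than P can have roots. *)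
set rs := [seq d / k.+2%:R | k <- iota 0 (size P)].
have inj : injective (fun k : nat => d / k.+2%:R).
  move=> j k /(mulfI (lt0r_neq0 d0)) /invr_inj /eqP.
  by rewrite eqr_nat !eqSS => /eqP.
have := @max_poly_roots _ P rs P0; rewrite map_inj_uniq // iota_uniq size_map size_iota ltnn.
suff -> : all (root P) rs by move/(_ isT isT).
apply/allP => _ /mapP [k _ ->]; rewrite rootE; apply: contraT => Pk.
case: H; exists (d / k.+2%:R); split=> //; first by rewrite divr_gt0.
by rewrite ltr_pdivrMr // ltr_pMr // ltr1n.
Qed.

(** On the moment curve (1, t, t^2, ...) every nonzero v restricts to a nonzero polynomial in t, so
    a single t avoids all the hyperplanes. *)
Lemma avoid_hyperplanes vs : (forall v, v \in vs -> v != 0) ->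
  exists g, forall v, v \in vs -> dot v g != 0.
Proof.
move=> h; pose p v : {poly R} := \sum_(i < n) (v 0 i)%:P * 'X^i.
have pE v t : (p v).[t] = dot v (\row_i t ^+ i).
  rewrite dotE horner_sum; apply: eq_bigr => i _.
  by rewrite hornerM hornerXn hornerC mxE.
have p0 v : v \in vs -> p v != 0.
  move=> /h; apply: contra_neq => pv; apply/rowP => i; rewrite mxE.
  have := congr1 (fun q : {poly R} => q`_i) pv; rewrite coef0 coef_sum.
  rewrite (bigD1 i) //= big1 ?addr0 => [|j ji]; first by rewrite coefCM coefXn eqxx mulr1.
  by rewrite coefCM coefXn (_ : (_ == _) = false) ?mulr0 //; apply: contraNF ji => /eqP e; apply/eqP/val_inj.
have P0 : \prod_(v <- vs) p v != 0 by rewrite prodf_seq_neq0; apply/allP => v /p0.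
have [t [_ _ Pt]] := poly_nonroot_near P0 (@ltr01 R).
exists (\row_i t ^+ i) => v vvs; rewrite -pE; move: Pt.
by rewrite horner_prod prodf_seq_neq0 => /allP /(_ v vvs).
Qed.

(** The vector is h + t g with g off all the hyperplanes: small t > 0 keeps the positive values
    positive, and only finitely many t land on a hyperplane. *)
Lemma perturb h us vs : (forall v, v \in vs -> v != 0) ->
  exists g, (forall v, v \in vs -> dot v g != 0) /\
    forall u, u \in us -> 0 < dot u h -> 0 < dot u g.
Proof.
move=> h0; have [g gP] := avoid_hyperplanes h0.
have [d d0 dP] : exists2 d, 0 < d & forall t u, 0 < t -> t < d -> u \in us ->
    0 < dot u h -> 0 < dot u (h + t *: g).
  elim: us => [|u us [d d0 IH]]; first by exists 1.
  have [uh|uh] := leP (dot u h) 0.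
    exists d => // t v t0 td; rewrite inE => /orP[/eqP ->|]; last exact: IH.
    by rewrite ltNge uh.
  set e := dot u h / (`|dot u g| + 1).
  have e0 : 0 < e by rewrite divr_gt0 // ltr_wpDl.
  exists (Num.min d e); first by rewrite lt_min d0.
  move=> t v t0; rewrite lt_min => /andP[td te]; rewrite inE => /orP[/eqP ->|]; last exact: IH.
  move=> _; rewrite dotDr dotZr -ltrBlDl sub0r.
  move: te; rewrite /e ltr_pdivlMr ?ltr_wpDl // => te.
  have := ler_norm (- (dot u g)); rewrite normrN => n1; nra.
have P0 : \prod_(v <- vs) ((dot v h)%:P + (dot v g)%:P * 'X) != 0 :> {poly R}.
  rewrite prodf_seq_neq0; apply/allP => v /gP /=; apply: contra_neq => e.
  have := congr1 (fun q : {poly R} => q`_1) e.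
  by rewrite coefD coefC coefCM coefX mulr1 coef0 add0r.
have [t [t0 td Pt]] := poly_nonroot_near P0 d0.
exists (h + t *: g); split=> [v vvs|u uus]; last exact: dP.
move: Pt; rewrite horner_prod prodf_seq_neq0 => /allP /(_ v vvs) /=.
by rewrite hornerD hornerM hornerX !hornerC dotDr dotZr [t * _]mulrC.
Qed.

End Perturbation.

Section Reflections.
Context {R : realType} {n : nat}.
Local Notation V := ('rV[R]_n).
Implicit Types (a b u v h : V).

Lemma reflE a v : v *m refl_mx a = v - dot v (coroot a) *: a.
Proof.
rewrite /refl_mx mulmxBr mulmx1 mulmxA; congr (_ - _).
by rewrite -mul_scalar_mx; congr (_ *m _); rewrite [LHS]mx11_scalar.
Qed.

Lemma coroot_dot a v : dot (coroot a) v = 2 / dot a a * dot a v.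
Proof. by rewrite /coroot dotZl. Qed.

Lemma reflE' a v : v *m refl_mx a = v - dot v a *: coroot a.
Proof. by rewrite reflE /coroot dotZr scalerA mulrC. Qed.

Lemma dot_scoroot k a v : dot (k *: coroot a) v = k * dot (coroot a) v.
Proof. exact: dotZl. Qed.

Lemma coroot_self a : a != 0 -> dot (coroot a) a = 2.
Proof. by move=> a0; rewrite coroot_dot divfK // dot_sq_eq0. Qed.

Lemma corootN a : coroot (- a) = - coroot a.
Proof. by rewrite /coroot dotNl dotNr opprK scalerN. Qed.

Lemma coroot_neq0 a : a != 0 -> coroot a != 0.
Proof.
move=> a0; apply/eqP => e; have := coroot_self a0; rewrite e dot0l => /esym/eqP.
by rewrite pnatr_eq0.
Qed.

Lemma coroot_gt0 a v : a != 0 -> (0 < dot (coroot a) v) = (0 < dot a v).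
Proof. by move=> a0; rewrite coroot_dot pmulr_rgt0 // divr_gt0 // dot_sq_gt0. Qed.

Lemma coroot_lt0 a v : a != 0 -> (dot (coroot a) v < 0) = (dot a v < 0).
Proof. by move=> a0; rewrite coroot_dot pmulr_rlt0 // divr_gt0 // dot_sq_gt0. Qed.

Lemma coroot_eq0 a v : a != 0 -> (dot (coroot a) v == 0) = (dot a v == 0).
Proof. by move=> a0; rewrite coroot_dot mulf_eq0 gt_eqF // divr_gt0 // dot_sq_gt0. Qed.

Lemma refl_isom a u v : a != 0 -> dot (u *m refl_mx a) (v *m refl_mx a) = dot u v.
Proof.
move=> a0; have := coroot_self a0; rewrite coroot_dot => e.
have aa : dot a a != 0 by rewrite dot_sq_eq0.
rewrite !reflE /coroot !dotBl !dotBr !dotZl !dotZr [dot a v]dotC; field.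
exact: aa.
Qed.

Lemma reflK a v : a != 0 -> v *m refl_mx a *m refl_mx a = v.
Proof.
move=> a0; rewrite [v *m _ *m _]reflE [v *m _]reflE dotBl dotZl [dot a _]dotC coroot_self //.
apply/rowP => i; rewrite !mxE; ring.
Qed.

Lemma refl_self a : a != 0 -> a *m refl_mx a = - a.
Proof.
by move=> a0; rewrite reflE dotC coroot_self // scaler_nat mulr2n opprD addrA subrr sub0r.
Qed.

Lemma reflN a u : (- u) *m refl_mx a = - (u *m refl_mx a).
Proof. exact: mulNmx. Qed.

Lemma refl_dot a u v : a != 0 -> dot (u *m refl_mx a) v = dot u (v *m refl_mx a).
Proof. by move=> a0; rewrite -{1}(reflK v a0) refl_isom. Qed.

Lemma refl_fix a v : dot a v = 0 -> v *m refl_mx a = v.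
Proof. by move=> av; rewrite reflE' dotC av scale0r subr0. Qed.

Lemma coroot_isom (w : 'M[R]_n) b : (forall u v, dot (u *m w) (v *m w) = dot u v) ->
  coroot (b *m w) = coroot b *m w.
Proof. by move=> iw; rewrite /coroot iw -scalemxAl. Qed.

Lemma coroot_refl a b : a != 0 -> coroot (b *m refl_mx a) = coroot b *m refl_mx a.
Proof. by move=> a0; apply: coroot_isom => u v; exact: refl_isom. Qed.

End Reflections.

Opaque coroot refl_mx.

Section RootSystem.
Context {R : realType} {n : nat} {Phi : {fset 'rV[R]_n}}.
Context (HPhi : reduced_irreducible_root_system Phi).
Local Notation V := ('rV[R]_n).
Implicit Types (a b c u v h : V).

Lemma root_neq0 a : a \in Phi -> a != 0.
Proof. by move=> aP; apply: contraNneq (roots_neq0 HPhi) => <-. Qed.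

Lemma rootN a : (- a \in Phi) = (a \in Phi).
Proof.
have aux b : b \in Phi -> - b \in Phi.
  by move=> bP; rewrite -refl_self ?root_neq0 //; apply: (roots_refl HPhi).
by apply/idP/idP => [/aux|/aux //]; rewrite opprK.
Qed.

Lemma root_refl a b : a \in Phi -> (b *m refl_mx a \in Phi) = (b \in Phi).
Proof.
move=> aP; apply/idP/idP => [|bP]; last exact: (roots_refl HPhi).
by move/(roots_refl HPhi aP); rewrite reflK // root_neq0.
Qed.

Lemma root_parallel a b (k : R) : a \in Phi -> b \in Phi -> b = k *: a -> b = a \/ b = - a.
Proof.
move=> aP bP e; have := roots_reduced HPhi aP (c := k); rewrite -e => /(_ bP) [] k1.
  by left; rewrite e k1 scale1r.
by right; rewrite e k1 scaleN1r.
Qed.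

Lemma root_int a b : a \in Phi -> b \in Phi -> exists k : int, dot (coroot a) b = k%:~R.
Proof. by move=> aP bP; apply/intrP; exact: (roots_int HPhi). Qed.

Lemma root_span_coord v : exists c : V -> R, v = \sum_(a <- Phi) c a *: a.
Proof.
have vs : v \in <<enum_fset Phi>>%VS by rewrite (roots_span HPhi) memvf.
have us : uniq (enum_fset Phi) by exact: fset_uniq.
have := coord_span (X := in_tuple (enum_fset Phi)) vs => ->.
set X := in_tuple _.
exists (fun a => match insub (index a (enum_fset Phi)) with Some i => coord X i v | None => 0 end).
rewrite (big_nth 0) big_mkord; apply: eq_bigr => i _.
rewrite index_uniq //; case: insubP => [j _ ji|]; last by rewrite ltn_ord.
by rewrite (_ : j = i) //; apply: val_inj.
Qed.

Lemma root_sep u : (forall a, a \in Phi -> dot a u = 0) -> u = 0.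
Proof.
move=> h; apply/eqP; rewrite -dot_sq_eq0; apply/eqP.
have [c cE] := root_span_coord u; rewrite {1}cE dot_suml big_seq big1 // => a aP.
by rewrite dotZl h // mulr0.
Qed.

Lemma root_mx_ext (M N : 'M[R]_n) : (forall a, a \in Phi -> a *m M = a *m N) -> M = N.
Proof.
move=> h; apply/row_matrixP => i; rewrite !rowE.
have [c ->] := root_span_coord (delta_mx 0 i); rewrite !mulmx_suml.
by rewrite big_seq [RHS]big_seq; apply: eq_bigr => a aP; rewrite -!scalemxAl h.
Qed.

Lemma big_root_reindex (T : Type) (idx : T) (op : Monoid.com_law idx) (f : V -> V)
    (P : pred V) (F : V -> T) :
  (forall a, (f a \in Phi) = (a \in Phi)) -> involutive f ->
  \big[op/idx]_(a <- Phi | P a) F a = \big[op/idx]_(a <- Phi | P (f a)) F (f a).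
Proof.
move=> fP fK; rewrite -(big_map f P F); apply: perm_big; apply: uniq_perm.
- exact: fset_uniq.
- by rewrite map_inj_uniq ?fset_uniq //; exact: can_inj fK.
- move=> a; apply/idP/mapP => [aP|[b bP ->]]; last by have := fP b; move=> ->.
  by exists (f a); [have := fP a; move=> -> | rewrite fK].
Qed.

Lemma big_root_refl (T : Type) (idx : T) (op : Monoid.com_law idx) b
    (P : pred V) (F : V -> T) : b \in Phi ->
  \big[op/idx]_(a <- Phi | P a) F a =
  \big[op/idx]_(a <- Phi | P (a *m refl_mx b)) F (a *m refl_mx b).
Proof.
move=> bP; apply: big_root_reindex => a; first exact: root_refl.
by rewrite reflK // root_neq0.
Qed.

Lemma big_root_opp (T : Type) (idx : T) (op : Monoid.com_law idx)
    (P : pred V) (F : V -> T) :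
  \big[op/idx]_(a <- Phi | P a) F a = \big[op/idx]_(a <- Phi | P (- a)) F (- a).
Proof. apply: big_root_reindex => a; [exact: rootN|exact: opprK]. Qed.

Lemma big_rootD1 (T : Type) (idx : T) (op : Monoid.com_law idx) a (P : pred V) (F : V -> T) :
  a \in Phi -> P a ->
  \big[op/idx]_(b <- Phi | P b) F b = op (F a) (\big[op/idx]_(b <- Phi | (b != a) && P b) F b).
Proof.
move=> aP Pa; rewrite big_mkcond (bigD1_seq a) ?fset_uniq //= Pa; congr (op _ _).
by rewrite big_mkcondr.
Qed.

Definition regular h := forall a, a \in Phi -> dot a h != 0.

Lemma big_root_split (T : Type) (idx : T) (op : Monoid.com_law idx) h (F : V -> T) : regular h ->
  \big[op/idx]_(a <- Phi) F a =
  \big[op/idx]_(a <- Phi | 0 < dot a h) op (F a) (F (- a)).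
Proof.
move=> rh; rewrite big_split /= (bigID (fun a => 0 < dot a h)) /=; congr (op _ _).
rewrite big_root_opp [LHS]big_seq_cond [RHS]big_seq_cond; apply: eq_bigl => a.
case aP: (a \in Phi) => //=; rewrite dotNl oppr_gt0 -leNgt le_eqVlt.
by rewrite eq_sym (negPf (rh a aP)).
Qed.

Context (m : V -> nat).
Context (m_refl : forall a b, a \in Phi -> b \in Phi -> m (a *m refl_mx b) = m a).

Lemma m_opp a : a \in Phi -> m (- a) = m a.
Proof. by move=> aP; rewrite -refl_self ?root_neq0 // m_refl. Qed.

(* [HN] is the support function of the polytope N of the paper; [rhoh h] is rho^vee for the
   positive system [0 < dot a h]. *)
Definition HN h : R := 4^-1 * \sum_(a <- Phi) (m a)%:R * `|dot (coroot a) h|.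

Definition rhoh h : V := 2^-1 *: \sum_(a <- Phi | 0 < dot a h) (m a)%:R *: coroot a.

Lemma HN_split h h' : regular h ->
  HN h' = 2^-1 * \sum_(a <- Phi | 0 < dot a h) (m a)%:R * `|dot (coroot a) h'|.
Proof.
move=> rh; rewrite /HN (big_root_split _ _ rh).
have -> : \sum_(a <- Phi | 0 < dot a h) ((m a)%:R * `|dot (coroot a) h'| +
    (m (- a))%:R * `|dot (coroot (- a)) h'|) =
    2 * \sum_(a <- Phi | 0 < dot a h) (m a)%:R * `|dot (coroot a) h'|.
  rewrite mulr_sumr big_seq_cond [RHS]big_seq_cond; apply: eq_bigr => a /andP[aP _].
  by rewrite m_opp // corootN dotNl normrN; ring.
by rewrite mulrA; congr (_ * _); lra.
Qed.

(** Only the roots whose hyperplanes separate h from h' contribute, each by m_a |(a^vee, h')|. The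
    proof of convexity collects these contributions wall by wall. *)
Lemma HN_sub_rhoh h h' : regular h -> HN h' - dot (rhoh h) h' =
  \sum_(a <- Phi | (0 < dot a h) && (dot a h' < 0)) (m a)%:R * - dot (coroot a) h'.
Proof.
move=> rh; rewrite (HN_split h' rh) /rhoh dotZl dot_suml -mulrBr -sumrB mulr_sumr.
rewrite [RHS]big_mkcondr big_seq_cond [RHS]big_seq_cond; apply: eq_bigr => a /andP[aP _].
rewrite dot_scoroot; case: ifP => ah.
  by rewrite ltr0_norm ?coroot_lt0 ?root_neq0 //; lra.
rewrite ger0_norm ?subrr ?mulr0 //.
by rewrite leNgt coroot_lt0 ?root_neq0 // ah.
Qed.

Lemma HN_rhoh h : regular h -> HN h = dot (rhoh h) h.
Proof.
move=> rh; apply/eqP; rewrite -subr_eq0 HN_sub_rhoh // big1_seq // => a /andP[/andP[h1 h2] _].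
by have := lt_trans h1 h2; rewrite ltxx.
Qed.

Lemma HN_ge_rhoh h h' : regular h -> dot (rhoh h) h' <= HN h'.
Proof.
move=> rh; rewrite -subr_ge0 HN_sub_rhoh // big_seq_cond; apply: sumr_ge0 => a /andP[aP /andP[_ h2]].
by rewrite mulr_ge0 // oppr_ge0 ltW // coroot_lt0 ?root_neq0.
Qed.

Lemma HN_refl a h : a \in Phi -> HN (h *m refl_mx a) = HN h.
Proof.
move=> aP; rewrite /HN (big_root_refl _ _ _ aP); congr (_ * _).
rewrite big_seq [RHS]big_seq; apply: eq_bigr => b bP.
by rewrite m_refl // coroot_refl ?root_neq0 // refl_isom // root_neq0.
Qed.

Lemma regular_refl a h : a \in Phi -> regular h -> regular (h *m refl_mx a).
Proof.
move=> aP rh b bP; rewrite -refl_dot ?root_neq0 //; apply: rh.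
by rewrite root_refl.
Qed.

Lemma rhoh_refl a h : a \in Phi -> rhoh (h *m refl_mx a) = rhoh h *m refl_mx a.
Proof.
move=> aP; rewrite /rhoh -scalemxAl mulmx_suml (big_root_refl _ _ _ aP); congr (_ *: _).
rewrite big_seq_cond [RHS]big_seq_cond.
apply: eq_big => [b|b /andP[bP _]].
  by case: (b \in Phi) => //=; rewrite refl_isom // root_neq0.
by rewrite m_refl // coroot_refl ?root_neq0 // scalemxAl.
Qed.

Lemma rhoh_ext h h' : (forall a, a \in Phi -> (0 < dot a h) = (0 < dot a h')) ->
  rhoh h = rhoh h'.
Proof.
move=> e; rewrite /rhoh; congr (_ *: _); rewrite big_seq_cond [RHS]big_seq_cond.
by apply: eq_bigl => a; case aP: (a \in Phi) => //=; exact: e.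
Qed.

(** A simple root of the chamber of h, encoded through the property that the arguments use: its
    reflection permutes the other positive roots. *)
Definition wall a h := [/\ a \in Phi, regular h, 0 < dot a h &
  forall b, b \in Phi -> b != a -> 0 < dot b h -> 0 < dot (b *m refl_mx a) h].

(** The reflection in a permutes the other positive roots and preserves m, so the sum [s] of their
    contributions is its own negative. Only a itself contributes, and (a^vee, a) = 2 cancels the
    factor 1/2. *)
Lemma wall_rhoh a h : wall a h -> dot (rhoh h) a = (m a)%:R.
Proof.
move=> [aP rh ah aw]; have a0 := root_neq0 aP.
rewrite /rhoh dotZl dot_suml (big_rootD1 _ _ aP ah).
set s := \sum_(b <- Phi | _) _.
have s0 : s = - s.
  rewrite {1}/s (big_root_refl _ _ _ aP) -sumrN big_seq_cond [RHS]big_seq_cond.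
  apply: eq_big => [b|b /andP[bP _]].
    case bP: (b \in Phi) => //=; apply/andP/andP => -[h1 h2].
      have ba : b != a.
        apply: contraTneq h2 => ->; rewrite refl_self // dotNl oppr_gt0 -leNgt.
        exact: ltW.
      split=> //; have := aw _ _ h1 h2; rewrite root_refl // bP reflK //.
      exact.
    split; last by exact: aw.
    apply: contraTneq h2 => e; have -> : b = - a.
      by rewrite -(reflK b a0) e refl_self.
    by rewrite dotNl oppr_gt0 -leNgt ltW.
  by rewrite m_refl // coroot_refl // scalemxAl refl_dot // refl_self // dotNr.
have -> : s = 0 by lra.
by rewrite /= addr0 dot_scoroot coroot_self //; lra.
Qed.

Lemma wall_refl a h : wall a h -> rhoh (h *m refl_mx a) = rhoh h - (m a)%:R *: coroot a.
Proof.
by move=> w; have [aP _ _ _] := w; rewrite rhoh_refl // reflE' wall_rhoh.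
Qed.

Lemma wall_sign a h b : wall a h -> b \in Phi -> b != a -> b != - a ->
  (0 < dot b (h *m refl_mx a)) = (0 < dot b h).
Proof.
move=> [aP rh ah aw] bP ba bNa; have a0 := root_neq0 aP.
rewrite -refl_dot //; apply/idP/idP => [h1|]; last exact: aw.
have := aw _ _ _ h1; rewrite root_refl // bP reflK //; apply=> //.
by apply: contra_neq bNa => e; rewrite -(reflK b a0) e refl_self.
Qed.

(** The point [h1] lies inside the facet cut out by a and is fixed by the reflection, so a root b
    positive at [h1] has its image positive there too; the image cannot be negative at h. *)
Lemma wallP a h h1 : a \in Phi -> regular h -> 0 < dot a h -> dot a h1 = 0 ->
  (forall b, b \in Phi -> b != a -> b != - a -> 0 < dot b h -> 0 < dot b h1) -> wall a h.
Proof.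
move=> aP rh ah ah1 H; have a0 := root_neq0 aP; split=> // b bP ba bh.
have bNa : b != - a.
  by apply: contraTneq bh => ->; rewrite dotNl oppr_gt0 -leNgt ltW.
have b1 := H b bP ba bNa bh.
have rb1 : 0 < dot (b *m refl_mx a) h1 by rewrite refl_dot // refl_fix.
have rbP : b *m refl_mx a \in Phi by rewrite root_refl.
rewrite lt_def rh //= leNgt; apply/negP => neg.
have := H (- (b *m refl_mx a)); rewrite rootN rbP !dotNl !oppr_gt0 neg => /(_ isT).
have -> : - (b *m refl_mx a) != a.
  apply: contraNneq ba => e; rewrite -(reflK b a0) -[b *m refl_mx a]opprK e reflN.
  by rewrite refl_self // opprK.
have -> : - (b *m refl_mx a) != - a.
  apply: contraNneq bNa => /oppr_inj e; rewrite -(reflK b a0) e.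
  by rewrite refl_self.
by move=> /(_ isT isT isT) /(lt_trans rb1); rewrite ltxx.
Qed.

Lemma wall_exists a : a \in Phi -> exists h, wall a h.
Proof.
move=> aP; have a0 := root_neq0 aP.
have aa : dot a a != 0 by rewrite dot_sq_eq0.
have [g gP] : exists g, forall v, v \in [seq b - (dot b a / dot a a) *: a |
    b <- [seq b <- enum_fset Phi | (b != a) && (b != - a)]] -> dot v g != 0.
  apply: avoid_hyperplanes => v /mapP [b]; rewrite mem_filter => /andP[/andP[ba bNa] bP] ->.
  apply/eqP => /eqP; rewrite subr_eq0 => /eqP /(root_parallel aP bP) [e|e].
    by rewrite e eqxx in ba.
  by rewrite e eqxx in bNa.
(* Projection of a generic vector to the hyperplane of a. No root other than a and -a vanishes
   there, so a small perturbation lies in a chamber having a or -a as a wall. *)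
pose h1 := g - (dot g a / dot a a) *: a.
have ah1 : dot a h1 = 0 by rewrite /h1 dotBr dotZr [dot a g]dotC divfK // subrr.
have bh1 b : b \in Phi -> b != a -> b != - a -> dot b h1 != 0.
  move=> bP ba bNa; have := gP (b - (dot b a / dot a a) *: a).
  rewrite (_ : dot (b - _) g = dot b h1); last first.
    by rewrite /h1 dotBl dotBr dotZl dotZr [dot a g]dotC; ring.
  apply.
  by apply: map_f; rewrite mem_filter ba bNa.
have [h [rh hP]] := perturb h1 (enum_fset Phi) (vs := enum_fset Phi) (fun v vP => root_neq0 vP).
have key h2 : regular h2 -> 0 < dot a h2 -> (forall u, u \in Phi -> 0 < dot u h1 -> 0 < dot u h2) ->
    wall a h2.
  move=> r2 ah2 H; apply: (wallP aP r2 ah2 ah1) => b bP ba bNa bh.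
  rewrite lt_def bh1 //= leNgt; apply/negP => neg.
  have := H (- b); rewrite rootN !dotNl !oppr_gt0 bP => /(_ isT neg) /(lt_trans bh).
  by rewrite ltxx.
have [ah|ah] := ltP 0 (dot a h); first by exists h; apply: key.
exists (h *m refl_mx a); apply: key.
- exact: regular_refl.
- by rewrite -refl_dot // refl_self // dotNl oppr_gt0 lt_neqAle rh.
- move=> u uP uh; rewrite -refl_dot //; apply: hP; first by rewrite root_refl.
  by rewrite refl_dot // refl_fix.
Qed.

Definition inversions h0 h := [seq b <- enum_fset Phi | (0 < dot b h0) && (dot b h < 0)].

Lemma inversions0 h0 h : regular h0 -> regular h -> inversions h0 h = [::] ->
  forall a, a \in Phi -> (0 < dot a h0) = (0 < dot a h).
Proof.
move=> r0 rh i0 a aP.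
have aux b : b \in Phi -> 0 < dot b h0 -> 0 < dot b h.
  move=> bP b0; rewrite lt_def rh //= leNgt; apply/negP => neg.
  have : b \in inversions h0 h by rewrite mem_filter b0 neg.
  by rewrite i0.
apply/idP/idP; first exact: aux.
move=> ah; rewrite lt_def r0 //= leNgt; apply/negP => neg.
have := aux (- a); rewrite rootN !dotNl !oppr_gt0 => /(_ aP neg) /(lt_trans ah).
by rewrite ltxx.
Qed.

Lemma regular_ext h h' : regular h -> regular h' ->
  (forall u, u \in Phi -> 0 < dot u h -> 0 < dot u h') ->
  forall a, a \in Phi -> (0 < dot a h) = (0 < dot a h').
Proof.
move=> r1 r2 H a aP; apply/idP/idP => [|ah]; first exact: H.
rewrite lt_def r1 //= leNgt; apply/negP => neg.
have := H (- a); rewrite rootN !dotNl !oppr_gt0 => /(_ aP neg) /(lt_trans ah).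
by rewrite ltxx.
Qed.

(** If h' is orthogonal to none of these vectors, then h' is regular and the segment from h to h'
    meets no two distinct root hyperplanes at the same point: b and c vanish together only if (b,
    h)(c, h') = (c, h)(b, h'). *)
Definition crossing_vectors h :=
  enum_fset Phi ++ [seq dot p.1 h *: p.2 - dot p.2 h *: p.1 |
   p <- [seq (b, c) | b <- enum_fset Phi, c <- enum_fset Phi] & (p.2 != p.1) && (p.2 != - p.1)].

Lemma crossing_vectors_neq0 h : regular h -> forall v, v \in crossing_vectors h -> v != 0.
Proof.
move=> r0 v; rewrite mem_cat => /orP[/root_neq0 //|/mapP [[b c]]].
rewrite mem_filter /= => /andP[/andP[cb cNb] /allpairsP [[b' c'] /= [bP cP [eb ec]]]] ->.
subst b' c'; apply/eqP => /eqP; rewrite subr_eq0 => /eqP e.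
have [||] := @root_parallel b c (dot c h / dot b h) bP cP.
- by rewrite mulrC -scalerA -e scalerA mulVf ?r0 // scale1r.
- by move/eqP; rewrite (negPf cb).
- by move/eqP; rewrite (negPf cNb).
Qed.

(* The last wall crossed by a generic segment from [h0] to the chamber of [h]. *)
Lemma last_wall h0 h : regular h0 -> regular h -> inversions h0 h != [::] ->
  exists h2 a, [/\ forall b, b \in Phi -> (0 < dot b h) = (0 < dot b h2), wall a h2,
    dot a h0 < 0 & (size (inversions h0 (h2 *m refl_mx a)) < size (inversions h0 h))%N].
Proof.
move=> r0 rh inv.
have [h2 [h2v h2u]] := perturb h (enum_fset Phi) (crossing_vectors_neq0 r0).
have r2 : regular h2 by move=> a aP; apply: h2v; rewrite mem_cat; apply/orP; left.
have sg := regular_ext rh r2 h2u.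
have invE : inversions h0 h = inversions h0 h2.
  apply: eq_in_filter => b bP; congr (_ && _).
  by have := sg (- b); rewrite rootN !dotNl !oppr_gt0 => /(_ bP).
(* Parameter at which b vanishes on the segment from [h0] to [h2]; the inversion with the largest
   parameter is the wall crossed last. *)
pose t b := dot b h0 / (dot b h0 - dot b h2).
have [b binv bmax] : exists2 b, b \in inversions h0 h2 &
    forall c, c \in inversions h0 h2 -> t c <= t b.
  rewrite -invE; move: inv; case: (inversions h0 h) => // b s _.
  exact: seq_argmax (mem_head b s).
move: (binv); rewrite mem_filter => /andP[/andP[b0 b2] bP].
have D : 0 < dot b h0 - dot b h2 by lra.
have tb : t b * (dot b h0 - dot b h2) = dot b h0 by rewrite /t divfK // gt_eqF.
have t0 : 0 < t b by rewrite divr_gt0.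
have t1 : t b < 1 by rewrite ltr_pdivrMr // mul1r; lra.
pose h1 := (1 - t b) *: h0 + t b *: h2.
have h1E c : dot c h1 = (1 - t b) * dot c h0 + t b * dot c h2 by rewrite dotDr !dotZr.
have wa : wall (- b) h2.
  apply: (@wallP _ _ h1); rewrite ?rootN //.
  - by rewrite dotNl oppr_gt0.
  - rewrite dotNl h1E (_ : _ + _ = dot b h0 - t b * (dot b h0 - dot b h2)); last by ring.
    by rewrite tb subrr oppr0.
  - move=> c cP; rewrite opprK => cNb cb c2; rewrite h1E.
    have [c0|c0] := ltP 0 (dot c h0).
      by rewrite addr_gt0 // mulr_gt0 // subr_gt0.
    have c0' : dot c h0 < 0 by rewrite lt_neqAle r0.
    have cinv : - c \in inversions h0 h2.
      by rewrite mem_filter !dotNl oppr_gt0 oppr_lt0 c0' c2 rootN.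
    have Dc : 0 < - dot c h0 + dot c h2 by lra.
    have tc : t (- c) * (- dot c h0 + dot c h2) = - dot c h0.
      by rewrite /t !dotNl opprK divfK // gt_eqF.
    have ne : t (- c) != t b.
      have : dot (dot b h0 *: c - dot c h0 *: b) h2 != 0.
        apply: h2v; rewrite mem_cat; apply/orP; right.
        apply/mapP; exists (b, c) => //; rewrite mem_filter /= cb cNb /=.
        by apply/allpairsP; exists (b, c).
      apply: contra_neq => e; rewrite dotBl !dotZl.
      move: tc tb; rewrite e; move: (t b) => T e1 e2; nra.
    have lt : t (- c) < t b by rewrite lt_neqAle ne bmax.
    nra.
exists h2, (- b); split=> //; first by rewrite dotNl oppr_lt0.
rewrite invE; have [_ _ ah2 aw] := wa; have bn0 := root_neq0 bP.
have sub : {subset inversions h0 (h2 *m refl_mx (- b)) <= rem b (inversions h0 h2)}.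
  move=> c; rewrite mem_filter => /andP[/andP[c0 c2] cP].
  have Ph2 : - b \in Phi by rewrite rootN.
  rewrite mem_rem_uniq ?filter_uniq ?fset_uniq // inE.
  have cb : c != b.
    apply: contraTneq c2 => ->; rewrite -refl_dot ?root_neq0 // -[b]opprK reflN opprK refl_self ?root_neq0 //.
    by rewrite opprK -leNgt ltW.
  rewrite cb mem_filter c0 cP andbT /=.
  have := wall_sign wa (b := - c); rewrite rootN cP !dotNl !oppr_gt0 => /(_ isT) <- //.
    by rewrite eqr_opp.
  by rewrite opprK; apply: contraTneq c0 => e; rewrite -[c]opprK e dotNl oppr_gt0 -leNgt ltW.
have ui : uniq (inversions h0 (h2 *m refl_mx (- b))) by rewrite filter_uniq ?fset_uniq.
have := uniq_leq_size ui sub; rewrite size_rem // => h3.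
rewrite -ltnS; apply: leq_ltn_trans h3 _.
by rewrite prednK // -has_predT; apply/hasP; exists b.
Qed.

Definition inverted h h' := [seq a <- enum_fset Phi | (0 < dot a h) && (dot a h' < 0)].

(** Two exponents of S on the line through nu along a^vee, at least m_a steps apart; nu need not be
    one of them. This is all that the convexity argument takes from quasi-invariance. *)
Variant string_span (S : seq V) a nu : Prop :=
  StringSpan nu1 nu2 (l : nat) (k : R) of nu1 \in S & nu2 \in S & (m a <= l)%N &
    nu1 = nu2 + l%:R *: coroot a & nu1 = nu + k *: coroot a.

Lemma convexity_generic (S : seq V) h h' v : regular h ->
  (forall u, u \in crossing_vectors h -> dot u h' != 0) ->
  v \in S -> (forall nu, nu \in S -> dot nu h <= dot v h) ->
  (forall nu a, nu \in S -> a \in Phi -> string_span S a nu) ->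
  exists2 nu, nu \in S & dot (v - rhoh h) h' + HN h' <= dot nu h'.
Proof.
move=> rh gh' vS vtop str.
pose t a := dot a h / (dot a h - dot a h').
pose H s := (1 - s) *: h + s *: h'.
have HE s u : dot u (H s) = (1 - s) * dot u h + s * dot u h' by rewrite dotDr !dotZr.
have tP a : a \in inverted h h' -> [/\ 0 < t a, t a < 1 & dot a (H (t a)) = 0].
  rewrite mem_filter => /andP[/andP[a1 a2] aP].
  have D : 0 < dot a h - dot a h' by lra.
  have ta : t a * (dot a h - dot a h') = dot a h by rewrite /t divfK // gt_eqF.
  split; first by rewrite divr_gt0.
    by rewrite ltr_pdivrMr // mul1r; lra.
  rewrite HE (_ : _ + _ = dot a h - t a * (dot a h - dot a h')); last by ring.
  by rewrite ta subrr.
have tinj a b : a \in inverted h h' -> b \in inverted h h' -> a != b -> t a != t b.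
  move=> ai bi ab; have [_ _ a0] := tP _ ai; have [_ _ b0] := tP _ bi.
  move: ai bi; rewrite !mem_filter => /andP[/andP[a1 a2] aP] /andP[/andP[b1 b2] bP].
  apply/eqP => e; have : dot (dot a h *: b - dot b h *: a) h' != 0.
    apply: gh'; rewrite mem_cat; apply/orP; right.
    apply/mapP; exists (a, b) => //; rewrite mem_filter /= eq_sym ab /=.
    apply/andP; split; last by apply/allpairsP; exists (a, b).
    by apply: contraTneq b1 => ->; rewrite dotNl oppr_gt0 -leNgt ltW.
  move/eqP; apply; rewrite dotBl !dotZl.
  move: a0 b0; rewrite !HE e; move: (t b) => T; nra.
(* [L] lists the walls still ahead of the parameter s, and p is highest in the direction [H s]. At
   the next wall a the height is constant along a^vee, and passing from [p1] to [p2] on the string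
   gains l |(a^vee, h')| >= m_a |(a^vee, h')| in the final direction. *)
have main k : forall (L : seq V) s p, size L = k -> uniq L -> {subset L <= inverted h h'} ->
    (forall a, a \in L -> s < t a) -> p \in S ->
    (forall nu, nu \in S -> dot nu (H s) <= dot p (H s)) ->
    exists2 nu, nu \in S &
      dot p h' + \sum_(a <- L) (m a)%:R * - dot (coroot a) h' <= dot nu h'.
  elim: k => [|k IH] L s p.
    by move/size0nil => -> _ _ _ pS _; exists p => //; rewrite big_nil addr0.
  move=> sL uL Li Ls pS ptop.
  have [a aL amin] : exists2 a, a \in L & forall b, b \in L -> t a <= t b.
    by move: sL {uL Li Ls IH}; case: L => // a L _; exact: seq_argmin (mem_head a L).
  have ai := Li _ aL; have [ta0 ta1 aH] := tP _ ai; have sta := Ls _ aL.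
  have aP : a \in Phi by move: ai; rewrite mem_filter => /andP[].
  have ah' : dot (coroot a) h' < 0.
    by rewrite coroot_lt0 ?root_neq0 //; move: ai; rewrite mem_filter => /andP[/andP[]].
  have caH : dot (coroot a) (H (t a)) = 0 by rewrite coroot_dot aH mulr0.
  have [r rS rtop] : exists2 r, r \in S & forall nu, nu \in S -> dot nu (H (t a)) <= dot r (H (t a)).
    exact: seq_argmax pS.
  have [p1 p2 l z p1S p2S lm p12 p1r] := str _ _ rS aP.
  have p1top nu : nu \in S -> dot nu (H (t a)) <= dot p1 (H (t a)).
    by move=> /rtop; rewrite p1r dotDl dot_scoroot caH mulr0 addr0.
  have p2top nu : nu \in S -> dot nu (H (t a)) <= dot p2 (H (t a)).
    by move=> /p1top; rewrite p12 dotDl dot_scoroot caH mulr0 addr0.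
  have [||||nu nuS nuE] := IH (rem a L) (t a) p2 _ _ _ _ p2S p2top.
  - by rewrite size_rem // sL.
  - exact: rem_uniq.
  - by move=> b /mem_rem /Li.
  - move=> b; rewrite mem_rem_uniq // inE => /andP[ba bL].
    by rewrite lt_neqAle amin // andbT tinj // ?Li // eq_sym.
  exists nu => //; apply: le_trans nuE.
  rewrite (perm_big _ (perm_to_rem aL)) big_cons addrA lerD2r.
  (* p is highest at s and [p1] at [t a] > s, so the height of [p1 - p], affine along the segment,
     is nonpositive at s and nonnegative at [t a], hence nonnegative at the end h'. *)
  have h1 : dot p h' <= dot p1 h'.
    have A := p1top _ pS; have B := ptop _ p1S; move: A B.
    rewrite !HE -subr_ge0 => A; rewrite -subr_le0 => B.
    set D := dot p1 h' - dot p h'; set D0 := dot p1 h - dot p h.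
    have A' : 0 <= (1 - t a) * D0 + t a * D by move: A; congr (_ <= _); rewrite /D /D0; ring.
    have B' : (1 - s) * D0 + s * D <= 0 by move: B; congr (_ <= _); rewrite /D /D0; ring.
    rewrite -subr_ge0 -/D -(@pmulr_rge0 _ (t a - s)) ?subr_gt0 //.
    rewrite (_ : (t a - s) * D = (1 - s) * ((1 - t a) * D0 + t a * D) - (1 - t a) * ((1 - s) * D0 + s * D)); last by ring.
    have s1 : 0 <= 1 - s by rewrite subr_ge0 ltW // (lt_trans sta).
    have t1' : 0 <= 1 - t a by rewrite subr_ge0 ltW.
    nra.
  move: h1; rewrite p12 dotDl dot_scoroot => h1.
  have : (m a)%:R <= l%:R :> R by rewrite ler_nat.
  nra.
have [||||nu nuS nuE] := main _ (inverted h h') 0 v erefl _ _ _ vS _ => //.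
- by rewrite filter_uniq ?fset_uniq.
- by move=> a /tP[].
- by move=> nu /vtop; rewrite !HE !mul0r !addr0 subr0 !mul1r.
exists nu => //; apply: le_trans nuE.
by rewrite dotBl -addrA lerD2l addrC HN_sub_rhoh // big_filter.
Qed.

Lemma HN_attained h : exists2 g, regular g & HN h = dot (rhoh g) h.
Proof.
have [g [g1 g2]] := perturb h (enum_fset Phi) (vs := enum_fset Phi) (fun v vP => root_neq0 vP).
exists g => //; apply/eqP; rewrite -subr_eq0 HN_sub_rhoh // big_seq_cond big1 // => a /andP[aP /andP[a1 a2]].
have := g2 (- a); rewrite rootN !dotNl !oppr_gt0 => /(_ aP a2) /(lt_trans a1).
by rewrite ltxx.
Qed.

(** If the bound failed at h' for all exponents, it would fail strictly, hence also at a nearby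
    direction to which the generic case applies. *)
Lemma convexity (S : seq V) h h' v : regular h ->
  v \in S -> (forall nu, nu \in S -> dot nu h <= dot v h) ->
  (forall nu a, nu \in S -> a \in Phi -> string_span S a nu) ->
  exists2 nu, nu \in S & dot (v - rhoh h) h' + HN h' <= dot nu h'.
Proof.
move=> rh vS vtop str; apply: contrapT => H.
have [g rg gE] := HN_attained h'.
have [h2 [h2a h2b]] := perturb h' [seq v - rhoh h + rhoh g - nu | nu <- S]
  (crossing_vectors_neq0 rh).
have [nu nuS] := convexity_generic rh h2a vS vtop str.
have : 0 < dot (v - rhoh h + rhoh g - nu) h2.
  apply: h2b; first exact: map_f.
  rewrite dotBl [dot (_ + rhoh g) _]dotDl -gE subr_gt0 ltNge; apply/negP => h3.
  by apply: H; exists nu.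
rewrite dotBl [dot (_ + rhoh g) _]dotDl subr_gt0.
have := HN_ge_rhoh h2 rg; lra.
Qed.

Lemma weyl_isom w u v : weyl Phi w -> dot (u *m w) (v *m w) = dot u v.
Proof.
move=> Ww; elim: Ww u v => [|a w' aP _ IH] u v; first by rewrite !mulmx1.
by rewrite !mulmxA IH refl_isom // root_neq0.
Qed.

Lemma weyl_root w a : weyl Phi w -> a \in Phi -> a *m w \in Phi.
Proof.
move=> Ww; elim: Ww a => [|b w' bP _ IH] a aP; first by rewrite mulmx1.
by rewrite mulmxA IH // root_refl.
Qed.

Lemma weylM' w w' : weyl Phi w -> weyl Phi w' -> weyl Phi (w *m w').
Proof.
elim=> [|b w0 bP _ IH] Ww'; first by rewrite mul1mx.
by rewrite -mulmxA; apply: weylM => //; exact: IH.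
Qed.

Lemma weyl_refl a : a \in Phi -> weyl Phi (refl_mx a).
Proof. by move=> aP; rewrite -[refl_mx a]mulmx1; apply: weylM => //; exact: weyl1. Qed.

Lemma refl_mxK a : a \in Phi -> refl_mx a *m refl_mx a = 1%:M.
Proof.
by move=> aP; apply: root_mx_ext => b bP; rewrite mulmxA reflK ?root_neq0 // mulmx1.
Qed.

Lemma weyl_inverse w : weyl Phi w -> exists2 w', weyl Phi w' & w *m w' = 1%:M /\ w' *m w = 1%:M.
Proof.
elim=> [|a w0 aP _ [w' Ww' [e1 e2]]]; first by exists 1%:M; [exact: weyl1|rewrite mul1mx].
exists (w' *m refl_mx a); first by apply: weylM' => //; exact: weyl_refl.
split; first by rewrite mulmxA -(mulmxA _ w0) e1 mulmx1 refl_mxK.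
by rewrite mulmxA -(mulmxA w') refl_mxK // mulmx1.
Qed.

Lemma weyl_invmx w : weyl Phi w -> weyl Phi (invmx w) /\ w *m invmx w = 1%:M /\ invmx w *m w = 1%:M.
Proof.
move=> Ww; have [w' Ww' [e1 e2]] := weyl_inverse Ww.
have [wu iw] := mulmx1_unit e1.
have -> : invmx w = w' by rewrite -[RHS]mul1mx -(mulVmx wu) -mulmxA e1 mulmx1.
by [].
Qed.

(** A Weyl group element is determined by its action on the finite set of roots, which spans. *)
Lemma weyl_finite : finite_set [set w | weyl Phi w].
Proof.
pose F (f : {ffun Phi -> Phi}) : 'M[R]_n :=
  xget 0 [set w | weyl Phi w /\ forall a : Phi, val a *m w = val (f a)].
apply: (@sub_finite_set _ _ (range F)); last exact/finite_image/finite_finset.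
move=> w /= Ww.
pose f := [ffun a : Phi => [` weyl_root Ww (valP a)]%fset].
exists f => //; rewrite /F; case: xgetP => [w' -> [Ww' e]|/(_ w)].
  by apply: root_mx_ext => a aP; have := e [` aP]%fset; rewrite ffunE /=.
by case; split=> // a; rewrite ffunE.
Qed.

(** Take w for which the pairing of [h0 *m w] with h is largest; comparison with [refl_mx a *m w]
    gives the sign at each positive root a. *)
Lemma weyl_dominant h0 h : exists2 w, weyl Phi w &
  forall a, a \in Phi -> 0 < dot a h0 -> 0 <= dot (a *m w) h.
Proof.
have [w [Ww wmax]] : exists w, weyl Phi w /\
    forall w', weyl Phi w' -> dot (h0 *m w') h <= dot (h0 *m w) h.
  have /finite_seqP [s sE] := weyl_finite.
  have mem w : weyl Phi w <-> w \in s.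
    by split=> [Ww|ws]; [have : [set w | weyl Phi w] w by []; rewrite sE|
      have : [set` s] w by []; rewrite -sE].
  have [w ws wmax] : exists2 w, w \in s & forall w', w' \in s -> dot (h0 *m w') h <= dot (h0 *m w) h.
    have /mem : weyl Phi 1%:M by exact: weyl1.
    exact: seq_argmax.
  by exists w; split; [exact/mem|move=> w' /mem; exact: wmax].
exists w => // a aP a0; have := wmax _ (weylM aP Ww).
rewrite mulmxA reflE mulmxBl dotBl -scalemxAl dotZl gerBl dotC pmulr_rge0 //.
by rewrite [dot h0 _]dotC coroot_gt0 ?root_neq0.
Qed.

Lemma rhoh_weyl w h : weyl Phi w -> rhoh (h *m w) = rhoh h *m w.
Proof.
move=> Ww; elim: Ww h => [|a w' aP _ IH] h; first by rewrite !mulmx1.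
by rewrite !mulmxA IH rhoh_refl.
Qed.

Lemma regular_weyl w h : weyl Phi w -> regular h -> regular (h *m w).
Proof.
move=> Ww; elim: Ww h => [|a w' aP _ IH] h rh; first by rewrite mulmx1.
by rewrite mulmxA; apply: IH; exact: regular_refl.
Qed.

Lemma regular_transitive h0 h : regular h0 -> regular h -> exists2 w, weyl Phi w &
  forall a, a \in Phi -> (0 < dot a h) = (0 < dot a (h0 *m w)).
Proof.
move=> r0 rh; have [w Ww wP] := weyl_dominant h0 h.
have [Wi [e1 e2]] := weyl_invmx Ww.
exists w => // a aP; apply/esym/regular_ext => //; first exact: regular_weyl.
move=> u uP; rewrite -{1}[u]mulmx1 -e2 mulmxA weyl_isom // => u0.
have := wP _ (weyl_root Wi uP) u0; rewrite -mulmxA e2 mulmx1 le_eqVlt => /orP[|//].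
by rewrite eq_sym (negPf (rh _ uP)).
Qed.

Definition short_roots : {fset V} :=
  [fset a in Phi | all (fun b => dot a a <= dot b b) (enum_fset Phi)]%fset.

Lemma short_rootP a : reflect (a \in Phi /\ forall b, b \in Phi -> dot a a <= dot b b)
  (a \in short_roots).
Proof.
rewrite !inE /=; apply: (iffP andP) => -[aP]; first by move/allP.
by move=> h; split=> //; apply/allP.
Qed.

Lemma short_root_refl a b : b \in Phi -> (a *m refl_mx b \in short_roots) = (a \in short_roots).
Proof.
have aux c : b \in Phi -> c \in short_roots -> c *m refl_mx b \in short_roots.
  move=> bP /short_rootP [cP h]; apply/short_rootP; rewrite root_refl //.
  by rewrite refl_isom // root_neq0.
move=> bP; apply/idP/idP; last exact: aux.
by move/(aux _ bP); rewrite reflK // root_neq0.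
Qed.

Lemma short_rootN a : (- a \in short_roots) = (a \in short_roots).
Proof. by apply/short_rootP/short_rootP; rewrite rootN dotNl dotNr opprK. Qed.

Lemma short_root_exists : exists a, a \in short_roots.
Proof.
have [a aP] : exists a, a \in Phi.
  apply: contrapT => H; case: (roots_nonempty HPhi); apply/fsetP => a; rewrite inE.
  by apply/negP => aP; apply: H; exists a.
have [b bP bmin] := seq_argmin (fun b => dot b b) aP.
by exists b; apply/short_rootP.
Qed.

(** Strict Cauchy-Schwarz for nonproportional roots, together with |b| <= |a|, forces (a^vee, b)^2 <
    4. *)
Lemma short_root_quasiminuscule a b : b \in short_roots -> a \in Phi -> a != b -> a != - b ->
  [\/ dot (coroot a) b = 1, dot (coroot a) b = 0 | dot (coroot a) b = -1].
Proof.
move=> /short_rootP [bP bmin] aP ab aNb.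
have a0 := root_neq0 aP; have b0 := root_neq0 bP.
have aa : 0 < dot a a by rewrite dot_sq_gt0.
have bb : 0 < dot b b by rewrite dot_sq_gt0.
have [k kE] := root_int aP bP.
have cs : dot a b ^+ 2 < dot a a * dot b b.
  have : 0 < dot (a - (dot a b / dot b b) *: b) (a - (dot a b / dot b b) *: b).
    rewrite dot_sq_gt0 subr_eq0; apply/eqP => /(root_parallel bP aP) [] /eqP.
      by rewrite (negPf ab).
    by rewrite (negPf aNb).
  rewrite dotBl !dotBr !dotZl !dotZr [dot b a]dotC => h.
  have : 0 < dot a a - dot a b ^+ 2 / dot b b.
    move: h; congr (_ < _); field; exact: lt0r_neq0.
  by rewrite subr_gt0 ltr_pdivrMr.
have ba := bmin _ aP.
have kk : dot a b = k%:~R * dot a a / 2 by rewrite -kE coroot_dot; field; exact: lt0r_neq0.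
have k4 : (k%:~R : R) ^+ 2 < 4.
  rewrite ltNge; apply/negP => k4; move: cs; rewrite kk ltNge => /negP; apply.
  rewrite (_ : (_ / 2) ^+ 2 = k%:~R ^+ 2 / 4 * dot a a * dot a a); last by field.
  apply: le_trans (ler_wpM2l (ltW aa) ba) _; rewrite -[leRHS]mulrA ler_peMl ?mulr_ge0 ?(ltW aa) //.
  by rewrite ler_pdivlMr // mul1r.
have k4' : (k ^+ 2 < 4)%R by rewrite -(ltr_int R) rmorphXn.
have := int_sq_lt4 k4'.
by rewrite kE => /orP[/orP[]|] /eqP ->; [constructor 1|constructor 2|constructor 3].
Qed.

(** Irreducibility enters here. The roots in the span of the short roots ([sp], written as a double
    orthogonal) are orthogonal to all other roots: if a short t is not orthogonal to b, then b is a
    multiple of t minus its reflection in b. *)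
Lemma short_root_sep u : (forall b, b \in short_roots -> dot b u = 0) -> u = 0.
Proof.
move=> hu.
pose sp v := `[< forall w, (forall b, b \in short_roots -> dot b w = 0) -> dot v w = 0 >].
pose A := [fset a in Phi | sp a]%fset; pose B := [fset a in Phi | ~~ sp a]%fset.
have AB : Phi = (A `|` B)%fset.
  by apply/fsetP => a; rewrite !inE /=; case: (a \in Phi) => //=; case: (sp a).
have orth a b : a \in A -> b \in B -> dot a b = 0.
  rewrite !inE /= => /andP[aP /asboolP sa] /andP[bP nsb].
  apply: sa => t ts; apply/eqP; apply: contraNT nsb => tb.
  have [tP _] := short_rootP _ ts.
  have tb' : dot t (coroot b) != 0 by rewrite dotC coroot_eq0 ?root_neq0 // dotC.
  apply/asboolP => w hw.
  have := hw (t *m refl_mx b); rewrite short_root_refl // => /(_ ts).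
  rewrite reflE dotBl (hw _ ts) dotZl sub0r => /eqP.
  by rewrite oppr_eq0 mulf_eq0 (negPf tb') => /eqP.
have [A0|B0] := roots_irreducible HPhi AB orth.
  have [a aS] := short_root_exists; have [aP _] := short_rootP _ aS.
  have : a \in A by rewrite !inE /= aP; apply/asboolP => w; apply.
  by rewrite A0 inE.
apply: root_sep => a aP; have : a \in A by move: aP; rewrite {1}AB B0 fsetU0.
by rewrite !inE /= => /andP[_ /asboolP]; apply.
Qed.

Definition Qv : set V := coroot_lattice Phi.

Lemma Qv0 : Qv 0.
Proof. by exists (fun=> 0); rewrite big1 // => a _; rewrite mulr0z. Qed.

Lemma QvD u v : Qv u -> Qv v -> Qv (u + v).
Proof.
move=> [k ->] [l ->]; exists (fun a => k a + l a); rewrite -big_split.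
by apply: eq_bigr => a _; rewrite mulrzDr.
Qed.

Lemma QvN u : Qv u -> Qv (- u).
Proof.
move=> [k ->]; exists (fun a => - k a); rewrite -sumrN.
by apply: eq_bigr => a _; rewrite mulrNz.
Qed.

Lemma Qv_coroot a : a \in Phi -> Qv (coroot a).
Proof.
move=> aP; exists (fun b => (b == a)%:Z); rewrite (bigD1_seq a) ?fset_uniq //= eqxx.
by rewrite big1 ?addr0 // => b /negPf ->; rewrite mulr0z.
Qed.

Lemma QvZ u (k : int) : Qv u -> Qv (k%:~R *: u).
Proof.
move=> [l ->]; exists (fun a => k * l a); rewrite scaler_sumr.
by apply: eq_bigr => a _; rewrite -[coroot a *~ l a]scaler_int scalerA -intrM scaler_int.
Qed.

Lemma Qv_coroot_int a (k : int) : a \in Phi -> Qv (k%:~R *: coroot a).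
Proof. by move=> aP; exact/QvZ/Qv_coroot. Qed.

Lemma Qv_sum I (r : seq I) (P : pred I) (F : I -> V) :
  (forall i, P i -> Qv (F i)) -> Qv (\sum_(i <- r | P i) F i).
Proof. by move=> h; elim/big_ind: _ => //; [exact: Qv0|exact: QvD]. Qed.

Lemma Qv_int u a : Qv u -> a \in Phi -> exists k : int, dot u a = k%:~R.
Proof.
move=> [k ->] aP; apply/intrP; rewrite dot_suml big_seq; apply: rpred_sum => b bP.
have [l lE] := root_int bP aP; rewrite -scaler_int dotZl lE -intrM; exact: intr_int.
Qed.

Lemma rhoh_Qv h h0 : regular h -> regular h0 -> Qv (rhoh h - rhoh h0).
Proof.
move=> rh r0; have rhohE g : regular g -> rhoh g = 2^-1 *: \sum_(a <- Phi | 0 < dot a h0)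
   (if 0 < dot a g then (m a)%:R *: coroot a else - ((m a)%:R *: coroot a)).
  move=> rg; rewrite /rhoh big_mkcond (big_root_split _ _ r0); congr (_ *: _).
  rewrite big_seq_cond [RHS]big_seq_cond; apply: eq_bigr => a /andP[aP _] /=.
  rewrite m_opp // corootN scalerN dotNl oppr_gt0; case: ltgtP (rg a aP) => //= _ _.
    by rewrite addr0.
  by rewrite add0r.
rewrite (rhohE h) // (rhohE h0) // -scalerBr -sumrB scaler_sumr big_seq_cond.
apply: Qv_sum => a /andP[aP a0]; rewrite a0; case: ifP => _.
  by rewrite subrr scaler0; exact: Qv0.
rewrite -opprD scalerN -scalerDl scalerA; apply: QvN.
have -> : 2^-1 * ((m a)%:R + (m a)%:R) = ((m a)%:Z)%:~R :> R by rewrite -pmulrn; field.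
exact: Qv_coroot_int.
Qed.

Lemma rhoh_int h a : regular h -> a \in Phi -> exists k : int, dot (rhoh h) a = k%:~R.
Proof.
move=> rh aP; have [h1 w] := wall_exists aP; have [_ r1 _ _] := w.
have [k kE] := Qv_int (rhoh_Qv rh r1) aP.
exists (k + (m a)%:Z); rewrite rmorphD /= -kE dotBl (wall_rhoh w).
by rewrite -[(_%:~R)]/((m a)%:R) subrK.
Qed.

End RootSystem.

End RootSystems.
Import RootSystems.

(** * Quasi-invariance as a condition on the coefficients along coroot strings *)

Module StringConditions.

Section SymmetricPowerSums.
Context {F : fieldType}.

(* [(chebU2 k).1] is U_k(X / 2), U_k the Chebyshev polynomial of the second kind. *)
Fixpoint chebU2 (k : nat) : {poly F} * {poly F} :=
  if k is k'.+1 then let: (u, v) := chebU2 k' in (v, 'X * v - u) else (1, 'X).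

Lemma chebU2E k (y : F) : y != 0 ->
  (y - y^-1) * (chebU2 k).1.[y + y^-1] = y ^+ k.+1 - y ^- k.+1 /\
  (y - y^-1) * (chebU2 k).2.[y + y^-1] = y ^+ k.+2 - y ^- k.+2.
Proof.
move=> y0; elim: k => [|k] /=.
  by rewrite hornerX hornerC mulr1 !expr1; split; field.
case: (chebU2 k) => u v /= [h1 h2]; split=> //.
rewrite hornerD hornerN hornerM hornerX mulrBr mulrCA h1 h2 !exprS.
have yk : y ^+ k != 0 by rewrite expf_neq0.
by move: (y ^+ k) yk => Y Y0; field; rewrite ?y0 ?Y0.
Qed.

Lemma size_chebU2 k : (chebU2 k).1 \is monic /\ size (chebU2 k).1 = k.+1 /\
  (chebU2 k).2 \is monic /\ size (chebU2 k).2 = k.+2.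
Proof.
elim: k => [|k] /=; first by rewrite monic1 size_poly1 monicX size_polyX.
case: (chebU2 k) => u v /= [um [su [vm sv]]]; split=> //; split=> //.
have sX : size ('X * v) = k.+3 by rewrite size_Mmonic ?monicX ?size_polyX ?sv // polyX_eq0.
have lt : (size (- u) < size ('X * v)%R)%N by rewrite size_polyN su sX ltnS ltnW.
by rewrite size_polyDl // monicE lead_coefDl // -monicE monicMr // monicX.
Qed.

Context (T : Type) (J : seq T) (P : pred T) (y c : T -> F) (m : nat).
Context (y0 : forall j, y j != 0).
Context (h : forall s, (1 <= s <= m)%N ->
  \sum_(j <- J | P j) c j * (y j ^+ s - y j ^- s) = 0).

(** With u = y + 1/y, the difference y^s - y^{-s} is (y - 1/y) times a monic polynomial of degree s
    - 1 in u, so the conditions s = 1, ..., m together annihilate all polynomials of degree below m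
    in u. *)
Lemma sym_sum_poly (p : {poly F}) : (size p <= m)%N ->
  \sum_(j <- J | P j) c j * (y j - (y j)^-1) * p.[y j + (y j)^-1] = 0.
Proof.
have [k] := ubnP (size p); elim: k p => // k IH p; rewrite ltnS => sk sm.
have [->|p0] := eqVneq p 0; first by rewrite big1 // => j _; rewrite horner0 mulr0.
have sp : (0 < size p)%N by rewrite lt0n size_poly_eq0.
pose U := (chebU2 (size p).-1).1; have [Um [sU _]] := size_chebU2 (size p).-1.
rewrite prednK // in sU.
pose r := p - lead_coef p *: U.
have sr : (size r < size p)%N.
  rewrite ltn_neqAle; apply/andP; split.
    apply/eqP => e; have : r`_(size p).-1 != 0.
      by rewrite -e -lead_coefE lead_coef_eq0 -size_poly_gt0 e.
    by rewrite coefB coefZ -lead_coefE -[in U`__]sU -lead_coefE (monicP Um) mulr1 subrr eqxx.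
  apply: leq_trans (size_polyD _ _) _; rewrite geq_max leqnn size_polyN.
  by rewrite (leq_trans (size_scale_leq _ _)) // sU.
have pE : p = r + lead_coef p *: U by rewrite subrK.
transitivity (\sum_(j <- J | P j) c j * (y j - (y j)^-1) * r.[y j + (y j)^-1] +
  lead_coef p * \sum_(j <- J | P j) c j * (y j ^+ size p - y j ^- size p)).
  rewrite mulr_sumr -big_split; apply: eq_bigr => j _ /=.
  have [e _] := chebU2E (size p).-1 (y0 j); rewrite prednK // in e.
  rewrite -e {1}pE hornerD hornerZ -/U; ring.
rewrite IH ?h ?mulr0 ?addr0 ?sp //; first exact: leq_trans sr sk.
exact: leq_trans (ltnW sr) sm.
Qed.

(** When u takes at most m values, a polynomial of degree below m that vanishes at all of them but
    [u0] isolates the class of [u0]. *)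
Lemma sym_sum_class (u0 : F) :
  (size (undup [seq (y j + (y j)^-1)%R | j <- J & P j]) <= m)%N ->
  \sum_(j <- J | P j && (y j + (y j)^-1 == u0)) c j * (y j - (y j)^-1) = 0.
Proof.
set us := undup _ => sus.
have [uus|uus] := boolP (u0 \in us); last first.
  have key (B : seq T) : u0 \notin undup [seq y j + (y j)^-1 | j <- B & P j] ->
     \sum_(j <- B | P j && (y j + (y j)^-1 == u0)) c j * (y j - (y j)^-1) = 0.
    elim: B => [|j B IH]; first by rewrite big_nil.
    rewrite big_cons mem_undup /=; case: ifP => [Pj|Pj].
      rewrite /= inE negb_or eq_sym => /andP[/negPf -> hB] /=.
      by apply: IH; rewrite mem_undup.
    by move=> hB /=; apply: IH; rewrite mem_undup.
  exact: key.
pose p := \prod_(u <- rem u0 us) ('X - u%:P).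
have sp : (size p <= m)%N.
  by rewrite size_prod_XsubC size_rem // prednK // -has_predT; apply/hasP; exists u0.
have pu0 : p.[u0] != 0.
  rewrite horner_prod prodf_seq_neq0; apply/allP => u; rewrite mem_rem_uniq ?undup_uniq // inE.
  by rewrite hornerXsubC subr_eq0 eq_sym => /andP[].
have := sym_sum_poly sp; rewrite (bigID (fun j => y j + (y j)^-1 == u0)) /=.
rewrite [X in _ + X](_ : _ = 0) ?addr0; last first.
  have key (B : seq T) : (forall u, u \in [seq y j + (y j)^-1 | j <- B & P j] -> u \in us) ->
     \sum_(j <- B | P j && (y j + (y j)^-1 != u0)) c j * (y j - (y j)^-1) * p.[y j + (y j)^-1] = 0.
    elim: B => [|j B IH] hB; first by rewrite big_nil.
    rewrite big_cons IH ?addr0; last first.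
      by move=> u uB; apply: hB => /=; case: ifP => // _; rewrite inE uB orbT.
    case: ifP => // /andP[Pj ju]; rewrite (_ : p.[_] = 0) ?mulr0 //.
    have ji : y j + (y j)^-1 \in rem u0 us.
      by rewrite mem_rem_uniq ?undup_uniq // inE ju hB //= Pj mem_head.
    by rewrite horner_prod (big_rem _ ji) /= hornerXsubC subrr mul0r.
  by apply: key => u; rewrite mem_undup.
rewrite (eq_bigr (fun j => c j * (y j - (y j)^-1) * p.[u0])); last by move=> j /andP[_ /eqP ->].
by rewrite -mulr_suml => /eqP; rewrite mulf_eq0 (negPf pu0) orbF => /eqP.
Qed.

End SymmetricPowerSums.

Section QuasiInvariance.
Context {R : realType} {C : numClosedFieldType} {n : nat} {rc : {rmorphism R -> C}}.
Context {E : C -> C} (HE : qexponential E).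
Context {Phi : {fset 'rV[R]_n}} (HPhi : reduced_irreducible_root_system Phi).
Context (m : 'rV[R]_n -> nat).
Local Notation V := ('rV[R]_n).
Local Notation VC := ('rV[C]_n).
Local Notation cv := (cv rc).
Local Notation EE := (@EE C n E).
Local Notation csum := (@csum R C n rc E).
Implicit Types (x z w : VC) (a b u v nu : V) (f g : VC -> C) (S : seq V) (c : V -> C).

(** The number q^{(a, x + nu)}: a shift of z by (s/2) a multiplies the exponential at x + nu by its
    s-th power. *)
Definition yv a x nu : C := E (dot (cv a) (x + cv nu)).

(* [QIf] is the quasi-invariance imposed on psi; [QI] is its form on the coefficients, one equation
   for each [coroot a]-string and each [s]. *)
Definition QI x S c := forall a nu0 s, a \in Phi -> (1 <= s <= m a)%N ->
  \sum_(nu <- S | `[< str (coroot a) nu0 nu >]) c nu * (yv a x nu ^+ s - yv a x nu ^- s) = 0.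

Definition QIf f := forall a s z, a \in Phi -> (1 <= s <= m a)%N -> @Gam R C n rc E (coroot a) z ->
  f (z + (s%:R / 2) *: cv a) = f (z - (s%:R / 2) *: cv a).

Lemma yv_neq0 a x nu : yv a x nu != 0.
Proof. exact: (qexp_neq0 HE). Qed.

Lemma EE_half x nu a (s : nat) : EE (x + cv nu) ((s%:R / 2) *: cv a) = yv a x nu ^+ s.
Proof. by rewrite /ExponentialSums.EE dotZr /yv -(qexpMn HE) [dot (x + _) _]dotC; congr E; field. Qed.

Lemma csum_half x S c a (s : nat) z :
  csum x S c (z + (s%:R / 2) *: cv a) - csum x S c (z - (s%:R / 2) *: cv a) =
  EE x z * \sum_(nu <- S) (c nu * (yv a x nu ^+ s - yv a x nu ^- s)) * EE (cv nu) z.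
Proof.
rewrite mulr_sumr -sumrB; apply: eq_bigr => nu _.
by rewrite !(EEDr HE) (EENr HE) EE_half (EEDl HE); ring.
Qed.

(** Up to the factor [EE x z], the difference of the two sides of quasi-invariance is a sum of
    characters of [Gam (coroot a)]; these are independent, and exponents share a character exactly
    along a string. *)
Lemma QIf_QI x S c : QIf (csum x S c) -> QI x S c.
Proof.
move=> q a nu0 s aP sm; apply: (@Gam_str_sum _ _ _ rc _ HE (coroot a)).
  exact/coroot_neq0/(root_neq0 HPhi).
move=> z Gz; apply: (mulfI (EE_neq0 HE x z)); rewrite mulr0 -csum_half.
by rewrite q // subrr.
Qed.

Lemma QI_QIf x S c : QI x S c -> QIf (csum x S c).
Proof.
move=> q a s z aP sm Gz; apply/eqP; rewrite -subr_eq0 csum_half.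
rewrite (_ : \sum_(nu <- S) _ = \sum_(nu <- S) (c nu * (yv a x nu ^+ s - yv a x nu ^- s)) *
  EE (cv (rep (coroot a) nu)) z); last first.
  apply: eq_bigr => nu _; congr (_ * _); apply: (Gam_str HE) Gz.
  exact/str_sym/rep_str.
rewrite (str_sum_rep (coroot a) S _ (fun r => EE (cv r) z)) big_seq big1 ?mulr0 //.
move=> r; rewrite mem_undup => /mapP [nu0 _ ->].
rewrite (eq_bigl (fun nu => `[< str (coroot a) nu0 nu >])) ?q ?mul0r // => nu.
by rewrite -str_rep eq_sym.
Qed.

(** Non-resonance: besides y = y', only y y' = 1 makes y + 1/y and y' + 1/y' coincide. The case nu =
    nu' is included and says that y differs from 1/y. *)
Definition nonres x S := forall a nu nu', a \in Phi -> nu \in S -> nu' \in S ->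
  str (coroot a) nu nu' -> yv a x nu * yv a x nu' != 1.

Lemma yv_str a x nu (k : int) : a \in Phi ->
  yv a x (nu + k%:~R *: coroot a) = yv a x nu * E (2 * k)%:~R.
Proof.
move=> aP; rewrite /yv -(qexpD HE); congr E.
rewrite cvD addrA [dot _ (_ + cv (_ *: _))]dotDr dot_cv dotZr [dot a (coroot a)]dotC.
by rewrite (coroot_self (root_neq0 HPhi aP)) rmorphM rmorph_int rmorph_nat intrM mulrC.
Qed.

Lemma yv_inj a x nu nu' : a \in Phi -> str (coroot a) nu nu' -> yv a x nu = yv a x nu' -> nu = nu'.
Proof.
move=> aP [k ->]; rewrite yv_str // -{1}[yv a x nu]mulr1 => /(mulfI (yv_neq0 _ _ _)) /esym e.
have /eqP := qexp_nroot HE e; rewrite mulf_eq0 /= => /eqP ->.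
by rewrite scale0r addr0.
Qed.

Lemma addV_eq (y1 y2 : C) : y1 != 0 -> y2 != 0 -> y1 + y1^-1 = y2 + y2^-1 -> y1 = y2 \/ y1 * y2 = 1.
Proof.
move=> h1 h2 e; have : (y1 - y2) * (y1 * y2 - 1) = 0.
  have -> : (y1 - y2) * (y1 * y2 - 1) = y1 * y2 * ((y1 + y1^-1) - (y2 + y2^-1)).
    by field; rewrite h2.
  by rewrite e subrr mulr0.
by move/eqP; rewrite mulf_eq0 !subr_eq0 => /orP[] /eqP; [left|right].
Qed.

Lemma uniq_int_spread (s : seq int) (k : nat) : uniq s -> (k < size s)%N ->
  exists i j (l : nat), [/\ i \in s, j \in s, (k <= l)%N & i = j + l%:Z].
Proof.
move=> us ks; case: s us ks => // i0 s us ks.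
have [i si imax] := seq_argmax id (mem_head i0 s).
have [j sj jmin] := seq_argmin id (mem_head i0 s).
have ij : j <= i by exact: imax.
exists i, j, `|i - j|%N; split=> //; last by rewrite gez0_abs ?subr_ge0 //; lia.
rewrite leqNgt; apply/negP => lt.
have sub : {subset [seq `|t - j|%N | t <- i0 :: s] <= iota 0 k}.
  move=> _ /mapP [t ts ->]; rewrite mem_iota add0n.
  have := imax _ ts; have := jmin _ ts => /= h1 h2; lia.
have ut : uniq [seq `|t - j|%N | t <- i0 :: s]; last first.
  by have := uniq_leq_size ut sub; rewrite size_map size_iota leqNgt ks.
rewrite map_inj_in_uniq // => t1 t2 /jmin /= h1 /jmin /= h2; lia.
Qed.

Lemma string_span_size (S : seq V) (c : V -> C) nu a : uniq S -> a \in Phi ->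
  (m a < size [seq nu' <- S | (c nu' != 0)%R && `[< str (coroot a) nu nu' >]])%N ->
  string_span m [seq nu <- S | c nu != 0] a nu.
Proof.
move=> uS aP; set T := [seq nu' <- S | _] => sT.
have strT v : v \in T -> exists k : int, v = nu + k%:~R *: coroot a.
  by rewrite mem_filter => /andP[/andP[_ /asboolP]].
pose kk v : int := if pselect (exists k : int, v = nu + k%:~R *: coroot a) is left e then projT1 (cid e) else 0.
have kkE v : v \in T -> v = nu + (kk v)%:~R *: coroot a.
  by move=> /strT e; rewrite /kk; case: pselect => // e'; case: (cid e').
have ukk : uniq (map kk T).
  by rewrite map_inj_in_uniq ?filter_uniq // => v1 v2 /kkE e1 /kkE e2 e; rewrite e1 e2 e.
have [|i [j [l [/mapP [v1 v1T e1] /mapP [v2 v2T e2] kl ij]]]] := uniq_int_spread (k := m a) ukk.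
  by rewrite size_map.
exists v1 v2 l ((kk v1)%:~R : R) => //.
- by move: v1T; rewrite !mem_filter => /andP[/andP[-> _] ->].
- by move: v2T; rewrite !mem_filter => /andP[/andP[-> _] ->].
- rewrite (kkE _ v1T) (kkE _ v2T) -e1 -e2 ij intrD scalerDl addrA; congr (_ + _ + _ *: _).
- exact: kkE.
Qed.

(** On a string, y + 1/y separates the exponents. With at most m_a nonzero coefficients the
    conditions would isolate each one and force c (y - 1/y) = 0. So there are at least m_a + 1, and
    two of these are at least m_a steps apart. *)
Lemma QI_string_span x S c : uniq S -> QI x S c -> nonres x S ->
  forall nu a, nu \in [seq nu <- S | c nu != 0] -> a \in Phi ->
  string_span m [seq nu <- S | c nu != 0] a nu.
Proof.
move=> uS q nr nu a nuS aP; set T := [seq nu' <- S | (c nu' != 0) && `[< str (coroot a) nu nu' >]].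
have [nuS' cnu] : nu \in S /\ c nu != 0 by move: nuS; rewrite mem_filter => /andP[].
have inj : {in T &, injective (fun v => yv a x v + (yv a x v)^-1)}.
  move=> v1 v2; rewrite !mem_filter => /andP[/andP[_ /asboolP s1] v1S] /andP[/andP[_ /asboolP s2] v2S].
  have s12 := str_trans (str_sym s1) s2.
  move=> /(addV_eq (yv_neq0 _ _ _) (yv_neq0 _ _ _)) [|/eqP]; first exact: yv_inj.
  by rewrite (negPf (nr _ _ _ aP v1S v2S s12)).
have nuT : nu \in T by rewrite mem_filter cnu nuS' andbT; apply/asboolP; exact: str_refl.
have sT : (m a < size T)%N.
  rewrite ltnNge; apply/negP => sT.
  have hT s : (1 <= s <= m a)%N ->
      \sum_(v <- T | true) c v * (yv a x v ^+ s - yv a x v ^- s) = 0.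
    move=> sm; rewrite -[RHS](q a nu s aP sm) big_filter big_mkcondl; apply: eq_bigr => v _.
    by case: eqVneq => //= ->; rewrite mul0r.
  have := sym_sum_class (fun v => yv_neq0 a x v) hT (yv a x nu + (yv a x nu)^-1).
  rewrite filter_predT => /(_ _) H.
  have {}H := H (leq_trans (size_undup _) _); rewrite size_map in H.
  have := H sT; rewrite -big_filter (_ : [seq _ <- T | _] = [:: nu]); last first.
    rewrite (@eq_in_filter _ _ (pred1 nu)) ?filter_pred1_uniq ?filter_uniq //.
    by move=> v vT /=; apply/eqP/eqP => [|-> //]; exact: inj.
  rewrite big_seq1 => /eqP; rewrite mulf_eq0 (negPf cnu) subr_eq0 /= => /eqP e.
  have := nr _ _ _ aP nuS' nuS' (str_refl _ _).
  by rewrite {2}e divff ?yv_neq0 ?eqxx.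
by apply: string_span_size.
Qed.

Context (m_refl : forall a b, a \in Phi -> b \in Phi -> m (a *m refl_mx b) = m a).

Lemma QI_convexity x S c h h' v (K : R) : uniq S -> QI x S c -> nonres x S -> @regular R n Phi h ->
  v \in S -> c v != 0 -> (forall nu, nu \in S -> c nu != 0 -> dot nu h <= dot v h) ->
  (forall nu, nu \in S -> c nu != 0 -> dot nu h' <= K) ->
  dot (v - @rhoh R n Phi m h) h' + @HN R n Phi m h' <= K.
Proof.
move=> uS q nr rh vS cv0 vtop HK.
have [||nu] := @convexity _ _ _ HPhi m m_refl [seq nu <- S | c nu != 0] h h' v rh _ _ (QI_string_span uS q nr).
- by rewrite mem_filter cv0.
- by move=> nu; rewrite mem_filter => /andP[h1 h2]; exact: vtop.
rewrite mem_filter => /andP[h1 h2] /le_trans; apply; exact: HK.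
Qed.

End QuasiInvariance.

End StringConditions.
Import StringConditions.

(** * The Macdonald operator in z of the short roots, and why it preserves quasi-invariance *)

Module DualOperator.

Section GenericLines.
Context {R : realType} {C : numClosedFieldType} {n : nat} {rc : {rmorphism R -> C}}.
Context {E : C -> C} (HE : qexponential E).
Local Notation V := ('rV[R]_n).
Local Notation VC := ('rV[C]_n).
Local Notation cv := (cv rc).
Local Notation EE := (@EE C n E).
Local Notation bsum := (@bsum R C n rc E).
Implicit Types (x z w : VC) (u v b : V).

(* Moving along an imaginary multiple of the period avoids roots of unity. *)
Lemma generic_line (s : seq (V * C)) (w0 : V) z :
  (forall p, p \in s -> dot p.1 w0 != 0) -> exists w : VC,
  (forall u, dot u w0 = 0 -> forall t, EE (cv u) (z + t *: w) = EE (cv u) z) /\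
  exists N, forall k, (N <= k)%N -> forall p, p \in s -> EE (cv p.1) (z + k%:R *: w) != p.2.
Proof.
move=> sw; have [per per0 perP] := qexp_ker HE.
exists ((per * 'i) *: cv w0); split=> [u uw t|].
  by rewrite (EEDr HE) /ExponentialSums.EE !dotZr dot_cv uw rmorph0 !mulr0 (qexp0 HE) mulr1.
elim: s sw => [|p s IH] sw; first by exists 0%N.
have [|N HN] := IH; first by move=> r rs; apply: sw; rewrite inE rs orbT.
have pw := sw p (mem_head _ _).
have [[k0 k0E]|H] := pselect (exists k : nat, EE (cv p.1) (z + k%:R *: ((per * 'i) *: cv w0)) = p.2); last first.
  exists N => k Nk r; rewrite inE => /orP[/eqP ->|]; last exact: HN.
  by apply/eqP => e; apply: H; exists k.
exists (maxn N k0.+1) => k; rewrite geq_max => /andP[Nk k0k] r.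
rewrite inE => /orP[/eqP ->|]; last exact: HN.
apply/eqP; rewrite -k0E !(EEDr HE) => /(mulfI (EE_neq0 HE _ _)) e.
have : E (2 * dot (cv p.1) ((k - k0)%:R *: ((per * 'i) *: cv w0))) = 1.
  rewrite natrB ?(ltnW k0k) // scalerBl dotBr mulrBr (qexpB HE) -!/(EE _ _) e.
  by rewrite divff // (EE_neq0 HE).
move/perP => [j]; rewrite !dotZr dot_cv => jE.
have {jE} : ((k - k0)%:R * 2 * 'i * rc (dot p.1 w0)) = j%:~R :> C.
  by apply: (mulIf per0); rewrite -jE; ring.
move/(congr1 (fun t => t ^+ 2)); rewrite !exprMn sqrCi mulrN1 mulNr => jE.
have : rc (((k - k0)%:R * 2 * dot p.1 w0) ^+ 2 + j%:~R ^+ 2) = 0.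
  rewrite rmorphD !rmorphXn /= rmorph_int -jE !rmorphM /= !rmorph_nat; ring.
move/eqP; rewrite fmorph_eq0 paddr_eq0 ?sqr_ge0 // sqrf_eq0 !mulf_eq0 (negPf pw) orbF.
by rewrite !pnatr_eq0 orbF subn_eq0 leqNgt k0k.
Qed.

(** Through each z passes a line whose points z + k w avoid the excluded level sets for large k, and
    [bsum_vanish] leads back to z. *)
Lemma bsum_dense x L (s : seq (V * C)) F : bsum x L F -> (forall p, p \in s -> p.1 != 0) ->
  (forall z, (forall p, p \in s -> EE (cv p.1) z != p.2) -> F z = 0) -> forall z, F z = 0.
Proof.
move=> bF s0 h z.
have [w0 hw0] : exists w0 : V, forall v, v \in [seq p.1 | p <- s] -> dot v w0 != 0.
  by apply: avoid_hyperplanes => v /mapP [p ps ->]; exact: s0.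
have [|w [_ [N hN]]] := @generic_line s w0 z; first by move=> p ps; apply/hw0/map_f.
apply: (bsum_vanish HE (w := w) (N := N) bF) => k Nk; apply: h; exact: hN.
Qed.

Lemma avoid_orth b (vs : seq V) : (forall v (k : R), v \in vs -> v <> k *: b) ->
  exists2 w0, dot b w0 = 0 & forall v, v \in vs -> dot v w0 != 0.
Proof.
move=> h; have [->|b0] := eqVneq b 0.
  have [|g gP] := @avoid_hyperplanes R n vs.
    by move=> v vvs; apply/eqP => v0; apply: (h v 0 vvs); rewrite scale0r.
  by exists g; rewrite ?dot0l.
have bb : dot b b != 0 by rewrite dot_sq_eq0.
have [|g gP] := @avoid_hyperplanes R n [seq v - (dot v b / dot b b) *: b | v <- vs].
  by move=> _ /mapP [v vvs ->]; rewrite subr_eq0; apply/eqP; exact: h.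
exists (g - (dot b g / dot b b) *: b).
  by rewrite dotBr dotZr divfK // subrr.
move=> v vvs; have := gP _ (map_f _ vvs); congr (_ != _).
by rewrite dotBl dotBr !dotZl !dotZr; ring.
Qed.

(** The same inside a level set of b, along a line orthogonal to b; hence the requirement that no
    excluded exponent is proportional to b. *)
Lemma bsum_dense_level x L b (k : C) (s : seq (V * C)) F : bsum x L F ->
  (forall p (l : R), p \in s -> p.1 <> l *: b) ->
  (forall z, EE (cv b) z = k -> (forall p, p \in s -> EE (cv p.1) z != p.2) -> F z = 0) ->
  forall z, EE (cv b) z = k -> F z = 0.
Proof.
move=> bF sb h z Gz.
have [|w0 bw0 hw0] := @avoid_orth b [seq p.1 | p <- s].
  by move=> v l /mapP [p ps ->]; exact: sb.
have [|w [hw [N hN]]] := @generic_line s w0 z; first by move=> p ps; apply/hw0/map_f.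
apply: (bsum_vanish HE (w := w) (N := N) bF) => l Nl; apply: h; last exact: hN.
by rewrite hw.
Qed.

End GenericLines.

Section DualMacdonald.
Context {R : realType} {C : numClosedFieldType} {n : nat} {rc : {rmorphism R -> C}}.
Context {E : C -> C} (HE : qexponential E).
Context {Phi : {fset 'rV[R]_n}} (HPhi : reduced_irreducible_root_system Phi).
Context (m : 'rV[R]_n -> nat).
Context (m_refl : forall a b, a \in Phi -> b \in Phi -> m (a *m refl_mx b) = m a).
Local Notation V := ('rV[R]_n).
Local Notation VC := ('rV[C]_n).
Local Notation cv := (cv rc).
Local Notation EE := (@EE C n E).
Local Notation bsum := (@bsum R C n rc E).
Local Notation Gam := (@Gam R C n rc E).
Local Notation O := (@short_roots R n Phi).
Local Notation Qv := (@Qv R n Phi).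
Local Notation QIf := (@QIf R C n rc E Phi m).
Implicit Types (x z w : VC) (a b u v tau : V) (f g : VC -> C) (L : set V).

Definition ee a z := EE (cv (coroot a)) z.

(** With e = q^{2u} this is [u - k]/[u], written so that only the character e of z appears and not
    its square root q^u. The argument q^2 e gives [u + 1 - k]/[u + 1]. *)
Definition rt (k e : C) := E k * (E (- (2 * k)) * e - 1) / (e - 1).

(* [Drel f g] says [g = D f], where D is the Macdonald operator in [z] of the orbit of short roots,
   which are the quasiminuscule coweights of the dual system. *)
Definition az tau z := (\prod_(a <- Phi | 0 < dot (coroot a) tau) rt (m a)%:R (ee a z)) *
  rt (m tau)%:R (E 2 * ee tau z).

Definition Drel f g := forall z, (forall a, a \in Phi -> ee a z != 1 /\ E 2 * ee a z != 1) ->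
  g z = \sum_(tau <- O) az tau z * (f (z + cv tau) - f z).

Lemma rt0 e : e != 1 -> rt 0 e = 1.
Proof. by move=> e1; rewrite /rt mulr0 oppr0 (qexp0 HE) !mul1r divff // subr_eq0. Qed.

Lemma E2k k : E (2 * k) = E k ^+ 2.
Proof. exact: (qexpMn HE 2). Qed.

Lemma rtV k e : e != 0 -> e != 1 -> rt k e^-1 = rt (- k) e.
Proof.
move=> e0 e1; rewrite /rt mulrN opprK !(qexpN HE) E2k; have := qexp_neq0 HE k.
have e1' : e - 1 != 0 by rewrite subr_eq0.
have -> : e^-1 - 1 = - ((e - 1) / e) by field.
by move: (E k) => X X0; field; rewrite X0 e0 e1'.
Qed.

Lemma eeN a z : ee (- a) z = (ee a z)^-1.
Proof. by rewrite /ee corootN cvN (EENl HE). Qed.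

Lemma ee_neq0 a z : ee a z != 0.
Proof. exact: (EE_neq0 HE). Qed.

Definition hs b (j : int) : VC := (j%:~R / 2) *: cv b.

Lemma hsD b i j : hs b i + hs b j = hs b (i + j).
Proof. by rewrite /hs -scalerDl -mulrDl -intrD. Qed.

Lemma hsN b j : - hs b j = hs b (- j).
Proof. by rewrite /hs -scaleNr -mulNr -rmorphN. Qed.

Lemma hsV b j : hs (- b) j = hs b (- j).
Proof. by rewrite /hs cvN scalerN -scaleNr -mulNr -rmorphN. Qed.

Lemma hs0 b : hs b 0 = 0.
Proof. by rewrite /hs mul0r scale0r. Qed.

Lemma hs2 b : hs b 2 = cv b.
Proof. by rewrite /hs divff ?scale1r // (pnatr_eq0 C 2). Qed.

Lemma hs_cv b (k : int) : cv (k%:~R *: b) = hs b (2 * k).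
Proof. by rewrite /hs cvZint intrM mulrAC divff ?mul1r // (pnatr_eq0 C 2). Qed.

Lemma ee_shift a z b (j : int) (k : int) : dot (coroot a) b = k%:~R ->
  ee a (z + hs b j) = ee a z * E (j * k)%:~R.
Proof.
move=> ab; rewrite /ee (EEDr HE); congr (_ * _).
by rewrite /ExponentialSums.EE dotZr dot_cv ab rmorph_int; congr E; rewrite intrM; field.
Qed.

Lemma ee_self z b (j : int) : b \in Phi -> Gam (coroot b) z ->
  ee b (z + hs b j) = E (2 * j)%:~R.
Proof.
move=> bP Gz; rewrite (@ee_shift b z b j 2) ?(coroot_self (root_neq0 HPhi bP)) //.
by rewrite /ee (Gz : EE _ _ = 1) mul1r mulrC.
Qed.

(** For z on [Gam (coroot b)] the points z + (j/2) b and z - (j/2) b are mirror images as far as the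
    characters of the coroots can see. *)
Lemma ee_reflect a b z (j : int) : a \in Phi -> b \in Phi -> Gam (coroot b) z ->
  ee (a *m refl_mx b) (z + hs b (- j)) = ee a (z + hs b j).
Proof.
move=> aP bP Gz; have [k kE] := root_int HPhi aP bP.
rewrite (ee_shift _ _ kE).
rewrite {1}/ee (coroot_refl _ (root_neq0 HPhi bP)) reflE' kE cvB (EEBl HE) cvZint.
rewrite (EEint HE) -!/(ee _ _) (ee_shift _ _ kE) (ee_self _ bP Gz).
rewrite -(qexpMz HE) -mulrA -(qexpB HE); congr (_ * E _).
by rewrite !intrM !rmorphN /=; ring.
Qed.

Lemma QIf_int f b z (j : int) : QIf f -> b \in Phi -> Gam (coroot b) z -> (`|j| <= m b)%N ->
  f (z + hs b j) = f (z + hs b (- j)).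
Proof.
move=> q bP Gz; case: j => k km.
  case: k km => [|k] km; first by rewrite oppr0.
  by rewrite -hsN; exact: (q b k.+1 z).
rewrite NegzE opprK -hsN; apply/esym.
exact: (q b k.+1 z).
Qed.

Lemma Gam_shift b z u (k : int) : b \in Phi -> Gam (coroot b) z -> dot (coroot b) u = k%:~R ->
  Gam (coroot b) (z + cv u + hs b (- k)).
Proof.
move=> bP Gz ku; rewrite /ExponentialSums.Gam -addrA (EEDr HE) (Gz : EE _ _ = 1) mul1r.
rewrite /ExponentialSums.EE dotDr dotZr !dot_cv ku (coroot_self (root_neq0 HPhi bP)) rmorph_int rmorph_nat.
by rewrite (_ : _ * _ = 0) ?(qexp0 HE) // rmorphN; field.
Qed.

Section Preservation.
Context (x : VC) (L : set V) (LQ : forall u v, L u -> Qv v -> L (u + v)).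
Context (f : VC -> C) (bf : bsum x L f) (qf : QIf f).

Let mul_Q (F G : VC -> C) : bsum 0 Qv F -> bsum x L G -> bsum x L (fun z => F z * G z).
Proof. by move=> bF bG; apply: (bsumM HE bF bG) => u v Qu Lv; rewrite addrC; exact: LQ. Qed.

Lemma bsum_affine_ee (k l : C) a : a \in Phi -> bsum 0 Qv (fun z => k * ee a z + l).
Proof.
move=> aP; apply: bsumD; last exact/(bsum_const HE)/Qv0.
by have := @bsum_exp R C n rc E 0 Qv k _ (Qv_coroot aP); apply: bsum_ext => z; rewrite /ee add0r.
Qed.

(** [T] is the term of tau in D f without the product over a; its denominator q^2 e_tau - 1 has been
    divided out. Quasi-invariance for s = 1 makes f(z + tau/2) - f(z - tau/2) divisible by e_tau -
    1, with quotient [K], and the shift by tau/2 turns e_tau into q^2 e_tau. *)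
Definition regterm tau (T K : VC -> C) := [/\ bsum x L T,
    forall z, (E 2 * ee tau z - 1) * T z =
      E (m tau)%:R * (E (2 - 2 * (m tau)%:R) * ee tau z - 1) * (f (z + cv tau) - f z) &
    (0 < m tau)%N -> [/\ bsum x L K,
      forall z, f (z + hs tau 1) - f (z + hs tau (- 1)) = (ee tau z - 1) * K z &
      forall z, T z = E (m tau)%:R * (E (2 - 2 * (m tau)%:R) * ee tau z - 1) * K (z + hs tau 1)]].

Lemma regterm_exists tau : tau \in Phi -> exists T K, regterm tau T K.
Proof.
move=> tP; case: (posnP (m tau)) => [m0|m0].
  exists (fun z => f (z + cv tau) - f z), (fun=> 0); split=> //=.
  - by apply: bsumB => //; exact: bsum_shift.
  - by move=> z; rewrite m0 mulr0 subr0 (qexp0 HE) mul1r.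
  - by rewrite m0.
have bG : bsum x L (fun z => f (z + hs tau 1) - f (z + hs tau (- 1))).
  by apply: bsumB; exact: bsum_shift.
have [||||K bK KE] := @bsum_divide R C n rc E HE x L (coroot tau) 1 _ _ _ _ bG.
- exact/coroot_neq0/(root_neq0 HPhi).
- exact: oner_neq0.
- by move=> u j Lu; apply: LQ => //; exact: Qv_coroot_int.
- move=> z Gz; have := @QIf_int f tau z 1 qf tP Gz m0.
  by move=> ->; rewrite subrr.
exists (fun z => (E (m tau)%:R * (E (2 - 2 * (m tau)%:R) * ee tau z - 1)) * K (z + hs tau 1)), K.
split=> //=.
- apply: mul_Q; last exact: bsum_shift.
  have := bsumZ (E (m tau)%:R) (bsum_affine_ee (E (2 - 2 * (m tau)%:R)) (-1) tP).
  by apply: bsum_ext => z.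
- move=> z; have := KE (z + hs tau 1); rewrite -!addrA !hsD subrr hs0 addr0 hs2 => ->.
  rewrite -/(ee _ _).
  rewrite (@ee_shift tau z tau 1 2) ?(coroot_self (root_neq0 HPhi tP)) // mul1r.
  rewrite -[E 2]/(E (2%:~R)); move: (E 2%:~R) => X; ring.
Qed.

Context (T K : V -> VC -> C) (TK : forall tau, tau \in O -> regterm tau (T tau) (K tau)).

Let Oroot b : b \in O -> b \in Phi. Proof. by case/short_rootP. Qed.

Let Vdiv_neq0 b (c : C) : b \in Phi -> forall p, p \in [:: (coroot b, c)] -> p.1 != 0.
Proof. by move=> bP p; rewrite inE => /eqP -> /=; exact/coroot_neq0/(root_neq0 HPhi). Qed.

Let K_opp b z : b \in O -> (0 < m b)%N -> K (- b) z = ee b z * K b z.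
Proof.
move=> bO m0; have bP := Oroot bO.
have [_ _ /(_ m0) [bK KE _]] := TK bO.
have NbO : - b \in O by rewrite (short_rootN HPhi).
have mN := m_opp HPhi m_refl bP.
have [_ _] := TK NbO; rewrite mN => /(_ m0) [bK' KE' _].
apply/eqP; rewrite -subr_eq0; apply/eqP.
have bF : bsum x L (fun z => K (- b) z - ee b z * K b z).
  apply: bsumB => //; apply: mul_Q => //.
  by have := bsum_affine_ee 1 0 bP; apply: bsum_ext => y; rewrite mul1r addr0.
apply: (bsum_dense HE bF (Vdiv_neq0 (c := 1) bP)) => y /(_ _ (mem_head _ _)) /= e1.
have := KE' y; rewrite !hsV opprK -[LHS]opprB KE eeN -/(ee _ _).
have e0 := ee_neq0 b y; have e1' : ee b y - 1 != 0 by rewrite subr_eq0.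
move: (ee b y) (K b y) (K (- b) y) e0 e1' => e A B e0 e1' h.
apply: (mulfI e1'); rewrite mulr0 mulrBr [X in _ - X]mulrCA -[_ * A]opprK h.
by field.
Qed.

(** For r <> 0, quasi-invariance at r + 1 and r - 1 compares the two quotients, with the nonzero
    factor q^{2r} - 1 to be cancelled; at r = 0 that factor vanishes and [K_opp] alone gives the
    equality. *)
Let K_flip b z (r : int) : b \in O -> (`|r| < m b)%N -> Gam (coroot b) z ->
  K (- b) (z + hs b r) = K b (z + hs b (- r)).
Proof.
move=> bO rm Gz; have bP := Oroot bO; have m0 : (0 < m b)%N by apply: leq_ltn_trans rm.
rewrite K_opp // (ee_self _ bP Gz).
have [->|r0] := eqVneq r 0.
  by rewrite mulr0 oppr0 hs0 (qexp0 HE) mul1r.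
have [_ _ /(_ m0) [_ KE _]] := TK bO.
have K1 := KE (z + hs b r); have K2 := KE (z + hs b (- r)).
move: K1 K2; rewrite !(ee_self _ bP Gz) -!addrA !hsD.
rewrite (QIf_int (j := r + 1) qf bP Gz); last by lia.
rewrite (QIf_int (j := r - 1) qf bP Gz); last by lia.
rewrite opprB opprD.
move=> K1 K2; have : E (2 * r)%:~R != 1.
  apply/eqP => /(qexp_nroot HE) e; move: r0; apply/negP; rewrite negbK; apply/eqP; lia.
have e0 := qexp_neq0 HE (2 * r)%:~R.
move: K1 K2; rewrite mulrN rmorphN (qexpN HE) (addrC 1).
move: (E _) e0 (K b _) (K b _) (f _) (f _) => X X0 A B f1 f2 h1 h2 X1.
have X1' : X - 1 != 0 by rewrite subr_eq0.
apply: (mulfI X1'); rewrite mulrCA -h1 -[f2 - f1]opprB h2; field.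
exact: X0.
Qed.

(** For tau other than b and -b both sides are compared through quasi-invariance of f at s and at s
    + k, which needs |s + k| <= m_b; the excluded case s = m_b, k > 0 is one where the coefficient
    of the term vanishes. For tau = b or -b the denominator may vanish, and the quotients [K] are
    compared instead. *)
Lemma T_reflect b tau z (s : nat) (k : int) : b \in Phi -> tau \in O -> Gam (coroot b) z ->
  (s <= m b)%N -> dot (coroot b) tau = k%:~R ->
  (tau != b -> tau != - b -> E 2 * ee tau (z + hs b s) != 1) ->
  (0 < k -> (s < m b)%N) -> (k != 0 -> (0 < m b)%N) ->
  T tau (z + hs b s) = T (tau *m refl_mx b) (z + hs b (- s%:Z)).
Proof.
move=> bP tO Gz sm ktau gen k1 k2; have tP := Oroot tO.
have b0 := root_neq0 HPhi bP.
have [tb|tb] := eqVneq tau b.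
  have bO : b \in O by rewrite -tb.
  have kE : k = 2.
    by apply: (@intr_inj R); rewrite -ktau tb (coroot_self b0).
  have sm' : (s < m b)%N by apply: k1; rewrite kE.
  have m0 : (0 < m b)%N by apply: leq_ltn_trans sm'.
  have [_ _ /(_ m0) [_ _ TE]] := TK bO.
  have NbO : - b \in O by rewrite (short_rootN HPhi).
  have [_ _] := TK NbO; rewrite (m_opp HPhi m_refl bP) => /(_ m0) [_ _ TE'].
  rewrite tb (refl_self b0) TE TE' hsV eeN !(ee_self _ bP Gz) -!(addrA z) !hsD.
  rewrite mulrN rmorphN (qexpN HE) invrK.
  (* Here the numerator q^{2 - 2 m_b} e_b - 1 vanishes on both sides; [K_flip] would be called at r
     = -m_b, outside its range. *)
  have [sm1|sm1] := eqVneq s.+1 (m b).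
    have e0 : 2 - 2 * (m b)%:R + (2 * s%:Z)%:~R = 0 :> C.
      by rewrite -sm1 -addn1 natrD intrM; ring.
    by rewrite -(qexpD HE) e0 (qexp0 HE) subrr mulr0 !mul0r.
  congr (_ * _); have := @K_flip b z (- (s%:Z + 1)) bO _ Gz.
  rewrite opprK opprD => -> //; lia.
have [tb'|tb'] := eqVneq tau (- b).
  have bO : b \in O by rewrite -(short_rootN HPhi) -tb'.
  have m0 : (0 < m b)%N.
    apply: k2; apply/eqP => kE; move: ktau; rewrite kE tb' dotNr (coroot_self b0) => /eqP.
    by rewrite oppr_eq0 (pnatr_eq0 R 2).
  have [_ _ /(_ m0) [_ _ TE]] := TK bO.
  have NbO : - b \in O by rewrite (short_rootN HPhi).
  have [_ _] := TK NbO; rewrite (m_opp HPhi m_refl bP) => /(_ m0) [_ _ TE'].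
  rewrite tb' reflN (refl_self b0) opprK TE TE' hsV eeN !(ee_self _ bP Gz) -!(addrA z) !hsD.
  rewrite mulrN rmorphN (qexpN HE).
  have [ms1|ms1] := eqVneq (m b + s)%N 1%N.
    have e0 : 2 - 2 * (m b)%:R - (2 * s%:Z)%:~R = 0 :> C.
      by rewrite -addrA -opprD intrM -mulrDr -natrD ms1; ring.
    by rewrite -(qexpB HE) e0 (qexp0 HE) subrr mulr0 !mul0r.
  congr (_ * _); have := @K_flip b z (s%:Z - 1) bO _ Gz.
  by rewrite opprB (addrC 1) => -> //; move: sm m0 ms1; clear; lia.
have {}gen := gen tb tb'.
have t'O : tau *m refl_mx b \in O by rewrite (short_root_refl HPhi).
have [_ T1 _] := TK tO; have [_ T2 _] := TK t'O.
have e1 : E 2 * ee tau (z + hs b s) - 1 != 0 by rewrite subr_eq0.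
apply: (mulfI e1); rewrite T1.
have eE := @ee_reflect tau b z s tP bP Gz.
rewrite -eE T2 m_refl // (QIf_int qf bP Gz (j := s)) //; congr (_ * (_ - _)).
have kD : (`|(s%:Z + k)%R| <= m b)%N.
  have kE : [\/ k = 1, k = 0 | k = -1].
    case: (short_root_quasiminuscule HPhi tO bP); rewrite 1?eq_sym // ?[in _ == - _]eq_sym ?eqr_oppLR //.
    - by rewrite ktau => /(@intr_inj R _ 1) ->; constructor 1.
    - by rewrite ktau => /(@intr_inj R _ 0) ->; constructor 2.
    - by rewrite ktau => /(@intr_inj R _ (-1)) ->; constructor 3.
  by move: kE k1 k2 sm; clear; case=> ->; lia.
have := @QIf_int f b _ (s%:Z + k) qf bP (Gam_shift bP Gz ktau) kD.
have -> : z + cv tau + hs b (- k) + hs b (s%:Z + k) = z + hs b s + cv tau.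
  by rewrite -!addrA hsD (addrC (cv tau)) (addrC s%:Z) addKr.
move=> ->; congr f.
rewrite reflE dotC ktau cvB hs_cv -!addrA; congr (_ + _).
rewrite hsD hsN [RHS]addrCA hsD; congr (_ + hs b _).
by rewrite opprD addrCA -opprD (_ : k + k = 2 * k) //; ring.
Qed.

Definition Apre (Q : pred V) tau z := \prod_(a <- Phi | Q a && (0 < dot (coroot a) tau)) rt (m a)%:R (ee a z).

Lemma Apre_reflect (Q : pred V) b tau z (j : int) : b \in Phi -> Gam (coroot b) z ->
  (forall a, Q (a *m refl_mx b) = Q a) ->
  Apre Q tau (z + hs b j) = Apre Q (tau *m refl_mx b) (z + hs b (- j)).
Proof.
move=> bP Gz Qb; rewrite /Apre [RHS](big_root_refl HPhi _ _ _ bP).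
rewrite big_seq_cond [RHS]big_seq_cond; apply: eq_big => [a|a /andP [aP _]].
  case: (boolP (a \in Phi)) => aP //=; rewrite Qb (coroot_refl _ (root_neq0 HPhi bP)).
  by rewrite (refl_isom _ _ (root_neq0 HPhi bP)).
by rewrite m_refl // ee_reflect.
Qed.

(** The multiplicity with the sign of (a^vee, tau): since [-u - k]/[-u] = [u + k]/[u], the product
    over the roots positive on tau becomes one over a fixed positive system, with denominators
    independent of tau. *)
Definition kk a tau : C :=
  if 0 < dot (coroot a) tau then (m a)%:R else if dot (coroot a) tau < 0 then - (m a)%:R else 0.

Lemma kkN a tau : a \in Phi -> kk (- a) tau = - kk a tau.
Proof.
move=> aP; rewrite /kk corootN dotNl oppr_gt0 oppr_lt0 (m_opp HPhi m_refl aP).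
by case: ltrgt0P; rewrite ?opprK ?oppr0.
Qed.

Lemma kk_refl a b tau : a \in Phi -> b \in Phi -> kk (a *m refl_mx b) (tau *m refl_mx b) = kk a tau.
Proof.
move=> aP bP; rewrite /kk (coroot_refl _ (root_neq0 HPhi bP)).
by rewrite (refl_isom _ _ (root_neq0 HPhi bP)) m_refl.
Qed.

Lemma Apre_kk (Q : pred V) h0 tau z : @regular R n Phi h0 -> (forall a, Q (- a) = Q a) ->
  (forall a, a \in Phi -> Q a -> ee a z != 1) ->
  Apre Q tau z = \prod_(a <- Phi | Q a && (0 < dot a h0)) rt (kk a tau) (ee a z).
Proof.
move=> h0r QN Qe; rewrite /Apre big_mkcond (big_root_split HPhi _ _ h0r) [RHS]big_mkcond /=.
rewrite [LHS]big_mkcond big_seq [RHS]big_seq; apply: eq_bigr => a aP /=.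
rewrite QN andbC corootN dotNl oppr_gt0 (m_opp HPhi m_refl aP) eeN.
case: ifP => a0; last by case: (Q a); rewrite ?andbF.
case: (boolP (Q a)) => Qa /=; last by rewrite andbF mulr1.
have e1 := Qe a aP Qa; have e0 := ee_neq0 a z; rewrite andbT.
rewrite /kk; case: ltrgt0P => _; rewrite ?mulr1 ?mul1r ?rt0 //.
by rewrite rtV.
Qed.

Lemma coroot_parallel a b (k : R) : a \in Phi -> b \in Phi -> a != b -> a != - b ->
  coroot a <> k *: coroot b.
Proof.
move=> aP bP ab ab' e; have a0 := root_neq0 HPhi aP.
have aa : dot a a != 0 by rewrite dot_sq_eq0.
have : a = (dot a a / 2 * (k * (2 / dot b b))) *: b.
  have -> : (dot a a / 2 * (k * (2 / dot b b))) *: b = (dot a a / 2) *: (k *: coroot b).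
    by rewrite /coroot !scalerA mulrA.
  by rewrite -e /coroot scalerA mulrA divfK ?pnatr_eq0 // divff // scale1r.
by case/(root_parallel HPhi bP aP) => e'; [move: ab|move: ab']; rewrite e' eqxx.
Qed.

(** It suffices to check F at those points of the hyperplane where roots other than b and -b produce
    no poles. *)
Lemma dense_shift F b (js : seq int) : bsum x L F -> b \in Phi ->
  (forall z, Gam (coroot b) z -> (forall j a, j \in js -> a \in Phi -> a != b -> a != - b ->
     ee a (z + hs b j) != 1 /\ E 2 * ee a (z + hs b j) != 1) -> F z = 0) ->
  forall z, Gam (coroot b) z -> F z = 0.
Proof.
move=> bF bP h.
pose A := [seq a <- Phi | (a != b) && (a != - b)].
pose l1 := [seq (coroot a, (ee a (hs b j))^-1) | a <- A, j <- js].
pose l2 := [seq (coroot a, (E 2 * ee a (hs b j))^-1) | a <- A, j <- js].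
apply: (@bsum_dense_level R C n rc E HE x L (coroot b) 1 (l1 ++ l2)) => //.
  move=> p k; rewrite mem_cat => /orP[] /allpairsP [[a j] /= [+ _ ->]] /=;
    rewrite mem_filter => /andP[/andP[ab ab'] aP]; exact: coroot_parallel.
move=> z Gz hz; apply: h => // j a jjs aP ab ab'.
have aA : a \in A by rewrite mem_filter ab ab'.
have ez : ee a (z + hs b j) = EE (cv (coroot a)) z * ee a (hs b j) by rewrite /ee (EEDr HE).
split; apply/eqP => e1.
  have /hz /eqP : (coroot a, (ee a (hs b j))^-1) \in l1 ++ l2.
    by rewrite mem_cat; apply/orP; left; apply/allpairsP; exists (a, j).
  by apply; rewrite /= -[RHS]mul1r -e1 ez mulfK // ee_neq0.
have /hz /eqP : (coroot a, (E 2 * ee a (hs b j))^-1) \in l1 ++ l2.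
  by rewrite mem_cat; apply/orP; right; apply/allpairsP; exists (a, j).
apply=> /=; move: e1; rewrite ez; have := ee_neq0 a (hs b j); have := qexp_neq0 HE 2.
move: (E 2) (ee a _) (EE _ z) => X Y u X0 Y0 e1.
by apply: (mulfI (mulf_neq0 X0 Y0)); rewrite divff ?mulf_neq0 // -e1; ring.
Qed.

(** Division along one hyperplane keeps the vanishing on the others, because nonproportional coroots
    have level sets that meet in a nowhere dense part of each. *)
Lemma divide_all (s : seq V) F : bsum x L F -> uniq s -> {subset s <= Phi} ->
  (forall a, a \in s -> - a \notin s) ->
  (forall a z, a \in s -> Gam (coroot a) z -> F z = 0) ->
  exists2 g, bsum x L g & forall z, F z = (\prod_(a <- s) (ee a z - 1)) * g z.
Proof.
elim: s F => [|b s IH] F bF us sP sN F0.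
  by exists F => // z; rewrite big_nil mul1r.
have /andP[bs us'] : (b \notin s) && uniq s by [].
have bP : b \in Phi by apply: sP; exact: mem_head.
have [||||F1 bF1 FE] := @bsum_divide R C n rc E HE x L (coroot b) 1 _ _ _ _ bF.
- exact/coroot_neq0/(root_neq0 HPhi).
- exact: oner_neq0.
- by move=> u j Lu; apply: LQ => //; exact: Qv_coroot_int.
- by move=> z Gz; apply: (F0 b) => //; exact: mem_head.
have [|||g bg gE] := IH F1 bF1 us'; last first.
- by exists g => // z; rewrite big_cons FE gE mulrA.
- move=> a z as_; apply: (@bsum_dense_level R C n rc E HE x L (coroot a) 1 [:: (coroot b, 1)]) => //.
    move=> p k; rewrite inE => /eqP -> /=; apply: coroot_parallel => //.
    + by apply: sP; rewrite inE as_ orbT.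
    + by apply: contraNneq bs => ->.
    + have := sN b (mem_head _ _); rewrite inE negb_or => /andP[_ ba].
      by apply: contraNneq ba => ->; rewrite opprK.
  move=> y Gy /(_ _ (mem_head _ _)) /= e1; have := F0 a y _ Gy; rewrite inE as_ orbT FE => /(_ isT).
  by move/eqP; rewrite mulf_eq0 subr_eq0 (negPf e1) /= => /eqP.
- by move=> a as_; have := sN a; rewrite !inE as_ orbT => /(_ isT); rewrite negb_or => /andP[].
- by move=> a as_; apply: sP; rewrite inE as_ orbT.
Qed.

Context (h0 : V) (h0r : @regular R n Phi h0).

Let pos := [seq a <- Phi | 0 < dot a h0].

Definition num a tau z := E (kk a tau) * (E (- (2 * kk a tau)) * ee a z - 1).

Lemma num_rt a tau z : ee a z != 1 -> num a tau z = (ee a z - 1) * rt (kk a tau) (ee a z).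
Proof. by move=> e1; rewrite /rt mulrCA divff ?mulr1 // subr_eq0. Qed.

Lemma bsum_num s tau G : {subset s <= Phi} -> bsum x L G ->
  bsum x L (fun z => (\prod_(a <- s) num a tau z) * G z).
Proof.
elim: s => [|a s IH] sP bG; first by apply: bsum_ext bG => z; rewrite big_nil mul1r.
have := mul_Q (bsum_affine_ee (E (kk a tau) * E (- (2 * kk a tau))) (- E (kk a tau)) (sP a (mem_head _ _)))
   (IH (fun b bs => sP b (mem_behead (s := a :: s) bs)) bG).
by apply: bsum_ext => z; rewrite big_cons mulrA /num mulrBr mulr1 mulrA.
Qed.

(** D f multiplied by the denominators e_a - 1, one for each positive root. *)
Let E1 z := \sum_(tau <- O) (\prod_(a <- pos) num a tau z) * T tau z.

Let bE1 : bsum x L E1.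
Proof.
rewrite /E1; have : forall s : seq V, {subset s <= O} ->
  bsum x L (fun z => \sum_(tau <- s) (\prod_(a <- pos) num a tau z) * T tau z).
  elim=> [|tau s IH] sO; first by move: (@bsum0 R C n rc E x L); apply: bsum_ext => z; rewrite big_nil.
  have tO : tau \in O by apply: sO; exact: mem_head.
  have [bT _ _] := TK tO.
  have ppos : {subset pos <= Phi} by move=> a; rewrite mem_filter => /andP[].
  have := bsumD (bsum_num tau ppos bT) (IH (fun b bs => sO b (mem_behead (s := tau :: s) bs))).
  by apply: bsum_ext => z; rewrite big_cons.
by apply.
Qed.

Let posP a : (a \in pos) = (a \in Phi) && (0 < dot a h0).
Proof. by rewrite mem_filter andbC. Qed.

Let Orefl b tau : b \in Phi -> (tau *m refl_mx b \in O) = (tau \in O).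
Proof. exact: short_root_refl. Qed.

Let sum_O_refl b (F : V -> C) : b \in Phi ->
  \sum_(tau <- O) F tau = \sum_(tau <- O) F (tau *m refl_mx b).
Proof.
move=> bP; apply: (@big_root_reindex R n O _ _ +%R (fun tau => tau *m refl_mx b) predT F).
  by move=> a; rewrite Orefl.
by move=> v; apply: reflK; exact: (root_neq0 HPhi).
Qed.

(** Where e_b = 1 the numerator belonging to b is q^{-k} - q^k, odd in the signed multiplicity k.
    All else is symmetric under the reflection in b, so the sum over tau equals its own negative. *)
Let E1_vanish b z : b \in pos -> Gam (coroot b) z -> E1 z = 0.
Proof.
rewrite posP => /andP[bP bh0]; move: z; have b0 := root_neq0 HPhi bP.
apply: (dense_shift (js := [:: 0]) bE1 bP) => z Gz gen.
have {}gen a : a \in Phi -> a != b -> a != - b -> ee a z != 1 /\ E 2 * ee a z != 1.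
  by move=> aP ab ab'; have := gen 0 a (mem_head _ _) aP ab ab'; rewrite hs0 addr0.
pose Q a := (a != b) && (a != - b).
have QN a : Q (- a) = Q a by rewrite /Q eqr_oppLR eqr_opp andbC.
have Qs a : Q (a *m refl_mx b) = Q a.
  have e1 : (a *m refl_mx b == b) = (a == - b).
    by rewrite -[RHS](inj_eq (can_inj (g := fun v => v *m refl_mx b) (fun v => reflK v b0))) reflN (refl_self b0) opprK.
  have e2 : (a *m refl_mx b == - b) = (a == b).
    by rewrite -[RHS](inj_eq (can_inj (g := fun v => v *m refl_mx b) (fun v => reflK v b0))) (refl_self b0).
  by rewrite /Q e1 e2 andbC.
pose Y tau := num b tau z * Apre Q tau z * T tau z.
have E1Y : E1 z = (\prod_(a <- pos | a != b) (ee a z - 1)) * \sum_(tau <- O) Y tau.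
  rewrite /E1 mulr_sumr; apply: eq_bigr => tau _; rewrite /Y (Apre_kk _ h0r QN); last first.
    by move=> a aP /andP[ab ab']; case: (gen a aP ab ab').
  have bpos : b \in pos by rewrite posP bP.
  rewrite (bigD1_seq b) //=; last exact/filter_uniq/fset_uniq.
  rewrite [RHS]mulrA; congr (_ * _); rewrite [RHS]mulrCA; congr (_ * _).
  have pQ F : \prod_(a <- pos | a != b) F a = \prod_(a <- Phi | Q a && (0 < dot a h0)) F a :> C.
    rewrite big_filter_cond; apply: eq_bigl => a; rewrite /Q andbC.
    case: (boolP (0 < dot a h0)) => ah0; rewrite ?andbF // !andbT.
    have -> : a != - b by apply: contraTneq ah0 => ->; rewrite dotNl oppr_gt0 -leNgt ltW.
    by rewrite andbT.
  rewrite !pQ -big_split /= big_seq_cond [RHS]big_seq_cond; apply: eq_bigr => a /and3P[aP /andP[ab ab'] _].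
  by rewrite num_rt //; case: (gen a aP ab ab').
rewrite E1Y; apply/eqP; rewrite mulf_eq0; apply/orP; right; apply/eqP.
have YN tau : tau \in O -> Y (tau *m refl_mx b) = - Y tau.
  move=> tO; have [k kE] := root_int HPhi bP (Oroot tO).
  have kb : kk b (tau *m refl_mx b) = - kk b tau.
    by rewrite -(kk_refl tau bP bP) (refl_self b0) (kkN _ bP) opprK.
  have eb : ee b z = 1 by [].
  rewrite /Y /num eb kb !mulr1.
  have [k0|k0] := eqVneq (kk b tau) 0.
    by rewrite k0 !(mulr0, oppr0) (qexp0 HE) subrr !(mulr0, mul0r) oppr0.
  have gm : (0 < m b)%N.
    rewrite lt0n; apply: contra_neqN k0 => /eqP m0.
    by rewrite /kk m0 oppr0; do 2?case: ifP.
  have gt : tau != b -> tau != - b -> E 2 * ee tau (z + hs b 0) != 1.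
    by move=> tb tb'; rewrite hs0 addr0; case: (gen tau (Oroot tO) tb tb').
  have := T_reflect bP tO Gz (leq0n _) kE gt (fun=> gm) (fun=> gm).
  rewrite oppr0 hs0 addr0 => <-.
  have := @Apre_reflect Q b tau z 0 bP Gz Qs; rewrite oppr0 hs0 addr0 => ->.
  rewrite mulrN opprK !(qexpN HE) E2k.
  have := qexp_neq0 HE (kk b tau); move: (E _) (Apre _ _ _) (T _ _) => X A B X0.
  by field.
have : \sum_(tau <- O) Y tau = - \sum_(tau <- O) Y tau.
  rewrite [LHS](sum_O_refl _ bP) -sumrN big_seq [RHS]big_seq; apply: eq_bigr => tau; exact: YN.
by move/eqP; rewrite -addr_eq0 -mulr2n mulrn_eq0 /= => /eqP.
Qed.

(** [E1] is divisible by all its denominators, so D f has no poles. For quasi-invariance in the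
    direction b the sum is reindexed by the reflection in b and compared term by term. *)
Lemma dual_operator_reg : exists g, [/\ bsum x L g, QIf g & Drel f g].
Proof.
have posS : {subset pos <= Phi} by move=> a; rewrite posP => /andP[].
have [||| |g bg gE] := @divide_all pos E1 bE1.
- exact/filter_uniq/fset_uniq.
- exact: posS.
- by move=> a; rewrite !posP dotNl oppr_gt0 => /andP[_ a0]; rewrite ltNge ltW ?andbF.
- by move=> a z; exact: E1_vanish.
have gA z : (forall a, a \in Phi -> ee a z != 1) -> g z = \sum_(tau <- O) Apre predT tau z * T tau z.
  move=> e1; have d0 : \prod_(a <- pos) (ee a z - 1) != 0.
    by rewrite prodf_seq_neq0; apply/allP => a /posS aP /=; rewrite subr_eq0; exact: e1.
  apply: (mulfI d0); rewrite -gE /E1 mulr_sumr; apply: eq_bigr => tau _.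
  rewrite [RHS]mulrA; congr (_ * _).
  rewrite (Apre_kk tau h0r (Q := predT)) //; last by move=> a aP _; exact: e1.
  have -> F : \prod_(a <- Phi | predT a && (0 < dot a h0)) F a = \prod_(a <- pos) F a :> C.
    by rewrite big_filter.
  rewrite -big_split /= big_seq [RHS]big_seq.
  by apply: eq_bigr => a /posS aP; rewrite num_rt ?e1.
exists g; split=> //; last first.
  move=> z gen; rewrite gA; last by move=> a /gen [].
  rewrite big_seq [RHS]big_seq; apply: eq_bigr => tau tO; rewrite /az -mulrA; congr (_ * _).
  have [_ TE _] := TK tO; have [_ e2] := gen tau (Oroot tO).
  have e2' : E 2 * ee tau z - 1 != 0 by rewrite subr_eq0.
  apply: (mulfI e2'); rewrite TE /rt [RHS]mulrA; congr (_ * _).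
  rewrite [RHS]mulrCA divff // mulr1; congr (_ * (_ - 1)).
  by rewrite mulrA -(qexpD HE) addrC.
move=> b s z bP sm.
have m0 : (0 < m b)%N by case/andP: sm => s0 sm; apply: leq_trans s0 sm.
have bG : bsum x L (fun z => g (z + hs b s) - g (z + hs b (- s%:Z))).
  by apply: bsumB; exact: bsum_shift.
suff H : forall z, Gam (coroot b) z -> g (z + hs b s) - g (z + hs b (- s%:Z)) = 0.
  by move=> Gz; apply/eqP; rewrite -subr_eq0; apply/eqP; have := H z Gz; rewrite -hsN.
apply: (dense_shift (js := [:: s%:Z; - s%:Z]) bG bP) => {}z Gz gen.
have sn1 (j : int) : j != 0 -> E (2 * j)%:~R != 1.
  move=> j0; apply/eqP => /(qexp_nroot HE) e; move: j0; apply/negP; rewrite negbK; apply/eqP.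
  by move: e; clear; lia.
have e1 (j : int) a : j \in [:: s%:Z; - s%:Z] -> a \in Phi -> ee a (z + hs b j) != 1.
  move=> js aP; have j0 : j != 0.
    by move: js sm; rewrite !inE; clear; case: s => // s; case/orP => /eqP ->.
  have [->|ab] := eqVneq a b; first by rewrite (ee_self _ bP Gz) sn1.
  have [->|ab'] := eqVneq a (- b); last by case: (gen j a js aP ab ab').
  by rewrite eeN (ee_self _ bP Gz) -(qexpN HE) -rmorphN -mulrN sn1 // oppr_eq0.
rewrite !gA; last 2 first.
- by move=> a aP; apply: e1 => //; rewrite !inE eqxx orbT.
- by move=> a aP; apply: e1 => //; rewrite !inE eqxx.
apply/eqP; rewrite subr_eq0 [X in _ == X](sum_O_refl _ bP); apply/eqP.
rewrite big_seq [RHS]big_seq; apply: eq_bigr => tau tO.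
have [k kE] := root_int HPhi bP (Oroot tO).
rewrite -(@Apre_reflect predT b tau z s bP Gz) //.
(* The case missing from [T_reflect]: the factor [u - m_b] of the coefficient vanishes, since e_b =
   q^{2 m_b} at this point. *)
case: (boolP ((0 < k) && (s == m b))) => [/andP[k0 /eqP sb]|ks].
  rewrite (_ : Apre _ _ _ = 0) ?mul0r // /Apre (big_rootD1 _ _ bP) /=; last first.
    by rewrite kE ltr0z.
  rewrite /rt (ee_self _ bP Gz) sb (_ : E _ * E _ = 1) ?subrr ?mulr0 ?mul0r //.
  by rewrite -(qexpD HE) rmorphM /= addNr (qexp0 HE).
congr (_ * _); apply: (T_reflect bP tO Gz _ kE) => //.
- by case/andP: sm.
- move=> tb tb'; case: (gen s%:Z tau _ (Oroot tO) tb tb') => //; exact: mem_head.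
- move=> k0; move: ks sm; rewrite k0 /=; clear; lia.
Qed.

End Preservation.

Lemma dual_operator x L f : (forall u v, L u -> Qv v -> L (u + v)) -> bsum x L f -> QIf f ->
  exists g, [/\ bsum x L g, QIf g & Drel f g].
Proof.
move=> LQ bf qf.
have [h0 h0r] : exists h0 : V, forall v, v \in enum_fset Phi -> dot v h0 != 0.
  by apply: avoid_hyperplanes => v vP; exact: (root_neq0 HPhi).
have /choice [TK HTK] : forall tau : V, exists TK : (VC -> C) * (VC -> C), tau \in O ->
    regterm x L f tau TK.1 TK.2.
  move=> tau; case: (boolP (tau \in O)) => tO; last by exists (fun=> 0, fun=> 0).
  have [tP _] := short_rootP _ tO.
  by have [T [K TK]] := regterm_exists LQ bf qf tP; exists (T, K).
exact: (@dual_operator_reg x L LQ f qf (fun t => (TK t).1) (fun t => (TK t).2) HTK h0 h0r).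
Qed.

End DualMacdonald.

End DualOperator.
Import DualOperator.

(** * Triangularity of the dual operator and construction of its eigenfunctions *)

Module DualSpectrum.

Section DualSpectrum.
Context {R : realType} {C : numClosedFieldType} {n : nat} {rc : {rmorphism R -> C}}.
Context {E : C -> C} (HE : qexponential E).
Context {Phi : {fset 'rV[R]_n}} (HPhi : reduced_irreducible_root_system Phi).
Context (m : 'rV[R]_n -> nat).
Context (m_refl : forall a b, a \in Phi -> b \in Phi -> m (a *m refl_mx b) = m a).
Local Notation V := ('rV[R]_n).
Local Notation VC := ('rV[C]_n).
Local Notation cv := (cv rc).
Local Notation EE := (@EE C n E).
Local Notation bsum := (@bsum R C n rc E).
Local Notation csum := (@csum R C n rc E).
Local Notation topc := (@topc R C n rc E).
Local Notation Gam := (@Gam R C n rc E).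
Local Notation O := (@short_roots R n Phi).
Local Notation Qv := (@Qv R n Phi).
Local Notation QIf := (@QIf R C n rc E Phi m).
Local Notation rhoh := (@rhoh R n Phi m).
Local Notation HN := (@HN R n Phi m).
Local Notation regular := (@regular R n Phi).
Local Notation ee := (@ee R C n rc E).
Local Notation hs := (@hs R C n rc).
Local Notation az := (@az R C n rc E Phi m).
Local Notation Drel := (@Drel R C n rc E Phi m).
Implicit Types (x z w : VC) (a b h u v tau : V) (f g : VC -> C) (L : set V).

Lemma qexp_sum (I : Type) (r : seq I) (P : pred I) (F : I -> C) :
  E (\sum_(i <- r | P i) F i) = \prod_(i <- r | P i) E (F i).
Proof. by apply: big_morph => [u v|]; [exact: qexpD|exact: qexp0]. Qed.

(** All positive pairings (a^vee, tau) are 1, except 2 for a = tau. The separate term for tau, which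
    stems from the extra factor of the Macdonald coefficient, supplies the missing half. *)
Lemma two_rho_short h tau : regular h -> tau \in O ->
  \sum_(a <- Phi | 0 < dot (coroot a) tau) (if 0 < dot a h then (m a)%:R else - (m a)%:R) +
  (if 0 < dot tau h then (m tau)%:R else - (m tau)%:R) = 2 * dot (rhoh h) tau :> R.
Proof.
move=> hr tO; have tP : tau \in Phi by case/short_rootP: tO.
have t0 := root_neq0 HPhi tP.
pose s a : R := if 0 < dot a h then (m a)%:R else - (m a)%:R.
pose F a := s a * dot (coroot a) tau.
have FN a : a \in Phi -> F (- a) = F a.
  move=> aP; rewrite /F /s corootN !dotNl mulrN -mulNr (m_opp HPhi m_refl aP) oppr_gt0.
  by have := hr a aP; case: ltrgt0P => // _ _; rewrite opprK.
have -> : 2 * dot (rhoh h) tau = \sum_(a <- Phi | 0 < dot a h) F a.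
  rewrite /RootSystems.rhoh dotZl mulrA divff ?pnatr_eq0 // mul1r dot_suml.
  by apply: eq_bigr => a ah; rewrite /F /s ah dotZl.
have -> : \sum_(a <- Phi | 0 < dot a h) F a = \sum_(a <- Phi | 0 < dot (coroot a) tau) F a.
  rewrite [RHS]big_mkcond (big_root_split HPhi _ _ hr) big_seq_cond [RHS]big_seq_cond.
  apply: eq_bigr => a /andP[aP _] /=; rewrite FN // corootN dotNl oppr_gt0.
  by case: (ltrgt0P (dot (coroot a) tau)) => e; rewrite ?addr0 ?add0r // /F e mulr0.
have tt : 0 < dot (coroot tau) tau by rewrite (coroot_self t0) ltr0n.
rewrite !(big_rootD1 _ _ tP tt) /= {1}/F (coroot_self t0) mulr_natr mulr2n.
rewrite [X in X = _]addrAC; congr (_ + _); rewrite big_seq_cond [X in _ = X]big_seq_cond.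
apply: eq_bigr => a /and3P[aP at1 a0].
have at2 : a != - tau by apply: contraTneq a0 => ->; rewrite corootN dotNl oppr_gt0 -leNgt ltW.
rewrite /F; case: (short_root_quasiminuscule HPhi tO aP at1 at2) => e.
- by rewrite e mulr1.
- by rewrite e ltxx in a0.
- by rewrite e ltr0N1 in a0.
Qed.

Lemma single_prod (F : V -> C) tau : tau \in Phi ->
  \prod_(a <- Phi) (if a == tau then F a else 1) = F tau.
Proof.
move=> tP; rewrite (bigD1_seq tau) ?fset_uniq //= eqxx big1 ?mulr1 //.
by move=> a /negPf ->.
Qed.

Definition Eorb (y : VC) := \sum_(tau <- O) EE y (cv tau).

Definition aff (k c : C) a z := k * (c * ee a z - 1).

Definition affv h a : V := if 0 < dot a h then coroot a else 0.

Definition affc (k c : C) h a := if 0 < dot a h then k * c else - k.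

Lemma topc_aff h k c a : regular h -> a \in Phi -> topc h 0 (aff k c a) (affv h a) (affc k c h a).
Proof.
move=> hr aP; rewrite /affv /affc; have a0 := root_neq0 HPhi aP.
have t1 := @topc_exp R C n rc E h 0 (coroot a) (k * c); have t2 := @topc_const R C n rc E HE h (- k).
have eE z : k * c * EE (0 + cv (coroot a)) z + - k = aff k c a z.
  by rewrite add0r /aff /DualOperator.ee; ring.
case: ifP => ah; apply: (topc_ext eE).
  rewrite -[k * c in X in topc _ _ _ _ X]addr0; apply: topcD t1 (topcW t2 _).
  by rewrite dot0l (coroot_gt0 _ a0).
rewrite -[- k in X in topc _ _ _ _ X]add0r; apply: topcD t2; apply: (topcW t1).
by rewrite dot0l (coroot_lt0 _ a0) lt_neqAle (hr a aP) leNgt ah.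
Qed.

Lemma topc_root_prod h (F : V -> VC -> C) (v : V -> V) (c : V -> C) :
  (forall a, a \in Phi -> topc h 0 (F a) (v a) (c a)) ->
  topc h 0 (fun z => \prod_(a <- Phi) F a z) (\sum_(a <- Phi) v a) (\prod_(a <- Phi) c a).
Proof.
move=> H; rewrite big_seq [\prod_(a <- _) c a]big_seq.
by apply: topc_ext (topc_prod HE _ H) => z; rewrite [RHS]big_seq.
Qed.

(** In the direction h each factor of a coefficient of D tends to a power of q, and by
    [two_rho_short] these combine to q^{-2(rho_h, tau)}. Top coefficients are compared after
    multiplication by the denominators. *)
Lemma Drel_top h x f g v (s t : C) : regular h -> Drel f g -> topc h x f v s -> topc h x g v t ->
  t = (Eorb (x + cv v - cv (rhoh h)) - Eorb (- cv (rhoh h))) * s.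
Proof.
move=> hr fg tf tg.
pose N0 z := \prod_(a <- Phi) (aff 1 1 a z * aff 1 (E 2) a z).
pose p1 tau a := if 0 < dot (coroot a) tau then E (m a)%:R else 1.
pose p2 tau a := if 0 < dot (coroot a) tau then E (- (2 * (m a)%:R)) else 1.
pose q1 tau a := if a == tau then E (m a)%:R else 1.
pose q2 tau a := if a == tau then E (- (2 * (m a)%:R)) else 1.
pose N tau z := \prod_(a <- Phi) (aff (p1 tau a) (p2 tau a) a z * aff (q1 tau a) (q2 tau a * E 2) a z).
pose wd := \sum_(a <- Phi) (affv h a + affv h a).
pose c0 := \prod_(a <- Phi) (affc 1 1 h a * affc 1 (E 2) h a).
pose cN tau := \prod_(a <- Phi) (affc (p1 tau a) (p2 tau a) h a * affc (q1 tau a) (q2 tau a * E 2) h a).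
have t0 : topc h 0 N0 wd c0 by apply: topc_root_prod => a aP; apply: topcM => //; exact: topc_aff.
have tN tau : topc h 0 (N tau) wd (cN tau).
  by apply: topc_root_prod => a aP; apply: topcM => //; exact: topc_aff.
have affc0 k c a : k != 0 -> c != 0 -> affc k c h a != 0.
  by move=> k0 c1; rewrite /affc; case: ifP => _; rewrite ?oppr_eq0 ?mulf_neq0.
have c00 : c0 != 0.
  rewrite prodf_seq_neq0; apply/allP => a _ /=.
  by rewrite mulf_neq0 // affc0 ?oner_neq0 // (qexp_neq0 HE).
have cNE tau : tau \in O -> cN tau = c0 * EE (- cv (rhoh h)) (cv tau).
  move=> tO; have tP : tau \in Phi by case/short_rootP: tO.
  pose w a := E (- (if 0 < dot a h then (m a)%:R else - (m a)%:R)).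
  have e1 : cN tau = c0 * (\prod_(a <- Phi | 0 < dot (coroot a) tau) w a * w tau).
    have wE : w tau = \prod_(a <- Phi) (if a == tau then w a else 1).
      exact/esym/single_prod.
    rewrite wE [X in c0 * (X * _)]big_mkcond -!big_split /=; apply: eq_bigr => a _.
    rewrite /affc /p1 /p2 /q1 /q2 /w.
    have X0 := qexp_neq0 HE (m a)%:R; rewrite !(qexpN HE) E2k //.
    move: (E 2) => Y.
    by case: ifP => _; case: ifP => _; case: eqP => _; rewrite ?opprK ?(qexpN HE);
      move: (E _) X0 => X X0; field.
  rewrite e1; congr (_ * _).
  have := two_rho_short hr tO => /(congr1 (fun r => E (- rc r))).
  rewrite rmorphM /= rmorph_nat -dot_cv => e2.
  rewrite /ExponentialSums.EE dotNl mulrN -e2 rmorphD opprD (qexpD HE); congr (_ * _).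
    rewrite rmorph_sum -sumrN qexp_sum; apply: eq_bigr => a _; congr E; congr (- _).
    by case: ifP => _; rewrite ?rmorphN /= rmorph_nat.
  by congr E; congr (- _); case: ifP; rewrite ?rmorphN rmorph_nat.
(* The relation is known only where [N0] is nonzero; the additional factor [N0] makes it an identity
   at all z. *)
have key z : N0 z * (N0 z * g z) = N0 z * \sum_(tau <- O) N tau z * (f (z + cv tau) - f z).
  have [->|N00] := eqVneq (N0 z) 0; first by rewrite !mul0r.
  have gen a : a \in Phi -> ee a z != 1 /\ E 2 * ee a z != 1.
    move=> aP; move: N00; rewrite prodf_seq_neq0 => /allP /(_ a aP) /=.
    by rewrite /aff !mul1r mulf_eq0 negb_or !subr_eq0 => /andP[].
  congr (_ * _); rewrite fg // mulr_sumr big_seq [RHS]big_seq; apply: eq_bigr => tau tO.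
  have tP : tau \in Phi by case/short_rootP: tO.
  rewrite mulrA; congr (_ * _); rewrite /N /DualOperator.az.
  have -> : @rt C E (m tau)%:R (E 2 * ee tau z) =
     \prod_(a <- Phi) (if a == tau then @rt C E (m a)%:R (E 2 * ee a z) else 1).
    exact/esym/(single_prod (fun a => @rt C E (m a)%:R (E 2 * ee a z))).
  rewrite [X in N0 z * (X * _)]big_mkcond -!big_split /= big_seq [RHS]big_seq.
  apply: eq_bigr => a /gen [g1 g2]; rewrite /aff /p1 /p2 /q1 /q2 /rt.
  have g1' : ee a z - 1 != 0 by rewrite subr_eq0.
  have g2' : E 2 * ee a z - 1 != 0 by rewrite subr_eq0.
  move: (E 2) (ee a z) (E _) (E (- _)) g1' g2' => Y e A B g1' g2'.
  by case: ifP => _; case: eqP => _; field; rewrite ?g1' ?g2'.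
have T1 := topcM HE t0 (topcM HE t0 tg).
have T2 : topc h x (fun z => N0 z * \sum_(tau <- O) N tau z * (f (z + cv tau) - f z)) (wd + (wd + v))
   (c0 * \sum_(tau <- O) cN tau * (s * EE (x + cv v) (cv tau) - s)).
  apply: (topcM HE t0); apply: topc_sum => tau _; apply: (topcM HE (tN tau)).
  have := topcD (topc_shift HE (cv tau) tf) (topcZ (-1) tf).
  by rewrite mulN1r; apply: topc_ext => z; rewrite mulN1r.
have := topc_inj HE T1 (topc_ext (fun z => esym (key z)) T2) => /(mulfI c00).
rewrite (eq_big_seq (fun tau => c0 * (EE (- cv (rhoh h)) (cv tau) * (s * EE (x + cv v) (cv tau) - s)))); last first.
  by move=> tau tO; rewrite cNE // mulrA.
rewrite -mulr_sumr => /(mulfI c00) ->.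
rewrite mulrBl !mulr_suml -sumrB; apply: eq_bigr => tau _.
by rewrite (EEDl HE (x + cv v)); ring.
Qed.

Lemma Eorb_refl b u : b \in Phi -> Eorb (cv (u *m refl_mx b)) = Eorb (cv u).
Proof.
move=> bP; have b0 := root_neq0 HPhi bP.
rewrite [RHS](@big_root_reindex R n O _ _ +%R (fun tau => tau *m refl_mx b) predT); last 2 first.
- by move=> a; rewrite (short_root_refl HPhi).
- by move=> v; exact: reflK.
by apply: eq_bigr => tau _; rewrite /ExponentialSums.EE !dot_cv (refl_dot _ _ b0).
Qed.

Lemma Eorb_weyl (w : 'M[R]_n) u : weyl Phi w -> Eorb (cv (u *m w)) = Eorb (cv u).
Proof.
move=> Ww; elim: Ww u => [|a {}w aP _ IH] u; first by rewrite mulmx1.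
by rewrite mulmxA IH Eorb_refl //.
Qed.

Lemma Eorb_rhoh h h' : regular h -> regular h' -> Eorb (- cv (rhoh h)) = Eorb (- cv (rhoh h')).
Proof.
move=> r r'; have [w Ww wP] := regular_transitive HPhi r' r.
by rewrite (rhoh_ext m wP) (rhoh_weyl HPhi m_refl) // -!cvN -mulNmx Eorb_weyl.
Qed.

Lemma csum_ext x S c d : {in S, c =1 d} -> forall z, csum x S c z = csum x S d z.
Proof. by move=> e z; rewrite /ExponentialSums.csum; apply: eq_big_seq => nu /e ->. Qed.

Lemma csum_lin x S c d (s t : C) z :
  csum x S (fun nu => s * c nu + t * d nu) z = s * csum x S c z + t * csum x S d z.
Proof.
rewrite /ExponentialSums.csum !mulr_sumr -big_split; apply: eq_bigr => nu _ /=; ring.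
Qed.

Lemma QIf_ext f g : (forall z, f z = g z) -> QIf f -> QIf g.
Proof. by move=> e q a s z aP sm Gz; rewrite -!e; exact: q. Qed.

Lemma QIf_lin f g (s t : C) : QIf f -> QIf g -> QIf (fun z => s * f z + t * g z).
Proof. by move=> qf qg a k z aP km Gz; rewrite (qf a k z) // (qg a k z). Qed.

Lemma Drel_ext f g f' g' : (forall z, f z = f' z) -> (forall z, g z = g' z) -> Drel f g -> Drel f' g'.
Proof. by move=> e e' D z gen; rewrite -e' D //; apply: eq_bigr => tau _; rewrite !e. Qed.

Lemma Drel_lin f g f' g' (s t : C) : Drel f g -> Drel f' g' ->
  Drel (fun z => s * f z + t * f' z) (fun z => s * g z + t * g' z).
Proof.
move=> D D' z gen; rewrite D // D' // !mulr_sumr -big_split; apply: eq_bigr => tau _ /=; ring.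
Qed.

Lemma csum_supp x S S' c : uniq S -> uniq S' -> (forall nu, nu \in S -> nu \notin S' -> c nu = 0) ->
  (forall nu, nu \in S' -> nu \notin S -> c nu = 0) -> forall z, csum x S c z = csum x S' c z.
Proof.
move=> uS uS' h h' z; rewrite /ExponentialSums.csum.
have e (T T' : seq V) : (forall nu, nu \in T -> nu \notin T' -> c nu = 0) ->
    \sum_(nu <- T) c nu * EE (x + cv nu) z = \sum_(nu <- [seq nu <- T | nu \in T']) c nu * EE (x + cv nu) z.
  move=> hT; rewrite big_filter [RHS]big_mkcond; apply: eq_big_seq => nu nT.
  by case: ifP => // /negbT nT'; rewrite hT ?mul0r.
rewrite (e S S') // (e S' S) //; apply: perm_big; apply: uniq_perm; rewrite ?filter_uniq //.
by move=> nu; rewrite !mem_filter andbC.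
Qed.

Lemma topc_csum_in h x S c v : uniq S -> v \in S ->
  (forall mu, mu \in S -> c mu != 0 -> mu != v -> dot mu h < dot v h) -> topc h x (csum x S c) v (c v).
Proof.
move=> uS vS H; pose d u := if u \in S then c u else 0.
have dE u : u \in S -> d u = c u by rewrite /d => ->.
have e z : csum x S d z = csum x S c z by apply: csum_ext => u /dE.
rewrite -(dE v vS); apply: (topc_ext e); apply: topc_csum => //.
- by move=> u /negPf uS1; rewrite /d uS1.
- by move=> u uS1; rewrite dE //; exact: H.
Qed.

(** Were nu higher than the whole support of the argument, then after a perturbation of h the top
    coefficient of the result would by [Drel_top] be a multiple of the zero coefficient of the
    argument there. *)
Lemma Drel_hull x S c S' c' nu h : uniq S -> uniq S' -> Drel (csum x S c) (csum x S' c') ->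
  nu \in S' -> c' nu != 0 -> exists mu, [/\ mu \in S, c mu != 0 & dot nu h <= dot mu h].
Proof.
move=> uS uS' D nS cn; apply: contrapT => H.
have H' mu : mu \in S -> c mu != 0 -> 0 < dot (nu - mu) h.
  move=> muS cm; rewrite dotBl subr_gt0 ltNge; apply/negP => le; apply: H; by exists mu.
pose vs := enum_fset Phi ++ [seq p.1 - p.2 | p <- allpairs pair S' S' & p.1 != p.2].
have [|g [g1 g2]] := @perturb R n h [seq nu - mu | mu <- S] vs.
  move=> v; rewrite mem_cat => /orP[/(root_neq0 HPhi) //|/mapP [p]].
  by rewrite mem_filter => /andP[p12 _] ->; rewrite subr_eq0.
have rg : regular g by move=> a aP; apply: g1; rewrite mem_cat aP.
have ig : {in S' &, injective (fun u => dot u g)}.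
  move=> u v uS1 vS1 /= e; apply/eqP; apply: contraT => uv.
  have /g1 : u - v \in vs.
    rewrite mem_cat; apply/orP; right; apply/mapP; exists (u, v) => //.
    by rewrite mem_filter uv /=; apply/allpairsP; exists (u, v).
  by rewrite dotBl e subrr eqxx.
have [|v [vS cv0 vmax]] := csum_top uS' ig (c := c'); first by exists nu.
have muv mu : mu \in S -> c mu != 0 -> dot mu g < dot v g.
  move=> muS cm; have := g2 (nu - mu) (map_f _ muS) (H' mu muS cm).
  rewrite dotBl subr_gt0 => lt; have [->|nv] := eqVneq v nu; first by [].
  by apply: lt_trans lt _; apply: vmax => //; rewrite eq_sym.
have tf : topc g x (csum x S c) v 0.
  apply: topc_below; have -> : csum x S c = csum x [seq mu <- S | c mu != 0] c.
    apply: funext => z; rewrite /ExponentialSums.csum big_filter [LHS]big_mkcond [RHS]big_mkcond.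
    by apply: eq_bigr => mu _; case: eqP => // ->; rewrite mul0r.
  by apply: csum_bsum => mu; rewrite mem_filter => /andP[]; move=> cm muS; exact: muv.
have tg : topc g x (csum x S' c') v (c' v) by exact: topc_csum_in.
by have := Drel_top rg D tf tg; rewrite mulr0 => e; rewrite e eqxx in cv0.
Qed.

(** The roots span, so a point is determined by its pairings with them, and these are integral up to
    a fixed translation and bounded. *)
Lemma int_points_enum (v0 : V) (A : set V) (K : R) :
  (forall nu a, A nu -> a \in Phi -> (exists k : int, dot (nu - v0) a = k%:~R) /\ `|dot nu a| <= K) ->
  exists2 S : seq V, uniq S & forall nu, (nu \in S) <-> A nu.
Proof.
move=> bP.
have [M MK] : exists M : nat, forall a, a \in Phi -> `|dot v0 a| + K <= M%:R.
  have : forall s : seq V, exists M : nat, forall a, a \in s -> `|dot v0 a| + K <= M%:R.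
    elim=> [|b s [M IH]]; first by exists 0%N.
    pose y := Num.max (`|dot v0 b| + K) M%:R.
    have y0 : 0 <= y by rewrite le_max ler0n orbT.
    exists (Num.truncn y).+1 => a; rewrite inE => /orP[/eqP ->|/IH h].
      by apply: le_trans (ltW (truncnS_gt _)); rewrite /y le_max lexx.
    by apply: le_trans (ltW (truncnS_gt _)); rewrite /y le_max h orbT.
  by apply.
pose F (t : {ffun Phi -> 'I_(M + M).+1}) : V :=
  xget 0 [set nu | forall a : Phi, dot (nu - v0) (val a) = (t a)%:R - M%:R].
have fin : finite_set A.
  apply: sub_finite_set (finite_image F (@finite_finset _ setT)) => nu /= An.
  have tP (a : Phi) : exists k : 'I_(M + M).+1, dot (nu - v0) (val a) = k%:R - M%:R.
    have [[k kE] nK] := bP nu (val a) An (valP a).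
    have : `|dot (nu - v0) (val a)| <= M%:R.
      apply: le_trans (MK _ (valP a)); rewrite dotBl; apply: le_trans (ler_normB _ _) _.
      by rewrite addrC lerD2l.
    rewrite kE -intr_norm -[M%:R]/(M%:~R) ler_int => kM.
    have km : (`|(k + M%:Z)%R| < (M + M).+1)%N by move: kM; clear; lia.
    exists (Ordinal km) => /=; transitivity ((`|(k + M%:Z)%R|%N%:Z - M%:Z)%:~R : R).
    by congr (_%:~R); move: kM; clear; lia.
  by rewrite intrB.
  have [t tE] := choice tP.
  exists (finfun t) => //; rewrite /F; case: xgetP => [u _ uE|].
    apply/eqP; rewrite -subr_eq0; apply/eqP; apply: (root_sep HPhi) => a aP.
    rewrite dotC dotBl -[dot u a](subrK (dot v0 a)) -dotBl -[dot nu a](subrK (dot v0 a)) -dotBl.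
    have := uE [` aP]%fset; rewrite ffunE -tE /= => ->; by rewrite subrr.
  by move=> /(_ nu) []; move=> a; rewrite ffunE.
have /finite_seqP [s sE] := fin.
exists (undup s); first exact: undup_uniq.
by move=> nu; rewrite mem_undup sE.
Qed.

Lemma lattice_enum (v0 : V) (P : V -> Prop) (K : R) :
  (forall nu, P nu -> forall a, a \in Phi -> `|dot nu a| <= K) ->
  exists2 S : seq V, uniq S & forall nu, (nu \in S) <-> Qv (nu - v0) /\ P nu.
Proof.
move=> bP; apply: (@int_points_enum v0 [set nu | Qv (nu - v0) /\ P nu] K) => nu a [Qn Pn] aP.
by split; [exact: (Qv_int HPhi Qn aP)|exact: bP].
Qed.

Lemma HN_ge0 h : 0 <= HN h.
Proof. by rewrite mulr_ge0 ?invr_ge0 ?ler0n // sumr_ge0 // => a _; rewrite mulr_ge0. Qed.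

(** The points of K N in the class of rho^vee modulo the coroot lattice; K = 1 gives the support of
    psi, K = 9 that of the initial sum of [seed_exists]. *)
Definition Om (K : R) h0 nu := Qv (nu - rhoh h0) /\ forall h, dot nu h <= K * HN h.

Lemma Om_enum K h0 : exists2 S : seq V, uniq S & forall nu, (nu \in S) <-> Om K h0 nu.
Proof.
have [|S uS SE] := @lattice_enum (rhoh h0) (fun nu => forall h, dot nu h <= K * HN h)
   (\sum_(a <- Phi) `|K * HN a|); last by exists S.
move=> nu h a aP; have : `|K * HN a| <= \sum_(a <- Phi) `|K * HN a|.
  by rewrite (bigD1_seq a) ?fset_uniq //= lerDl sumr_ge0.
apply: le_trans; apply: le_trans (ler_norm _); rewrite ler_norml h andbT lerNl -dotNr.
apply: le_trans (h _) _; rewrite -[- a](refl_self (root_neq0 HPhi aP)) (HN_refl HPhi m_refl) //.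
Qed.

(** Diagonal entry of the operator, which is triangular for the order of exponents by height in the
    direction h. *)
Definition lam x h v := Eorb (x + cv v - cv (rhoh h)) - Eorb (- cv (rhoh h)).

Lemma dual_on_Om x K h0 S c : (forall nu, (nu \in S) <-> Om K h0 nu) -> uniq S ->
  QIf (csum x S c) -> exists2 d, QIf (csum x S d) & Drel (csum x S c) (csum x S d).
Proof.
move=> SP uS q; pose L : set V := fun nu => Qv (nu - rhoh h0).
have [|||g [bg qg Dg]] := @dual_operator R C n rc E HE Phi HPhi m m_refl x L (csum x S c).
- by move=> u v Lu Qw; rewrite /L addrAC; apply: QvD.
- by apply: csum_bsum => nu /SP [].
- exact: q.
have [S' [c' [uS' S'L c'0 gE]]] := bsum_csum bg.
have Dg' := Drel_ext (fun=> erefl) gE Dg.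
have sub nu : c' nu != 0 -> nu \in S.
  move=> cn; have nS' : nu \in S' by apply: contraNT cn => /c'0 ->.
  apply/SP; split=> [|h]; first exact: S'L.
  have [mu [/SP [_ /(_ h) mh] _ le]] := Drel_hull h uS uS' Dg' nS' cn.
  exact: le_trans le mh.
have e z : g z = csum x S c' z.
  rewrite gE; apply: csum_supp => // nu _ h; first by apply/eqP; apply: contraNT h => /sub.
  exact: c'0.
exists c'; [exact: QIf_ext e qg|exact: Drel_ext (fun=> erefl) e Dg].
Qed.

(** Triangular elimination. If w is the top exponent of the residue r = (D - lam_v) u, adding r /
    (lam_v - lam_w) to u replaces the residue by (D - lam_w) r / (lam_v - lam_w), which has lost
    w. *)
Lemma dual_eliminate x K h0 S h v c : (forall nu, (nu \in S) <-> Om K h0 nu) -> uniq S ->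
  regular h -> {in S &, injective (fun u => dot u h)} -> v \in S ->
  (forall mu, mu \in S -> dot mu h < dot v h -> lam x h mu != lam x h v) ->
  QIf (csum x S c) -> c v = 1 -> (forall mu, mu \in S -> c mu != 0 -> mu != v -> dot mu h < dot v h) ->
  exists d, [/\ QIf (csum x S d), d v = 1,
    forall mu, mu \in S -> d mu != 0 -> mu != v -> dot mu h < dot v h &
    Drel (csum x S d) (fun z => lam x h v * csum x S d z)].
Proof.
move=> SP uS hr ih vS sep.
have top (c1 d1 : V -> C) u : Drel (csum x S c1) (csum x S d1) -> u \in S ->
    (forall mu, mu \in S -> c1 mu != 0 -> mu != u -> dot mu h < dot u h) ->
    d1 u = lam x h u * c1 u /\ forall mu, mu \in S -> d1 mu != 0 -> mu != u -> dot mu h < dot u h.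
  move=> D uS1 c1u.
  have d1u mu : mu \in S -> d1 mu != 0 -> mu != u -> dot mu h < dot u h.
    move=> muS dmu mu_u; have [nu [nuS cnu le]] := Drel_hull h uS uS D muS dmu.
    have le2 : dot nu h <= dot u h.
      by have [->|nu_u] := eqVneq nu u; [exact: lexx|exact/ltW/c1u].
    rewrite lt_neqAle (le_trans le le2) andbT; apply: contra mu_u => /eqP e.
    by apply/eqP; exact: ih.
  by split=> //; exact: Drel_top hr D (topc_csum_in x uS uS1 c1u) (topc_csum_in x uS uS1 d1u).
(* The induction counts the exponents of [S] below K', a strict bound for the heights occurring in
   the residue r. *)
have step k : forall K' (u r : V -> C), (count (fun mu => dot mu h < K')%R S <= k)%N -> K' <= dot v h ->
   QIf (csum x S u) -> QIf (csum x S r) -> u v = 1 ->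
   (forall mu, mu \in S -> u mu != 0 -> mu != v -> dot mu h < dot v h) ->
   (forall mu, mu \in S -> r mu != 0 -> dot mu h < K') ->
   Drel (csum x S u) (csum x S (fun mu => 1 * r mu + lam x h v * u mu)) ->
   exists d, [/\ QIf (csum x S d), d v = 1,
    forall mu, mu \in S -> d mu != 0 -> mu != v -> dot mu h < dot v h &
    Drel (csum x S d) (fun z => lam x h v * csum x S d z)].
  elim: k => [|k IH] K' u r kK K'v qu qr uv us rs D.
    exists u; split=> //; apply: Drel_ext D => // z; rewrite csum_lin mul1r.
    rewrite [X in X + _](_ : _ = 0) ?add0r // /ExponentialSums.csum big_seq big1 // => mu muS.
    have [->|rm] := eqVneq (r mu) 0; first by rewrite mul0r.
    have := rs mu muS rm => lt; move: kK; rewrite leqn0 => /eqP c0.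
    have : has (fun mu => dot mu h < K') S by apply/hasP; exists mu.
    by rewrite has_count c0.
  have [r0|rn0] := pselect (forall mu, mu \in S -> r mu = 0).
    exists u; split=> //; apply: Drel_ext D => // z; rewrite csum_lin mul1r.
    rewrite [X in X + _](_ : _ = 0) ?add0r // /ExponentialSums.csum big_seq big1 // => mu muS.
    by rewrite r0 // mul0r.
  have [nu nuS rn] : exists2 nu, nu \in S & r nu != 0.
    apply: contrapT => H; apply: rn0 => mu muS; apply/eqP; apply: contraT => rm.
    by case: H; exists mu.
  have [w [wS rw wmax]] := csum_top uS ih (ex_intro2 _ _ nu nuS rn).
  have [dr qdr Ddr] := dual_on_Om SP uS qr.
  have [drw drmax] := top _ _ _ Ddr wS wmax.
  have wv : dot w h < dot v h by apply: lt_le_trans (rs w wS rw) K'v.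
  have lw : lam x h v - lam x h w != 0 by rewrite subr_eq0 eq_sym sep.
  apply: (IH (dot w h) (fun mu => 1 * u mu + (lam x h v - lam x h w)^-1 * r mu)
     (fun mu => (lam x h v - lam x h w)^-1 * dr mu + (- lam x h w / (lam x h v - lam x h w)) * r mu)).
  - rewrite -ltnS; apply: leq_trans _ kK.
    have sub1 : (count (fun mu => dot mu h < dot w h)%R S < count (predU (fun mu => dot mu h < dot w h)%R (pred1 w)) S)%N.
      rewrite -[X in (_ < X)%N](addn0) -[X in (_ + X)%N](_ : count (predI (fun mu => dot mu h < dot w h)%R (pred1 w)) S = 0%N).
        by rewrite count_predUI -addn1 leq_add2l -has_count has_pred1.
      by apply/eqP; rewrite -leqn0 leqNgt -has_count; apply/hasPn => mu _ /=; apply/negP => /andP[lt /eqP e]; rewrite e ltxx in lt.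
    apply: leq_trans sub1 _; apply: sub_count => mu /= /orP[lt|/eqP ->]; last exact: rs.
    by apply: lt_trans lt _; exact: rs.
  - exact: ltW.
  - by apply: QIf_ext (QIf_lin 1 (lam x h v - lam x h w)^-1 qu qr) => z; rewrite csum_lin.
  - by apply: QIf_ext (QIf_lin (lam x h v - lam x h w)^-1 (- lam x h w / (lam x h v - lam x h w)) qdr qr) => z; rewrite csum_lin.
  - have -> : r v = 0.
      by apply/eqP; apply: contraT => rv; have := lt_le_trans (rs v vS rv) K'v; rewrite ltxx.
    by rewrite mulr0 addr0 mul1r.
  - move=> mu muS; have [->|rm] := eqVneq (r mu) 0; first by rewrite mulr0 addr0 mul1r; exact: us.
    by move=> _ _; apply: lt_le_trans (rs mu muS rm) K'v.
  - move=> mu muS; have [->|mw] := eqVneq mu w.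
      rewrite drw mulrCA mulrA (mulrC (lam x h w)) mulNr mulNr (mulrC (lam x h w)).
      by rewrite addrN eqxx.
    have [->|drm] := eqVneq (dr mu) 0; last by move=> _; exact: drmax.
    rewrite mulr0 add0r; have [->|rm _] := eqVneq (r mu) 0; first by rewrite mulr0 eqxx.
    exact: wmax.
  - apply: Drel_ext (Drel_lin 1 (lam x h v - lam x h w)^-1 D Ddr) => z; rewrite !csum_lin //.
    by move: (csum x S u z) (csum x S r z) (csum x S dr z) (lam x h v) (lam x h w) lw => A B D' l1 l2 l0; field.
move=> qc cv1 cs; have [d qd Dd] := dual_on_Om SP uS qc.
have [dv ds] := top _ _ _ Dd vS cs.
apply: (step _ (dot v h) c (fun mu => 1 * d mu + (- lam x h v) * c mu) (leqnn _)) => //.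
- by apply: QIf_ext (QIf_lin 1 (- lam x h v) qd qc) => z; rewrite csum_lin.
- move=> mu muS; have [->|muv] := eqVneq mu v.
    by rewrite dv cv1 !mulr1 mul1r addrN eqxx.
  have [->|dm] := eqVneq (d mu) 0; last by move=> _; exact: ds.
  rewrite mulr0 add0r; have [->|cm _] := eqVneq (c mu) 0; first by rewrite mulr0 eqxx.
  exact: cs.
- by apply: Drel_ext Dd => // z; apply: csum_ext => mu _; ring.
Qed.

(** Zero at all points z + (s/2) b and z - (s/2) b occurring in the conditions for b = a or -a, so
    that any multiple of the product over the positive roots is trivially quasi-invariant. *)
Definition seed_factor a z :=
  \prod_(j <- iota 1 (m a)) (aff 1 (E (2 * j%:R)) a z * aff 1 (E (- (2 * j%:R))) a z).

Definition Bq (K : V -> R) : set V := [set u | Qv u /\ forall h, dot u h <= K h].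

Lemma Bq_mul K1 K2 K f g : bsum 0 (Bq K1) f -> bsum 0 (Bq K2) g -> (forall h, K1 h + K2 h <= K h) ->
  bsum 0 (Bq K) (fun z => f z * g z).
Proof.
move=> bf bg h12; apply: (bsumM HE bf bg) => u v [Qu hu] [Qw hw]; split; first exact: QvD.
by move=> h; rewrite dotDl; apply: le_trans (h12 h); exact: lerD.
Qed.

Lemma Bq_const (k : C) : bsum 0 (Bq (fun=> 0)) (fun=> k).
Proof. by apply: (bsum_const HE); split=> [|h]; [exact: Qv0|rewrite dot0l]. Qed.

Lemma seed_factor_bsum a : a \in Phi ->
  bsum 0 (Bq (fun h => 2 * (m a)%:R * `|dot (coroot a) h|)) (seed_factor a).
Proof.
move=> aP; rewrite /seed_factor -[in X in Bq X](size_iota 1 (m a)).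
have af k c : bsum 0 (Bq (fun h => `|dot (coroot a) h|)) (aff k c a).
  have b1 := @bsum_exp R C n rc E 0 (Bq (fun h => `|dot (coroot a) h|)) (k * c) (coroot a)
    (conj (Qv_coroot aP) (fun h => ler_norm _)).
  have b2 : bsum 0 (Bq (fun h => `|dot (coroot a) h|)) (fun=> - k).
    by apply: (bsum_const HE); split=> [|h]; [exact: Qv0|rewrite dot0l].
  have := bsumD b1 b2; apply: bsum_ext => z; rewrite add0r /aff /DualOperator.ee; ring.
elim: (iota _ _) => [|j r IH].
  apply: bsum_ext (bsumS _ (Bq_const 1)) => [z|u [Qu hu]]; first by rewrite big_nil.
  by split=> // h; rewrite mulr0 mul0r.
have := Bq_mul (Bq_mul (af 1 (E (2 * j%:R))) (af 1 (E (- (2 * j%:R)))) (fun h => lexx _)) IH.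
move=> /(_ (fun h => 2 * (size (j :: r))%:R * `|dot (coroot a) h|)) H.
apply: bsum_ext (H _) => [z|h]; first by rewrite big_cons.
by rewrite /= -addn1 natrD le_eqVlt; apply/orP; left; apply/eqP; ring.
Qed.

Definition seed h0 z := \prod_(a <- [seq a <- Phi | 0 < dot a h0]) seed_factor a z.

Lemma seed_bsum h0 :
  bsum 0 (Bq (fun h => \sum_(a <- [seq a <- Phi | 0 < dot a h0]) 2 * (m a)%:R * `|dot (coroot a) h|)) (seed h0).
Proof.
rewrite /seed; have : {subset [seq a <- Phi | 0 < dot a h0] <= Phi}.
  by move=> a; rewrite mem_filter => /andP[].
elim: [seq _ <- _ | _] => [|a s IH] sP.
  by apply: bsum_ext (bsumS _ (Bq_const 1)) => [z|u [Qu hu]]; rewrite ?big_nil //; split=> // h; rewrite big_nil.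
have := Bq_mul (seed_factor_bsum (sP a (mem_head _ _))) (IH (fun b bs => sP b (mem_behead (s := a :: s) bs))).
move=> /(_ (fun h => \sum_(b <- a :: s) 2 * (m b)%:R * `|dot (coroot b) h|)) H.
apply: bsum_ext (H _) => [z|h]; first by rewrite big_cons.
by rewrite big_cons.
Qed.

Lemma seed_factor_top a h : regular h -> a \in Phi -> 0 < dot a h ->
  topc h 0 (seed_factor a) ((2 * (m a)%:R) *: coroot a) 1.
Proof.
move=> hr aP ah.
have t (j : nat) : topc h 0 (fun z => aff 1 (E (2 * j%:R)) a z * aff 1 (E (- (2 * j%:R))) a z)
   (coroot a + coroot a) 1.
  have := topcM HE (topc_aff 1 (E (2 * j%:R)) hr aP) (topc_aff 1 (E (- (2 * j%:R))) hr aP).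
  by rewrite /affv /affc ah !mul1r -(qexpD HE) subrr (qexp0 HE).
have -> : (2 * (m a)%:R) *: coroot a = coroot a *+ (2 * m a) by rewrite -natrM scaler_nat.
have := topc_prod HE (iota 1 (m a)) (P := predT) (fun j _ => t j).
by rewrite big1_eq big_const_seq count_predT size_iota iter_addr_0 -mulr2n -mulrnA.
Qed.

Lemma seed_top h : regular h ->
  topc h 0 (seed h) (\sum_(a <- [seq a <- Phi | 0 < dot a h]) (2 * (m a)%:R) *: coroot a) 1.
Proof.
move=> hr; rewrite /seed.
have : {subset [seq a <- Phi | 0 < dot a h] <= [pred a | (a \in Phi) && (0 < dot a h)]}.
  by move=> a; rewrite mem_filter andbC.
elim: [seq _ <- _ | _] => [|a s IH] sP.
  rewrite big_nil; apply: topc_ext (topc_const HE h 1) => z; by rewrite big_nil.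
have /andP[aP ah] := sP a (mem_head _ _).
have := topcM HE (seed_factor_top hr aP ah) (IH (fun b bs => sP b (mem_behead (s := a :: s) bs))).
rewrite big_cons mulr1; apply: topc_ext => z; by rewrite big_cons.
Qed.

Lemma seed_zero h0 b z (s : nat) : regular h0 -> b \in Phi -> Gam (coroot b) z -> (0 < s <= m b)%N ->
  seed h0 (z + hs b s) = 0 /\ seed h0 (z + hs b (- s%:Z)) = 0.
Proof.
move=> r0 bP Gz sm.
have H c : c \in Phi -> (c = b) \/ (c = - b) -> 0 < dot c h0 ->
    forall t, (t = s%:Z) \/ (t = - s%:Z) -> seed h0 (z + hs b t) = 0.
  move=> cP cb c0 t ts; have mc : m c = m b by case: cb => -> //; exact: (m_opp HPhi m_refl).
  have cS : c \in [seq a <- Phi | 0 < dot a h0] by rewrite mem_filter c0.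
  rewrite /seed (bigD1_seq c) ?filter_uniq ?fset_uniq //= (_ : seed_factor _ _ = 0) ?mul0r //.
  rewrite /seed_factor (bigD1_seq s) ?iota_uniq //=; last by rewrite mem_iota add1n ltnS mc.
  have et : ee c (z + hs b t) = E (2 * s%:R) \/ ee c (z + hs b t) = E (- (2 * s%:R)).
    have i1 : (2 * s%:Z)%:~R = 2 * s%:R :> C by rewrite intrM.
    have i2 : (2 * - s%:Z)%:~R = - (2 * s%:R) :> C by rewrite mulrN rmorphN /= i1.
    by case: cb => ->; case: ts => ->; rewrite ?(eeN HE) (ee_self HE HPhi _ bP Gz) -?(qexpN HE) ?i1 ?i2 ?opprK;
      auto.
  by rewrite /aff; case: et => ->; rewrite !mul1r -!(qexpD HE) ?subrr ?addNr (qexp0 HE) subrr ?(mulr0, mul0r).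
have [bh|bh] := ltP 0 (dot b h0).
  by split; apply: (H b) => //; [left|left|left|right].
have Nb : 0 < dot (- b) h0 by rewrite dotNl oppr_gt0 lt_neqAle r0.
have NbP : - b \in Phi by rewrite (rootN HPhi).
by split; apply: (H (- b)) => //; [right|left|right|right].
Qed.

(** The starting point of the elimination. The bound 9 is 4 from the seed, 4 from the translation
    that brings its top exponent down, and 1 from rho^vee. *)
Lemma seed_exists x h0 : regular h0 -> exists F, [/\ bsum x (Om 9 h0) F, QIf F &
  forall h, regular h -> (forall a, a \in Phi -> (0 < dot a h) = (0 < dot a h0)) -> topc h x F (rhoh h0) 1].
Proof.
move=> r0; set pos := [seq a <- Phi | 0 < dot a h0].
pose u0 := rhoh h0 - \sum_(a <- pos) (2 * (m a)%:R) *: coroot a.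
pose F z := seed h0 z * EE (x + cv u0) z.
exists F; split.
- have bE := @bsum_exp R C n rc E x [set u | u = u0] 1 u0 erefl.
  have := bsumM HE (seed_bsum h0) bE (L := Om 9 h0); rewrite /F => H.
  apply: bsum_ext (H _) => [z|u v [Qu hu] ->]; first by rewrite mul1r.
  have posQ : Qv (\sum_(a <- pos) (2 * (m a)%:R) *: coroot a).
    rewrite big_seq; apply: Qv_sum => a; rewrite mem_filter => /andP[_ aP].
    have -> : 2 * (m a)%:R = (2 * m a)%N%:Z%:~R :> R by rewrite -pmulrn natrM.
    exact: Qv_coroot_int.
  split=> [|h].
    rewrite (_ : _ - _ = u - \sum_(a <- pos) (2 * (m a)%:R) *: coroot a); last by rewrite /u0 addrCA addrAC addrN add0r.
    by apply: QvD => //; exact: QvN.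
  have e1 : \sum_(a <- pos) 2 * (m a)%:R * `|dot (coroot a) h| = 4 * HN h.
    rewrite (HN_split HPhi m_refl h r0) mulrA big_filter mulr_sumr; apply: eq_bigr => a _.
    by rewrite mulrA; congr (_ * _ * _); lra.
  have e2 : - dot (\sum_(a <- pos) (2 * (m a)%:R) *: coroot a) h <= 4 * HN h.
    rewrite -e1 dot_suml -sumrN; apply: ler_sum => a _; rewrite dotZl -mulrN ler_wpM2l ?mulr_ge0 //.
    by rewrite -normrN ler_norm.
  have e3 := HN_ge_rhoh HPhi m_refl h r0; have := hu h; rewrite e1 => e4.
  rewrite dotDl dotBl; lra.
- move=> b s z bP sm Gz; rewrite /F.
  have [f1 f2] := seed_zero r0 bP Gz sm.
  by rewrite -[_ *: cv b]/(hs b s) hsN f1 f2 !mul0r.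
- move=> h hr hs0.
  have e : pos = [seq a <- Phi | 0 < dot a h].
    by apply: eq_in_filter => a aP; rewrite hs0.
  have eS : seed h0 = seed h by rewrite /seed -/pos e.
  have := topcM HE (seed_top hr) (@topc_exp R C n rc E h x u0 1).
  rewrite -e -eS mulr1 (_ : _ + u0 = rhoh h0); last by rewrite /u0 addrCA subrr addr0.
  by apply: topc_ext => z; rewrite mul1r.
Qed.

(** Elimination takes place in 9 N. That the result lies in N is read off its eigenvalue: in every
    generic direction g the top exponent has this same eigenvalue, which for the given x belongs to
    rho_g only. *)
Lemma dual_eigen x h0 SN S9 : regular h0 -> uniq SN -> (forall nu, (nu \in SN) <-> Om 1 h0 nu) ->
  uniq S9 -> (forall nu, (nu \in S9) <-> Om 9 h0 nu) ->
  (forall nu h, nu \in S9 -> regular h -> nu != rhoh h -> Eorb (x + cv nu - cv (rhoh h)) != Eorb x) ->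
  exists c, [/\ QIf (csum x SN c), c (rhoh h0) = 1 &
    Drel (csum x SN c) (fun z => (Eorb x - Eorb (- cv (rhoh h0))) * csum x SN c z)].
Proof.
move=> r0 uN NP u9 P9 gen.
have [F [bF qF tF]] := seed_exists x r0.
pose vs := enum_fset Phi ++ [seq p.1 - p.2 | p <- allpairs pair S9 S9 & p.1 != p.2].
have [|h [g1 g2]] := @perturb R n h0 (enum_fset Phi) vs.
  move=> v; rewrite mem_cat => /orP[/(root_neq0 HPhi) //|/mapP [p]].
  by rewrite mem_filter => /andP[p12 _] ->; rewrite subr_eq0.
have hr : regular h by move=> a aP; apply: g1; rewrite mem_cat aP.
have ig : {in S9 &, injective (fun u => dot u h)}.
  move=> u v uS1 vS1 /= e; apply/eqP; apply: contraT => uv.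
  have /g1 : u - v \in vs.
    rewrite mem_cat; apply/orP; right; apply/mapP; exists (u, v) => //.
    by rewrite mem_filter uv /=; apply/allpairsP; exists (u, v).
  by rewrite dotBl e subrr eqxx.
have hpos a : a \in Phi -> (0 < dot a h) = (0 < dot a h0).
  move=> aP; have := r0 a aP; case: (ltgtP 0 (dot a h0)) => // a0 _; first exact: g2.
    have := g2 (- a); rewrite (rootN HPhi) !dotNl oppr_gt0 => /(_ aP a0).
    by rewrite oppr_gt0 => lt; apply/negbTE; rewrite -leNgt ltW.
have rh0 : rhoh h = rhoh h0 by exact: rhoh_ext.
have [S' [c' [uS' S'L c'0 FE]]] := bsum_csum bF.
have r9 : rhoh h0 \in S9.
  apply/P9; split=> [|h1]; first by rewrite subrr; exact: Qv0.
  by apply: le_trans (HN_ge_rhoh HPhi m_refl h1 r0) _; have := HN_ge0 h1; lra.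
have F9 z : F z = csum x S9 c' z.
  rewrite FE; apply: csum_supp => // nu nS nS'; last exact: c'0.
  by case/negP: nS'; apply/P9; exact: S'L.
have t1 := topc_ext F9 (tF h hr hpos).
have [c'r c'low] : c' (rhoh h0) = 1 /\ forall mu, mu \in S9 -> c' mu != 0 -> mu != rhoh h0 -> dot mu h < dot (rhoh h0) h.
  have [nu nuS cnu] : exists2 nu, nu \in S9 & c' nu != 0.
    apply: contrapT => H; have /eqP : (1 : C) = 0; last by rewrite oner_eq0.
    apply: (topc_eq0 HE t1) => z; rewrite /ExponentialSums.csum big_seq big1 // => mu muS.
    have [->|cm] := eqVneq (c' mu) 0; first by rewrite mul0r.
    by case: H; exists mu.
  have [v [vS cv0 vmax]] := csum_top u9 ig (ex_intro2 _ _ nu nuS cnu).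
  have t2 := topc_csum_in x u9 vS vmax.
  have vr : v = rhoh h0.
    apply: ig => //; case: (ltgtP (dot v h) (dot (rhoh h0) h)) => // lt.
      by have /eqP := topc_inj HE (topcW t2 lt) t1; rewrite eq_sym oner_eq0.
    by have e := topc_inj HE (topcW t1 lt) t2; rewrite -e eqxx in cv0.
  by split; [rewrite -vr; apply: (topc_inj HE t2); rewrite vr|move=> mu; rewrite -vr; exact: vmax].
have lamE nu : lam x h nu = Eorb (x + cv nu - cv (rhoh h0)) - Eorb (- cv (rhoh h0)).
  by rewrite /lam rh0.
have lam0 : lam x h (rhoh h0) = Eorb x - Eorb (- cv (rhoh h0)) by rewrite lamE addrK.
have sep mu : mu \in S9 -> dot mu h < dot (rhoh h0) h -> lam x h mu != lam x h (rhoh h0).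
  move=> muS lt; rewrite lam0 lamE (inj_eq (addIr _)); apply: gen => //.
  by apply: contraTneq lt => ->; rewrite ltxx.
have [d [qd dr dlow Dd]] := dual_eliminate P9 u9 hr ig r9 sep (QIf_ext F9 qF) c'r c'low.
have dN nu : nu \in S9 -> d nu != 0 -> nu \in SN.
  move=> nuS dnu; apply/NP; split=> [|h1]; first by case/P9: nuS.
  rewrite mul1r leNgt; apply/negP => lt.
  have [|g [k1 k2]] := @perturb R n h1 [seq nu - mu | mu <- S9] vs.
    move=> v; rewrite mem_cat => /orP[/(root_neq0 HPhi) //|/mapP [p]].
    by rewrite mem_filter => /andP[p12 _] ->; rewrite subr_eq0.
  have gr : regular g by move=> a aP; apply: k1; rewrite mem_cat aP.
  have ig' : {in S9 &, injective (fun u => dot u g)}.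
    move=> u v uS1 vS1 /= e; apply/eqP; apply: contraT => uv.
    have /k1 : u - v \in vs.
      rewrite mem_cat; apply/orP; right; apply/mapP; exists (u, v) => //.
      by rewrite mem_filter uv /=; apply/allpairsP; exists (u, v).
    by rewrite dotBl e subrr eqxx.
  have rgS : rhoh g \in S9.
    apply/P9; split=> [|h2]; first exact: rhoh_Qv.
    by apply: le_trans (HN_ge_rhoh HPhi m_refl h2 gr) _; have := HN_ge0 h2; lra.
  have lt2 : 0 < dot (nu - rhoh g) g.
    apply: k2; first exact: map_f.
    by rewrite dotBl subr_gt0; apply: le_lt_trans (HN_ge_rhoh HPhi m_refl h1 gr) lt.
  have [v [vS dv0 vmax]] := csum_top u9 ig' (ex_intro2 _ _ nu nuS dnu).
  have t2 := topc_csum_in x u9 vS vmax.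
  have := Drel_top gr Dd t2 (topcZ (lam x h (rhoh h0)) t2) => /(mulIf dv0).
  rewrite lam0 -(Eorb_rhoh gr r0) => /addIr e.
  have vg : v = rhoh g.
    by apply/eqP; apply: contraT => ne; have := gen v g vS gr ne; rewrite -e eqxx.
  have [nv|nv] := eqVneq nu v; first by move: lt2; rewrite nv vg subrr dot0l ltxx.
  have := vmax nu nuS dnu nv; rewrite vg => lt3.
  by move: lt2; rewrite dotBl subr_gt0 => /(lt_trans lt3); rewrite ltxx.
have e z : csum x S9 d z = csum x SN d z.
  apply: csum_supp => // nu nS nS'; first by apply/eqP; apply: contraNT nS'; exact: dN.
  case/negP: nS'; apply/P9; have /NP [Qn hn] := nS; split=> // h1.
  by apply: le_trans (hn h1) _; have := HN_ge0 h1; lra.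
exists d; split=> //; first exact: QIf_ext e qd.
by apply: Drel_ext Dd => // z; rewrite lam0 e.
Qed.

End DualSpectrum.

End DualSpectrum.
Import DualSpectrum.

(** * Generic conditions on x, and Laurent polynomials along lines *)

Module GenericSets.

Section Generic.
Context {R : realType} {C : numClosedFieldType} {n : nat} {rc : {rmorphism R -> C}}.
Context {E : C -> C} (HE : qexponential E).
Local Notation V := ('rV[R]_n).
Local Notation VC := ('rV[C]_n).
Local Notation cv := (cv rc).
Local Notation EE := (@EE C n E).
Local Notation bsum := (@bsum R C n rc E).
Local Notation csum := (@csum R C n rc E).
Implicit Types (x z w : VC) (u v h : V) (f g : VC -> C) (P Q : VC -> Prop).

Lemma bsum_nontrivial x (L : set V) f : bsum x L f -> (exists z, f z != 0) -> exists S c,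
  [/\ uniq S, forall nu, nu \in S -> L nu, forall z, f z = csum x S c z & exists2 nu, nu \in S & c nu != 0].
Proof.
move=> /bsum_csum [S [c [uS SL c0 fE]]] [z fz]; exists S, c; split=> //.
apply: contrapT => H; case/negP: fz; rewrite fE /ExponentialSums.csum big_seq big1 // => nu nS.
have [->|cn] := eqVneq (c nu) 0; first by rewrite mul0r.
by case: H; exists nu.
Qed.

Lemma generic_direction (S : seq V) : exists h, {in S &, injective (fun u => dot u h)}.
Proof.
have [|h hP] := @avoid_hyperplanes R n [seq p.1 - p.2 | p <- allpairs pair S S & p.1 != p.2].
  by move=> v /mapP [p]; rewrite mem_filter => /andP[p12 _] ->; rewrite subr_eq0.
exists h => u v uS vS /= e; apply/eqP; apply: contraT => uv.
have /hP : u - v \in [seq p.1 - p.2 | p <- allpairs pair S S & p.1 != p.2].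
  by apply/mapP; exists (u, v) => //; rewrite mem_filter uv /=; apply/allpairsP; exists (u, v).
by rewrite dotBl e subrr eqxx.
Qed.

(** In a direction that separates the exponents of both sums the top coefficients multiply. *)
Lemma bsum_domain x (L L' : set V) f g : bsum 0 L f -> bsum x L' g -> (exists z, f z != 0) ->
  (exists z, g z != 0) -> exists z, f z * g z != 0.
Proof.
move=> bf bg /(bsum_nontrivial bf) [S [c [uS _ fE cS]]] /(bsum_nontrivial bg) [S' [c' [uS' _ gE cS']]].
have [h hi] := generic_direction (S ++ S').
have i1 : {in S &, injective (fun u => dot u h)}.
  by move=> u v uS1 vS1; apply: hi; rewrite mem_cat ?uS1 ?vS1.
have i2 : {in S' &, injective (fun u => dot u h)}.
  by move=> u v uS1 vS1; apply: hi; rewrite mem_cat ?uS1 ?vS1 orbT.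
have [v [vS cv0 vm]] := csum_top uS i1 cS; have [v' [vS' cv0' vm']] := csum_top uS' i2 cS'.
have T := topcM HE (@topc_csum_in R C n rc E h 0 S c v uS vS vm) (@topc_csum_in R C n rc E h x S' c' v' uS' vS' vm').
apply: contrapT => H; have := topc_eq0 HE T.
move=> /(_ _) e; have /eqP : c v * c' v' = 0; last by rewrite mulf_eq0 (negPf cv0) (negPf cv0').
apply: e => z; rewrite -fE -gE; apply/eqP; apply: contraT => ne; by case: H; exists z.
Qed.

Section GenericSet.
Context (L : set V) (L0 : L 0) (LD : forall u v, L u -> L v -> L (u + v)).

(** One nonzero exponential sum in x witnesses the condition. The exponent set [L] is recorded
    because sums with exponents in [LQ] become Laurent polynomials on lines in lattice directions;
    [setT] forgets this. *)
Definition gener P := exists f, [/\ bsum 0 L f, exists x, f x != 0 & forall x, f x != 0 -> P x].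

Lemma gener_mono P Q : (forall x, P x -> Q x) -> gener P -> gener Q.
Proof. by move=> PQ [f [bf fx fP]]; exists f; split=> // x /fP /PQ. Qed.

Lemma gener_and P Q : gener P -> gener Q -> gener (fun x => P x /\ Q x).
Proof.
move=> [f [bf fx fP]] [g [bg gx gQ]]; exists (fun x => f x * g x); split.
- exact: bsumM bf bg LD.
- exact: (bsum_domain bf bg).
- by move=> x; rewrite mulf_eq0 negb_or => /andP[/fP Px /gQ Qx].
Qed.

Lemma gener_true P : (forall x, P x) -> gener P.
Proof.
by move=> H; exists (fun=> 1); split=> //; [exact: (bsum_const HE)|exists 0; exact: oner_neq0].
Qed.

Lemma gener_seq (T : eqType) (s : seq T) (P : T -> VC -> Prop) : (forall i, i \in s -> gener (P i)) ->
  gener (fun x => forall i, i \in s -> P i x).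
Proof.
elim: s => [|i s IH] H; first exact: gener_true.
have H1 := H i (mem_head _ _); have H2 := IH (fun j js => H j (mem_behead (s := i :: s) js)).
apply: gener_mono (gener_and H1 H2) => x [Pi Ps] j; rewrite inE => /orP[/eqP ->//|]; exact: Ps.
Qed.

Lemma gener_ex P : gener P -> exists x, P x.
Proof. by move=> [f [bf [x fx] fP]]; exists x; exact: fP. Qed.

Lemma gener_neq0 f : bsum 0 L f -> (exists x, f x != 0) -> gener (fun x => f x != 0).
Proof. by move=> bf fx; exists f. Qed.

Lemma bsum_shift0 f w : bsum 0 L f -> bsum 0 L (fun x => f (x + w)).
Proof. exact: bsum_shift. Qed.

Lemma gener_shift P w : gener P -> gener (fun x => P (x + w)).
Proof.
move=> [f [bf [x fx] fP]]; exists (fun x => f (x + w)); split.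
- exact: bsum_shift0.
- by exists (x - w); rewrite subrK.
- by move=> y /fP.
Qed.

Lemma gener_EE v (k : C) : v != 0 -> L v -> gener (fun x => EE (cv v) x != k).
Proof.
move=> v0 Lv; apply: (@gener_mono (fun x => EE (cv v) x - k != 0)); first by move=> x; rewrite subr_eq0.
apply: gener_neq0.
  have := bsumD (@bsum_exp R C n rc E 0 L 1 v Lv) (bsum_const HE (- k) L0).
  by apply: bsum_ext => x; rewrite mul1r add0r.
pose y : C := if k == 1 then 2 else 1.
have y0 : y != 0 by rewrite /y; case: ifP; rewrite ?pnatr_eq0 ?oner_neq0.
have yk : y != k.
  rewrite /y; case: (eqVneq k 1) => [->|k1]; last by rewrite eq_sym.
  by rewrite -[1]/(1%:R) eqr_nat.
have [t tE] := qexp_surj HE y0.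
exists ((t / (2 * rc (dot v v))) *: cv v); rewrite /ExponentialSums.EE dotZr dot_cv subr_eq0.
have vv : rc (dot v v) != 0 by rewrite fmorph_eq0 dot_sq_eq0.
move: (rc _) vv => X X0; have -> : 2 * (t / (2 * X) * X) = t by field.
by rewrite tE.
Qed.

End GenericSet.

Lemma gener_sub (L L' : set V) P : L `<=` L' -> gener L P -> gener L' P.
Proof. by move=> LL [f [bf fx fP]]; exists f; split=> //; exact: bsumS bf. Qed.

Lemma bsum_comp f (pi : VC -> VC) w : bsum 0 setT f ->
  (forall v, exists v', forall x, dot (cv v) (pi x) = dot (cv v') x) -> bsum 0 setT (fun x => f (pi x + w)).
Proof.
move=> [s [_ fE]] H; have {fE} : forall x, f (pi x + w) = \sum_(p <- s) p.1 * EE (0 + cv p.2) (pi x + w).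
  by move=> x; exact: fE.
move=> fE; apply: (@bsum_ext R C n rc E 0 setT (fun x => \sum_(p <- s) p.1 * EE (0 + cv p.2) (pi x + w))).
  by move=> x; rewrite fE.
apply: bsum_sum => p _; have [v' hv'] := H p.2.
have := @bsum_exp R C n rc E 0 setT (p.1 * EE (cv p.2) w) v' I.
apply: bsum_ext => x; rewrite !add0r (EEDr HE) /ExponentialSums.EE hv'; ring.
Qed.

End Generic.

Section LaurentLines.
Context {C : numClosedFieldType}.
Context {E : C -> C} (HE : qexponential E).
Implicit Types (F G : C -> C) (p q : {poly C}).

(** With T = E t: Laurent polynomials in T, and next to them ([cofin]) the conditions that hold for
    all but finitely many values of T. *)
Definition laur F := exists p k, forall t, E t ^+ k * F t = p.[E t].

Definition cofin (P : C -> Prop) := exists2 q : {poly C}, q != 0 & forall t, q.[E t] != 0 -> P t.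

Lemma laur_ext F G : (forall t, F t = G t) -> laur F -> laur G.
Proof. by move=> e [p [k h]]; exists p, k => t; rewrite -e. Qed.

Lemma laurD F G : laur F -> laur G -> laur (fun t => F t + G t).
Proof.
move=> [p [k h]] [q [l h']]; exists ('X^l * p + 'X^k * q), (k + l)%N => t.
by rewrite hornerD !hornerM !hornerXn -h -h' exprD; move: (E t ^+ k) (E t ^+ l) => A B; ring.
Qed.

Lemma laurM F G : laur F -> laur G -> laur (fun t => F t * G t).
Proof.
move=> [p [k h]] [q [l h']]; exists (p * q), (k + l)%N => t.
by rewrite hornerM -h -h' exprD; move: (E t ^+ k) (E t ^+ l) => A B; ring.
Qed.

Lemma laur_const (c : C) : laur (fun=> c).
Proof. by exists c%:P, 0%N => t; rewrite hornerE mul1r. Qed.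

Lemma laur_sum (I : Type) (r : seq I) (P : pred I) (F : I -> C -> C) : (forall i, P i -> laur (F i)) ->
  laur (fun t => \sum_(i <- r | P i) F i t).
Proof.
move=> H; elim: r => [|i r IH].
  by apply: laur_ext (laur_const 0) => t; rewrite big_nil.
case Pi: (P i); last by apply: laur_ext IH => t; rewrite big_cons Pi.
by apply: laur_ext (laurD (H i Pi) IH) => t; rewrite big_cons Pi.
Qed.

Lemma laur_exp (j : int) : laur (fun t => E (t * j%:~R)).
Proof.
case: j => j.
  exists 'X^j, 0%N => t; rewrite mul1r hornerXn -(qexpMn HE); congr E.
  by rewrite mulrC.
have e t : E (t * (Negz j)%:~R) = (E t ^+ j.+1)^-1.
  by rewrite NegzE rmorphN mulrN (qexpN HE) mulrC -(qexpMn HE).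
by exists 1, j.+1 => t; rewrite hornerE e divff // expf_neq0 // (qexp_neq0 HE).
Qed.

Lemma qexp_poly_eq p q : cofin (fun t => p.[E t] = q.[E t]) -> p = q.
Proof.
move=> [d d0 dP]; apply/eqP; rewrite -subr_eq0; apply/eqP.
have : (p - q) * d * 'X = 0.
  apply/eqP; apply: contraT => ne.
  have : forall T, ((p - q) * d * 'X).[T] = 0.
    move=> T; have [->|T0] := eqVneq T 0; first by rewrite hornerMX mulr0.
    have [t <-] := qexp_surj HE T0; rewrite hornerMX hornerM hornerD hornerN.
    by have [->|/dP ->] := eqVneq d.[E t] 0; rewrite ?subrr ?(mulr0, mul0r).
  by move=> H; have /closed_nonrootP [T] := ne; rewrite /root H eqxx.
move/eqP; rewrite !mulf_eq0 (negPf d0) polyX_eq0 !orbF => /eqP //.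
Qed.

Lemma cofin_and (P Q : C -> Prop) : cofin P -> cofin Q -> cofin (fun t => P t /\ Q t).
Proof.
move=> [d d0 dP] [e e0 eP]; exists (d * e); first by rewrite mulf_neq0.
by move=> t; rewrite hornerM mulf_eq0 negb_or => /andP[/dP Pt /eP Qt].
Qed.

Lemma cofin_mono (P Q : C -> Prop) : (forall t, P t -> Q t) -> cofin P -> cofin Q.
Proof. by move=> PQ [d d0 dP]; exists d => // t /dP /PQ. Qed.

Lemma cofin_laur F : laur F -> F 0 != 0 -> cofin (fun t => F t != 0).
Proof.
move=> [p [k h]] F0; exists p.
  apply: contraNneq F0 => p0; have := h 0; rewrite p0 horner0 (qexp0 HE) expr1n mul1r => ->.
  by [].
by move=> t; rewrite -h mulf_eq0 negb_or => /andP[].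
Qed.

Lemma laur_eq0 F : laur F -> cofin (fun t => F t = 0) -> forall t, F t = 0.
Proof.
move=> [p [k h]] cF t; have E0 := qexp_neq0 HE t.
have p0 : p = 0.
  by apply: qexp_poly_eq; apply: cofin_mono cF => u Fu; rewrite -h Fu mulr0 horner0.
by apply/eqP; have /eqP := h t; rewrite p0 horner0 mulf_eq0 expf_eq0 (negPf E0) andbF.
Qed.

(* Cancelling common roots leaves a denominator none of whose roots is common to all numerators. *)
Lemma ratio_reduce (T : eqType) (S : seq T) (F : T -> C -> C) (D : {poly C}) (N : T -> {poly C}) :
  D != 0 -> cofin (fun t => forall i, i \in S -> D.[E t] * F i t = (N i).[E t]) ->
  exists D' N', [/\ D' != 0, cofin (fun t => forall i, i \in S -> D'.[E t] * F i t = (N' i).[E t]) &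
    forall T0, root D' T0 -> exists2 i, i \in S & ~~ root (N' i) T0].
Proof.
have [k] := ubnP (size D); elim: k D N => // k IH D N; rewrite ltnS => sD D0 cD.
have [[T0 [DT0 HN]]|H] := pselect (exists T0, root D T0 /\ forall i, i \in S -> root (N i) T0); last first.
  exists D, N; split=> // T0 DT0; apply: contrapT => H'; apply: H; exists T0; split=> // i iS.
  by apply: contraT => ne; case: H'; exists i.
have /factor_theorem [D1 D1E] := DT0.
have N1P i : exists q, i \in S -> N i = q * ('X - T0%:P).
  by case: (boolP (i \in S)) => iS; [have /factor_theorem [q qE] := HN i iS; exists q|exists 0].
have [N1 N1E] := choice N1P.
have D10 : D1 != 0 by apply: contraNneq D0 => e; rewrite D1E e mul0r.
apply: (IH D1 N1) => //.
  by move: sD; rewrite D1E size_Mmonic ?monicXsubC // size_XsubC addn2.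
have X0 : 'X - T0%:P != 0 :> {poly C} by rewrite polyXsubC_eq0.
apply: cofin_mono (cofin_and cD (ex_intro2 _ _ ('X - T0%:P) X0 (fun t => id))) => t [h ne] i iS.
have := h i iS; rewrite D1E (N1E i iS) !hornerM => e; apply: (mulIf ne); rewrite -e; ring.
Qed.

Lemma poly_no_root (D : {poly C}) : D != 0 -> (forall T, root D T -> T = 0) -> exists2 c, c != 0 &
  exists k, D = c *: 'X^k.
Proof.
move=> D0 H; have [k [q]] := multiplicity_XsubC D 0; rewrite D0 /= => q0 DE.
have /size_poly1P [c c0 qE] : size q == 1%N.
  apply: contraT => /closed_rootP [x qx]; have : root D x by rewrite DE rootM qx.
  by move/H => x0; rewrite x0 (negPf q0) in qx.
by exists c => //; exists k; rewrite DE qE subr0 mul_polyC.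
Qed.

(** Both integers are minus the order of F at T = 0. *)
Lemma laur_top (F : C -> C) (p p' : {poly C}) (e e' : int) : ~~ root p 0 -> ~~ root p' 0 ->
  cofin (fun t => E (t * e%:~R) * F t = p.[E t]) -> cofin (fun t => E (t * e'%:~R) * F t = p'.[E t]) ->
  e = e'.
Proof.
wlog le : e e' p p' / e <= e'.
  by move=> H p0 p0' h h'; case: (leP e e') => [le|/ltW le]; [exact: (H e e' p p')|apply/esym; exact: (H e' e p' p)].
move=> p0 p0' h h'; apply/eqP; rewrite eq_le le /=; rewrite leNgt; apply/negP => lt.
have [k kE] : exists k : nat, e' = e + k.+1%:Z by exists (`|e' - e|.-1)%N; move: lt; clear; lia.
have : p' = 'X^(k.+1) * p.
  apply: qexp_poly_eq; apply: cofin_mono (cofin_and h h') => t [h1 h2].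
  rewrite hornerM hornerXn -h1 -h2 kE rmorphD /= mulrDr (qexpD HE).
  have -> : E (t * k.+1%:~R) = E t ^+ k.+1 by rewrite -(qexpMn HE) mulrC.
  ring.
by move=> e1; case/negP: p0'; rewrite e1 /root hornerM hornerXn expr0n mul0r.
Qed.

End LaurentLines.

End GenericSets.
Import GenericSets.

(** * Uniqueness at good x, and coefficients as quotients of exponential sums in x *)

Module CramerSolution.

Section Coefficients.
Context {R : realType} {C : numClosedFieldType} {n : nat} {rc : {rmorphism R -> C}}.
Context {E : C -> C} (HE : qexponential E).
Context {Phi : {fset 'rV[R]_n}} (HPhi : reduced_irreducible_root_system Phi).
Context (m : 'rV[R]_n -> nat).
Context (m_refl : forall a b, a \in Phi -> b \in Phi -> m (a *m refl_mx b) = m a).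
Local Notation V := ('rV[R]_n).
Local Notation VC := ('rV[C]_n).
Local Notation cv := (cv rc).
Local Notation EE := (@EE C n E).
Local Notation bsum := (@bsum R C n rc E).
Local Notation csum := (@csum R C n rc E).
Local Notation O := (@short_roots R n Phi).
Local Notation Qv := (@Qv R n Phi).
Local Notation QI := (@QI R C n rc E Phi m).
Local Notation nonres := (@nonres R C n rc E Phi).
Local Notation yv := (@yv R C n rc E).
Local Notation rhoh := (@rhoh R n Phi m).
Local Notation HN := (@HN R n Phi m).
Local Notation regular := (@regular R n Phi).
Local Notation Eorb := (@Eorb R C n rc E Phi).
Local Notation Om := (@Om R n Phi m).
Local Notation Drel := (@Drel R C n rc E Phi m).
Local Notation gener := (@gener R C n rc E).
Local Notation laur := (@laur C E).
Implicit Types (x z w : VC) (a b h u v tau : V) (f g : VC -> C) (L : set V).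

(* Exponents of the functions that become Laurent polynomials in [E t] on lines directed by [Qv]. *)
Definition LQ v := forall eta, Qv eta -> exists k : int, 2 * dot v eta = k%:~R.

Lemma LQ0 : LQ 0.
Proof. by move=> eta _; exists 0; rewrite dot0l mulr0. Qed.

Lemma LQD u v : LQ u -> LQ v -> LQ (u + v).
Proof.
move=> Lu Lv eta Qe; have [k kE] := Lu eta Qe; have [l lE] := Lv eta Qe.
by exists (k + l); rewrite dotDl mulrDr kE lE intrD.
Qed.

Lemma LQ_half a (s : int) : a \in Phi -> LQ ((s%:~R / 2) *: a).
Proof.
move=> aP eta Qe; have [k kE] := Qv_int HPhi Qe aP; exists (s * k).
by rewrite dotZl dotC kE intrM; field.
Qed.

Lemma LQ_root a : a \in Phi -> LQ a.
Proof. by move=> aP; have := LQ_half 2 aP; rewrite divff ?scale1r // (pnatr_eq0 R 2). Qed.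

Lemma laur_line f x0 eta : bsum 0 LQ f -> Qv eta -> laur (fun t => f (x0 + t *: cv eta)).
Proof.
move=> [s [sL fE]] Qe; apply: (@laur_ext C E (fun t => \sum_(p <- s) p.1 * EE (0 + cv p.2) (x0 + t *: cv eta))).
  by move=> t; rewrite fE.
rewrite (eq_fun (fun t => big_seq _ _ _ _)); apply: laur_sum => p /sL /(_ eta Qe) [k kE].
apply: (@laur_ext C E (fun t => (p.1 * EE (cv p.2) x0) * E (t * k%:~R))).
  move=> t; rewrite add0r (EEDr HE) -mulrA; congr (_ * (_ * E _)).
  by rewrite dotZr dot_cv -(rmorph_int rc) -kE rmorphM rmorph_nat; ring.
by apply: laurM; [exact: laur_const|exact: laur_exp].
Qed.

(** By convexity v - rho_h + N lies in N, so v - rho_h is nonpositive in every direction, in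
    particular in its own, and vanishes. *)
Lemma span_vertex (T : seq V) h : (forall nu h', nu \in T -> dot nu h' <= HN h') -> T != [::] ->
  (forall nu a, nu \in T -> a \in Phi -> string_span m T a nu) -> regular h -> rhoh h \in T.
Proof.
case: T => // nu0 T0 TH _ str hr; set T := nu0 :: T0 in TH str *.
have [v vT vmax] := seq_argmax (fun nu => dot nu h) (mem_head nu0 T0 : nu0 \in T).
have H h' : dot (v - rhoh h) h' <= 0.
  have [nu nT le] := convexity HPhi m_refl h' hr vT vmax str.
  by have := le_trans le (TH nu h' nT); rewrite gerDr.
have := H (v - rhoh h) => le; have := dot_sq_ge0 (v - rhoh h).
by rewrite le_eqVlt ltNge le orbF eq_sym dot_sq_eq0 subr_eq0 => /eqP <-.
Qed.

Lemma QI_vertex x S c h : uniq S -> (forall nu h', nu \in S -> dot nu h' <= HN h') -> QI x S c ->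
  nonres x S -> (exists2 nu, nu \in S & c nu != 0) -> regular h -> c (rhoh h) != 0.
Proof.
move=> uS SH q nr [nu nuS cnu] hr.
have : rhoh h \in [seq nu <- S | c nu != 0].
  apply: span_vertex => //.
  - by move=> mu h'; rewrite mem_filter => /andP[_]; exact: SH.
  - by apply/eqP => e; have : nu \in [seq nu <- S | c nu != 0]; [rewrite mem_filter cnu|rewrite e].
  - exact: QI_string_span q nr.
by rewrite mem_filter => /andP[].
Qed.

Lemma bsum_det (k : nat) (L : set V) (B : VC -> 'M[C]_k) : L 0 -> (forall u v, L u -> L v -> L (u + v)) ->
  (forall i j, bsum 0 L (fun x => B x i j)) -> bsum 0 L (fun x => \det (B x)).
Proof.
move=> L0 LD H; apply: bsum_sum => s _; apply: bsumZ; exact: bsum_prod.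
Qed.

Section Cramer.
Context (h0 : V) (h0r : regular h0).
Context (S S9 : seq V) (uS : uniq S) (SP : forall nu, (nu \in S) <-> Om 1 h0 nu).
Context (uS9 : uniq S9) (S9P : forall nu, (nu \in S9) <-> Om 9 h0 nu).

(** Non-resonance serves for uniqueness of the normalised quasi-invariant sum, the separation of
    eigenvalues for its existence. *)
Definition good x := nonres x S /\
  forall mu nu, mu \in S9 -> nu \in S9 -> nu != mu -> Eorb (x + cv nu - cv mu) != Eorb x.

Let S_HN nu h' : nu \in S -> dot nu h' <= HN h'.
Proof. by move=> /SP [_ /(_ h')]; rewrite mul1r. Qed.

Lemma rhoh_S h : regular h -> rhoh h \in S.
Proof.
move=> hr; apply/SP; split=> [|h']; first exact: rhoh_Qv.
by rewrite mul1r; exact: (HN_ge_rhoh HPhi m_refl).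
Qed.

Lemma S_sub9 nu : nu \in S -> nu \in S9.
Proof.
move=> /SP [Qn hn]; apply/S9P; split=> // h'; apply: le_trans (hn h') _.
by have := HN_ge0 (Phi := Phi) m h'; lra.
Qed.

(** If the difference vanished identically, independence of characters would give q^{2(kappa, tau)}
    = 1 for all short tau; these pairings are integers, so kappa would be orthogonal to all short
    roots. *)
Lemma Eorb_generic (kappa : V) : Qv kappa -> kappa != 0 ->
  gener LQ (fun x => Eorb (x + cv kappa) != Eorb x).
Proof.
move=> Qk k0.
apply: (@gener_mono R C n rc E LQ (fun x => \sum_(tau <- O) (EE (cv kappa) (cv tau) - 1) * EE (cv tau) x != 0)).
  move=> x; apply: contraNneq => e; rewrite -[X in _ == X](subrr (Eorb x)) -{1}e -sumrB.
  by apply/eqP; apply: eq_bigr => tau _; rewrite (EEDl HE) (EEC _ x); ring.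
apply: gener_neq0.
  rewrite (eq_fun (fun x => big_seq _ _ _ _)); apply: bsum_sum => tau /short_rootP [tP _].
  have := @bsum_exp R C n rc E 0 LQ (EE (cv kappa) (cv tau) - 1) tau (LQ_root tP).
  by apply: bsum_ext => x; rewrite add0r.
apply: contrapT => H; case/negP: k0; apply/eqP; apply: (short_root_sep HPhi) => b bO.
have bP : b \in Phi by case/short_rootP: bO.
have := @EE_indep R C n rc E HE O (fun tau => EE (cv kappa) (cv tau) - 1) (fset_uniq _).
move=> /(_ _ b bO) e; have {e} /eqP : EE (cv kappa) (cv b) - 1 = 0.
  by apply: e => z; apply/eqP; apply: contraT => ne; case: H; exists z.
have [k kE] := Qv_int HPhi Qk bP.
rewrite subr_eq0 /ExponentialSums.EE dot_cv kE rmorph_int -[2]/(2%:~R) -intrM => /eqP /(qexp_nroot HE) /eqP.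
by rewrite mulf_eq0 /= => /eqP k0; rewrite dotC kE k0.
Qed.

Lemma good_generic : gener LQ good.
Proof.
apply: (gener_mono (P := fun x => nonres x S /\ forall mu nu, mu \in S9 -> nu \in S9 -> nu != mu ->
  Eorb (x + cv nu - cv mu) != Eorb x)); first by [].
apply: (gener_and HE LQD).
  apply: (@gener_mono R C n rc E LQ (fun x => forall a, a \in enum_fset Phi -> forall p, p \in allpairs pair S S ->
     EE (cv a) x != (E (rc (dot a p.1 + dot a p.2)))^-1)).
    move=> x H a nu nu' aP nS nS' _; apply/eqP => e.
    have /eqP := H a aP (nu, nu') (allpairs_f pair nS nS'); apply.
    apply: (mulIf (qexp_neq0 HE (rc (dot a nu + dot a nu')))).
    rewrite mulVf ?(qexp_neq0 HE) // -e /ExponentialSums.EE /StringConditions.yv -!(qexpD HE); congr E.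
    by rewrite !dotDr !dot_cv rmorphD; ring.
  apply: (gener_seq HE LQ0 LQD) => a aP; apply: (gener_seq HE LQ0 LQD) => p _.
  by apply: (gener_EE HE LQ0); [exact: (root_neq0 HPhi)|exact: LQ_root].
apply: (@gener_mono R C n rc E LQ (fun x => forall mu, mu \in S9 -> forall nu, nu \in [seq nu <- S9 | nu != mu] ->
   Eorb (x + cv (nu - mu)) != Eorb x)).
  move=> x H mu nu muS nuS ne; have := H mu muS nu; rewrite mem_filter ne => /(_ nuS).
  by rewrite cvB addrA.
apply: (gener_seq HE LQ0 LQD) => mu muS; apply: (gener_seq HE LQ0 LQD) => nu.
rewrite mem_filter => /andP[ne nuS]; apply: Eorb_generic; last by rewrite subr_eq0.
have [/S9P [Q1 _] /S9P [Q2 _]] := (muS, nuS).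
rewrite (_ : nu - mu = (nu - rhoh h0) + - (mu - rhoh h0)); last by rewrite opprB addrA subrK.
by apply: QvD => //; exact: QvN.
Qed.

Definition eigen x c := [/\ QI x S c, c (rhoh h0) = 1 &
  Drel (csum x S c) (fun z => (Eorb x - Eorb (- cv (rhoh h0))) * csum x S c z)].

Lemma good_eigen x : good x -> exists c, eigen x c.
Proof.
move=> [nr gn].
have [|c [q c1 D]] := @dual_eigen R C n rc E HE Phi HPhi m m_refl x h0 S S9 h0r uS SP uS9 S9P.
  move=> nu h nS hr ne; rewrite gn //; exact/S_sub9/rhoh_S.
exists c; split=> //; exact: QIf_QI.
Qed.

Lemma good_unique x c d : good x -> QI x S c -> QI x S d -> c (rhoh h0) = d (rhoh h0) ->
  {in S, c =1 d}.
Proof.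
move=> [nr _] qc qd e nu nS; apply/eqP; rewrite -subr_eq0; apply: contraT => ne.
have q : QI x S (fun nu => c nu - d nu).
  move=> a nu0 s aP sm; have := qc a nu0 s aP sm; have := qd a nu0 s aP sm => e2 e1.
  rewrite -[RHS](subrr 0) -[X in _ = X - _]e1 -[X in _ = _ - X]e2 -sumrB; apply: eq_bigr => mu _; ring.
have := @QI_vertex x S (fun nu => c nu - d nu) h0 uS S_HN q nr (ex_intro2 _ _ nu nS ne) h0r.
by rewrite e subrr eqxx.
Qed.

(* Equations of the string conditions together with the normalisation [c (rhoh h0) = 1] (row [None]). *)
Local Notation J := (option (Phi * 'I_(size S) * 'I_(\sum_(a <- Phi) m a).+1)%type).

Definition coef x (j : J) (nu : V) : C :=
  match j with
  | None => (nu == rhoh h0)%:R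
  | Some (a, i0, s) => if (0 < s <= m (val a))%N && `[< str (coroot (val a)) (nth 0 S i0) nu >]
      then yv (val a) x nu ^+ s - yv (val a) x nu ^- s else 0
  end.

Definition coefmx x : 'M[C]_(#|{: J}|, size S) := \matrix_(j, i) coef x (enum_val j) (nth 0 S i).

Definition eqrhs : 'cV[C]_(#|{: J}|) := \col_j (enum_val j == None)%:R.

Definition colS (c : V -> C) : 'cV[C]_(size S) := \col_i c (nth 0 S i).

Lemma sum_nthS (P : pred V) (F : V -> C) :
  \sum_(nu <- S | P nu) F nu = \sum_(i < size S | P (nth 0 S i)) F (nth 0 S i).
Proof. by rewrite (big_nth 0) big_mkord. Qed.

Lemma m_bound a : a \in Phi -> (m a <= \sum_(b <- Phi) m b)%N.
Proof. by move=> aP; rewrite (bigD1_seq a) ?fset_uniq //= leq_addr. Qed.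

Lemma coefmxP x c : coefmx x *m colS c = eqrhs <-> QI x S c /\ c (rhoh h0) = 1.
Proof.
have norm : \sum_(i < size S) (nth 0 S i == rhoh h0)%:R * c (nth 0 S i) = c (rhoh h0) :> C.
  rewrite -(sum_nthS predT (fun nu => (nu == rhoh h0)%:R * c nu)).
  rewrite (bigD1_seq (rhoh h0)) ?rhoh_S //= eqxx mul1r big1 ?addr0 // => nu /negPf ->.
  by rewrite mul0r.
split=> [e|[q c1]].
  split=> [a nu0 s aP sm|]; last first.
    have := congr1 (fun M : 'cV__ => M (enum_rank None) 0) e; rewrite !mxE enum_rankK eqxx -norm.
    by move=> e1; rewrite -[RHS]e1; apply: eq_bigr => i _; rewrite !mxE enum_rankK.
  have [->|[nu1 [nS st]]] : \sum_(nu <- S | `[< str (coroot a) nu0 nu >])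
        c nu * (yv a x nu ^+ s - yv a x nu ^- s) = 0 \/
      exists nu1, nu1 \in S /\ str (coroot a) nu0 nu1.
  - have [[nu1 H]|H] := pselect (exists nu1, nu1 \in S /\ str (coroot a) nu0 nu1); first by right; exists nu1.
    left; rewrite big_seq_cond big1 // => nu /andP[nS /asboolP st]; by case: H; exists nu.
  - by [].
  have i0P : (index nu1 S < size S)%N by rewrite index_mem.
  have sP : (s < (\sum_(b <- Phi) m b).+1)%N.
    by rewrite ltnS; apply: leq_trans (m_bound aP); case/andP: sm.
  pose j : J := Some ([` aP]%fset, Ordinal i0P, Ordinal sP).
  have := congr1 (fun M : 'cV__ => M (enum_rank j) 0) e; rewrite !mxE enum_rankK /= => e1.
  rewrite -[RHS]e1 sum_nthS big_mkcond; apply: eq_bigr => i _; rewrite !mxE enum_rankK /= sm /=.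
  rewrite nth_index //.
  have -> : `[< str (coroot a) nu1 (nth 0 S i) >] = `[< str (coroot a) nu0 (nth 0 S i) >].
    apply: asbool_equiv_eq; split=> h; first exact: str_trans st h.
    exact: str_trans (str_sym st) h.
  by case: ifP => _; rewrite ?mul0r // mulrC.
apply/matrixP => j z; rewrite !mxE ord1; case Ej: (enum_val j) => [[[a i0] s]|].
  transitivity (0 : C); last by [].
  case: (boolP (0 < s <= m (val a))%N) => sm; last first.
    by rewrite big1 // => i _; rewrite !mxE Ej /coef (negPf sm) mul0r.
  have := q (val a) (nth 0 S i0) s (valP a) sm => {2}<-.
  rewrite sum_nthS [RHS]big_mkcond; apply: eq_bigr => i _; rewrite !mxE Ej /coef sm /=.
  by case: ifP => _; rewrite ?mul0r // mulrC.
rewrite eqxx -c1 -norm; apply: eq_bigr => i _; by rewrite !mxE Ej.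
Qed.

Lemma coefmx_bsum i j : bsum 0 LQ (fun x => coefmx x i j).
Proof.
case Ei: (enum_val i) => [[[a i0] s]|]; last first.
  have := @bsum_const R C n rc E HE LQ ((nth 0 S j == rhoh h0)%:R) LQ0.
  by apply: bsum_ext => x; rewrite mxE Ei.
case C1: ((0 < s <= m (val a))%N && `[< str (coroot (val a)) (nth 0 S i0) (nth 0 S j) >]); last first.
  by have := @bsum_const R C n rc E HE LQ 0 LQ0; apply: bsum_ext => x; rewrite mxE Ei /coef C1.
have b1 (k : int) := @bsum_exp R C n rc E 0 LQ (E (k%:~R * dot (cv (val a)) (cv (nth 0 S j)))) _
  (LQ_half k (valP a)).
have := bsumB (b1 s) (b1 (- s%:Z)); apply: bsum_ext => x; rewrite mxE Ei /coef C1 !add0r.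
have e (k : int) : E (k%:~R * dot (cv (val a)) (cv (nth 0 S j))) * EE (cv ((k%:~R / 2) *: val a)) x =
    E (k%:~R * dot (cv (val a)) (x + cv (nth 0 S j))).
  rewrite /ExponentialSums.EE -(qexpD HE) cvZ dotZl dotDr fmorph_div rmorph_nat rmorph_int; congr E.
  by field.
rewrite !e rmorphN mulNr (qexpN HE) -[_%:~R]/(s%:R) (qexpMn HE) //.
Qed.

(** Existence and uniqueness at one good point give the linear system full column rank there. A
    square subsystem invertible at that point has a determinant that is not identically zero, and
    Cramer's rule applies wherever it is nonzero. *)
Lemma cramer : exists (Vf : V -> VC -> C) (Hf : VC -> C), [/\ forall nu, bsum 0 LQ (Vf nu), bsum 0 LQ Hf,
  exists x, Hf x != 0 & forall x c, Hf x != 0 -> QI x S c -> c (rhoh h0) = 1 ->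
    forall nu, nu \in S -> c nu = Vf nu x / Hf x].
Proof.
have [x1 g1] := gener_ex good_generic.
have fr : row_full (coefmx x1).
  suff : row_free (coefmx x1)^T by rewrite /row_free mxrank_tr.
  apply: inj_row_free => v vA; have [d [qd d1 _]] := good_eigen g1.
  pose c nu := if insub (index nu S) is Some i then v 0 i else 0.
  have cE : colS c = v^T.
    by apply/matrixP => i j; rewrite !mxE ord1 /c index_uniq // valK.
  have /coefmxP Ad := conj qd d1.
  have : coefmx x1 *m colS (fun nu => d nu + c nu) = eqrhs.
    have -> : colS (fun nu => d nu + c nu) = colS d + colS c by apply/matrixP => i j; rewrite !mxE.
    rewrite mulmxDr Ad cE -[coefmx x1 in X in _ + X]trmxK -trmx_mul vA trmx0 addr0 //.
  move/coefmxP => [q1 c1]; have dc := good_unique g1 q1 qd (etrans c1 (esym d1)).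
  apply/matrixP => i j; rewrite ord1 [RHS]mxE; have := congr1 (fun M : 'cV__ => M j 0) cE.
  rewrite !mxE => <-; have := dc (nth 0 S j) (mem_nth _ (ltn_ord j)).
  by rewrite -[RHS]addr0 => /addrI.
pose f := fullrankfun fr.
pose B x := rowsub f (coefmx x).
pose b := rowsub f eqrhs.
pose Vf nu x := if insub (index nu S) is Some i then (\adj (B x) *m b) i 0 else 0.
exists Vf, (fun x => \det (B x)).
have bB i j : bsum 0 LQ (fun x => B x i j).
  by have := coefmx_bsum (f i) j; apply: bsum_ext => x; rewrite !mxE.
split.
- move=> nu; rewrite /Vf; case: insub => [i|]; last exact: (@bsum_const R C n rc E HE LQ 0 LQ0).
  have e x : \sum_j cofactor (B x) j i * b j 0 = (\adj (B x) *m b) i 0.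
    by rewrite !mxE; apply: eq_bigr => j _; rewrite !mxE.
  apply: (bsum_ext e); apply: bsum_sum => j _.
  have := @bsum_det _ LQ (fun x => row' j (col' i (B x))) LQ0 LQD.
  move=> H; have H1 k l : bsum 0 LQ (fun x => row' j (col' i (B x)) k l).
    by have := bB (lift j k) (lift i l); apply: bsum_ext => x; rewrite !mxE.
  by have := bsumZ (b j 0 * (-1) ^+ (j + i)) (H H1); apply: bsum_ext => x; rewrite /cofactor; ring.
- exact: bsum_det LQ0 LQD bB.
- by exists x1; have := fullrowsub_unit fr; rewrite unitmxE unitfE.
move=> x c H0 q c1 nu nS; have /coefmxP e := conj q c1.
have Bu : B x \in unitmx by rewrite unitmxE unitfE.
have e1 : B x *m colS c = b by rewrite /B /b -e mul_rowsub_mx.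
have iS : (index nu S < size S)%N by rewrite index_mem.
rewrite /Vf insubT /=.
have := congr1 (fun M => \adj (B x) *m M) e1; rewrite mulmxA mul_adj_mx mul_scalar_mx.
move/(congr1 (fun M : 'cV__ => M (Ordinal iS) 0)); rewrite mxE [colS _ _ _]mxE /= nth_index // => <-.
by rewrite mulrC mulKf.
Qed.

End Cramer.

End Coefficients.

End CramerSolution.
Import CramerSolution.

(** * Coefficients at the vertices of N, and the points (1/2) sum m_a a *)

Module VertexCoefficients.

Section Vertices.
Context {R : realType} {C : numClosedFieldType} {n : nat} {rc : {rmorphism R -> C}}.
Context {E : C -> C} (HE : qexponential E).
Context {Phi : {fset 'rV[R]_n}} (HPhi : reduced_irreducible_root_system Phi).
Context (m : 'rV[R]_n -> nat).
Context (m_refl : forall a b, a \in Phi -> b \in Phi -> m (a *m refl_mx b) = m a).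
Local Notation V := ('rV[R]_n).
Local Notation VC := ('rV[C]_n).
Local Notation cv := (cv rc).
Local Notation EE := (@EE C n E).
Local Notation Gam := (@Gam R C n rc E).
Local Notation Qv := (@Qv R n Phi).
Local Notation QIf := (@QIf R C n rc E Phi m).
Local Notation QI := (@QI R C n rc E Phi m).
Local Notation yv := (@yv R C n rc E).
Local Notation rhoh := (@rhoh R n Phi m).
Local Notation regular := (@regular R n Phi).
Local Notation Om := (@Om R n Phi m).
Implicit Types (x z w : VC) (a b h u v tau : V) (f g : VC -> C) (L : set V).
Local Notation qn := (@qn C E).

Lemma qn_mul (A B : C) : qn ((A + B) / 2) * qn ((A - B) / 2) = E A + E (- A) - (E B + E (- B)).
Proof.
have e1 : E A = E ((A + B) / 2) * E ((A - B) / 2) by rewrite -(qexpD HE); congr E; field.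
have e2 : E B = E ((A + B) / 2) * E (- ((A - B) / 2)) by rewrite -(qexpD HE); congr E; field.
have e3 : E (- A) = E (- ((A + B) / 2)) * E (- ((A - B) / 2)) by rewrite -(qexpD HE); congr E; field.
have e4 : E (- B) = E (- ((A + B) / 2)) * E ((A - B) / 2) by rewrite -(qexpD HE); congr E; field.
by rewrite e1 e2 e3 e4 /qn; ring.
Qed.

Definition wprod (k : nat) (X : C) := \prod_(1 <= j < k.+1) qn (j%:R - X).

(** For the chamber that defines the positive roots this is the prescribed leading coefficient;
    [vertex_formula] finds it at the vertices of the other chambers too. *)
Definition ph h x := \prod_(b <- Phi | 0 < dot b h) wprod (m b) (dot (cv b) x).

Lemma wprod_shift (k : nat) X : \prod_(l < k) qn (X + (k - l)%:R) = wprod k (- X).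
Proof.
rewrite /wprod big_nat_rev /= big_add1 /= big_mkord; apply: eq_bigr => l _.
by rewrite opprK addrC; congr (qn (_%:R + _)); rewrite add1n subSS.
Qed.

Lemma sum_two (T : eqType) (J : seq T) (G : T -> C) j0 j1 : uniq J -> j0 \in J -> j1 \in J -> j1 != j0 ->
  (forall j, j \in J -> j != j0 -> j != j1 -> G j = 0) -> \sum_(j <- J) G j = G j0 + G j1.
Proof.
move=> uJ j0J j1J ne H; rewrite (bigD1_seq j0) //= -big_filter (bigD1_seq j1) ?filter_uniq ?mem_filter ?ne //=.
rewrite -[RHS]addr0 addrA; congr (_ + _); rewrite big_seq_cond big1 // => j.
by rewrite mem_filter => /andP[/andP[n0 jJ] n1]; exact: H.
Qed.

(* The symmetric-polynomial combination vanishing at the interior points of the edge keeps only its two end points. *)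
Lemma edge_ratio (T : eqType) (J : seq T) (P : pred T) (c : T -> C) (k : T -> nat) (M : nat) (X : C) j0 jM :
  uniq J -> j0 \in J -> jM \in J -> P j0 -> P jM -> k j0 = 0%N -> k jM = M ->
  (forall j, j \in J -> P j -> (k j <= M)%N) ->
  (forall j, j \in J -> P j -> k j = 0%N -> j = j0) -> (forall j, j \in J -> P j -> k j = M -> j = jM) ->
  (forall s, (1 <= s <= M)%N -> \sum_(j <- J | P j)
     c j * (E (X + M%:R - 2 * (k j)%:R) ^+ s - E (X + M%:R - 2 * (k j)%:R) ^- s) = 0) ->
  c j0 * wprod M (- X) = c jM * wprod M X.
Proof.
move=> uJ j0J jMJ Pj0 PjM k0 kM kle kz km H.
case: M => [|M] in kM kle km H *.
  by rewrite /wprod !big_geq // !mulr1; rewrite (kz jM) // kM.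
pose y j := E (X + M.+1%:R - 2 * (k j)%:R).
pose u (l : nat) : C := E (X + M.+1%:R - 2 * l%:R) + E (- (X + M.+1%:R - 2 * l%:R)).
(* The roots are the values y + 1/y of the interior exponents k = 1, ..., M of an edge with M + 1
   steps, so the degree M is just within reach of the M + 1 conditions. *)
pose p : {poly C} := \prod_(l < M) ('X - (u l.+1)%:P).
have sp : (size p <= M.+1)%N by rewrite size_prod_XsubC /index_enum -enumT size_enum_ord.
have y0 j : y j != 0 by exact: (qexp_neq0 HE).
have := @sym_sum_poly C T J P y c M.+1 y0 H p sp.
have pE (l : nat) : p.[u l] = \prod_(i < M) (u l - u i.+1).
  by rewrite horner_prod; apply: eq_bigr => i _; rewrite hornerXsubC.
have yE j : y j + (y j)^-1 = u (k j) by rewrite /u /y (qexpN HE).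
have j0M : jM != j0 by apply/eqP => e; move: kM; rewrite e k0.
rewrite big_mkcond (sum_two (j0 := j0) (j1 := jM)) //; last first.
  move=> j jJ n0 nM; case: ifP => // Pj; rewrite yE pE.
  have k1 : (0 < k j)%N by rewrite lt0n; apply: contra n0 => /eqP /(kz j jJ Pj) ->.
  have kM' : (k j < M.+1)%N by rewrite ltn_neqAle kle // andbT; apply: contra nM => /eqP /(km j jJ Pj) ->.
  have lP : ((k j).-1 < M)%N by rewrite -ltnS prednK.
  by rewrite (bigD1 (Ordinal lP)) //= prednK // subrr mul0r mulr0.
rewrite Pj0 PjM !yE !pE k0 kM /y k0 kM.
have um (l l' : nat) : u l - u l' = qn (X + M.+1%:R - l%:R - l'%:R) * qn (l'%:R - l%:R).
  by rewrite /u -qn_mul; congr (qn _ * qn _); field.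
pose Q := \prod_(l < M) qn l.+1%:R.
have Q0 : Q != 0.
  by rewrite prodf_seq_neq0; apply/allP => l _ /=; rewrite -[_%:R]/((l.+1%:Z)%:~R) (qn_int_neq0 HE).
have f0 : \prod_(i < M) (u 0%N - u i.+1) = \prod_(i < M) qn (X + (M.+1 - i.+1)%:R) * Q.
  rewrite -big_split; apply: eq_bigr => i _ /=; rewrite um !subr0 natrB; last exact: ltnW (ltn_ord i).
  by rewrite addrA.
have fM : \prod_(i < M) (u M.+1 - u i.+1) = \prod_(i < M) qn (i.+1%:R - X) * Q.
  have -> : Q = \prod_(i < M) qn (M.+1%:R - i.+1%:R).
    rewrite /Q (reindex_inj rev_ord_inj); apply: eq_bigr => i _ /=.
    by rewrite -subSn // natrB // ltnW // ltnS.
  rewrite -big_split; apply: eq_bigr => i _ /=; rewrite um.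
  have -> : qn (X + M.+1%:R - M.+1%:R - i.+1%:R) = - qn (i.+1%:R - X) by rewrite -qnN; congr qn; ring.
  have -> : qn (i.+1%:R - M.+1%:R) = - qn (M.+1%:R - i.+1%:R) by rewrite -qnN; congr qn; ring.
  by rewrite mulrNN.
rewrite f0 fM => e.
rewrite -wprod_shift big_ord_recl /= subn0.
have -> : \prod_(i < M) qn (X + (M.+1 - bump 0 i)%:R) = \prod_(i < M) qn (X + (M.+1 - i.+1)%:R).
  by apply: eq_bigr => i _; rewrite /bump add1n.
have -> : wprod M.+1 X = \prod_(i < M) qn (i.+1%:R - X) * qn (M.+1%:R - X).
  by rewrite /wprod big_add1 /= big_mkord big_ord_recr.
apply: (mulIf Q0); apply/eqP; rewrite -subr_eq0; apply/eqP; rewrite -[RHS]e.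
have -> : E (X + M.+1%:R - 2 * 0%:R) - (E (X + M.+1%:R - 2 * 0%:R))^-1 = qn (X + M.+1%:R).
  by rewrite mulr0 subr0 /ExponentialSums.qn (qexpN HE).
have -> : E (X + M.+1%:R - 2 * M.+1%:R) - (E (X + M.+1%:R - 2 * M.+1%:R))^-1 = - qn (M.+1%:R - X).
  by rewrite -(qexpN HE) -qnN /ExponentialSums.qn; congr (E _ - E _); ring.
ring.
Qed.

Local Notation wall := (@wall R n Phi).

(** On the string through rho_h along a^vee, the support function of N in the directions h and its
    reflection leaves only the m_a + 1 points between the two vertices: the string is an edge of N,
    and [edge_ratio] applies. *)
Lemma edge_vertices x S h0 c a h : uniq S -> (forall nu, (nu \in S) <-> Om 1 h0 nu) -> regular h0 ->
  QI x S c -> wall a h ->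
  c (rhoh h) * wprod (m a) (- dot (cv a) x) = c (rhoh (h *m refl_mx a)) * wprod (m a) (dot (cv a) x).
Proof.
move=> uS SP h0r q w; have [aP hr ah _] := w; have a0 := root_neq0 HPhi aP.
have ca0 := coroot_neq0 a0.
have h'r : regular (h *m refl_mx a) by exact: (regular_refl HPhi).
have rS : rhoh h \in S by apply: (rhoh_S HPhi m_refl h0r SP).
have r'S : rhoh (h *m refl_mx a) \in S by apply: (rhoh_S HPhi m_refl h0r SP).
have r'E := wall_refl HPhi m_refl w.
have cah : 0 < dot (coroot a) h by rewrite coroot_gt0.
have cah' : dot (coroot a) (h *m refl_mx a) < 0.
  by rewrite -(refl_dot _ _ a0) -(coroot_refl _ a0) (refl_self a0) corootN dotNl oppr_lt0.
have /choice [k kP] : forall nu, exists k : nat, nu \in S -> str (coroot a) (rhoh h) nu ->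
    nu = rhoh h - k%:R *: coroot a /\ (k <= m a)%N.
  move=> nu; have [[nS [kz kzE]]|H] := pselect (nu \in S /\ str (coroot a) (rhoh h) nu); last first.
    by exists 0%N => nS st; case: H.
  have /SP [_ H] := nS.
  have kz0 : kz <= 0.
    have := H h; rewrite mul1r (HN_rhoh HPhi m_refl hr) kzE dotDl gerDl dot_scoroot.
    by rewrite pmulr_lle0 // lerz0.
  have kzm : 0 <= (m a)%:Z + kz.
    have := H (h *m refl_mx a); rewrite mul1r (HN_rhoh HPhi m_refl h'r) r'E kzE.
    rewrite dotDl dotBl lerD2l !dot_scoroot -mulNr -subr_le0 -mulrBl opprK nmulr_lle0 //.
    by rewrite -[(m a)%:R]/((m a)%:Z%:~R) -intrD ler0z addrC.
  exists `|kz|%N => _ _; split; last by move: kz0 kzm; clear; lia.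
  rewrite kzE; congr (_ + _); rewrite -scaleNr; congr (_ *: _).
  by rewrite -[X in - X]/((`|kz|%N)%:Z%:~R) -rmorphN /=; congr (_%:~R); move: kz0; clear; lia.
have kr : k (rhoh h) = 0%N.
  have [e _] := kP _ rS (str_refl _ _); apply/eqP; move/eqP: e; rewrite -subr_eq0 opprB addrC subrK.
  by rewrite scaler_eq0 (negPf ca0) orbF pnatr_eq0.
have st' : str (coroot a) (rhoh h) (rhoh (h *m refl_mx a)).
  by exists (- (m a)%:Z); rewrite r'E rmorphN scaleNr.
have kr' : k (rhoh (h *m refl_mx a)) = m a.
  have [e _] := kP _ r'S st'; move: e; rewrite r'E => /addrI /oppr_inj /eqP.
  by rewrite -subr_eq0 -scalerBl scaler_eq0 (negPf ca0) orbF subr_eq0 eqr_nat => /eqP.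
apply: (edge_ratio (J := S) (P := fun nu => `[< str (coroot a) (rhoh h) nu >]) (k := k)) => //.
- by apply/asboolP; exact: str_refl.
- exact/asboolP.
- by move=> nu nS /asboolP st; case: (kP nu nS st).
- by move=> nu nS /asboolP st k0; have [-> _] := kP nu nS st; rewrite k0 scale0r subr0.
- by move=> nu nS /asboolP st km; have [-> _] := kP nu nS st; rewrite km r'E.
move=> s sm; rewrite -[RHS](q a (rhoh h) s aP sm) big_seq_cond [RHS]big_seq_cond.
apply: eq_bigr => nu /andP[nS /asboolP st]; have [nE _] := kP nu nS st.
have -> : yv a x nu = E (dot (cv a) x + (m a)%:R - 2 * (k nu)%:R) by
  rewrite /StringConditions.yv; congr E; rewrite {1}nE dotDr cvB dotBr dot_cv (dotC a) (wall_rhoh HPhi m_refl w) rmorph_nat cvZ dotZr dot_cv (dotC a) (coroot_self a0) !rmorph_nat; ring.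
by [].
Qed.

Lemma ph_ext h h' x : (forall a, a \in Phi -> (0 < dot a h) = (0 < dot a h')) -> ph h x = ph h' x.
Proof.
move=> e; rewrite /ph big_seq_cond [RHS]big_seq_cond; apply: eq_bigl => a.
by case: (boolP (a \in Phi)) => //= /e ->.
Qed.

Lemma ph_wall a h x : wall a h ->
  ph h x * wprod (m a) (- dot (cv a) x) = ph (h *m refl_mx a) x * wprod (m a) (dot (cv a) x).
Proof.
move=> w; have [aP hr ah _] := w; have a0 := root_neq0 HPhi aP.
have NaP : - a \in Phi by rewrite (rootN HPhi).
have nah : 0 < dot (- a) (h *m refl_mx a).
  by rewrite -(refl_dot _ _ a0) reflN (refl_self a0) opprK.
rewrite /ph (big_rootD1 _ _ aP ah) (big_rootD1 _ _ NaP nah) /= (m_opp HPhi m_refl aP) cvN dotNl.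
rewrite mulrAC [RHS]mulrAC [X in _ = X * _]mulrC; congr (_ * _).
rewrite big_seq_cond [RHS]big_seq_cond; apply: eq_bigl => b; case: (boolP (b \in Phi)) => //= bP.
have [->|ba] := eqVneq b a.
  have -> : (0 < dot a (h *m refl_mx a)) = false.
    by rewrite -(refl_dot _ _ a0) (refl_self a0) dotNl oppr_gt0 ltNge ltW.
  by rewrite andbF.
have [->|bNa] := eqVneq b (- a); first by rewrite dotNl oppr_gt0 ltNge ltW.
by rewrite (wall_sign HPhi w bP ba bNa).
Qed.

(** The ratios in [edge_vertices] and [ph_wall] agree across each wall, and every chamber is reached
    from that of [h0] by crossing walls. *)
Lemma vertex_formula x S h0 c h : uniq S -> (forall nu, (nu \in S) <-> Om 1 h0 nu) -> regular h0 ->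
  QI x S c -> (forall a, a \in Phi -> wprod (m a) (dot (cv a) x) != 0) -> regular h ->
  c (rhoh h) * ph h0 x = c (rhoh h0) * ph h x.
Proof.
move=> uS SP h0r q nz; have [k] := ubnP (size (@inversions R n Phi h0 h)); elim: k h => // k IH h; rewrite ltnS => sk hr.
have [i0|i0] := eqVneq (@inversions R n Phi h0 h) [::].
  have e := inversions0 HPhi h0r hr i0.
  by rewrite -(rhoh_ext m e) (ph_ext x e).
have [h2 [a [hs w ah0 lt]]] := last_wall HPhi h0r hr i0.
have [aP h2r ah _] := w.
have NaP : - a \in Phi by rewrite (rootN HPhi).
rewrite (rhoh_ext m hs) (ph_ext x hs).
have := IH (h2 *m refl_mx a) (leq_trans lt sk) (regular_refl HPhi aP h2r).
have e1 := edge_vertices uS SP h0r q w; have e2 := ph_wall x w.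
have n1 := nz a aP; have := nz _ NaP; rewrite (m_opp HPhi m_refl aP) cvN dotNl => n2 e3.
apply: (mulIf n2); rewrite mulrAC e1 mulrAC e3 -mulrA -e2; ring.
Qed.

(** Built from roots where [rhoh] uses coroots, because it is a point of the z-space and not an
    exponent: psi takes the same value at all these points. *)
Definition rhor h : V := 2^-1 *: \sum_(a <- Phi | 0 < dot a h) (m a)%:R *: a.

Lemma rhor_ext h h' : (forall a, a \in Phi -> (0 < dot a h) = (0 < dot a h')) -> rhor h = rhor h'.
Proof.
move=> e; rewrite /rhor; congr (_ *: _); rewrite big_seq_cond [RHS]big_seq_cond; apply: eq_bigl => a.
by case: (boolP (a \in Phi)) => //= /e ->.
Qed.

Lemma rhor_refl a h : a \in Phi -> rhor (h *m refl_mx a) = rhor h *m refl_mx a.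
Proof.
move=> aP; have a0 := root_neq0 HPhi aP; rewrite /rhor -scalemxAl mulmx_suml; congr (_ *: _).
rewrite (big_root_refl HPhi _ _ _ aP) big_seq_cond [RHS]big_seq_cond.
apply: eq_big => [b|b /andP[bP _]]; last by rewrite m_refl // scalemxAl.
by rewrite -(refl_dot _ _ a0) reflK.
Qed.

Lemma rhor_split h h' : regular h -> regular h' -> rhor h' =
  2^-1 *: \sum_(b <- Phi | 0 < dot b h) (if 0 < dot b h' then (m b)%:R *: b else - ((m b)%:R *: b)).
Proof.
move=> hr h'r; rewrite /rhor big_mkcond (big_root_split HPhi _ _ hr); congr (_ *: _).
rewrite big_seq_cond [RHS]big_seq_cond; apply: eq_bigr => b /andP[bP _] /=.
rewrite (m_opp HPhi m_refl bP) dotNl oppr_gt0 scalerN.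
by have := h'r b bP; case: (ltrgt0P (dot b h')) => //= _ _; rewrite ?addr0 ?add0r.
Qed.

Lemma rhor_max h h' : regular h -> regular h' -> dot (rhor h') h <= dot (rhor h) h.
Proof.
move=> hr h'r; rewrite (rhor_split hr h'r) /rhor !dotZl ler_wpM2l ?invr_ge0 // !dot_suml.
apply: ler_sum => b bh; case: ifP => // _; rewrite dotNl dotZl.
apply: (@le_trans _ _ 0); last by rewrite mulr_ge0 // ltW.
by rewrite oppr_le0 mulr_ge0 // ltW.
Qed.

Lemma rhor_dominant a h : a \in Phi -> regular h -> 0 < dot a h -> 0 <= dot (coroot a) (rhor h).
Proof.
move=> aP hr ah; have := rhor_max hr (regular_refl HPhi aP hr).
by rewrite rhor_refl // reflE dotBl gerBl dotZl (pmulr_lge0 _ ah) dotC.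
Qed.

Lemma rhor_wall a h : wall a h -> dot (coroot a) (rhor h) = (m a)%:R.
Proof.
move=> w; have [aP hr ah _] := w; have a0 := root_neq0 HPhi aP.
have NaP : - a \in Phi by rewrite (rootN HPhi).
have nah : 0 < dot (- a) (h *m refl_mx a).
  by rewrite -(refl_dot _ _ a0) reflN (refl_self a0) opprK.
have e : rhor (h *m refl_mx a) = rhor h - (m a)%:R *: a.
  rewrite /rhor (big_rootD1 _ _ aP ah) (big_rootD1 _ _ NaP nah) /= (m_opp HPhi m_refl aP).
  rewrite !scalerDr scalerN -[in RHS]addrAC scalerN; congr (_ + _).
    by rewrite scalerA -scalerBl -scaleNr; congr (_ *: _); field.
  congr (_ *: _); rewrite big_seq_cond [RHS]big_seq_cond; apply: eq_bigl => b; case: (boolP (b \in Phi)) => //= bP.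
  have [->|ba] := eqVneq b a.
    have -> : (0 < dot a (h *m refl_mx a)) = false.
      by rewrite -(refl_dot _ _ a0) (refl_self a0) dotNl oppr_gt0 ltNge ltW.
    by rewrite andbF.
  have [->|bNa] := eqVneq b (- a); first by rewrite ?eqxx /= dotNl oppr_gt0 ltNge ltW.
  by rewrite (wall_sign HPhi w bP ba bNa).
move: e; rewrite rhor_refl // reflE => /addrI /oppr_inj /eqP.
rewrite -subr_eq0 -scalerBl scaler_eq0 (negPf a0) orbF subr_eq0 dotC => /eqP //.
Qed.

(** The two points are z0 + (m_a/2) a and z0 - (m_a/2) a with z0 on [Gam (coroot a)], so the
    condition s = m_a applies. *)
Lemma QIf_rhor_wall f a h : QIf f -> wall a h -> f (cv (rhor h)) = f (cv (rhor (h *m refl_mx a))).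
Proof.
move=> q w; have [aP hr ah _] := w; have a0 := root_neq0 HPhi aP.
rewrite rhor_refl // reflE dotC (rhor_wall w).
have [m0|m0] := posnP (m a); first by rewrite m0 scale0r subr0.
have cE : cv ((m a)%:R *: a) = ((m a)%:R / 2) *: cv a + ((m a)%:R / 2) *: cv a.
  by rewrite -scalerDl cvZ rmorph_nat; congr (_ *: _); field.
have := q a (m a) (cv (rhor h) - ((m a)%:R / 2) *: cv a) aP; rewrite m0 leqnn => /(_ isT).
rewrite subrK cvB cE opprD addrA; apply.
rewrite /ExponentialSums.Gam /ExponentialSums.EE dotBr dotZr !dot_cv (rhor_wall w) (coroot_self a0) !rmorph_nat.
by rewrite (_ : _ * _ = 0) ?(qexp0 HE) //; field.
Qed.

Lemma QIf_rhor f h0 h : QIf f -> regular h0 -> regular h -> f (cv (rhor h)) = f (cv (rhor h0)).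
Proof.
move=> q h0r; have [k] := ubnP (size (@inversions R n Phi h0 h)); elim: k h => // k IH h; rewrite ltnS => sk hr.
have [i0|i0] := eqVneq (@inversions R n Phi h0 h) [::].
  by rewrite -(rhor_ext (inversions0 HPhi h0r hr i0)).
have [h2 [a [hs w ah0 lt]]] := last_wall HPhi h0r hr i0; have [aP h2r ah _] := w.
by rewrite (rhor_ext hs) (QIf_rhor_wall q w) IH //; [exact: leq_trans lt sk|exact: regular_refl].
Qed.

Lemma rhor_int eta h : Qv eta -> exists k : int, 2 * dot (rhor h) eta = k%:~R.
Proof.
move=> Qe; rewrite /rhor dotZl mulrA divff ?pnatr_eq0 // mul1r dot_suml big_seq_cond.
apply: (big_ind (fun t : R => exists k : int, t = k%:~R)).
- by exists 0.
- by move=> _ _ [k ->] [l ->]; exists (k + l); rewrite intrD.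
move=> a /andP[aP _]; have [k kE] := Qv_int HPhi Qe aP.
by exists ((m a)%:Z * k); rewrite dotZl dotC kE intrM.
Qed.

End Vertices.

End VertexCoefficients.
Import VertexCoefficients.

(** * The dual spectrum on the resonance hyperplanes *)

Module WallGenericity.

Section WallGeneric.
Context {R : realType} {C : numClosedFieldType} {n : nat} {rc : {rmorphism R -> C}}.
Context {E : C -> C} (HE : qexponential E).
Context {Phi : {fset 'rV[R]_n}} (HPhi : reduced_irreducible_root_system Phi).
Context (m : 'rV[R]_n -> nat).
Context (m_refl : forall a b, a \in Phi -> b \in Phi -> m (a *m refl_mx b) = m a).
Local Notation V := ('rV[R]_n).
Local Notation VC := ('rV[C]_n).
Local Notation cv := (cv rc).
Local Notation EE := (@EE C n E).
Local Notation bsum := (@bsum R C n rc E).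
Local Notation O := (@short_roots R n Phi).
Local Notation Qv := (@Qv R n Phi).
Local Notation regular := (@regular R n Phi).
Local Notation Eorb := (@Eorb R C n rc E Phi).
Local Notation gener := (@gener R C n rc E).
Implicit Types (x z w : VC) (a b h u v tau : V) (f g : VC -> C) (L : set V).

Lemma short_length a b : a \in O -> b \in O -> dot a a = dot b b.
Proof.
move=> aO bO; have [[aP amin] [bP bmin]] := (short_rootP _ aO, short_rootP _ bO).
by apply/eqP; rewrite eq_le amin // bmin.
Qed.

(** All short roots have the same length, so a line parallel to a meets them in at most tau and its
    reflection. *)
Lemma short_class a tau sigma (r : R) : a \in Phi -> tau \in O -> sigma \in O -> sigma = tau + r *: a ->
  sigma = tau \/ sigma = tau *m refl_mx a.
Proof.
move=> aP tO sO e; have a0 := root_neq0 HPhi aP.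
have aa : dot a a != 0 by rewrite dot_sq_eq0.
have := short_length sO tO; rewrite e !dotDl !dotDr !dotZl !dotZr (dotC a tau) => h.
have : r * (r * dot a a + 2 * dot tau a) = 0 by move: h; lra.
move/eqP; rewrite mulf_eq0 => /orP[/eqP ->|h2]; first by left; rewrite scale0r addr0.
right; rewrite reflE dotC coroot_dot (dotC a) -scaleNr; congr (_ + _ *: _).
apply: (mulIf aa); rewrite mulNr mulrAC divfK // (dotC a tau); move/eqP: h2; lra.
Qed.

Lemma unit_pair (u S S' : C) : u != 0 -> S != 0 -> S' != 0 -> u ^+ 2 != -1 ->
  u * (S - 1) + u^-1 * (S' - 1) = 0 -> u^-1 * (S^-1 - 1) + u * (S'^-1 - 1) = 0 ->
  (S = 1 /\ S' = 1) \/ (S = u ^- 2 /\ S' = u ^+ 2).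
Proof.
move=> u0 S0 S0' u1 e1 e2.
have f1 : u ^+ 2 * (S - 1) + (S' - 1) = 0.
  by transitivity (u * (u * (S - 1) + u^-1 * (S' - 1))); [field|rewrite e1 mulr0].
have f2 : S' * (1 - S) + u ^+ 2 * S * (1 - S') = 0.
  transitivity (u * S * S' * (u^-1 * (S^-1 - 1) + u * (S'^-1 - 1))); last by rewrite e2 mulr0.
  by field; rewrite S0 u0 S0'.
have SE : S' = 1 - u ^+ 2 * (S - 1) by move/eqP: f1; rewrite addrC addr_eq0 subr_eq addrC => /eqP.
have : (S - 1) * (u ^+ 2 + 1) * (u ^+ 2 * S - 1) = 0.
  by rewrite -[RHS]f2 SE; ring.
move/eqP; rewrite !mulf_eq0 [u ^+ 2 + 1 == 0]addr_eq0 (negPf u1) orbF !subr_eq0 => /orP[/eqP S1|/eqP S1].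
  by left; split=> //; rewrite SE S1 subrr mulr0 subr0.
right; split.
  by apply: (mulfI (expf_neq0 2 u0)); rewrite S1 divff // expf_neq0.
by rewrite SE mulrBr S1 mulr1; ring.
Qed.

(** On the hyperplane the characters of the short roots depend, up to constants, only on the
    projections orthogonal to a, so independence yields one equation for each pair of tau and its
    reflection. Together with the equation for -tau it leaves the two solutions of [unit_pair],
    which correspond to kappa = 0 and kappa = c a^vee. *)
Lemma wall_generic a (c k : int) (per : C) kappa : (forall j : int, E (j%:~R * per) = 1) -> a \in Phi -> Qv kappa ->
  (forall x1, dot (cv a) x1 = k%:~R * per / 2 - c%:~R -> Eorb (x1 + cv kappa) = Eorb x1) ->
  kappa = 0 \/ kappa = c%:~R *: coroot a.
Proof.
move=> perE aP Qk H; have a0 := root_neq0 HPhi aP.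
have aa : dot a a != 0 by rewrite dot_sq_eq0.
have aaC : rc (dot a a) != 0 by rewrite fmorph_eq0.
set th := k%:~R * per / 2 - c%:~R in H.
pose w0 : VC := (th / 2) *: cv (coroot a).
have aw0 : dot (cv a) w0 = th.
  by rewrite dotZr dot_cv dotC (coroot_self a0) rmorph_nat divfK // pnatr_eq0.
pose pr tau : V := tau - (dot tau a / dot a a) *: a.
pose d tau := EE w0 (cv tau) * (EE (cv kappa) (cv tau) - 1).
have sum0 z : \sum_(tau <- O) d tau * EE (cv (pr tau)) z = 0.
  pose y := z - (dot (cv a) z / rc (dot a a)) *: cv a.
  have ay : dot (cv a) y = 0 by rewrite dotBr dotZr dot_cv divfK // subrr.
  have Ey tau : EE y (cv tau) = EE (cv (pr tau)) z.
    rewrite /ExponentialSums.EE; congr (E (2 * _)); rewrite /y /pr dotBl dotZl cvB dotBl cvZ dotZl dot_cv dotC (dotC (cv a) z).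
    by rewrite fmorph_div (dotC a tau); congr (_ - _); field.
  have := H (y + w0); rewrite dotDr ay add0r aw0 => /(_ erefl) /eqP.
  rewrite -subr_eq0 -sumrB => /eqP e; rewrite -[RHS]e; apply: eq_bigr => tau _.
  by rewrite -Ey !(EEDl HE) /d; ring.
have pair tau : tau \in O -> d tau + d (tau *m refl_mx a) = 0.
  move=> tO; pose S0 := undup [seq pr sigma | sigma <- O].
  have tS : pr tau \in S0 by rewrite mem_undup map_f.
  have key : \sum_(sigma <- O | pr sigma == pr tau) d sigma = 0.
    have := @EE_indep R C n rc E HE S0 (fun u => \sum_(sigma <- O | pr sigma == u) d sigma) (undup_uniq _).
    move=> /(_ _ _ tS) h; apply: h => z; rewrite -[RHS](sum0 z).
    under eq_bigr => u _ do rewrite big_mkcond mulr_suml.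
    rewrite exchange_big /=; apply: eq_big_seq => sigma sO.
    rewrite (bigD1_seq (pr sigma)) ?undup_uniq ?mem_undup ?map_f //= eqxx big1 ?addr0 // => u /negPf.
    by rewrite eq_sym => ->; rewrite mul0r.
  have raO : tau *m refl_mx a \in O by rewrite (short_root_refl HPhi).
  have cls sigma : sigma \in O -> (pr sigma == pr tau) = (sigma == tau) || (sigma == tau *m refl_mx a).
    move=> sO; apply/eqP/orP => [e|[/eqP -> //|/eqP ->]].
      have : sigma = tau + ((dot sigma a / dot a a) - (dot tau a / dot a a)) *: a.
        by rewrite scalerBl addrCA -/(pr tau) -e addrC subrK.
      by case/(short_class aP tO sO) => ->; [left|right].
    rewrite /pr reflE' dotBl (dotZl (dot tau a)) (coroot_self a0) /coroot scalerA mulrBl scalerBl opprB addrA.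
    by rewrite mulrA subrK.
  move: key; rewrite big_mkcond big_seq (eq_bigr (fun sigma => if (sigma == tau) || (sigma == tau *m refl_mx a) then d sigma else 0)); last first.
    by move=> sigma sO; rewrite cls.
  rewrite -big_seq; have [e|ne] := eqVneq (tau *m refl_mx a) tau.
    rewrite (bigD1_seq tau) ?fset_uniq //= eqxx /= big1 ?addr0.
      by rewrite e => ->; rewrite addr0.
    by move=> sigma /negPf ns; rewrite e ns.
  rewrite (sum_two (j0 := tau) (j1 := tau *m refl_mx a)) ?fset_uniq //; last first.
    by move=> sigma _ /negPf -> /negPf ->.
  by rewrite !eqxx orbT.
have cases tau : tau \in O -> (dot tau kappa = 0 /\ dot (coroot a) tau * dot a kappa = 0) \/
   (dot tau kappa = c%:~R * dot (coroot a) tau /\ dot (coroot a) tau * dot a kappa = 2 * c%:~R * dot (coroot a) tau).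
  move=> tO; have tP : tau \in Phi by case/short_rootP: tO.
  have rP : tau *m refl_mx a \in Phi by rewrite (root_refl HPhi).
  have [j jE] := root_int HPhi aP tP.
  have NtO : - tau \in O by rewrite (short_rootN HPhi).
  pose u := E (th * j%:~R); pose S := EE (cv kappa) (cv tau); pose S' := EE (cv kappa) (cv (tau *m refl_mx a)).
  have wE : EE w0 (cv tau) = u.
    by rewrite /ExponentialSums.EE dotZl dot_cv jE rmorph_int; congr E; field.
  have rj : dot (coroot a) (tau *m refl_mx a) = - j%:~R.
    by rewrite -(refl_dot _ _ a0) -(coroot_refl _ a0) (refl_self a0) corootN dotNl jE.
  have wE' : EE w0 (cv (tau *m refl_mx a)) = u^-1.
    by rewrite /ExponentialSums.EE dotZl dot_cv rj rmorphN rmorph_int -(qexpN HE); congr E; field.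
  have u2 : u ^+ 2 = E (- (2 * c * j)%:~R).
    transitivity (E ((k * j)%:~R * per) * E (- (2 * c * j)%:~R)); last by rewrite perE mul1r.
    by rewrite -E2k // /th -(qexpD HE); congr E; rewrite !intrM; field.
  have := pair _ tO; have := pair _ NtO; rewrite /d reflN !cvN !(EENr HE) wE wE' -!/S -!/S' invrK => e2 e1.
  have n1 : u ^+ 2 != -1.
    apply/eqP => e; have : E (- (2 * c * j)%:~R) ^+ 2 = 1 by rewrite -u2 e sqrrN expr1n.
    rewrite -E2k // -rmorphN -[2]/(2%:~R) -intrM => /(qexp_nroot HE) /eqP; rewrite mulf_eq0 /= => /eqP c0.
    have := u2; rewrite e -rmorphN /= c0 (qexp0 HE) => /eqP; rewrite eq_sym -addr_eq0 -mulr2n pnatr_eq0 //.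
  have [kt ktE] := Qv_int HPhi Qk tP; have [kr krE] := Qv_int HPhi Qk rP.
  have [ka kaE] := Qv_int HPhi Qk aP.
  have SE : S = E (2 * kt)%:~R by rewrite /S /ExponentialSums.EE dot_cv ktE rmorph_int intrM.
  have SE' : S' = E (2 * kr)%:~R by rewrite /S' /ExponentialSums.EE dot_cv krE rmorph_int intrM.
  have krE' : kr = kt - j * ka.
    apply: (@intr_inj R); rewrite intrB intrM -krE -ktE -kaE -jE reflE' dotBr dotZr.
    by rewrite /coroot dotZr dotZl (dotC kappa a) (dotC tau a); ring.
  have inj (z : int) : E z%:~R = 1 -> z = 0 by exact: (qexp_nroot HE).
  have [] := unit_pair (qexp_neq0 HE _) (EE_neq0 HE _ _) (EE_neq0 HE _ _) n1 e1 e2; rewrite -/S -/S' SE SE'.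
    move=> -[/inj s1 /inj s2].
    have kt0 : kt = 0 by move: s1; clear; lia.
    have kr0 : kr = 0 by move: s2; clear; lia.
    left; rewrite (dotC tau) ktE kt0 jE (dotC a) kaE -intrM; split=> //.
    have -> : j * ka = 0 by move: krE'; rewrite kt0 kr0; clear; lia.
    by [].
  rewrite u2 => -[s1 s2].
  have f1 : 2 * kt = 2 * c * j.
    apply/eqP; rewrite -subr_eq0; apply/eqP/inj; rewrite intrB (qexpB HE) s1 (qexpN HE) invrK divff //.
    exact: (qexp_neq0 HE).
  have f2 : 2 * kr = - (2 * c * j).
    apply/eqP; rewrite -subr_eq0; apply/eqP/inj; rewrite intrB (qexpB HE) s2 rmorphN divff //.
    exact: (qexp_neq0 HE).
  right; rewrite (dotC tau) ktE jE (dotC a) kaE -!intrM -[2]/(2%:~R) -!intrM; split; congr (_%:~R).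
    by move: f1; clear; lia.
  by move: f1 f2 krE'; clear; nia.
(* The alternative in [cases] is made uniform in tau by asking whether (a, kappa) vanishes. *)
have [ak|ak] := eqVneq (dot a kappa) 0.
  left; apply: (short_root_sep HPhi) => tau tO; have [[-> _] //|[-> e]] := cases tau tO.
  have : c%:~R * dot (coroot a) tau = 0 by move: e; rewrite ak; lra.
  by [].
right; apply/eqP; rewrite -subr_eq0; apply/eqP; apply: (short_root_sep HPhi) => tau tO.
rewrite dotBr dotZr (dotC tau (coroot a)).
have [[-> /eqP]|[-> _]] := cases tau tO; last by rewrite subrr.
by rewrite mulf_eq0 (negPf ak) orbF => /eqP ->; rewrite mulr0 subr0.
Qed.

Lemma Eorb_per (per : C) (l : int) eta y : (forall j : int, E (j%:~R * per) = 1) -> Qv eta ->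
  Eorb (y + (l%:~R * per / 2) *: cv eta) = Eorb y.
Proof.
move=> perE Qe; apply: eq_big_seq => tau /short_rootP [tP _].
have [j jE] := Qv_int HPhi Qe tP.
rewrite (EEDl HE) -[RHS]mulr1; congr (_ * _); apply: etrans (perE (l * j)); rewrite /ExponentialSums.EE; congr E.
by rewrite dotZl dot_cv jE rmorph_int intrM; field.
Qed.

Lemma Eorb_bsum : bsum 0 setT Eorb.
Proof.
apply: bsum_sum => tau _; have := @bsum_exp R C n rc E 0 setT 1 tau I.
by apply: bsum_ext => x; rewrite mul1r add0r (EEC _ x).
Qed.

(** The condition concerns every point where the line meets a wall (a, x) = k per/2 - c, for
    infinitely many k. By periodicity of [Eorb] only k modulo d = (a, eta) matters, so finitely many
    generic conditions suffice. *)
Lemma wall_ok_generic eta (cs : seq int) (ks : seq V) : Qv eta -> regular eta -> (forall kappa, kappa \in ks -> Qv kappa) ->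
  gener setT (fun x0 => forall a, a \in enum_fset Phi -> forall c, c \in cs -> forall kappa, kappa \in ks ->
    forall t, E (2 * (dot (cv a) (x0 + t *: cv eta) + c%:~R)) = 1 ->
    Eorb (x0 + t *: cv eta + cv kappa) = Eorb (x0 + t *: cv eta) -> kappa = 0 \/ kappa = c%:~R *: coroot a).
Proof.
move=> Qe er Qks; have LT (u v : V) : [set: V] u -> [set: V] v -> [set: V] (u + v) by [].
apply: (gener_seq HE I LT) => a aP; apply: (gener_seq HE I LT) => c _; apply: (gener_seq HE I LT) => kappa kk.
have [H|nk] := pselect (kappa = 0 \/ kappa = c%:~R *: coroot a).
  by apply: (gener_true HE I) => x0 t _ _.
have [per per0 perP] := qexp_ker HE.
have perE (j : int) : E (j%:~R * per) = 1 by apply/perP; exists j.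
have [d dE] := Qv_int HPhi Qe aP.
have dn0 : d != 0 by apply: contraNneq (er a aP) => d0; rewrite dotC dE d0.
have dC0 : d%:~R != 0 :> C by rewrite intr_eq0.
have aeta : dot (cv a) (cv eta) = d%:~R by rewrite dot_cv dotC dE rmorph_int.
(* [pi x + w k] is the point where the line through x in the direction eta meets the k-th wall. *)
pose pi x := x - (dot (cv a) x / d%:~R) *: cv eta.
pose w (k : int) : VC := ((k%:~R * per / 2 - c%:~R) / d%:~R) *: cv eta.
pose f k x := Eorb (pi x + w k + cv kappa) - Eorb (pi x + w k).
have fg k : gener setT (fun x => f k x != 0).
  apply: gener_neq0.
    have piP v : exists v', forall x, dot (cv v) (pi x) = dot (cv v') x.
      exists (v - (dot v eta / d%:~R) *: a) => x; rewrite /pi dotBr dotZr cvB dotBl cvZ dotZl dot_cv.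
      by rewrite fmorph_div rmorph_int; congr (_ - _); field.
    have b1 := bsum_comp HE (w k + cv kappa) Eorb_bsum piP; have b2 := bsum_comp HE (w k) Eorb_bsum piP.
    by have := bsumB b1 b2; apply: bsum_ext => x; rewrite /f addrA.
  apply: contrapT => H; apply: nk; apply: (wall_generic perE aP (Qks _ kk) (k := k)) => x1 x1a.
  have e : pi x1 + w k = x1 by rewrite /pi /w x1a subrK.
  apply/eqP; apply: contraT => ne; case: H; exists x1; by rewrite /f e subr_eq0.
apply: gener_mono (gener_seq HE I LT (s := [seq i%:Z | i <- iota 0 `|d|]) (fun k _ => fg k)) => x0 H t e1 e2.
move/perP: e1 => [k' k'E].
have [k kE] : exists k, x0 + t *: cv eta = pi x0 + w k' /\ k = (k' %% d)%Z.
  exists (k' %% d)%Z; split=> //; rewrite /pi /w -addrA; congr (_ + _).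
  rewrite -scaleNr -scalerDl; congr (_ *: _).
  have := k'E; rewrite dotDr dotZr aeta => e3; rewrite -e3; field.
  by [].
have [xE kE'] := kE.
have kin : k \in [seq i%:Z | i <- iota 0 `|d|].
  have k0 : 0 <= k by rewrite kE' modz_ge0.
  have kd : k < `|d|%N by rewrite kE' ltz_mod.
  apply/mapP; exists `|k|%N; first by rewrite mem_iota /= add0n; move: k0 kd; clear; lia.
  by rewrite gez0_abs.
have wE : w k' = w k + ((k' %/ d)%Z%:~R * per / 2) *: cv eta.
  rewrite /w -scalerDl; congr (_ *: _); rewrite {1}(divz_eq k' d) -kE' intrD intrM; field.
  by [].
have := H k kin; rewrite /f; case/negP; apply/eqP.
have eq1 : Eorb (pi x0 + w k) = Eorb (x0 + t *: cv eta).
  by rewrite xE wE addrA (Eorb_per _ _ perE Qe).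
have eq2 : Eorb (pi x0 + w k + cv kappa) = Eorb (x0 + t *: cv eta + cv kappa).
  by rewrite xE wE (addrA (pi x0)) [X in _ = Eorb X]addrAC (Eorb_per _ _ perE Qe).
by rewrite eq1 eq2 e2 subrr.
Qed.

End WallGeneric.

End WallGenericity.
Import WallGenericity.

(** * Poles and leading terms of psi along a line in x *)

Module LineArgument.

Section Lines.
Context {R : realType} {C : numClosedFieldType} {n : nat} {rc : {rmorphism R -> C}}.
Context {E : C -> C} (HE : qexponential E).
Context {Phi : {fset 'rV[R]_n}} (HPhi : reduced_irreducible_root_system Phi).
Context (m : 'rV[R]_n -> nat).
Context (m_refl : forall a b, a \in Phi -> b \in Phi -> m (a *m refl_mx b) = m a).
Local Notation V := ('rV[R]_n).
Local Notation VC := ('rV[C]_n).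
Local Notation cv := (cv rc).
Local Notation EE := (@EE C n E).
Local Notation bsum := (@bsum R C n rc E).
Local Notation csum := (@csum R C n rc E).
Local Notation O := (@short_roots R n Phi).
Local Notation Qv := (@Qv R n Phi).
Local Notation QI := (@QI R C n rc E Phi m).
Local Notation nonres := (@nonres R C n rc E Phi).
Local Notation yv := (@yv R C n rc E).
Local Notation rhoh := (@rhoh R n Phi m).
Local Notation HN := (@HN R n Phi m).
Local Notation regular := (@regular R n Phi).
Local Notation Eorb := (@Eorb R C n rc E Phi).
Local Notation Om := (@Om R n Phi m).
Local Notation Drel := (@Drel R C n rc E Phi m).
Local Notation gener := (@gener R C n rc E).
Local Notation laur := (@laur C E).
Implicit Types (x z w : VC) (a b h u v tau : V) (f g : VC -> C) (L : set V).

Local Notation LQ := (@LQ R n Phi).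
Local Notation wprod := (@wprod C E).
Local Notation ph := (@ph R C n rc E Phi m).
Local Notation rhor := (@rhor R n Phi m).
Local Notation qn := (@qn C E).
Local Notation cofin := (@cofin C E).
Local Notation az := (@az R C n rc E Phi m).

(** A Vandermonde argument: with at most k nonzero weights at distinct nonzero nodes, a polynomial
    of degree at most k without constant term isolates one weight. *)
Lemma power_sum_size (S : seq V) (A w : V -> C) (P : pred V) (k : nat) nu : uniq S -> nu \in S -> P nu -> A nu != 0 ->
  (forall v, v \in S -> w v != 0) -> {in [seq v <- S | P v] &, injective w} ->
  (forall s, (1 <= s <= k)%N -> \sum_(v <- S | P v) A v * w v ^+ s = 0) ->
  (k < size [seq v <- S | (A v != 0)%R && P v])%N.
Proof.
move=> uS nuS Pn An w0 winj H; set T := [seq v <- S | _]; rewrite ltnNge; apply/negP => sT.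
have nT : nu \in T by rewrite mem_filter An Pn.
have uT : uniq T by rewrite filter_uniq.
pose p : {poly C} := \prod_(v <- rem nu T) ('X - (w v)%:P) * 'X.
have sp : (size p <= k.+1)%N.
  rewrite size_mulX ?monic_neq0 ?monic_prod_XsubC // size_prod_XsubC size_rem //.
  rewrite prednK ?ltnS //; by rewrite -has_predT; apply/hasP; exists nu.
have key : \sum_(v <- T) A v * p.[w v] = 0.
  rewrite (eq_bigr (fun v => \sum_(i < k.+1) p`_i * (A v * w v ^+ i))); last first.
    move=> v _; rewrite (horner_coef_wide _ sp) mulr_sumr; apply: eq_bigr => i _; ring.
  rewrite exchange_big /= big1 // => i _; rewrite -mulr_sumr.
  case: i => -[|i] ik /=; first by rewrite coefMX eqxx mul0r.
  have ik' : (1 <= i.+1 <= k)%N by [].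
  rewrite [X in _ * X](_ : _ = 0) ?mulr0 // -[RHS](H i.+1 ik').
  rewrite big_filter big_mkcondl; apply: eq_bigr => v _.
  by case: eqVneq => //= ->; rewrite mul0r.
have pz v : v \in T -> v != nu -> p.[w v] = 0.
  move=> vT vn; have vr : v \in rem nu T by rewrite mem_rem_uniq // inE vn.
  by rewrite hornerM horner_prod (big_rem _ vr) /= hornerXsubC subrr !mul0r.
move: key; rewrite (bigD1_seq nu) //= big_seq_cond big1 ?addr0; last first.
  by move=> v /andP[vT vn]; rewrite pz // mulr0.
move/eqP; rewrite hornerM hornerX !mulf_eq0 (negPf An) (negPf (w0 nu nuS)) orbF /=.
rewrite horner_prod prodf_seq_eq0 => /hasP [v]; rewrite mem_rem_uniq // inE => /andP[vn vT] /=.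
rewrite hornerXsubC subr_eq0 => /eqP e; case/negP: vn; apply/eqP/esym; apply: winj => //.
  by rewrite mem_filter Pn.
by move: vT; rewrite !mem_filter => /andP[/andP[_ ->] ->].
Qed.

Lemma strip_zero (T : eqType) (S : seq T) (N : T -> {poly C}) : (exists2 i, i \in S & N i != 0) ->
  exists j N1, (forall i, i \in S -> N i = 'X^j * N1 i) /\ exists2 i, i \in S & ~~ root (N1 i) 0.
Proof.
move=> [i iS Ni]; have [k] := ubnP (size (N i)); elim: k N Ni => // k IH N Ni; rewrite ltnS => sk.
have [H|H] := pselect (exists2 i, i \in S & ~~ root (N i) 0).
  by exists 0%N, N; split=> // i' _; rewrite mul1r.
have r0 i' : i' \in S -> root (N i') 0 by move=> iS'; apply: contraT => ne; case: H; exists i'.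
have /choice [N1 N1E] : forall i', exists q, i' \in S -> N i' = 'X * q.
  move=> i'; case: (boolP (i' \in S)) => iS'; last by exists 0.
  by have /factor_theorem [q qE] := r0 i' iS'; exists q => _; rewrite qE subr0 mulrC.
have N1i : N1 i != 0 by apply: contraNneq Ni => e; rewrite N1E // e mulr0.
have [|j [N2 [N2E H2]]] := IH N1 N1i.
  by move: sk; rewrite N1E // mulrC size_mulX // ltnS.
exists j.+1, N2; split=> // i' iS'; by rewrite N1E // N2E // exprS mulrA.
Qed.

Lemma gener_line (P : VC -> Prop) : gener LQ P ->
  gener LQ (fun x0 => P x0 /\ forall eta, Qv eta -> cofin (fun t => P (x0 + t *: cv eta))).
Proof.
move=> [f [bf nf fP]]; exists f; split=> // x0 f0; split=> [|eta Qe]; first exact: fP.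
have := cofin_laur HE (laur_line HE x0 bf Qe); rewrite scale0r addr0 => /(_ f0).
by apply: cofin_mono => t /fP.
Qed.

Lemma qn_bsum a (j k : C) (s : int) : a \in Phi -> bsum 0 LQ (fun x => qn (j + s%:~R * dot (cv a) x)).
Proof.
move=> aP; have b (i : int) (e : C) := @bsum_exp R C n rc E 0 LQ e _ (LQ_half HPhi i aP).
have eE (i : int) (e : C) x : E e * EE (0 + cv ((i%:~R / 2) *: a)) x = E (e + i%:~R * dot (cv a) x).
  by rewrite add0r /ExponentialSums.EE cvZ dotZl fmorph_div rmorph_nat rmorph_int -(qexpD HE); congr E; field.
have := bsumB (b s (E j)) (b (- s) (E (- j))); apply: bsum_ext => x; rewrite !eE /ExponentialSums.qn.
by congr (_ - E _); rewrite rmorphN; ring.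
Qed.

Lemma wprod_bsum a : a \in Phi -> bsum 0 LQ (fun x => wprod (m a) (dot (cv a) x)).
Proof.
move=> aP; apply: (bsum_prod HE) => [||j _]; [exact: LQ0|exact: LQD|].
by have := qn_bsum j%:R 0 (-1) aP; apply: bsum_ext => x; rewrite rmorphN mulN1r.
Qed.

Lemma ph_bsum h : bsum 0 LQ (ph h).
Proof.
have : forall s : seq V, {subset s <= Phi} -> bsum 0 LQ (fun x => \prod_(b <- s) wprod (m b) (dot (cv b) x)).
  elim=> [|b s IH] sP.
    by have := @bsum_const R C n rc E HE LQ 1 LQ0; apply: bsum_ext => x; rewrite big_nil.
  have := bsumM HE (wprod_bsum (sP b (mem_head _ _))) (IH (fun c cs => sP c (mem_behead (s := b :: s) cs))) (@LQD _ _ _).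
  by apply: bsum_ext => x; rewrite big_cons.
move=> /(_ [seq b <- Phi | 0 < dot b h]) H.
have {}H := H _; apply: bsum_ext (H _) => [x|b]; first by rewrite big_filter.
by rewrite mem_filter => /andP[].
Qed.

Lemma wprod_generic a : a \in Phi -> gener LQ (fun x => wprod (m a) (dot (cv a) x) != 0).
Proof.
move=> aP; apply: (@gener_mono R C n rc E LQ (fun x => forall j, j \in index_iota 1 (m a).+1 -> EE (cv a) x != E (2 * j%:R))).
  move=> x H; rewrite prodf_seq_neq0; apply/allP => j js /=; rewrite (qn_eq0 HE) mulrBr (qexpB HE).
  apply/eqP => e; have /eqP := H j js; apply; rewrite /ExponentialSums.EE.
  by apply: (mulIf (invr_neq0 (qexp_neq0 HE (2 * dot (cv a) x)))); rewrite divff ?(qexp_neq0 HE) // e.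
apply: (gener_seq HE (@LQ0 _ _ _) (@LQD _ _ _)) => j _; apply: (gener_EE HE (@LQ0 _ _ _)).
  exact: (root_neq0 HPhi).
exact: (LQ_root HPhi).
Qed.

Lemma cofin_ex (P : C -> Prop) : cofin P -> exists t, P t.
Proof.
move=> cP; apply: contrapT => nP; have := oner_neq0 {poly C}; rewrite -(_ : 0 = 1 :> {poly C}) ?eqxx //.
by apply: (qexp_poly_eq HE); apply: cofin_mono cP => t Pt; case: nP; exists t.
Qed.

Lemma cofin_all (P : C -> Prop) : (forall t, P t) -> cofin P.
Proof. by move=> H; exists 1; rewrite ?oner_neq0. Qed.

Lemma laurX (F : C -> C) (k : nat) : laur F -> laur (fun t => F t ^+ k).
Proof.
move=> lF; elim: k => [|k IH]; first exact: laur_const.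
by have := laurM lF IH; apply: laur_ext => t; rewrite exprS.
Qed.

Lemma laur_poly (p : {poly C}) : laur (fun t => p.[E t]).
Proof. by exists p, 0%N => t; rewrite mul1r. Qed.

Lemma laur_yv a x eta nu : a \in Phi -> Qv eta -> laur (fun t => yv a (x + t *: cv eta) nu) /\ laur (fun t => (yv a (x + t *: cv eta) nu)^-1).
Proof.
move=> aP Qe; have [k kE] := Qv_int HPhi Qe aP.
have e t : yv a (x + t *: cv eta) nu = yv a x nu * E (t * k%:~R).
  rewrite /StringConditions.yv -(qexpD HE); congr E; rewrite !dotDr dotZr !dot_cv (dotC a eta) kE rmorph_int; ring.
split; [apply: laur_ext (laurM (laur_const (yv a x nu)) (laur_exp HE k)) => t|].
  by rewrite e.
apply: laur_ext (laurM (laur_const (yv a x nu)^-1) (laur_exp HE (- k))) => t.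
by rewrite e invfM rmorphN mulrN (qexpN HE).
Qed.

Lemma wprod_line (k : nat) (X : C) (j : nat) : (0 < j)%N -> exists2 p : {poly C}, ~~ root p 0 &
  forall t, E (t * (k * j)%:R) * wprod k (X + t * j%:R) = p.[E t].
Proof.
move=> j0; exists (\prod_(1 <= l < k.+1) ((E (l%:R - X))%:P - (E (X - l%:R)) *: 'X^(2 * j))).
  rewrite /root horner_prod prodf_seq_neq0; apply/allP => l _ /=.
  by rewrite hornerD hornerN hornerC hornerZ hornerXn expr0n muln_eq0 /= (gtn_eqF j0) mulr0 subr0 (qexp_neq0 HE).
move=> t; have -> : E (t * (k * j)%:R) = \prod_(1 <= l < k.+1) E (t * j%:R).
  by rewrite prodr_const_nat subn1 /= -(qexpMn HE); congr E; rewrite natrM; ring.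
rewrite -big_split horner_prod; apply: eq_bigr => l _ /=.
rewrite hornerD hornerN hornerC hornerZ hornerXn mulrBr -!(qexpD HE) -(qexpMn HE) -(qexpD HE).
by congr (E _ - E _); rewrite ?natrM; ring.
Qed.

Section Fixed.
Context (h0 : V) (h0r : regular h0).
Context (S S9 : seq V) (uS : uniq S) (SP : forall nu, (nu \in S) <-> Om 1 h0 nu).
Context (uS9 : uniq S9) (S9P : forall nu, (nu \in S9) <-> Om 9 h0 nu).
Context (Vf : V -> VC -> C) (Hf : VC -> C) (bV : forall nu, bsum 0 LQ (Vf nu)) (bH : bsum 0 LQ Hf).
Context (nH : exists x, Hf x != 0).
Context (VH : forall x c, Hf x != 0 -> QI x S c -> c (rhoh h0) = 1 -> forall nu, nu \in S -> c nu = Vf nu x / Hf x).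

(** The factor [ph h0] turns the normalisation 1 into the prescribed one, which frees the vertex
    coefficients from poles. *)
Definition psic x nu := if nu \in S then Vf nu x * ph h0 x / Hf x else 0.

Definition nice x := [/\ @good R C n rc E Phi S S9 x, Hf x != 0 & forall a, a \in Phi -> wprod (m a) (dot (cv a) x) != 0].

Lemma nice_generic : gener LQ nice.
Proof.
apply: (@gener_mono R C n rc E LQ (fun x => @good R C n rc E Phi S S9 x /\ (Hf x != 0 /\
   forall a, a \in enum_fset Phi -> wprod (m a) (dot (cv a) x) != 0))); first by move=> x [? [? ?]].
apply: (gener_and HE (@LQD _ _ _)); first exact: (good_generic HE HPhi S S9P).
apply: (gener_and HE (@LQD _ _ _)); first exact: gener_neq0.
apply: (gener_seq HE (@LQ0 _ _ _) (@LQD _ _ _)) => a; exact: wprod_generic.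
Qed.

Lemma psic_nice x : nice x -> [/\ QI x S (psic x), forall h, regular h -> psic x (rhoh h) = ph h x &
  Drel (csum x S (psic x)) (fun z => (Eorb x - Eorb (- cv (rhoh h0))) * csum x S (psic x) z)].
Proof.
move=> [g Hx wx]; have [c [qc c1 Dc]] := good_eigen HE HPhi m_refl h0r uS SP uS9 S9P g.
have e nu : nu \in S -> psic x nu = ph h0 x * c nu.
  by move=> nS; rewrite /psic nS (VH Hx qc c1 nS); ring.
have eS z : csum x S (psic x) z = ph h0 x * csum x S c z.
  rewrite (csum_ext x e) -[RHS]addr0 -(mul0r (csum x S c z)) -csum_lin; apply: csum_ext => nu _; ring.
split.
- move=> a nu0 s aP sm; rewrite -[RHS](mulr0 (ph h0 x)) -[X in _ = _ * X](qc a nu0 s aP sm) mulr_sumr.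
  by rewrite big_seq_cond [RHS]big_seq_cond; apply: eq_bigr => nu /andP[/e -> _]; ring.
- move=> h hr; rewrite e; last exact: (rhoh_S HPhi m_refl h0r SP).
  by rewrite mulrC (vertex_formula HE HPhi m_refl uS SP h0r qc wx hr) c1 mul1r.
- move=> z gen; rewrite eS mulrCA Dc // mulr_sumr; apply: eq_bigr => tau _; rewrite !eS; ring.
Qed.

(** For nu and nu' on one a^vee-string, (a, nu) + (a, nu') is an even integer 2c, and resonance of
    the two means q^{2((a, x) + c)} = 1. For all other pairs the floor merely supplies some
    integer. *)
Definition resonance_shifts : seq int :=
  [seq Num.floor ((dot a p.1 + dot a p.2) / 2) | a <- enum_fset Phi, p <- allpairs pair S S].

Definition top_shifts : seq V := allpairs (fun v u => v - u) S S.

Definition wall_ok x0 eta := forall a, a \in enum_fset Phi -> forall c, c \in resonance_shifts ->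
  forall kappa, kappa \in top_shifts -> forall t, E (2 * (dot (cv a) (x0 + t *: cv eta) + c%:~R)) = 1 ->
  Eorb (x0 + t *: cv eta + cv kappa) = Eorb (x0 + t *: cv eta) -> kappa = 0 \/ kappa = c%:~R *: coroot a.

Lemma wall_ok_gener eta : Qv eta -> regular eta -> gener setT (fun x0 => wall_ok x0 eta).
Proof.
move=> Qe er; apply: (wall_ok_generic HE HPhi _ Qe er) => kappa /allpairsP [[v u] /= [vS uS1 ->]].
have [/SP [Q1 _] /SP [Q2 _]] := (vS, uS1).
rewrite (_ : v - u = (v - rhoh h0) + - (u - rhoh h0)); last by rewrite opprB addrA subrK.
by apply: QvD => //; exact: QvN.
Qed.

Lemma S_bound nu h' : nu \in S -> dot nu h' <= HN h'.
Proof. by move=> /SP [_ /(_ h')]; rewrite mul1r. Qed.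

Section Line.
Context (x0 : VC) (eta : V) (Qe : Qv eta) (er : regular eta).
Context (nl : cofin (fun t => nice (x0 + t *: cv eta))) (wo : wall_ok x0 eta).

Local Notation xt := (fun t : C => x0 + t *: cv eta).

(** At a nonresonant point [QI_vertex] applies. At a point resonant through a and c, let h be
    generic and close to c a: the top exponent has the eigenvalue of rho_h, so by [wall_ok] it is
    rho_h, a vertex, or rho_h + c a^vee, which for c <> 0 is higher in the direction h than N
    allows. *)
Lemma vanishing_vertices t0 A : QI (xt t0) S A ->
  Drel (csum (xt t0) S A) (fun z => (Eorb (xt t0) - Eorb (- cv (rhoh h0))) * csum (xt t0) S A z) ->
  (forall h, regular h -> A (rhoh h) = 0) -> forall nu, nu \in S -> A nu = 0.
Proof.
move=> q D Az nu nS; apply/eqP; apply: contraT => An.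
have [nr|nr] := pselect (nonres (xt t0) S).
  by have := QI_vertex HE HPhi m_refl uS S_bound q nr (ex_intro2 _ _ nu nS An) h0r; rewrite Az // eqxx.
have [a [v [v' [aP vS v'S st]]]] : exists a v v', [/\ a \in Phi, v \in S, v' \in S &
    str (coroot a) v v' /\ yv a (xt t0) v * yv a (xt t0) v' = 1].
  apply: contrapT => H; apply: nr => a v v' aP vS v'S st; apply/eqP => e.
  by apply: H; exists a, v, v'.
have [{}st yy] := st; have a0 := root_neq0 HPhi aP.
have [c cE] : exists c : int, dot a v + dot a v' = 2 * c%:~R.
  have [k kE] := st; have [/SP [Q1 _] _] := (vS, I); have [l lE] := Qv_int HPhi Q1 aP.
  have [r rE] := rhoh_int HPhi m_refl h0r aP.
  exists (l + r + k); rewrite kE dotDr dotZr (dotC a (coroot a)) (coroot_self a0) !intrD -lE -rE dotBl (dotC v).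
  by rewrite (dotC (rhoh h0)); ring.
have cin : c \in resonance_shifts.
  apply/allpairsPdep; exists a, (v, v'); split=> //=; first exact: allpairs_f.
  by rewrite cE mulrAC divff ?mul1r ?floorK ?intrKfloor // pnatr_eq0.
have e1 : E (2 * (dot (cv a) (xt t0) + c%:~R)) = 1.
  apply: etrans yy; rewrite /StringConditions.yv -(qexpD HE); congr E; rewrite !dotDr !dot_cv.
  have := congr1 rc cE; rewrite rmorphD rmorphM rmorph_nat rmorph_int => e2.
  transitivity (2 * (dot (cv a) x0 + dot (cv a) (t0 *: cv eta)) + (2 * c%:~R)); first by rewrite mulrDr.
  by rewrite -e2; ring.
pose vs := enum_fset Phi ++ [seq p.1 - p.2 | p <- allpairs pair S S & p.1 != p.2].
have vs0 u : u \in vs -> u != 0.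
  rewrite mem_cat => /orP[/(root_neq0 HPhi) //|/mapP [p]].
  by rewrite mem_filter => /andP[p12 _] ->; rewrite subr_eq0.
have [h [h1 h2]] := perturb (c%:~R *: a) [:: c%:~R *: a] vs0.
have hr : regular h by move=> b bP; apply: h1; rewrite mem_cat bP.
have ig : {in S &, injective (fun u => dot u h)}.
  move=> u w uS1 wS1 /= e; apply/eqP; apply: contraT => uw.
  have /h1 : u - w \in vs.
    rewrite mem_cat; apply/orP; right; apply/mapP; exists (u, w) => //.
    by rewrite mem_filter uw /=; apply/allpairsP; exists (u, w).
  by rewrite dotBl e subrr eqxx.
have [w [wS Aw wmax]] := csum_top uS ig (ex_intro2 _ _ nu nS An).
have T := @topc_csum_in R C n rc E h (xt t0) S A w uS wS wmax.
have := Drel_top HE HPhi m_refl hr D T (topcZ _ T) => /(mulIf Aw).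
rewrite -(Eorb_rhoh HPhi m_refl hr h0r) => /addIr e2.
have rS := rhoh_S HPhi m_refl h0r SP hr.
have kin : w - rhoh h \in top_shifts by apply/allpairsP; exists (w, rhoh h).
have e3 : Eorb (xt t0 + cv (w - rhoh h)) = Eorb (xt t0) by rewrite cvB addrA -e2.
have [k0|k0] := wo aP cin kin e1 e3.
- by move: Aw; have := subr0_eq k0 => ->; rewrite Az // eqxx.
have [c0|c0] := eqVneq c 0.
  by move: Aw; move: k0; rewrite c0 scale0r => /subr0_eq ->; rewrite Az // eqxx.
have := h2 _ (mem_head _ _); rewrite dot_sq_gt0 scaler_eq0 (negPf a0) orbF intr_eq0 c0 => /(_ isT).
rewrite dotZl => pos; have := S_bound h wS; rewrite (HN_rhoh HPhi m_refl hr).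
rewrite -subr_le0 -dotBl k0 dot_scoroot coroot_dot mulrCA pmulr_rle0 ?leNgt ?pos //.
by rewrite divr_gt0 ?ltr0n // dot_sq_gt0.
Qed.

Lemma ph_neq0 h x : (forall a, a \in Phi -> wprod (m a) (dot (cv a) x) != 0) -> ph h x != 0.
Proof. by move=> H; rewrite prodf_seq_neq0; apply/allP => a aP; apply/implyP => _; exact: H. Qed.

(** Write the coefficients along the line over a common denominator in lowest terms. At a nonzero
    root of it the numerators form a quasi-invariant eigenfunction with vanishing vertex
    coefficients, so all of them vanish, against lowest terms. Hence the denominator is a monomial
    in T. *)
Lemma line_normal : exists (e : int) (N : V -> {poly C}),
  cofin (fun t => forall nu, nu \in S -> E (t * e%:~R) * psic (xt t) nu = (N nu).[E t]) /\ exists2 nu, nu \in S & ~~ root (N nu) 0.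
Proof.
have [pH [kH HE']] := laur_line HE x0 bH Qe.
have /choice [pk pkE] : forall nu, exists pk : {poly C} * nat, forall t,
    E t ^+ pk.2 * (Vf nu (xt t) * ph h0 (xt t)) = pk.1.[E t].
  move=> nu; have [p [k pk]] := laurM (laur_line HE x0 (bV nu) Qe) (laur_line HE x0 (ph_bsum h0) Qe).
  by exists (p, k).
pose K := (\sum_(nu <- S) (pk nu).2)%N.
pose D := pH * 'X^K; pose N nu := (pk nu).1 * 'X^(K - (pk nu).2) * 'X^kH.
have pH0 : pH != 0.
  have [t [_ Ht _]] := cofin_ex nl; apply: contraNneq Ht => p0.
  by move/eqP: (HE' t); rewrite p0 horner0 mulf_eq0 expf_eq0 (negPf (qexp_neq0 HE _)) andbF /=.
have D0 : D != 0 by rewrite mulf_neq0 // monic_neq0 // monicXn.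
have DN : cofin (fun t => forall nu, nu \in S -> D.[E t] * psic (xt t) nu = (N nu).[E t]).
  apply: cofin_mono nl => t [_ Ht _] nu nS; rewrite /psic nS !hornerM !hornerXn -HE' -pkE.
  have -> : E t ^+ K = E t ^+ (pk nu).2 * E t ^+ (K - (pk nu).2).
    by rewrite -exprD subnKC // /K (big_rem _ nS) /= leq_addr.
  by field.
have [D' [N' [D'0 DN' rt']]] := ratio_reduce D0 DN.
have nice_t : cofin (fun t => nice (xt t) /\ forall nu, nu \in S -> D'.[E t] * psic (xt t) nu = (N' nu).[E t]).
  exact: cofin_and.
have lN nu : laur (fun t => (N' nu).[E t]) by exact: laur_poly.
have rD T0 : root D' T0 -> T0 = 0.
  move=> rT; apply/eqP; apply: contraT => T00; have [t0 t0E] := qexp_surj HE T00.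
  have [nu nS] := rt' _ rT; rewrite /root -t0E; case/negP; apply/eqP.
  apply: (@vanishing_vertices t0 (fun nu => (N' nu).[E t0])) nS.
  - move=> a nu0 s aP sm.
    apply: (laur_eq0 HE (F := fun t => \sum_(nu <- S | `[< str (coroot a) nu0 nu >])
      (N' nu).[E t] * (yv a (xt t) nu ^+ s - yv a (xt t) nu ^- s))).
      apply: laur_sum => nu' _; apply: laurM => //; have [l1 l2] := laur_yv x0 nu' aP Qe.
      apply: laur_ext (laurD (laurX s l1) (laurM (laur_const (-1)) (laurX s l2))) => t.
      by rewrite exprVn; ring.
    apply: cofin_mono nice_t => t [nt Nt]; have [q _ _] := psic_nice nt.
    rewrite -[RHS](mulr0 D'.[E t]) -[X in _ = _ * X](q a nu0 s aP sm) mulr_sumr.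
    by rewrite big_seq_cond [RHS]big_seq_cond; apply: eq_bigr => nu' /andP[/Nt <- _]; rewrite mulrA.
  (* [I] is the sum without the factor q^{2(x, z)}, which along the line need not be a Laurent
     polynomial in T. Once it is removed, the eigenvalue equation is Laurent in T and extends to
     t0. *)
  - move=> z gz; pose I (A : V -> C) z := \sum_(nu <- S) A nu * EE (cv nu) z.
    have lI z' : laur (fun t => I (fun nu => (N' nu).[E t]) z').
      by apply: laur_sum => nu' _; apply: laurM => //; exact: laur_const.
    have lE tau : tau \in O -> laur (fun t => EE (xt t) (cv tau)).
      move=> /short_rootP [tP _]; have [k kE] := Qv_int HPhi Qe tP.
      apply: laur_ext (laurM (laur_const (EE x0 (cv tau))) (laur_exp HE (2 * k))) => t.
      rewrite /ExponentialSums.EE -(qexpD HE); congr E; rewrite dotDl dotZl dot_cv kE rmorph_int intrM; ring.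
    pose F t := (Eorb (xt t) - Eorb (- cv (rhoh h0))) * I (fun nu => (N' nu).[E t]) z -
      \sum_(tau <- O | tau \in O) az tau z * (EE (xt t) (cv tau) * I (fun nu => (N' nu).[E t]) (z + cv tau)
         - I (fun nu => (N' nu).[E t]) z).
    have lEo : laur (fun t => Eorb (xt t)).
      rewrite /DualSpectrum.Eorb; apply: laur_ext (_ : laur (fun t => \sum_(tau <- O | tau \in O) EE (xt t) (cv tau))).
        by move=> t; rewrite -big_seq.
      by apply: laur_sum => tau; exact: lE.
    have lF : laur F.
      apply: laur_ext (laurD (laurM (laurD lEo (laur_const (- Eorb (- cv (rhoh h0))))) (lI z))
        (laurM (laur_const (-1)) (laur_sum (enum_fset O) (P := fun tau => tau \in O)
         (F := fun tau t => az tau z * (EE (xt t) (cv tau) * I (fun nu => (N' nu).[E t]) (z + cv tau)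
         - I (fun nu => (N' nu).[E t]) z)) _))) => [t|tau tO].
        by rewrite mulN1r.
      apply: laurM; first exact: laur_const.
      apply: laur_ext (laurD (laurM (lE _ tO) (lI (z + cv tau))) (laurM (laur_const (-1)) (lI z))) => t.
      by rewrite mulN1r.
    have cs t A z' : csum (xt t) S A z' = EE (xt t) z' * I A z' by rewrite csumE.
    have F0 : F t0 = 0.
      apply: (laur_eq0 HE lF); apply: cofin_mono nice_t => t [nt Nt]; have [_ _ De] := psic_nice nt.
      have IN z' : I (fun nu => (N' nu).[E t]) z' = D'.[E t] * I (psic (xt t)) z'.
        rewrite /I mulr_sumr big_seq [RHS]big_seq; apply: eq_bigr => nu' /Nt <-; ring.
      apply: (mulfI (EE_neq0 HE (xt t) z)); rewrite mulr0 /F -big_seq.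
      have e : (Eorb (xt t) - Eorb (- cv (rhoh h0))) * (EE (xt t) z * I (psic (xt t)) z) = \sum_(tau <- O) az tau z *
          (EE (xt t) z * EE (xt t) (cv tau) * I (psic (xt t)) (z + cv tau) - EE (xt t) z * I (psic (xt t)) z).
        by rewrite -cs (De z gz); apply: eq_bigr => tau _; rewrite !cs (EEDr HE).
      rewrite mulrBr.
      transitivity (D'.[E t] * ((Eorb (xt t) - Eorb (- cv (rhoh h0))) * (EE (xt t) z * I (psic (xt t)) z)) -
        D'.[E t] * \sum_(tau <- O) az tau z *
          (EE (xt t) z * EE (xt t) (cv tau) * I (psic (xt t)) (z + cv tau) - EE (xt t) z * I (psic (xt t)) z)); last first.
        by rewrite e subrr.
      congr (_ - _); first by rewrite IN; ring.
      by rewrite [LHS]mulr_sumr [RHS]mulr_sumr; apply: eq_bigr => tau _; rewrite !IN; ring.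
    rewrite cs mulrCA; move/eqP: F0; rewrite /F subr_eq0 => /eqP ->.
    by rewrite -big_seq [LHS]mulr_sumr; apply: eq_bigr => tau _; rewrite !cs (EEDr HE); ring.
  - move=> h hr; have rS := rhoh_S HPhi m_refl h0r SP hr.
    have := laur_eq0 HE (F := fun t => (N' (rhoh h)).[E t] - D'.[E t] * ph h (xt t)) _ _ t0.
    move=> /(_ _ _) H; have {}H := H _ _.
    have : (N' (rhoh h)).[E t0] - D'.[E t0] * ph h (xt t0) = 0.
      apply: H.
        apply: laur_ext (laurD (lN (rhoh h)) (laurM (laur_const (-1)) (laurM (laur_poly D') (laur_line HE x0 (ph_bsum h) Qe)))) => t.
        by rewrite mulN1r.
      apply: cofin_mono nice_t => t [nt Nt]; have [_ v _] := psic_nice nt.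
      by rewrite -Nt // v // subrr.
    by rewrite t0E (eqP rT) mul0r subr0.
have [c c0 [k DE]] := poly_no_root D'0 rD.
have Nn0 : exists2 nu, nu \in S & N' nu != 0.
  have [t [nt Nt]] := cofin_ex nice_t; have [_ v _] := psic_nice nt; have [_ _ w0] := nt.
  exists (rhoh h0); first exact: (rhoh_S HPhi m_refl h0r SP).
  apply: contraTneq (ph_neq0 h0 w0) => e; rewrite -v // negbK; have := Nt _ (rhoh_S HPhi m_refl h0r SP h0r).
  rewrite e horner0 DE hornerZ hornerXn => /eqP; rewrite !mulf_eq0 (negPf c0) expf_eq0 (negPf (qexp_neq0 HE _)).
  by rewrite andbF.
have [j [N1 [N1E [nu1 n1S n1r]]]] := strip_zero Nn0.
exists (k%:Z - j%:Z), (fun nu => c^-1 *: N1 nu); split; last first.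
  by exists nu1; rewrite // /root hornerZ mulf_eq0 invr_eq0 (negPf c0).
apply: cofin_mono nice_t => t [_ Nt] nu nS; have := Nt nu nS.
rewrite DE N1E // hornerM !hornerZ !hornerXn => e.
have Tj : E t ^+ j != 0 by rewrite expf_neq0 // (qexp_neq0 HE).
apply: (mulfI Tj); apply: (mulfI c0); rewrite [in RHS]mulrCA mulVKf // -e.
rewrite rmorphB /= mulrBr (qexpB HE) [t * k%:~R]mulrC [t * j%:~R]mulrC !(qexpMn HE); by field.
Qed.

(** Each factor [j - X] belonging to b has at T = 0 a pole of order (b, eta); there are m_b of them,
    which adds up to 2 ([rhor eta], eta). *)
Lemma ph_line : exists (e : int) (p : {poly C}), [/\ e%:~R = 2 * dot (rhor eta) eta, ~~ root p 0 &
  forall t, E (t * e%:~R) * ph eta (xt t) = p.[E t]].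
Proof.
have /choice [j jE] : forall b, exists j : nat, b \in Phi -> 0 < dot b eta -> (0 < j)%N /\ dot b eta = j%:R.
  move=> b; case: (boolP (b \in Phi)) => bP; last by exists 0%N.
  have [k kE] := Qv_int HPhi Qe bP; rewrite dotC in kE; exists `|k|%N => _; rewrite kE ltr0z => k0.
  by rewrite absz_gt0 gt_eqF // natr_absz gtr0_norm.
have /choice [p pE] : forall b, exists p : {poly C}, b \in Phi -> 0 < dot b eta -> ~~ root p 0 /\
    forall t, E (t * (m b * j b)%:R) * wprod (m b) (dot (cv b) (xt t)) = p.[E t].
  move=> b; case: (boolP ((b \in Phi) && (0 < dot b eta))) => [/andP[bP pos]|nb]; last first.
    by exists 0 => bP pos; rewrite bP pos in nb.
  have [j0 je] := jE b bP pos; have [p p0 pE] := wprod_line (m b) (dot (cv b) x0) j0.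
  by exists p => _ _; split=> // t; rewrite -pE dotDr dotZr dot_cv je rmorph_nat.
pose e := (\sum_(b <- Phi | (0 < dot b eta)%R) (m b * j b))%N.
exists e%:Z, (\prod_(b <- Phi | 0 < dot b eta) p b); split.
- rewrite -pmulrn /e natr_sum /rhor dotZl mulVKf ?pnatr_eq0 // dot_suml big_seq_cond [RHS]big_seq_cond.
  by apply: eq_bigr => b /andP[bP pos]; rewrite dotZl natrM; have [_ ->] := jE b bP pos.
- rewrite /root horner_prod prodf_seq_neq0; apply/allP => b bP; apply/implyP => pos.
  by have [] := pE b bP pos.
move=> t; rewrite -pmulrn /e natr_sum mulr_sumr (qexp_sum HE) -big_split horner_prod big_seq_cond [RHS]big_seq_cond.
by apply: eq_bigr => b /andP[bP pos]; have [_ /(_ t)] := pE b bP pos.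
Qed.

(** As T tends to 0, y^{-s} dominates y^s when (a, eta) > 0, so the leading coefficients satisfy
    one-sided conditions. By [power_sum_size] these still force long strings, hence nonzero
    coefficients at all vertices; at the vertex of eta the order is that of [ph eta], which
    determines e. *)
Lemma line_leading : exists (e : int) (N : V -> {poly C}), [/\ e%:~R = 2 * dot (rhor eta) eta,
  cofin (fun t => forall nu, nu \in S -> E (t * e%:~R) * psic (xt t) nu = (N nu).[E t]),
  forall h, regular h -> (N (rhoh h)).[0] != 0 &
  forall a nu0 s, a \in Phi -> 0 < dot a eta -> (1 <= s <= m a)%N ->
    \sum_(nu <- S | `[< str (coroot a) nu0 nu >]) (N nu).[0] * yv a x0 nu ^- s = 0].
Proof.
have [e [N [cN [nu1 n1S n1r]]]] := line_normal.
have key a nu0 s : a \in Phi -> 0 < dot a eta -> (1 <= s <= m a)%N ->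
    \sum_(nu <- S | `[< str (coroot a) nu0 nu >]) (N nu).[0] * yv a x0 nu ^- s = 0.
  move=> aP pos sm; have [kz kE] := Qv_int HPhi Qe aP.
  have [k k0 ke] : exists2 k : nat, (0 < k)%N & kz = k.
    move: pos; rewrite dotC kE ltr0z; case: kz kE => // k _ k0; by exists k.
  rewrite {kz}ke in kE.
  have yE t nu : yv a (xt t) nu = yv a x0 nu * E t ^+ k.
    rewrite /StringConditions.yv -(qexpMn HE) -(qexpD HE); congr E; rewrite !dotDr dotZr !dot_cv (dotC a eta) kE.
    by rewrite -pmulrn rmorph_nat; ring.
  pose G := \sum_(nu <- S | `[< str (coroot a) nu0 nu >]) N nu *
    ((yv a x0 nu ^+ s) *: 'X^(2 * (k * s)) - (yv a x0 nu ^- s)%:P).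
  have G0 : G = 0.
    apply: (qexp_poly_eq HE); apply: cofin_mono (cofin_and nl cN) => t [nt Nt].
    have [q _ _] := psic_nice nt; rewrite horner0 horner_sum.
    rewrite -[RHS](mulr0 (E t ^+ (k * s) * E (t * e%:~R))) -[X in _ = _ * X](q a nu0 s aP sm) mulr_sumr.
    rewrite big_seq_cond [RHS]big_seq_cond; apply: eq_bigr => nu /andP[/Nt Nn _].
    have Tn := expf_neq0 (k * s) (qexp_neq0 HE t).
    rewrite hornerM -Nn hornerD hornerN hornerZ hornerXn hornerC yE !exprMn -!exprM.
    have y0 := expf_neq0 s (@yv_neq0 R C n rc E HE a x0 nu).
    rewrite mul2n -addnn exprD; move: Tn y0; move: (_ ^+ (k * s)) (yv a x0 nu ^+ s) => A B A0 B0.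
    by field; rewrite A0 B0.
  have G1 : - G.[0] = 0 by rewrite G0 horner0 oppr0.
  apply: etrans G1; rewrite horner_sum -sumrN; apply: eq_bigr => nu _; rewrite hornerM hornerD hornerN hornerZ hornerXn hornerC.
  have s0 : (0 < s)%N by case/andP: sm.
  by rewrite expr0n !muln_eq0 (gtn_eqF k0) (gtn_eqF s0) mulr0 sub0r mulrN opprK.
have vert h : regular h -> (N (rhoh h)).[0] != 0.
  move=> hr; suff : rhoh h \in [seq nu <- S | (N nu).[0] != 0] by rewrite mem_filter => /andP[].
  apply: (span_vertex HPhi m_refl _ _ _ hr).
  - by move=> nu h'; rewrite mem_filter => /andP[_]; exact: S_bound.
  - by rewrite -has_filter; apply/hasP; exists nu1.
  have pos_case nu a : nu \in [seq nu <- S | (N nu).[0] != 0] -> a \in Phi -> 0 < dot a eta ->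
      string_span m [seq nu <- S | (N nu).[0] != 0] a nu.
    rewrite mem_filter => /andP[Nn nS] aP pos; apply: (string_span_size (Phi := Phi) (c := fun nu => (N nu).[0])) => //.
    apply: (power_sum_size (A := fun nu => (N nu).[0]) (w := fun nu => (yv a x0 nu)^-1) (nu := nu)) => //.
    + by apply/asboolP; exact: str_refl.
    + by move=> v _; rewrite invr_eq0 yv_neq0.
    + move=> u v; rewrite !mem_filter => /andP[/asboolP su _] /andP[/asboolP sv _] /invr_inj.
      by apply: (yv_inj HE HPhi) => //; exact: str_trans (str_sym su) sv.
    move=> s sm; apply: etrans (key a nu s aP pos sm); apply: eq_bigr => v _; by rewrite exprVn.
  (* For (a, eta) < 0 the string is obtained from -a and read in the opposite direction. *)
  move=> nu a nS aP; have := er aP; rewrite neq_lt => /orP[neg|]; last exact: pos_case.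
  have [||v1 v2 l k v1S v2S ml e1 e2] := pos_case nu (- a) nS; rewrite ?(rootN HPhi) // ?dotNl ?oppr_gt0 //.
  exists v2 v1 l (- (k - l%:R)) => //; first by move: ml; rewrite (m_opp HPhi m_refl).
    by rewrite e1 corootN scalerN subrK.
  move: e2; rewrite e1 corootN !scalerN => /(canRL (subrK _)) ->.
  by rewrite -addrA scaleNr scalerBl opprB [- _ + _]addrC.
exists e, N; split=> //.
have [e' [p [<- p0 pE]]] := ph_line; congr (_%:~R).
apply: (laur_top HE (vert eta er) p0); last exact: (cofin_all pE).
apply: cofin_mono (cofin_and nl cN) => t [nt Nt]; have [_ v _] := psic_nice nt.
by rewrite -v // Nt //; exact: (rhoh_S HPhi m_refl h0r SP).
Qed.

End Line.

End Fixed.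

End Lines.

End LineArgument.
Import LineArgument.

(** * The leading term along a line as an explicit product *)

Module ProductForm.

Section Product.
Context {R : realType} {C : numClosedFieldType} {n : nat} {rc : {rmorphism R -> C}}.
Context {E : C -> C} (HE : qexponential E).
Context {Phi : {fset 'rV[R]_n}} (HPhi : reduced_irreducible_root_system Phi).
Context (m : 'rV[R]_n -> nat).
Context (m_refl : forall a b, a \in Phi -> b \in Phi -> m (a *m refl_mx b) = m a).
Local Notation V := ('rV[R]_n).
Local Notation VC := ('rV[C]_n).
Local Notation cv := (cv rc).
Local Notation EE := (@EE C n E).
Local Notation bsum := (@bsum R C n rc E).
Local Notation csum := (@csum R C n rc E).
Local Notation topc := (@topc R C n rc E).
Local Notation Gam := (@Gam R C n rc E).
Local Notation yv := (@yv R C n rc E).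
Local Notation rhoh := (@rhoh R n Phi m).
Local Notation HN := (@HN R n Phi m).
Local Notation regular := (@regular R n Phi).
Implicit Types (x z w : VC) (a b h u v tau : V) (f g : VC -> C) (L : set V).
Local Notation rhor := (@rhor R n Phi m).
Local Notation ee := (@ee R C n rc E).

Lemma divide_levels x L (s : seq (V * C)) F : bsum x L F -> uniq s ->
  (forall p, p \in s -> [/\ p.1 != 0, p.2 != 0 & forall u (j : int), L u -> L (u + j%:~R *: p.1)]) ->
  (forall p p' (l : R), p \in s -> p' \in s -> p.1 = l *: p'.1 -> p.1 = p'.1) ->
  (forall p z, p \in s -> EE (cv p.1) z = p.2 -> F z = 0) ->
  exists2 g, bsum x L g & forall z, F z = (\prod_(p <- s) (EE (cv p.1) z - p.2)) * g z.
Proof.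
elim: s F => [|p s IH] F bF us sP sN F0.
  by exists F => // z; rewrite big_nil mul1r.
have /andP[ps us'] : (p \notin s) && uniq s by [].
have [p0 k0 Lp] := sP p (mem_head _ _).
have [z Gz|F1 bF1 FE] := @bsum_divide R C n rc E HE x L p.1 p.2 _ p0 k0 Lp bF.
  by apply: (F0 p) => //; exact: mem_head.
have [|||g bg gE] := IH F1 bF1 us'; last first.
- by exists g => // z; rewrite big_cons FE gE mulrA.
- move=> p' z ps'; have ps'' : p' \in p :: s by rewrite inE ps' orbT.
  have [e|ne] := eqVneq p.1 p'.1.
    move=> e1; have := F0 p' z ps'' e1; rewrite FE e e1 => /eqP; rewrite mulf_eq0 subr_eq0.
    case/orP => [/eqP e2|/eqP //]; case/negP: ps.
    by rewrite (_ : p = p') // [p]surjective_pairing [p']surjective_pairing e e2.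
  apply: (@bsum_dense_level R C n rc E HE x L p'.1 p'.2 [:: p]) => //.
    move=> q l; rewrite inE => /eqP -> e; case/eqP: ne; apply: sN e => //; exact: mem_head.
  move=> y Gy /(_ _ (mem_head _ _)) /= e1; have := F0 p' y ps'' Gy; rewrite FE.
  by move/eqP; rewrite mulf_eq0 subr_eq0 (negPf e1) /= => /eqP.
- by move=> q q' l qs qs'; apply: sN; rewrite inE ?qs ?qs' orbT.
- by move=> q qs; apply: sP; rewrite inE qs orbT.
Qed.

(** The level set e_a = q^{-2s} is [Gam (coroot a)] translated by -(s/2) a; after this translation
    the coefficients acquire the factors y^{-s} of the one-sided condition. *)
Lemma string_vanish x S A a (s : nat) z : a \in Phi ->
  (forall nu0, \sum_(nu <- S | `[< str (coroot a) nu0 nu >]) A nu * yv a x nu ^- s = 0) ->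
  EE (cv (coroot a)) z = E (- (2 * s%:R)) -> csum x S A z = 0.
Proof.
move=> aP q ez; pose z0 := z + (s%:R / 2) *: cv a.
have Gz : Gam (coroot a) z0.
  rewrite /ExponentialSums.Gam /z0 (EEDr HE) ez /ExponentialSums.EE dotZr dot_cv (coroot_self (root_neq0 HPhi aP)) rmorph_nat.
  by rewrite -(qexpD HE) -[RHS](qexp0 HE); congr E; field.
have -> : csum x S A z = EE x z0 * \sum_(nu <- S) (A nu * yv a x nu ^- s) * EE (cv nu) z0.
  rewrite mulr_sumr; apply: eq_bigr => nu _; have zE : z = z0 - (s%:R / 2) *: cv a by rewrite addrK.
  rewrite {1}zE (EEDr HE) (EENr HE) (EE_half HE) (EEDl HE); ring.
rewrite (_ : \sum_(nu <- S) _ = \sum_(nu <- S) (A nu * yv a x nu ^- s) * EE (cv (rep (coroot a) nu)) z0); last first.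
  by apply: eq_bigr => nu _; congr (_ * _); apply: (Gam_str HE) Gz; exact/str_sym/rep_str.
rewrite (str_sum_rep (coroot a) S _ (fun r => EE (cv r) z0)) big_seq big1 ?mulr0 //.
move=> r; rewrite mem_undup => /mapP [nu0 _ ->].
rewrite (eq_bigl (fun nu => `[< str (coroot a) nu0 nu >])) ?q ?mul0r // => nu.
by rewrite -str_rep eq_sym.
Qed.

Definition levels eta := [seq (coroot a, E (- (2 * s%:R))) | a <- [seq a <- Phi | 0 < dot a eta], s <- iota 1 (m a)].

Lemma levelsP eta p : p \in levels eta -> exists a (s : nat),
  [/\ a \in Phi, 0 < dot a eta, (1 <= s <= m a)%N & p = (coroot a, E (- (2 * s%:R)))].
Proof.
move=> /allpairsPdep [a [s [aP sm ->]]]; exists a, s.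
by move: aP sm; rewrite mem_filter mem_iota add1n ltnS => /andP[pos aP] sm; split.
Qed.

Lemma coroot_inj a b : a \in Phi -> b \in Phi -> coroot a = coroot b -> a = b.
Proof.
move=> aP bP e; have [//|ab] := eqVneq a b; have [e2|ab'] := eqVneq a (- b).
  have := congr1 (fun u => dot u a) e; rewrite /= (coroot_self (root_neq0 HPhi aP)) e2 dotNr.
  by rewrite (coroot_self (root_neq0 HPhi bP)) => /eqP; rewrite eq_sym eqNr pnatr_eq0.
have := coroot_parallel HPhi aP bP ab ab' (k := 1); by rewrite scale1r.
Qed.

Lemma levels_uniq eta : uniq (levels eta).
Proof.
apply: allpairs_uniq_dep; first by rewrite filter_uniq // fset_uniq.
  by move=> a _; exact: iota_uniq.
move=> _ _ /allpairsPdep [a [s [aP sm ->]]] /allpairsPdep [b [t [bP tm ->]]] /= [e1 e2].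
have {e1}e1 : a = b by apply: coroot_inj => //; [move: aP|move: bP]; rewrite mem_filter => /andP[].
rewrite {}e1 in aP sm *; congr (Tagged _ _).
have /(qexp_int_inj HE) : E ((- (2 * s%:Z))%:~R) = E ((- (2 * t%:Z))%:~R).
  by rewrite !mulrNz !intrM.
by move/oppr_inj/(mulfI (isT : 2 != 0 :> int)) => -[].
Qed.

Lemma big_levels eta (T : Type) (idx : T) (op : Monoid.com_law idx) (F : V * C -> T) :
  \big[op/idx]_(p <- levels eta) F p =
  \big[op/idx]_(a <- Phi | 0 < dot a eta) \big[op/idx]_(s <- iota 1 (m a)) F (coroot a, E (- (2 * s%:R))).
Proof. by rewrite big_allpairs_dep big_filter. Qed.

Lemma levels_top eta h : regular eta -> regular h -> exists v (k : C), [/\ k != 0,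
  dot v h = HN h + dot (rhoh eta) h & topc h 0 (fun z => \prod_(p <- levels eta) (EE (cv p.1) z - p.2)) v k].
Proof.
move=> er hr; pose vv (p : V * C) := if 0 < dot p.1 h then p.1 else 0.
pose kk (p : V * C) := if 0 < dot p.1 h then 1 else - p.2.
exists (\sum_(p <- levels eta | p \in levels eta) vv p), (\prod_(p <- levels eta | p \in levels eta) kk p); split.
- rewrite prodf_seq_neq0; apply/allP => p pl; apply/implyP => _; rewrite /kk; case: ifP => _; rewrite ?oner_neq0 //.
  by have [a [s [_ _ _ ->]]] := levelsP pl; rewrite oppr_eq0 (qexp_neq0 HE).
- rewrite -big_seq dot_suml big_levels (HN_split HPhi m_refl h er) dotZl dot_suml -mulrDr -big_split mulr_sumr.
  apply: eq_bigr => a pos; rewrite (eq_bigr (fun=> if 0 < dot (coroot a) h then dot (coroot a) h else 0)); last first.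
    by move=> s _; rewrite /vv /=; case: ifP; rewrite ?dot0l.
  rewrite [dot (_ *: coroot a) h]dotZl; move: (dot (coroot a) h) => u /=.
  rewrite big_const_seq count_predT size_iota iter_addr addr0 -mulrDr -[LHS]mulr_natl [RHS]mulrCA; congr (_ * _).
  case: ifP => [p1|/negbT]; first by rewrite gtr0_norm //; field.
  by rewrite -leNgt => /ler0_norm ->; rewrite addNr mulr0.
apply: (@topc_ext R C n rc E h 0 (fun z => \prod_(p <- levels eta | p \in levels eta) (EE (cv p.1) z - p.2))).
  by move=> z; rewrite -big_seq.
apply: (topc_prod HE) => p /levelsP [a [s [aP _ _ ->]]]; rewrite /vv /kk /= coroot_gt0 ?(root_neq0 HPhi) //.
have := @topc_aff R C n rc E HE Phi HPhi h (E (- (2 * s%:R))) (E (2 * s%:R)) a hr aP; rewrite /affv /affc (qexpN HE) mulVf ?(qexp_neq0 HE) //.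
apply: topc_ext => z; rewrite /aff /DualOperator.ee; have := qexp_neq0 HE (2 * s%:R); move: (E _) (EE _ _) => X Y X0.
by field.
Qed.

(** After division by all factors of [levels] the support of the quotient is bounded by -(rho_eta,
    h) in every regular direction h. Comparing a generic h with -h leaves the single exponent
    -rho_eta. *)
Lemma product_form x S A eta : uniq S -> (forall nu h', nu \in S -> dot nu h' <= HN h') ->
  (exists2 nu, nu \in S & A nu != 0) -> regular eta ->
  (forall a nu0 s, a \in Phi -> 0 < dot a eta -> (1 <= s <= m a)%N ->
    \sum_(nu <- S | `[< str (coroot a) nu0 nu >]) A nu * yv a x nu ^- s = 0) ->
  exists2 k, k != 0 & forall z, csum x S A z =
    (\prod_(p <- levels eta) (EE (cv p.1) z - p.2)) * (k * EE (x - cv (rhoh eta)) z).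
Proof.
move=> uS Sb An er str0.
have [||||g bg gE] := @divide_levels x setT (levels eta) (csum x S A) _ (levels_uniq eta).
- exact: csum_bsum.
- move=> p /levelsP [a [s [aP _ _ ->]]]; split=> //=; last exact: (qexp_neq0 HE).
  exact/coroot_neq0/(root_neq0 HPhi).
- move=> p p' l /levelsP [a [s [aP pa _ ->]]] /levelsP [b [t [bP pb _ ->]]] /= e.
  have [->//|ab] := eqVneq a b; have [ab'|ab'] := eqVneq a (- b).
    by move: pa; rewrite ab' dotNl oppr_gt0 => /(lt_trans pb); rewrite ltxx.
  by case: (coroot_parallel HPhi aP bP ab ab' e).
- by move=> p z /levelsP [a [s [aP pa sm ->]]] /= ez; apply: (string_vanish aP _ ez) => nu0; exact: str0.
have gn : exists z, g z != 0.
  apply: contrapT => g0; case: An => nu nS; case/negP; apply/eqP.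
  apply: (@csum_eq0 R C n rc E HE x S A uS _ nu nS) => z; rewrite gE [X in _ * X](_ : _ = 0) ?mulr0 //.
  by apply/eqP; apply: contraT => gz; case: g0; exists z.
have [T [c [uT _ gc cn]]] := bsum_nontrivial bg gn.
have Tb h v : regular h -> v \in T -> c v != 0 -> (forall nu, nu \in T -> c nu != 0 -> nu != v -> dot nu h < dot v h) ->
    dot v h <= - dot (rhoh eta) h.
  move=> hr vT cv0 vmax; have [u [k [k0 uE tk]]] := levels_top er hr.
  have tv := @topc_csum_in R C n rc E h x T c v uT vT vmax.
  have := topcM HE tk (topc_ext (fun z => esym (gc z)) tv) => /(topc_ext (fun z => esym (gE z))) tf.
  rewrite leNgt; apply/negP => lt.
  have t0 : topc h x (csum x S A) (u + v) 0.
    apply: topc_below; apply: csum_bsum => nu nS /=; rewrite dotDl uE; apply: le_lt_trans (Sb nu h nS) _.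
    by move: lt; lra.
  have /eqP := topc_inj HE tf t0; by rewrite mulf_eq0 (negPf k0) (negPf cv0).
have [h0 h0P] : exists h, forall v, v \in enum_fset Phi ++ [seq p.1 - p.2 | p <- allpairs pair (- rhoh eta :: T) (- rhoh eta :: T) & p.1 != p.2] -> dot v h != 0.
  apply: avoid_hyperplanes => v; rewrite mem_cat => /orP[/(root_neq0 HPhi) //|/mapP [p]].
  by rewrite mem_filter => /andP[p12 _] ->; rewrite subr_eq0.
have hr : regular h0 by move=> a aP; apply: h0P; rewrite mem_cat aP.
have ig : {in - rhoh eta :: T &, injective (fun u => dot u h0)}.
  move=> u w uS1 wS1 /= e; apply/eqP; apply: contraT => uw.
  have /h0P : u - w \in enum_fset Phi ++ [seq p.1 - p.2 | p <- allpairs pair (- rhoh eta :: T) (- rhoh eta :: T) & p.1 != p.2].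
    rewrite mem_cat; apply/orP; right; apply/mapP; exists (u, w) => //.
    by rewrite mem_filter uw; apply/allpairsP; exists (u, w).
  by rewrite dotBl e subrr eqxx.
have igT : {in T &, injective (fun u => dot u h0)} by move=> u w uT1 wT1; apply: ig; rewrite inE ?uT1 ?wT1 orbT.
have igN : {in T &, injective (fun u => dot u (- h0))} by move=> u w uT1 wT1; rewrite !dotNr => /oppr_inj; exact: igT.
have [v [vT cv0 vmax]] := csum_top uT igT cn.
have [v' [vT' cv0' vmax']] := csum_top uT igN cn.
have le1 := Tb h0 v hr vT cv0 vmax.
have hrN : regular (- h0) by move=> a aP; rewrite dotNr oppr_eq0 hr.
have le2 := Tb (- h0) v' hrN vT' cv0' vmax'.
have only u : u \in T -> c u != 0 -> u = - rhoh eta.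
  move=> uT1 cu; apply: ig; rewrite ?mem_head // ?inE ?uT1 ?orbT //.
  have l1 : dot u h0 <= dot v h0 by have [->//|uv] := eqVneq u v; exact: ltW (vmax u uT1 cu uv).
  have l2 : dot v' h0 <= dot u h0.
    by have [->//|uv] := eqVneq u v'; have := vmax' u uT1 cu uv; rewrite !dotNr ltrN2 => /ltW.
  by apply/eqP; move: le1 le2; rewrite !dotNr dotNl eq_le; move: l1 l2; lra.
have ve := only v vT cv0.
exists (c v) => // z; rewrite gE gc; congr (_ * _).
rewrite /ExponentialSums.csum (bigD1_seq v) //= big_seq_cond big1 ?addr0 ?ve ?cvN //.
move=> u /andP[uT1 uv]; have [->|cu] := eqVneq (c u) 0; first by rewrite mul0r.
by case/eqP: uv; exact: only.
Qed.

(** At this point q^{2(a^vee, z)} is a nonnegative power of q, by dominance, while the factors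
    vanish at q^{-2s} with s >= 1. *)
Lemma product_rhor x S A eta : uniq S -> (forall nu h', nu \in S -> dot nu h' <= HN h') ->
  (exists2 nu, nu \in S & A nu != 0) -> regular eta ->
  (forall a nu0 s, a \in Phi -> 0 < dot a eta -> (1 <= s <= m a)%N ->
    \sum_(nu <- S | `[< str (coroot a) nu0 nu >]) A nu * yv a x nu ^- s = 0) ->
  csum x S A (cv (rhor eta)) != 0.
Proof.
move=> uS Sb An er str0; have [k k0 ->] := product_form uS Sb An er str0.
rewrite !mulf_neq0 ?(EE_neq0 HE) // prodf_seq_neq0; apply/allP => p /levelsP [a [s [aP pos sm ->]]] /=.
have [l lE] := rhor_int HPhi m eta (Qv_coroot aP).
rewrite subr_eq0 /ExponentialSums.EE dot_cv; apply/eqP => e.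
have : E (l + 2 * s%:Z)%:~R = 1.
  rewrite intrD intrM (qexpD HE) -(rmorph_int rc) -lE rmorphM rmorph_nat (dotC (rhor eta)) e.
  by rewrite -pmulrn (qexpN HE) mulVf // (qexp_neq0 HE).
move/(qexp_nroot HE); apply/eqP; apply: lt0r_neq0.
have : 0 <= l%:~R :> R by rewrite -lE dotC mulr_ge0 // (rhor_dominant HPhi m_refl).
rewrite ler0z; case/andP: sm => s1 _; move: s1; clear; lia.
Qed.

End Product.

End ProductForm.
Import ProductForm.

(** * Constancy of the value of psi at (1/2) sum m_a a *)

Module BakerAkhiezer.

Section Value.
Context {R : realType} {C : numClosedFieldType} {n : nat} {rc : {rmorphism R -> C}}.
Context {E : C -> C} (HE : qexponential E).
Context {Phi : {fset 'rV[R]_n}} (HPhi : reduced_irreducible_root_system Phi).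
Context (m : 'rV[R]_n -> nat).
Context (m_refl : forall a b, a \in Phi -> b \in Phi -> m (a *m refl_mx b) = m a).
Local Notation V := ('rV[R]_n).
Local Notation VC := ('rV[C]_n).
Local Notation cv := (cv rc).
Local Notation EE := (@EE C n E).
Local Notation bsum := (@bsum R C n rc E).
Local Notation csum := (@csum R C n rc E).
Local Notation Qv := (@Qv R n Phi).
Local Notation QI := (@QI R C n rc E Phi m).
Local Notation nonres := (@nonres R C n rc E Phi).
Local Notation rhoh := (@rhoh R n Phi m).
Local Notation regular := (@regular R n Phi).
Local Notation Om := (@Om R n Phi m).
Local Notation gener := (@gener R C n rc E).
Local Notation laur := (@laur C E).
Implicit Types (x z w : VC) (a b h u v tau : V) (f g : VC -> C) (L : set V).

Local Notation LQ := (@LQ R n Phi).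
Local Notation ph := (@ph R C n rc E Phi m).
Local Notation rhor := (@rhor R n Phi m).
Local Notation cofin := (@cofin C E).

Lemma cofin_laur_neq0 (F : C -> C) : laur F -> (exists t, F t != 0) -> cofin (fun t => F t != 0).
Proof.
move=> [p [k pE]] [t0 Ft0]; exists p => [|t pt].
  by apply: contraNneq Ft0 => p0; have /eqP := pE t0; rewrite p0 horner0 mulf_eq0 expf_eq0 (negPf (qexp_neq0 HE _)) andbF.
by apply: contraNneq pt => F0; rewrite -pE F0 mulr0.
Qed.

Lemma cofin_poly (q : {poly C}) : q != 0 -> cofin (fun t => q.[E t] != 0).
Proof. by move=> q0; exists q. Qed.

Lemma cofin_opp (P : C -> Prop) : cofin P -> cofin (fun t => P (- t)).
Proof.
move=> [q q0 qP]; apply: (@cofin_mono C E (fun t => q.[E (- t)] != 0)) => [t /qP //|].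
apply: cofin_laur_neq0; last by have [t qt] := cofin_ex HE (cofin_poly q0); exists (- t); rewrite opprK.
apply: (@laur_ext C E (fun t => \sum_(i < size q) q`_i * E (t * (- i%:Z)%:~R))).
  move=> t; rewrite horner_coef; apply: eq_bigr => i _; congr (_ * _).
  by rewrite -(qexpMn HE) mulrNz mulrN -mulNr mulrC.
by apply: laur_sum => i _; apply: laurM; [exact: laur_const|exact: laur_exp].
Qed.

Lemma cofin_shift (P : C -> Prop) s : cofin P -> cofin (fun t => P (t + s)).
Proof.
move=> [q q0 qP]; apply: (@cofin_mono C E (fun t => q.[E (t + s)] != 0)) => [t /qP //|].
apply: cofin_laur_neq0; last by have [t qt] := cofin_ex HE (cofin_poly q0); exists (t - s); rewrite subrK.
apply: (@laur_ext C E (fun t => \sum_(i < size q) (q`_i * E s ^+ i) * E (t * i%:Z%:~R))).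
  move=> t; rewrite horner_coef; apply: eq_bigr => i _; rewrite -mulrA; congr (_ * _).
  by rewrite (qexpD HE) exprMn [RHS]mulrC -(qexpMn HE i t) [t * _]mulrC.
by apply: laur_sum => i _; apply: laurM; [exact: laur_const|exact: laur_exp].
Qed.

(** Regularity at both ends T = 0 and T = infinity: with n the size of [G'], T^n G equals the
    reversed [G'], whose degree is at most n. *)
Lemma poly_two_ends (G G' : {poly C}) : G != 0 ->
  cofin (fun t => G.[E t] = G'.[E (- t)]) -> exists c, G = c%:P.
Proof.
move=> G0 GG'; exists G`_0; apply: size1_polyC.
pose n' := size G'; pose Rv := \sum_(i < n') G'`_i *: 'X^(n' - i).
have RvE : 'X^n' * G = Rv.
  apply: (qexp_poly_eq HE); apply: cofin_mono GG' => t e.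
  rewrite hornerM hornerXn e /Rv horner_sum horner_coef mulr_sumr; apply: eq_bigr => i _.
  rewrite hornerZ hornerXn mulrCA; congr (_ * _); rewrite (qexpN HE) exprVn.
  by rewrite expfB_cond //; rewrite (negPf (qexp_neq0 HE t)); exact: ltnW (ltn_ord i).
have : (size Rv <= n'.+1)%N.
  apply: leq_trans (size_sum _ _ _) _; apply/bigmax_leqP => i _.
  by apply: leq_trans (size_scale_leq _ _) _; rewrite size_polyXn ltnS leq_subr.
rewrite -RvE size_monicM ?monicXn // size_polyXn addSn /= -[n'.+1]addn1 leq_add2l; exact.
Qed.

Lemma nat_nonroot (T : eqType) (F : idomainType) (s : seq T) (p : T -> {poly F}) : (forall k l : nat, k%:R = l%:R :> F -> k = l) ->
  (forall i, i \in s -> p i != 0) -> exists k : nat, forall i, i \in s -> (p i).[k%:R] != 0.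
Proof.
move=> inj p0; pose P := \prod_(i <- s) p i.
have P0 : P != 0 by rewrite prodf_seq_neq0; apply/allP => i /p0.
have [k kP] : exists k : nat, P.[k%:R] != 0.
  apply: contrapT => H; have := max_poly_roots (rs := [seq k%:R | k <- iota 0 (size P)]) P0.
  rewrite size_map size_iota ltnn => /(_ _ _) f; suff : false by []; apply: f.
    by apply/allP => _ /mapP [k _ ->]; apply: contraT => kP; case: H; exists k.
  by rewrite map_inj_uniq ?iota_uniq // => k l; exact: inj.
exists k => i is_; apply: contraNneq kP => e; by rewrite horner_prod (big_rem i) //= e mul0r.
Qed.

(** The combination of the coroots with coefficients 1, k, k^2, ... pairs with a root b in a
    polynomial in k, nonzero because the coroot of b itself occurs; some natural k is a root of none
    of them. *)
Lemma regular_Qv : exists eta, Qv eta /\ regular eta.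
Proof.
pose r := enum_fset Phi.
pose p b : {poly R} := \sum_(i < size r) dot b (coroot (nth 0 r i)) *: 'X^i.
have p0 b : b \in r -> p b != 0.
  move=> bP; have [a aP ab] : exists2 a, a \in r & dot b a != 0.
    by exists b => //; rewrite dot_sq_eq0 (root_neq0 HPhi).
  have ir : (index a r < size r)%N by rewrite index_mem.
  apply: contraNneq ab => e; have := congr1 (fun q : {poly R} => q`_(index a r)) e; rewrite coef0 coef_sum.
  rewrite (bigD1 (Ordinal ir)) //= coefZ coefXn eqxx mulr1 nth_index // big1 ?addr0; last first.
    move=> i ia; rewrite coefZ coefXn [_ == _](_ : _ = false) ?mulr0 //; apply: contraNF ia => /eqP e1.
    by apply/eqP/val_inj; rewrite /= e1.
  by move/eqP; rewrite dotC coroot_eq0 ?(root_neq0 HPhi) // dotC => /eqP ->.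
have [k kP] := nat_nonroot (F := R) (fun k l => @mulrIn R 1 (oner_neq0 _) k l) p0.
exists (\sum_(i < size r) ((k ^ i)%N%:Z)%:~R *: coroot (nth 0 r i)); split.
  by apply: Qv_sum => i _; apply: QvZ; apply: Qv_coroot; rewrite mem_nth.
move=> b bP; apply: contraNneq (kP b bP) => e; apply/eqP; rewrite -[RHS]e horner_sum dot_sumr; apply: eq_bigr => i _.
by rewrite hornerZ hornerXn [RHS]dotZr -pmulrn natrX [LHS]mulrC.
Qed.

Section Fixed.
Context (h0 : V) (h0r : regular h0).
Context (S S9 : seq V) (uS : uniq S) (SP : forall nu, (nu \in S) <-> Om 1 h0 nu).
Context (uS9 : uniq S9) (S9P : forall nu, (nu \in S9) <-> Om 9 h0 nu).
Context (Vf : V -> VC -> C) (Hf : VC -> C) (bV : forall nu, bsum 0 LQ (Vf nu)) (bH : bsum 0 LQ Hf).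
Context (nH : exists x, Hf x != 0).
Context (VH : forall x c, Hf x != 0 -> QI x S c -> c (rhoh h0) = 1 -> forall nu, nu \in S -> c nu = Vf nu x / Hf x).
Local Notation psic := (@psic R C n rc E Phi m h0 S Vf Hf).
Local Notation nice := (@nice R C n rc E Phi m S S9 Hf).
Local Notation wall_ok := (@wall_ok R C n rc E Phi S).

Definition gval x := csum x S (psic x) (cv (rhor h0)).

(** Quasi-invariance moves the evaluation to the point [rhor eta], where the factor q^{2(x, z)}
    contributes exactly the power T^e that clears the coefficients. So the value is regular at T =
    0, and nonzero there by [product_rhor]. *)
Lemma gval_line x0 eta : Qv eta -> regular eta -> cofin (fun t => nice (x0 + t *: cv eta)) ->
  wall_ok x0 eta -> exists2 G : {poly C}, ~~ root G 0 & cofin (fun t => gval (x0 + t *: cv eta) = G.[E t]).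
Proof.
move=> Qe er nl wo.
have [e [N [eE cN vert str0]]] := line_leading HE HPhi m_refl h0r uS SP uS9 S9P bV bH VH Qe er nl wo.
pose A nu := (N nu).[0].
have An : exists2 nu, nu \in S & A nu != 0 by exists (rhoh eta); [exact: (rhoh_S HPhi m_refl h0r SP er)|exact: vert].
have A0 := product_rhor (A := A) HE HPhi m_refl uS (S_bound SP) An er str0.
exists (EE x0 (cv (rhor eta)) *: \sum_(nu <- S) EE (cv nu) (cv (rhor eta)) *: N nu).
  apply: contraNN A0 => /eqP; rewrite hornerZ horner_sum (csumE HE) => e0; apply/eqP; rewrite -[RHS]e0.
  by congr (_ * _); apply: eq_bigr => nu _; rewrite hornerZ mulrC.
apply: cofin_mono (cofin_and nl cN) => t [nt Nt].
have [q _ _] := psic_nice HE HPhi m_refl h0r uS SP uS9 S9P VH nt.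
rewrite /gval -(QIf_rhor HE HPhi m_refl (QI_QIf HE q) h0r er) (csumE HE) hornerZ horner_sum.
have -> : EE (x0 + t *: cv eta) (cv (rhor eta)) = EE x0 (cv (rhor eta)) * E (t * e%:~R).
  rewrite /ExponentialSums.EE -(qexpD HE) -(rmorph_int rc) eE dotDl dotZl dot_cv (dotC eta) rmorphM rmorph_nat.
  by congr E; ring.
rewrite -mulrA; congr (_ * _); rewrite mulr_sumr big_seq [RHS]big_seq; apply: eq_bigr => nu /Nt Nn.
by rewrite hornerZ -Nn; ring.
Qed.

Lemma wall_ok_opp x0 eta : wall_ok x0 eta -> wall_ok x0 (- eta).
Proof.
move=> wo a aP c cs kappa ks t; have := wo a aP c cs kappa ks (- t).
by rewrite cvN scalerN scaleNr.
Qed.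

(** The same line read in the direction -eta gives regularity at T = infinity. *)
Lemma gval_const x0 eta : Qv eta -> regular eta -> cofin (fun t => nice (x0 + t *: cv eta)) ->
  wall_ok x0 eta -> exists2 c, c != 0 & cofin (fun t => gval (x0 + t *: cv eta) = c).
Proof.
move=> Qe er nl wo; have [G G0 cG] := gval_line Qe er nl wo.
have er' : regular (- eta) by move=> a aP; rewrite dotNr oppr_eq0 er.
have nl' : cofin (fun t => nice (x0 + t *: cv (- eta))).
  by apply: cofin_mono (cofin_opp nl) => t; rewrite cvN scalerN scaleNr.
have [G' _ cG'] := gval_line (QvN Qe) er' nl' (wall_ok_opp wo).
have Gn : G != 0 by apply: contraNneq G0 => ->; rewrite /root horner0.
have [c cE] : exists c, G = c%:P.
  apply: (poly_two_ends (G' := G')) => //; apply: cofin_mono (cofin_and cG (cofin_opp cG')) => t [<- <-].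
  by rewrite cvN scalerN scaleNr opprK.
exists c; first by move: Gn; rewrite cE polyC_eq0.
by apply: cofin_mono cG => t ->; rewrite cE hornerC.
Qed.

Definition Ug x := EE (cv (rhor h0)) x * \sum_(nu <- S) EE (cv nu) (cv (rhor h0)) * (Vf nu x * ph h0 x).

Lemma gvalE x : gval x = Ug x / Hf x.
Proof.
rewrite /gval (csumE HE) [EE x _]EEC /Ug -mulrA; congr (_ * _); rewrite mulr_suml big_seq [RHS]big_seq.
by apply: eq_bigr => nu nS; rewrite /LineArgument.psic nS; ring.
Qed.

Lemma Ug_bsum : bsum 0 LQ Ug.
Proof.
apply: (bsumM HE (L1 := LQ) (L2 := LQ)); last exact: LQD.
  have rL : LQ (rhor h0) by move=> eta Qe; exact: rhor_int.
  by have := @bsum_exp R C n rc E 0 LQ 1 _ rL; apply: bsum_ext => x; rewrite add0r mul1r.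
apply: bsum_sum => nu _; apply: bsumZ; apply: (bsumM HE (bV nu) (ph_bsum HE HPhi m h0)); exact: LQD.
Qed.

(** Cross-multiplied, invariance is an identity of exponential sums. If it failed at some x, it
    would fail at a point whose line in the direction eta is generic, along which the value is
    constant. *)
Lemma Ug_direction eta (s : C) x : Qv eta -> regular eta ->
  Ug (x + s *: cv eta) * Hf x = Ug x * Hf (x + s *: cv eta).
Proof.
move=> Qe er; pose W x := Ug (x + s *: cv eta) * Hf x - Ug x * Hf (x + s *: cv eta).
have bW : bsum 0 LQ W.
  apply: bsumB.
    exact: (bsumM HE (bsum_shift0 HE _ Ug_bsum) bH (@LQD _ _ _)).
  exact: (bsumM HE Ug_bsum (bsum_shift0 HE _ bH) (@LQD _ _ _)).
apply/eqP; rewrite -subr_eq0; apply: contraT => Wx; exfalso.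
have g1 : gener setT (fun x0 => W x0 != 0).
  by apply: (gener_sub (subsetT _) (L := LQ)); apply: gener_neq0 bW _; exists x.
have g2 := gener_sub (subsetT _) (gener_line HE (nice_generic HE HPhi S S9P bH nH)).
have g3 := @wall_ok_gener R C n rc E HE Phi HPhi m h0 S SP eta Qe er.
have sT : forall u v, [set: V] u -> [set: V] v -> [set: V] (u + v) by [].
have [x0 [W0 [[_ nl] wo]]] := gener_ex (gener_and HE sT g1 (gener_and HE sT g2 g3)).
have [c c0 cg] := gval_const Qe er (nl eta Qe) wo.
case/negP: W0; rewrite -[x0]addr0 -(scale0r (cv eta)); apply/eqP.
apply: (laur_eq0 HE (laur_line HE x0 bW Qe)).
apply: cofin_mono (cofin_and (cofin_and cg (cofin_shift s cg)) (cofin_and (nl eta Qe) (cofin_shift s (nl eta Qe)))).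
move=> t [[e1 e2] [[_ H1 _] [_ H2 _]]]; rewrite scalerDl addrA in e2 H2.
move: e1 e2; rewrite !gvalE /W => /(canRL (divfK H1)) -> /(canRL (divfK H2)) ->; ring.
Qed.

Lemma Ug_add w1 w2 : (forall x, Ug (x + w1) * Hf x = Ug x * Hf (x + w1)) ->
  (forall x, Ug (x + w2) * Hf x = Ug x * Hf (x + w2)) ->
  forall x, Ug (x + (w1 + w2)) * Hf x = Ug x * Hf (x + (w1 + w2)).
Proof.
move=> h1 h2 x; pose W x := Ug (x + (w1 + w2)) * Hf x - Ug x * Hf (x + (w1 + w2)).
have bW : bsum 0 LQ W.
  apply: bsumB.
    exact: (bsumM HE (bsum_shift0 HE _ Ug_bsum) bH (@LQD _ _ _)).
  exact: (bsumM HE Ug_bsum (bsum_shift0 HE _ bH) (@LQD _ _ _)).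
apply/eqP; rewrite -subr_eq0; apply: contraT => Wx.
have [||z] := bsum_domain HE bW (bsum_shift0 HE w1 bH); first by exists x.
  by have [y Hy] := nH; exists (y - w1); rewrite subrK.
rewrite /W addrA; case/negP; apply/eqP.
have e2 := h2 (z + w1); have e1 := h1 z.
transitivity ((Ug (z + w1 + w2) * Hf (z + w1) - Ug (z + w1) * Hf (z + w1 + w2)) * Hf z +
  (Ug (z + w1) * Hf z - Ug z * Hf (z + w1)) * Hf (z + w1 + w2)); last by rewrite e1 e2 !subrr !mul0r addr0.
ring.
Qed.

(** Lines are controlled only in regular lattice directions; for suitable k, a^vee = (a^vee + k eta)
    - k eta is a difference of multiples of two such directions, and the coroots span. *)
Lemma Ug_shift tau x : Ug (x + cv tau) * Hf x = Ug x * Hf (x + cv tau).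
Proof.
have [eta [Qe er]] := regular_Qv.
have Uc a (s : C) : a \in Phi -> forall x, Ug (x + s *: cv (coroot a)) * Hf x = Ug x * Hf (x + s *: cv (coroot a)).
  move=> aP; pose p b : {poly R} := (dot b (coroot a))%:P + dot b eta *: 'X.
  have [|k kP] := @nat_nonroot _ R (enum_fset Phi) p (fun k l => @mulrIn R 1 (oner_neq0 _) k l).
    move=> b bP; apply: contraNneq (er b bP) => e; have := congr1 (fun q : {poly R} => q`_1) e.
    by rewrite coef0 coefD coefC coefZ coefX /= mulr1 add0r => ->.
  pose v := coroot a + k%:~R *: eta.
  have vr : regular v.
    move=> b bP; apply: contraNneq (kP b bP) => e.
    by apply/eqP; rewrite hornerD hornerC hornerZ hornerX -[RHS]e /v dotDr [dot b (_ *: eta)]dotZr [_ * k%:R]mulrC.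
  have Qvv : Qv v by apply: QvD; [exact: Qv_coroot|exact: QvZ].
  have -> : s *: cv (coroot a) = s *: cv v + (- (s * k%:R)) *: cv eta.
    by rewrite /v cvD cvZint scalerDr scalerA scaleNr addrK.
  by apply: Ug_add => y; apply: Ug_direction.
have [c cE] := root_span_coord HPhi tau.
have -> : cv tau = \sum_(a <- Phi) (rc (c a * (dot a a / 2))) *: cv (coroot a).
  rewrite cE cv_sum big_seq [RHS]big_seq; apply: eq_bigr => a aP.
  rewrite -cvZ /coroot scalerA; congr (cv (_ *: _)); have := root_neq0 HPhi aP.
  by rewrite -dot_sq_eq0 => a0; field.
move: x; have : {subset enum_fset Phi <= Phi} by [].
elim: (enum_fset Phi) => [|a s IH] sP x; first by rewrite big_nil !addr0 mulrC.
rewrite big_cons; apply: Ug_add => y; first by apply: Uc; apply: sP; exact: mem_head.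
by apply: IH => b bs; apply: sP; rewrite inE bs orbT.
Qed.

Lemma gval_generic tau : gener LQ (fun x => gval (x + cv tau) = gval x /\ gval x != 0).
Proof.
have Un : exists x, Ug x != 0.
  have [eta [Qe er]] := regular_Qv.
  have g2 := gener_sub (subsetT _) (gener_line HE (nice_generic HE HPhi S S9P bH nH)).
  have sT : forall u v, [set: V] u -> [set: V] v -> [set: V] (u + v) by [].
  have [x0 [[_ nl] wo]] := gener_ex (gener_and HE sT g2 (@wall_ok_gener R C n rc E HE Phi HPhi m h0 S SP eta Qe er)).
  have [c c0 cg] := gval_const Qe er (nl eta Qe) wo.
  have [t gt] := cofin_ex HE cg; exists (x0 + t *: cv eta).
  by apply: contraNneq c0 => e; rewrite -gt gvalE e mul0r.
apply: (@gener_mono R C n rc E LQ (fun x => Ug x != 0 /\ (Hf x != 0 /\ Hf (x + cv tau) != 0))).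
  move=> x [Ux [Hx Ht]]; rewrite !gvalE; split; last by rewrite mulf_neq0 ?invr_eq0.
  by apply/eqP; rewrite eqr_div // Ug_shift.
apply: (gener_and HE (@LQD _ _ _)); first exact: gener_neq0 Ug_bsum Un.
apply: (gener_and HE (@LQD _ _ _)); first exact: gener_neq0.
exact: (gener_shift HE _ (gener_neq0 bH nH)).
Qed.

End Fixed.

Lemma ba_exists h0 : regular h0 -> exists (S : seq V) (Nf : V -> VC -> C) (Hf : VC -> C),
  [/\ uniq S, forall nu, (nu \in S) <-> Om 1 h0 nu,
      (forall nu, bsum 0 LQ (Nf nu)) /\ bsum 0 LQ Hf,
      gener LQ (fun x => [/\ Hf x != 0, nonres x S, QI x S (fun nu => Nf nu x / Hf x) &
        forall h, regular h -> Nf (rhoh h) x / Hf x = ph h x]) &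
      forall tau, gener LQ (fun x => csum (x + cv tau) S (fun nu => Nf nu (x + cv tau) / Hf (x + cv tau)) (cv (rhor h0)) =
        csum x S (fun nu => Nf nu x / Hf x) (cv (rhor h0)) /\
        csum x S (fun nu => Nf nu x / Hf x) (cv (rhor h0)) != 0)].
Proof.
move=> h0r; have [S uS SP] := Om_enum HPhi m_refl 1 h0; have [S9 uS9 S9P] := Om_enum HPhi m_refl 9 h0.
have [Vf [Hf [bV bH nH VH]]] := @cramer R C n rc E HE Phi HPhi m m_refl h0 h0r S S9 uS SP uS9 S9P.
have pE x z : csum x S (fun nu => Vf nu x * ph h0 x / Hf x) z = csum x S (@psic R C n rc E Phi m h0 S Vf Hf x) z.
  by apply: csum_ext => nu nS; rewrite /psic nS.
exists S, (fun nu x => Vf nu x * ph h0 x), Hf; split=> //.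
- split=> // nu; exact: (bsumM HE (bV nu) (ph_bsum HE HPhi m h0) (@LQD _ _ _)).
- apply: gener_mono (nice_generic HE HPhi S S9P bH nH) => x nx.
  have [q v _] := psic_nice HE HPhi m_refl h0r uS SP uS9 S9P VH nx; have [[nr _] Hx _] := nx.
  split=> //; first last.
    by move=> h hr; rewrite -(v h hr) /LineArgument.psic (rhoh_S HPhi m_refl h0r SP hr).
  move=> a nu0 s aP sm; apply: etrans (q a nu0 s aP sm); rewrite big_seq_cond [RHS]big_seq_cond.
  by apply: eq_bigr => nu /andP[nS _]; rewrite /psic nS.
- by move=> tau; have := gval_generic h0r uS SP uS9 S9P bV bH nH VH tau; apply: gener_mono => x; rewrite !pE.
Qed.

End Value.

End BakerAkhiezer.
Import BakerAkhiezer.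

(** * Weyl orbits of minuscule and quasiminuscule coweights *)

Module WeylOrbits.

Section Orbits.
Context {R : realType} {C : numClosedFieldType} {n : nat} {rc : {rmorphism R -> C}}.
Context {E : C -> C} (HE : qexponential E).
Context {Phi : {fset 'rV[R]_n}} (HPhi : reduced_irreducible_root_system Phi).
Context (m : 'rV[R]_n -> nat).
Context (m_refl : forall a b, a \in Phi -> b \in Phi -> m (a *m refl_mx b) = m a).
Local Notation V := ('rV[R]_n).
Local Notation VC := ('rV[C]_n).
Local Notation Qv := (@Qv R n Phi).
Implicit Types (x z w : VC) (a b h u v tau : V) (f g : VC -> C) (L : set V).

(** Negative multiples are absorbed by passing from a to -a. *)
Lemma Qv_list v : Qv v -> exists2 s : seq V, {subset s <= Phi} & v = \sum_(b <- s) coroot b.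
Proof.
pose P v := exists2 s : seq V, {subset s <= Phi} & v = \sum_(b <- s) coroot b.
have PD u1 u2 : P u1 -> P u2 -> P (u1 + u2).
  move=> [s1 h1 ->] [s2 h2 ->]; exists (s1 ++ s2); last by rewrite big_cat.
  by move=> a; rewrite mem_cat => /orP[/h1|/h2].
have Pn a (k : nat) : a \in Phi -> P (coroot a *+ k).
  move=> aP; elim: k => [|k IH]; first by exists [::]; rewrite ?big_nil.
  rewrite mulrS; apply: PD IH; exists [:: a]; last by rewrite big_seq1.
  by move=> b; rewrite inE => /eqP ->.
move=> [k ->]; rewrite big_seq; elim/big_ind: _ => [||a aP] //.
  by exists [::] => //; rewrite big_nil.
case: (k a) => j; first exact: Pn.
by rewrite NegzE mulrNz -mulNrz -corootN; apply: (Pn (- a) j.+1); rewrite (rootN HPhi).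
Qed.

Lemma corootK a : a != 0 -> coroot (coroot a) = a.
Proof.
move=> a0; rewrite {1}/coroot; have := a0; rewrite -dot_sq_eq0 => d0.
rewrite /coroot dotZl dotZr scalerA -[RHS]scale1r; congr (_ *: _); field; by rewrite d0.
Qed.

Definition small v := forall a, a \in Phi -> [\/ dot v a = 1, dot v a = 0 | dot v a = -1].

Lemma small_refl v b : b \in Phi -> small v -> small (v *m refl_mx b).
Proof.
by move=> bP sv a aP; rewrite refl_dot ?(root_neq0 HPhi) //; apply: sv; rewrite (root_refl HPhi).
Qed.

Lemma smallP v : coweight_lattice Phi v -> (forall a, a \in Phi -> dot v a <= 1) -> small v.
Proof.
move=> cv1 le1 a aP; have := le1 a aP; have := le1 (- a); rewrite (rootN HPhi) => /(_ aP); rewrite dotNr.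
have /intrP [l ->] := cv1 a aP; rewrite -mulrNz => h1 h2.
have {}h1 : - l <= 1 by move: h1; rewrite -(ler_int R).
have {}h2 : l <= 1 by move: h2; rewrite -(ler_int R).
have [e|[e|e]] : l = 1 \/ l = 0 \/ l = -1 by move: h1 h2; clear; lia.
- by constructor 1; rewrite e.
- by constructor 2; rewrite e.
- by constructor 3; rewrite e.
Qed.

(* Two small vectors differing by a sum of coroots are conjugate: some coroot of the sum pairs
   positively with the difference, and reflecting one of the vectors in it removes that coroot. *)
Lemma small_conjugate (s : seq V) u v : {subset s <= Phi} -> small u -> small v ->
  v - u = \sum_(b <- s) coroot b -> exists2 w, weyl Phi w & v = u *m w.
Proof.
have [k] := ubnP (size s); elim: k s u v => // k IH s u v; rewrite ltnS => sk sP su sv e.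
have [e0|ne] := eqVneq (v - u) 0.
  by exists 1%:M; [exact: weyl1|rewrite mulmx1; exact: subr0_eq].
have [b bs pos] : exists2 b, b \in s & 0 < dot b (v - u).
  apply: contrapT => H; move: ne; rewrite -dot_sq_gt0 {1}e dot_suml ltNge => /negP; apply.
  rewrite big_seq; apply: sumr_le0 => b bs; rewrite leNgt; apply/negP => lt; apply: H; exists b => //.
  by move: lt; rewrite coroot_gt0 // (root_neq0 HPhi) // sP.
have bP := sP b bs; have b0 := root_neq0 HPhi bP.
have sP' : {subset rem b s <= Phi} by move=> c /mem_rem /sP.
have sz : (size (rem b s) < k)%N.
  by apply: leq_trans sk; rewrite size_rem // ltn_predL -has_predT; apply/hasP; exists b.
have er : \sum_(c <- rem b s) coroot c = v - u - coroot b by apply: (addIr (coroot b)); rewrite subrK e [RHS](big_rem b bs) addrC.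
rewrite dotBr (dotC b v) (dotC b u) in pos.
have [v1|v1] : dot v b = 1 \/ dot u b = -1.
- by case: (sv b bP) => hv; case: (su b bP) => hu; rewrite hv hu in pos *; clear e er; [left|left|left|lra|lra|right|lra|lra|lra].
- have [||w Ww we] := IH (rem b s) u (v *m refl_mx b) sz sP' su; first exact: small_refl.
    by rewrite er reflE' v1 scale1r addrAC.
  exists (w *m refl_mx b); first by apply: weylM' => //; exact: weyl_refl.
  by rewrite mulmxA -we reflK.
- have [||w Ww we] := IH (rem b s) (u *m refl_mx b) v sz sP' _ sv; first exact: small_refl.
    by rewrite er reflE' v1 scaleN1r opprK opprD addrA.
  by exists (refl_mx b *m w); [exact: weylM|rewrite mulmxA].
Qed.

Section Orbit.
Context (p : V) (hp : quasi_or_minuscule Phi p).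
Context (Wp : seq V) (WP : forall tau, (tau \in Wp) <-> weyl_orbit Phi p tau).

Lemma orb_refl tau b : tau \in Wp -> b \in Phi -> tau *m refl_mx b \in Wp.
Proof.
move=> /WP [w Ww <-] bP; apply/WP; exists (w *m refl_mx b); last by rewrite mulmxA.
by apply: (weylM' Ww); exact: (weyl_refl bP).
Qed.

Lemma orb_weyl tau (w : 'M[R]_n) : tau \in Wp -> weyl Phi w -> tau *m w \in Wp.
Proof.
move=> /WP [w' Ww' <-] Ww; apply/WP; exists (w' *m w); last by rewrite mulmxA.
exact: weylM'.
Qed.

Lemma orb_norm tau : tau \in Wp -> dot tau tau = dot p p.
Proof. by move=> /WP [w Ww <-]; rewrite (weyl_isom HPhi). Qed.

Lemma orb_pull tau a : tau \in Wp -> a \in Phi -> exists (w : 'M[R]_n) b,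
  [/\ weyl Phi w, b \in Phi, tau = p *m w, a = b *m w & dot tau a = dot p b].
Proof.
move=> /WP [w Ww <-] aP; have [w' Ww' [e1 e2]] := weyl_inverse HPhi Ww.
exists w, (a *m w'); split=> //; first exact: (weyl_root HPhi).
  by rewrite -mulmxA e2 mulmx1.
by rewrite -(weyl_isom HPhi _ (a *m w') Ww) -mulmxA e2 mulmx1.
Qed.

Lemma orb_coweight tau : tau \in Wp -> coweight_lattice Phi tau.
Proof.
by move=> tW a aP; have [w [b [_ bP _ _ ->]]] := orb_pull tW aP; have [_ + _] := hp; apply.
Qed.

(** A Weyl element carries the question to p itself, where a pairing above 1 is possible only with
    the root whose coroot is p. *)
Lemma orb_big tau a : tau \in Wp -> a \in Phi -> 1 < dot tau a -> tau = coroot a /\ Qv p.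
Proof.
move=> tW aP; have [w [b [Ww bP -> -> ->]]] := orb_pull tW aP.
have [_ _ [mi|[[c cP pc] qm]]] := hp.
  by move=> lt; have := mi b bP; rewrite ler_norml => /andP[_]; rewrite leNgt lt.
have c0 := root_neq0 HPhi cP; rewrite pc corootK // in qm * => lt.
split; last exact: Qv_coroot.
have [->|bc] := eqVneq b c; first by rewrite (coroot_isom c (fun u v => weyl_isom HPhi u v Ww)).
have [bc'|bc'] := eqVneq b (- c).
  by move: lt; rewrite bc' dotNr (coroot_self c0) ltNge (le_trans _ ler01) // oppr_le0 ler0n.
by have := qm b bP (elimN eqP bc) (elimN eqP bc'); rewrite ler_norml => /andP[_]; rewrite leNgt lt.
Qed.

Lemma orb_le2 tau a : tau \in Wp -> a \in Phi -> dot tau a <= 2.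
Proof.
move=> tW aP; have [le|/(orb_big tW aP) [-> _]] := leP (dot tau a) 1; first by lra.
by rewrite (coroot_self (root_neq0 HPhi aP)).
Qed.

Lemma orb_value tau a : tau \in Wp -> a \in Phi -> 0 < dot tau a -> dot tau a = 1 \/ dot tau a = 2.
Proof.
move=> tW aP; have := orb_le2 tW aP; have /intrP [k ->] := orb_coweight tW aP.
rewrite ltr0z (_ : 2 = 2%:~R :> R) // ler_int => h1 h2.
have [->|->] : k = 1 \/ k = 2 by move: h1 h2; clear; lia.
  by left.
by right.
Qed.

Lemma orb_Qv tau : tau \in Wp -> Qv p -> Qv tau.
Proof.
move=> /WP [w Ww <-]; elim: Ww => [|a w' aP Ww IH] Qp; first by rewrite mulmx1.
have [_ cp _] := hp; have /intrP [k kE] := cp a aP.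
have [w1 W1 [e1 e2]] := weyl_inverse HPhi Ww.
rewrite mulmxA reflE' mulmxBl -scalemxAl kE; apply: QvD; first exact: IH.
apply: QvN; apply: QvZ; rewrite -(coroot_isom a (fun u v => weyl_isom HPhi u v Ww)).
by apply: Qv_coroot; exact: (weyl_root HPhi).
Qed.

(** The last hypothesis puts kappa in the convex hull of the orbit and 0. If kappa has a pairing
    above 1 with a root a, then some tau in the orbit is a^vee, and (kappa, tau) >= (p, p) >=
    (kappa, kappa) forces kappa = tau. Otherwise kappa is small, and small vectors congruent modulo
    the coroot lattice are conjugate: kappa is conjugate to an orbit element or to 0. *)
Lemma orb_hull kappa tau0 : tau0 = 0 \/ tau0 \in Wp -> Qv (kappa - tau0) ->
  (forall h K, 0 <= K -> (forall tau, tau \in Wp -> dot tau h <= K) -> dot kappa h <= K) ->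
  kappa \in Wp \/ kappa = 0.
Proof.
move=> t0 Qk hull.
have ck : coweight_lattice Phi kappa.
  move=> a aP; have [k kE] := Qv_int HPhi Qk aP; rewrite -[kappa](subrK tau0) dotDl kE.
  by rewrite rpredD ?intr_int //; case: t0 => [->|/orb_coweight]; [rewrite dot0l rpred0|exact].
have [[a [aP lt]]|nex] := pselect (exists a, a \in Phi /\ 1 < dot kappa a).
  left; have [tau tW ltau] : exists2 tau, tau \in Wp & 1 < dot tau a.
    apply: contrapT => H; move: lt; rewrite ltNge => /negP; apply; apply: hull => // tau tW.
    by rewrite leNgt; apply/negP => lt; apply: H; exists tau.
  have [te _] := orb_big tW aP ltau; suff -> : kappa = tau by [].
  have a0 := root_neq0 HPhi aP; have da : 0 < dot a a by rewrite dot_sq_gt0.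
  have k2 : 2 <= dot kappa a.
    move: lt; have /intrP [k ->] := ck a aP; rewrite (_ : 2 = 2%:~R :> R) // ler_int ltr1z; clear; lia.
  (* The hull condition in the direction kappa itself, with (sigma, kappa) <= ((sigma, sigma) +
     (kappa, kappa))/2 on the orbit, avoids square roots. *)
  have nk : dot kappa kappa <= dot p p.
    suff : dot kappa kappa <= (dot p p + dot kappa kappa) / 2 by lra.
    apply: hull => [|sg sW]; first by rewrite divr_ge0 // addr_ge0 // dot_sq_ge0.
    have := dot_sq_ge0 (sg - kappa); rewrite dotBl !dotBr (orb_norm sW) (dotC kappa sg); lra.
  apply/eqP; rewrite -subr_eq0 -dot_sq_eq0 eq_le dot_sq_ge0 andbT.
  rewrite dotBl !dotBr (dotC tau kappa) (orb_norm tW).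
  have : dot p p <= dot kappa tau.
    rewrite -(orb_norm tW) te (dotC kappa) !coroot_dot (dotC a (coroot a)) (coroot_self a0) (dotC a kappa).
    by rewrite ler_pM2l ?divr_gt0.
  lra.
have sk : small kappa.
  by apply: smallP => // a aP; rewrite leNgt; apply/negP => lt; apply: nex; exists a.
have small0 : small 0 by move=> a _; rewrite dot0l; constructor 2.
have zero : Qv kappa -> kappa = 0.
  move=> /Qv_list [s sP e]; have [|w _ ->] := small_conjugate sP small0 sk; rewrite ?mul0mx //.
  by rewrite subr0.
case: t0 Qk => [->|tW Qk]; first by rewrite subr0 => /zero; right.
have [Qp|nQ] := pselect (Qv p).
  by right; apply: zero; rewrite -(subrK tau0 kappa); apply: QvD => //; exact: orb_Qv.
have st : small tau0.
  apply: smallP; first exact: orb_coweight.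
  by move=> a aP; rewrite leNgt; apply/negP => lt; have [_ Qp] := orb_big tW aP lt.
have [s sP e] := Qv_list Qk; have [w Ww ->] := small_conjugate sP st sk e.
by left; exact: orb_weyl.
Qed.

End Orbit.

End Orbits.

End WeylOrbits.
Import WeylOrbits.

(** * psi as an eigenfunction of the Macdonald operators in x *)

Module MacdonaldEigen.

Section Macdonald.
Context {R : realType} {C : numClosedFieldType} {n : nat} {rc : {rmorphism R -> C}}.
Context {E : C -> C} (HE : qexponential E).
Context {Phi : {fset 'rV[R]_n}} (HPhi : reduced_irreducible_root_system Phi).
Context (m : 'rV[R]_n -> nat).
Context (m_refl : forall a b, a \in Phi -> b \in Phi -> m (a *m refl_mx b) = m a).
Local Notation V := ('rV[R]_n).
Local Notation VC := ('rV[C]_n).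
Local Notation cv := (cv rc).
Local Notation EE := (@EE C n E).
Local Notation csum := (@csum R C n rc E).
Local Notation Gam := (@Gam R C n rc E).
Local Notation QIf := (@QIf R C n rc E Phi m).
Local Notation QI := (@QI R C n rc E Phi m).
Local Notation nonres := (@nonres R C n rc E Phi).
Local Notation yv := (@yv R C n rc E).
Local Notation rhoh := (@rhoh R n Phi m).
Local Notation HN := (@HN R n Phi m).
Local Notation regular := (@regular R n Phi).
Local Notation Om := (@Om R n Phi m).
Local Notation gener := (@gener R C n rc E).
Implicit Types (x z w : VC) (a b h u v tau : V) (f g : VC -> C) (L : set V).

Local Notation LQ := (@LQ R n Phi).
Local Notation wprod := (@wprod C E).
Local Notation ph := (@ph R C n rc E Phi m).
Local Notation rhor := (@rhor R n Phi m).
Local Notation qn := (@qn C E).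
Local Notation hs := (@hs R C n rc).

Lemma perturb_generic (h : V) (us T : seq V) : exists h', [/\ regular h',
  {in T &, injective (fun u => dot u h')} & forall u, u \in us -> 0 < dot u h -> 0 < dot u h'].
Proof.
pose vs := enum_fset Phi ++ [seq p.1 - p.2 | p <- allpairs pair T T & p.1 != p.2].
have vs0 u : u \in vs -> u != 0.
  rewrite mem_cat => /orP[/(root_neq0 HPhi) //|/mapP [p]].
  by rewrite mem_filter => /andP[p12 _] ->; rewrite subr_eq0.
have [h' [h1 h2]] := perturb h us vs0; exists h'; split=> //.
  by move=> b bP; apply: h1; rewrite mem_cat bP.
move=> u w uS1 wS1 /= e; apply/eqP; apply: contraT => uw.
have /h1 : u - w \in vs.
  rewrite mem_cat; apply/orP; right; apply/mapP; exists (u, w) => //.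
  by rewrite mem_filter uw; apply/allpairsP; exists (u, w).
by rewrite dotBl e subrr eqxx.
Qed.

Definition tr (S : seq V) (c : V -> C) tau nu := if nu - tau \in S then c (nu - tau) else 0.

Lemma csum_tr x S T c tau z : uniq S -> uniq T -> (forall nu, nu \in S -> nu + tau \in T) ->
  csum (x + cv tau) S c z = csum x T (tr S c tau) z.
Proof.
move=> uS uT ST; rewrite -(@csum_supp R C n rc E x [seq nu + tau | nu <- S] T) //.
- rewrite /ExponentialSums.csum big_map big_seq [RHS]big_seq; apply: eq_bigr => nu nS.
  by rewrite /tr addrK nS cvD -addrA [cv tau + _]addrC.
- by rewrite map_inj_uniq //; exact: addIr.
- by move=> _ /mapP [nu nS ->]; rewrite ST.
move=> nu _ /mapP H; rewrite /tr; case: ifP => // nS; case: H; exists (nu - tau) => //.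
by rewrite subrK.
Qed.

Lemma EE_csum_tr x S T c tau z : uniq S -> uniq T -> (forall nu, nu \in S -> nu + tau \in T) ->
  EE (cv tau) z * csum x S c z = csum x T (tr S c tau) z.
Proof.
move=> uS uT ST; rewrite -csum_tr // mulr_sumr; apply: eq_bigr => nu _.
by rewrite addrAC (EEDl HE _ (cv tau)); ring.
Qed.

Lemma nonres_generic (T : seq V) : gener LQ (fun x => nonres x T).
Proof.
apply: (@gener_mono R C n rc E LQ (fun x => forall a, a \in enum_fset Phi -> forall p, p \in allpairs pair T T ->
   EE (cv a) x != (E (rc (dot a p.1 + dot a p.2)))^-1)).
  move=> x H a nu nu' aP nS nS' _; apply/eqP => e.
  have /eqP := H a aP (nu, nu') (allpairs_f pair nS nS'); apply.
  apply: (mulIf (qexp_neq0 HE (rc (dot a nu + dot a nu')))).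
  rewrite mulVf ?(qexp_neq0 HE) // -e /ExponentialSums.EE /StringConditions.yv -!(qexpD HE); congr E.
  by rewrite !dotDr !dot_cv rmorphD; ring.
apply: (gener_seq HE (@LQ0 _ _ _) (@LQD _ _ _)) => a aP; apply: (gener_seq HE (@LQ0 _ _ _) (@LQD _ _ _)) => p _.
by apply: (gener_EE HE (@LQ0 _ _ _)); [exact: (root_neq0 HPhi)|exact: (LQ_root HPhi)].
Qed.

Definition mac_coef tau x :=
  (\prod_(a <- Phi | 0 < dot a tau) (qn (dot (cv a) x - (m a)%:R) / qn (dot (cv a) x))) *
  (\prod_(a <- Phi | dot a tau == 2) (qn (dot (cv a) x - (m a)%:R + 1) / qn (dot (cv a) x + 1))).

Definition mac_regular x := forall a, a \in Phi -> qn (dot (cv a) x) != 0 /\ qn (dot (cv a) x + 1) != 0.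

Lemma mac_regular_generic : gener LQ mac_regular.
Proof.
apply: (@gener_mono R C n rc E LQ (fun x => forall a, a \in enum_fset Phi -> EE (cv a) x != 1 /\ EE (cv a) x != E (- 2))).
  move=> x H a /H [h1 h2]; rewrite !(qn_eq0 HE); split; first by rewrite -[1]/(1 : C) //.
  apply: contraNneq h2; rewrite mulrDr mulr1 (qexpD HE) (qexpN HE) => e.
  by apply/eqP; apply: (mulIf (qexp_neq0 HE 2)); rewrite mulVf ?(qexp_neq0 HE).
apply: (gener_seq HE (@LQ0 _ _ _) (@LQD _ _ _)) => a aP; apply: (gener_and HE (@LQD _ _ _)).
  by apply: (gener_EE HE (@LQ0 _ _ _)); [exact: (root_neq0 HPhi)|exact: (LQ_root HPhi)].
by apply: (gener_EE HE (@LQ0 _ _ _)); [exact: (root_neq0 HPhi)|exact: (LQ_root HPhi)].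
Qed.

(** Telescoping: replacing X by X + 1 shifts the factors [1 - X], ..., [k - X] by one place. *)
Lemma wprod_step (k : nat) X : qn X != 0 -> qn (X - k%:R) / qn X * wprod k (X + 1) = wprod k X.
Proof.
move=> X0; suff e : qn (X - k%:R) * wprod k (X + 1) = qn X * wprod k X by rewrite mulrAC e mulrAC divff ?mul1r.
elim: k => [|k IH]; first by rewrite subr0 /VertexCoefficients.wprod !big_geq.
have wS Y : wprod k.+1 Y = wprod k Y * qn (k.+1%:R - Y) by rewrite /VertexCoefficients.wprod big_nat_recr.
rewrite !wS (_ : k.+1%:R - (X + 1) = - (X - k%:R)); last by rewrite -natr1; ring.
rewrite qnN (_ : k.+1%:R - X = - (X - k.+1%:R)); last by ring.
rewrite qnN !mulrN; congr (- _); rewrite [RHS]mulrA -IH; ring.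
Qed.

Section Orbit.
Context (p : V) (hp : quasi_or_minuscule Phi p).
Context (Wp : seq V) (uW : uniq Wp) (WP : forall tau, (tau \in Wp) <-> weyl_orbit Phi p tau).
Local Notation Wp_refl := (orb_refl WP).

(** For dominant kappa a root pairing to 1 with kappa gives one [wprod_step], and a root pairing to
    2 gives two, the second from the extra product in the coefficient. This matches the
    normalisation of psi with the operator. *)
Lemma mac_vertex kappa h x : kappa \in Wp -> regular h -> (forall a, a \in Phi -> 0 < dot a h -> 0 <= dot a kappa) ->
  mac_regular x -> mac_coef kappa x * ph h (x + cv kappa) = ph h x.
Proof.
move=> kW hr dom xr.
have pos a : a \in Phi -> 0 < dot a kappa -> 0 < dot a h.
  move=> aP ak; rewrite lt_def hr //=; rewrite leNgt; apply/negP => neg.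
  by have := dom (- a); rewrite (rootN HPhi) !dotNl oppr_gt0 neg oppr_ge0 leNgt ak => /(_ aP isT).
rewrite /mac_coef.
have e1 (F : V -> C) : \prod_(a <- Phi | 0 < dot a kappa) F a = \prod_(a <- Phi | 0 < dot a h) (if 0 < dot a kappa then F a else 1).
  rewrite -big_mkcondr big_seq_cond [RHS]big_seq_cond; apply: eq_bigl => a.
  by case: (boolP (a \in Phi)) => //= aP; case: (boolP (0 < dot a kappa)) => ak; rewrite ?andbF ?(pos a aP ak).
have e2 (F : V -> C) : \prod_(a <- Phi | dot a kappa == 2) F a = \prod_(a <- Phi | 0 < dot a h) (if dot a kappa == 2 then F a else 1).
  rewrite -big_mkcondr big_seq_cond [RHS]big_seq_cond; apply: eq_bigl => a.
  case: (boolP (a \in Phi)) => //= aP; case: eqP => ak; rewrite ?andbF ?andbT //.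
  by rewrite pos // ak ltr0n.
rewrite e1 e2 /VertexCoefficients.ph -!big_split big_seq_cond [RHS]big_seq_cond; apply: eq_bigr => b /andP[bP bh] /=.
rewrite dotDr dot_cv; have [q1 q2] := xr b bP.
have [e0|] : dot b kappa = 0 \/ 0 < dot b kappa.
- by have := dom b bP bh; rewrite le_eqVlt => /orP[/eqP <-|]; [left|right].
- by rewrite e0 ltxx eq_sym pnatr_eq0 /= rmorph0 addr0 !mul1r.
move=> b0; have [] := orb_value HPhi hp WP kW bP; rewrite (dotC kappa) // => ->.
- rewrite ltr01 (_ : (1 == 2 :> R) = false) ?mulr1 ?rmorph1 ?wprod_step //.
  by apply/negbTE; rewrite -subr_eq0 [X in X != 0](_ : _ = -1) ?oppr_eq0 ?oner_neq0 //; ring.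
rewrite ltr0n eqxx rmorph_nat.
have := wprod_step (m b) q2; rewrite (_ : dot (cv b) x + 1 - (m b)%:R = dot (cv b) x - (m b)%:R + 1); last by ring.
rewrite -!addrA (_ : 1 + 1 = 2 :> C) ?addrA // => e3; rewrite -mulrA e3; exact: wprod_step.
Qed.

Definition Eo z := \sum_(tau <- Wp) EE (cv tau) z.

Lemma Eo_QI b z (s : nat) : b \in Phi -> Gam (coroot b) z ->
  Eo (z + (s%:R / 2) *: cv b) = Eo (z - (s%:R / 2) *: cv b).
Proof.
move=> bP Gz; rewrite /Eo; have b0 := root_neq0 HPhi bP.
have pW : perm_eq Wp [seq tau *m refl_mx b | tau <- Wp].
  apply: uniq_perm => //; first by rewrite map_inj_uniq // => u v /(congr1 (fun w : V => w *m refl_mx b)); rewrite !reflK.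
  move=> tau; apply/idP/mapP => [tW|[sg sW ->]]; last exact: Wp_refl.
  by exists (tau *m refl_mx b); [exact: Wp_refl|rewrite reflK].
rewrite [RHS](perm_big _ pW) big_map big_seq [RHS]big_seq; apply: eq_bigr => tau tW.
rewrite !(EEDr HE) (EENr HE); congr (_ * _).
  apply/esym; apply: (Gam_str HE) Gz; have /intrP [k kE] := orb_coweight HPhi hp WP tW bP.
  by exists (- k); rewrite reflE' kE mulrNz scaleNr.
rewrite /ExponentialSums.EE -(qexpN HE); congr E; rewrite !dotZr !dot_cv -mulrN; congr (_ * _); rewrite -mulrN; congr (_ * _).
by rewrite refl_dot // refl_self // dotNr rmorphN opprK.
Qed.

Section Residual.
Context (h0 : V) (h0r : regular h0).
Context (S : seq V) (uS : uniq S) (SP : forall nu, (nu \in S) <-> Om 1 h0 nu).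

Definition hull_support := undup (S ++ [seq nu + tau | nu <- S, tau <- Wp]).

Lemma hull_supportP nu : nu \in hull_support -> exists nu0 tau,
  [/\ nu0 \in S, tau = 0 \/ tau \in Wp & nu = nu0 + tau].
Proof.
rewrite mem_undup mem_cat => /orP[nS|/allpairsP [[nu0 tau] /= [nS tW ->]]].
  by exists nu, 0; rewrite addr0; split=> //; left.
by exists nu0, tau; split=> //; right.
Qed.

(** [B] kills the coefficient at the vertex of [h0]. By convexity kappa = v - rho_h, for the top
    exponent v, lies in the hull of the orbit and 0, hence is in the orbit or 0. If kappa = 0, v is
    the killed exponent. If not, in a generic direction h' close to kappa the top exponent can only
    be rho_h' + kappa, and its coefficient cancels by [mac_vertex]. *)
Lemma mac_residual x c0 (c : V -> V -> C) (k : C) : QI x S c0 ->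
  (forall tau, tau \in Wp -> QI (x + cv tau) S (c tau)) ->
  (forall h, regular h -> c0 (rhoh h) = ph h x) ->
  (forall tau h, tau \in Wp -> regular h -> c tau (rhoh h) = ph h (x + cv tau)) ->
  c0 (rhoh h0) != 0 -> nonres x hull_support -> mac_regular x ->
  exists B, forall z, \sum_(tau <- Wp) mac_coef tau x * (csum (x + cv tau) S (c tau) z - csum x S c0 z) +
    k * csum x S c0 z = (Eo z + B) * csum x S c0 z.
Proof.
move=> q0 qt v0 vt c00 nr xr; set T := hull_support in nr.
have uT : uniq T by exact: undup_uniq.
have ST nu : nu \in S -> nu \in T by move=> nS; rewrite mem_undup mem_cat nS.
have STt tau nu : tau \in Wp -> nu \in S -> nu + tau \in T.
  by move=> tW nS; rewrite mem_undup mem_cat; apply/orP; right; apply/allpairsP; exists (nu, tau).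
pose c0' nu := if nu \in S then c0 nu else 0.
pose d0 nu := \sum_(tau <- Wp) mac_coef tau x * (tr S (c tau) tau nu - c0' nu) + k * c0' nu -
  \sum_(tau <- Wp) tr S c0 tau nu.
pose B := d0 (rhoh h0) / c0 (rhoh h0); exists B.
pose d nu := d0 nu - B * c0' nu.
pose F z := \sum_(tau <- Wp) mac_coef tau x * (csum (x + cv tau) S (c tau) z - csum x S c0 z) +
    k * csum x S c0 z - (Eo z + B) * csum x S c0 z.
have cs0 z : csum x S c0 z = csum x T c0' z.
  rewrite (csum_ext x (d := c0')) => [|nu nS]; last by rewrite /c0' nS.
  by apply: csum_supp => // [nu /ST -> //|nu _ /negPf nS]; rewrite /c0' nS.
have FE z : F z = csum x T d z.
  rewrite /F /Eo mulrDl mulr_suml cs0.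
  rewrite (eq_big_seq (fun tau => \sum_(nu <- T) mac_coef tau x * (tr S (c tau) tau nu - c0' nu) * EE (x + cv nu) z)); last first.
    move=> tau tW; rewrite (csum_tr _ _ _ uS uT (STt tau ^~ tW)) /ExponentialSums.csum -sumrB mulr_sumr.
    by apply: eq_bigr => nu _; ring.
  rewrite [X in _ - (X + _)](eq_big_seq (fun tau => \sum_(nu <- T) tr S c0 tau nu * EE (x + cv nu) z)); last first.
    by move=> tau tW; rewrite -cs0 (EE_csum_tr _ _ _ uS uT (STt tau ^~ tW)).
  rewrite exchange_big [X in _ - (X + _)]exchange_big /= /ExponentialSums.csum !mulr_sumr -!big_split -sumrB.
  apply: eq_bigr => nu _ /=; rewrite /d /d0 !mulrBl mulrDl !mulr_suml; ring.
have qF : QIf F.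
  move=> a s z aP sm Gz; rewrite /F (Eo_QI _ aP Gz) (QI_QIf HE q0 aP sm Gz); congr (_ + _ - _).
  rewrite big_seq [RHS]big_seq; apply: eq_bigr => tau tW.
  by rewrite (QI_QIf HE (qt tau tW) aP sm Gz).
have qd : QI x T d by apply: (QIf_QI HE HPhi); apply: QIf_ext qF.
have dv : d (rhoh h0) = 0.
  by rewrite /d /B /c0' (rhoh_S HPhi m_refl h0r SP h0r) divfK // subrr.
suff dz nu : nu \in T -> d nu = 0.
  move=> z; apply/eqP; rewrite -subr_eq0 -/(F z) FE; apply/eqP.
  by rewrite /ExponentialSums.csum big_seq big1 // => nu /dz ->; rewrite mul0r.
move=> nuT; apply/eqP; apply: contraT => dnu; exfalso.
have Tb u h' K : 0 <= K -> (forall tau, tau \in Wp -> dot tau h' <= K) -> u \in T -> dot u h' <= HN h' + K.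
  move=> K0 Kb /hull_supportP [u0 [tau [uS0 t0 ->]]]; rewrite dotDl lerD ?(S_bound SP) //.
  by case: t0 => [->|/Kb //]; rewrite dot0l.
have [h [hr hi hc]] := perturb_generic h0 (enum_fset Phi) T.
have hs a : a \in Phi -> (0 < dot a h) = (0 < dot a h0).
  move=> aP; apply/idP/idP => [ah|]; last exact: hc.
  rewrite lt_def h0r //= leNgt; apply/negP => neg; have := hc (- a).
  by rewrite (rootN HPhi) !dotNl !oppr_gt0 neg => /(_ aP isT); rewrite ltNge (ltW ah).
have [v [vT dv0 vmax]] := csum_top uT hi (ex_intro2 (fun nu => nu \in T) (fun nu => d nu != 0) nu nuT dnu).
have vle u : u \in T -> d u != 0 -> dot u h <= dot v h.
  by move=> uT1 du; have [->//|uv] := eqVneq u v; exact: ltW (vmax u uT1 du uv).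
set kappa := v - rhoh h.
have kle h' K : (forall u, u \in T -> d u != 0 -> dot u h' <= K) -> dot kappa h' + HN h' <= K.
  by move=> H; exact: (QI_convexity HE HPhi m_refl uT qd nr hr vT dv0 vle H).
have [nu0 [tau0 [nS0 t0 ve]]] := hull_supportP vT.
have [||kW|k0] := @orb_hull R n Phi HPhi p hp Wp WP kappa tau0 t0.
- rewrite /kappa ve addrAC addrK (rhoh_ext m hs); by have /SP [] := nS0.
- by move=> h' K K0 Kb; rewrite -(lerD2r (HN h')) addrC [K + _]addrC; rewrite addrC; apply: kle => u uT1 _; exact: Tb.
- clearbody kappa; have kk : 0 < dot kappa kappa by rewrite (orb_norm HPhi WP kW) dot_sq_gt0; have [] := hp.
  pose us := kappa :: enum_fset Phi ++ [seq kappa - tau | tau <- Wp].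
  have [h' [hr' hi' hc']] := perturb_generic kappa us T.
  have kpos : 0 < dot kappa h' by apply: hc'; rewrite ?mem_head.
  have kmax tau : tau \in Wp -> dot kappa h' <= dot tau h' -> tau = kappa.
    move=> tW le; apply/eqP; apply: contraT => ne.
    have : 0 < dot (kappa - tau) h'.
      apply: hc'; first by rewrite inE mem_cat (map_f (fun tau => kappa - tau)) ?orbT.
      have : 0 < dot (kappa - tau) (kappa - tau) by rewrite dot_sq_gt0 subr_eq0 eq_sym.
      rewrite !dotBl !dotBr (orb_norm HPhi WP kW) (orb_norm HPhi WP tW) (dotC tau) -(orb_norm HPhi WP kW); lra.
    by rewrite dotBl subr_gt0 ltNge le.
  have dom a : a \in Phi -> 0 < dot a h' -> 0 <= dot a kappa.
    move=> aP ah; rewrite leNgt; apply/negP => neg; have := hc' (- a).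
    rewrite inE mem_cat (rootN HPhi) aP orbT !dotNl !oppr_gt0 neg => /(_ isT isT).
    by rewrite ltNge (ltW ah).
  have [v' [vT' dv' vmax']] := csum_top uT hi' (ex_intro2 (fun nu => nu \in T) (fun nu => d nu != 0) nu nuT dnu).
  have le1 : dot kappa h' + HN h' <= dot v' h'.
    by apply: kle => u uT1 du; have [->//|uv] := eqVneq u v'; exact: ltW (vmax' u uT1 du uv).
  have inS u tau : tau = 0 \/ tau \in Wp -> u \in S -> v' = u + tau -> tau = kappa.
    move=> t1 uS1 e1; have b1 := S_bound SP h' uS1; rewrite e1 dotDl in le1.
    case: t1 => [t10|tW]; last by apply: kmax => //; rewrite -(lerD2r (HN h')); apply: le_trans le1 _; rewrite addrC lerD2l.
    by move: le1; rewrite t10 dot0l addr0 => /le_trans /(_ b1); rewrite gerDr leNgt kpos.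
  have [u [tau [uS1 t1 e1]]] := hull_supportP vT'; have te := inS u tau t1 uS1 e1; rewrite {}te in e1.
  have ue : u = rhoh h'.
    apply: hi'; rewrite ?ST ?(rhoh_S HPhi m_refl h0r SP hr') //=.
    apply/eqP; rewrite eq_le -(HN_rhoh HPhi m_refl hr') (S_bound SP) //=.
    by move: le1; rewrite e1 dotDl addrC lerD2r.
  have ktr c1 tau1 : tau1 \in Wp -> tau1 != kappa -> tr S c1 tau1 v' = 0.
    move=> tW ne; rewrite /tr; case: ifP => // vS; case/eqP: ne.
    by apply: (inS (v' - tau1)); [right| |rewrite subrK].
  case/negP: dv'; rewrite /d /d0.
  have c0v : c0' v' = 0.
    rewrite /c0'; case: ifP => // vS; have := inS v' 0 (or_introl erefl) vS; rewrite addr0 => /(_ erefl) k0.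
    by move: kk; rewrite -k0 dot0l ltxx.
  have kr c1 : tr S c1 kappa v' = c1 (rhoh h') by rewrite /tr e1 addrK uS1 ue.
  rewrite c0v !mulr0 addr0 subr0 (bigD1_seq kappa) //= [X in _ + X - _](_ : _ = 0); last first.
    by rewrite big_seq_cond big1 // => tau1 /andP[tW ne]; rewrite ktr // subr0 mulr0.
  rewrite [X in _ - X](bigD1_seq kappa) //= [X in _ - (_ + X)](_ : _ = 0); last first.
    by rewrite big_seq_cond big1 // => tau1 /andP[tW ne]; rewrite ktr.
  by rewrite !addr0 subr0 !kr v0 // vt // mac_vertex // subrr.
by case/negP: dv0; rewrite (subr0_eq k0) (rhoh_ext m hs) dv.
Qed.

Section BA.
Context (Nf : V -> VC -> C) (Hf : VC -> C).
Context (ba_ok : gener LQ (fun x => [/\ Hf x != 0, nonres x S, QI x S (fun nu => Nf nu x / Hf x) &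
        forall h, regular h -> Nf (rhoh h) x / Hf x = ph h x])).
Context (ba_val : forall tau, gener LQ (fun x => csum (x + cv tau) S (fun nu => Nf nu (x + cv tau) / Hf (x + cv tau)) (cv (rhor h0)) =
        csum x S (fun nu => Nf nu x / Hf x) (cv (rhor h0)) /\
        csum x S (fun nu => Nf nu x / Hf x) (cv (rhor h0)) != 0)).

Definition bafun x z := csum x S (fun nu => Nf nu x / Hf x) z.

Lemma ph_generic : gener LQ (fun x => ph h0 x != 0).
Proof.
apply: (@gener_mono R C n rc E LQ (fun x => forall a, a \in enum_fset Phi -> wprod (m a) (dot (cv a) x) != 0)).
  move=> x H; rewrite prodf_seq_neq0; apply/allP => a aP; apply/implyP => _; exact: H.
by apply: (gener_seq HE (@LQ0 _ _ _) (@LQD _ _ _)) => a aP; exact: (wprod_generic HE HPhi).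
Qed.

(** The constant left open by [mac_residual] is found at the point [rhor h0]: there the differences
    of psi under the shifts vanish, [Eo] equals the constant term of the operator, and psi is
    nonzero, so it is 0. *)
Lemma mac_eigen : gener LQ (fun x => forall z,
  \sum_(tau <- Wp) mac_coef tau x * (bafun (x + cv tau) z - bafun x z) +
  (\sum_(tau <- Wp) E (2 * rc (dot (rhor h0) tau))) * bafun x z = Eo z * bafun x z).
Proof.
have gW (P : V -> VC -> Prop) : (forall tau, gener LQ (P tau)) -> gener LQ (fun x => forall tau, tau \in Wp -> P tau x).
  by move=> H; apply: (gener_seq HE (@LQ0 _ _ _) (@LQD _ _ _)) => tau _; exact: H.
apply: gener_mono (gener_and HE (@LQD _ _ _) (gener_and HE (@LQD _ _ _) ba_ok (gW _ (fun tau => gener_shift HE (cv tau) ba_ok)))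
  (gener_and HE (@LQD _ _ _) (gener_and HE (@LQD _ _ _) (nonres_generic hull_support) mac_regular_generic)
   (gener_and HE (@LQD _ _ _) ph_generic (gener_and HE (@LQD _ _ _) (ba_val 0) (gW _ ba_val))))).
move=> x [[[Hx nr q v] okt] [[nrT xr] [ph0 [[_ g0] gt]]]] z.
set k := \sum_(tau <- Wp) E _.
have [|||B BE] := @mac_residual x (fun nu => Nf nu x / Hf x) (fun tau nu => Nf nu (x + cv tau) / Hf (x + cv tau)) k q _ v _ _ nrT xr.
- by move=> tau tW; have [] := okt tau tW.
- by move=> tau h tW hr; have [_ _ _ ->] := okt tau tW.
- by rewrite v.
have eo : Eo (cv (rhor h0)) = k.
  by rewrite /Eo /k; apply: eq_bigr => tau _; rewrite /ExponentialSums.EE dot_cv (dotC tau).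
have := BE (cv (rhor h0)); rewrite eo big_seq big1 => [|tau tW]; last first.
  by have [-> _] := gt tau tW; rewrite subrr mulr0.
rewrite add0r mulrDl -{1}[k * _]addr0 => /addrI /esym /eqP; rewrite mulf_eq0 (negPf g0) orbF => /eqP B0.
by rewrite /bafun BE B0 addr0.
Qed.

End BA.

End Residual.

End Orbit.

End Macdonald.

End MacdonaldEigen.
Import MacdonaldEigen.

(** * The factor c_m(z) c_m(-z) *)

Module ShiftFactor.

Section Shift.
Context {R : realType} {C : numClosedFieldType} {n : nat} {rc : {rmorphism R -> C}}.
Context {E : C -> C} (HE : qexponential E).
Context {Phi : {fset 'rV[R]_n}} (HPhi : reduced_irreducible_root_system Phi).
Context (m : 'rV[R]_n -> nat).
Context (m_refl : forall a b, a \in Phi -> b \in Phi -> m (a *m refl_mx b) = m a).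
Local Notation V := ('rV[R]_n).
Local Notation VC := ('rV[C]_n).
Local Notation cv := (cv rc).
Local Notation EE := (@EE C n E).
Local Notation bsum := (@bsum R C n rc E).
Local Notation topc := (@topc R C n rc E).
Local Notation Gam := (@Gam R C n rc E).
Local Notation QIf := (@QIf R C n rc E Phi).
Local Notation rhoh := (@rhoh R n Phi).
Local Notation HN := (@HN R n Phi).
Local Notation regular := (@regular R n Phi).
Implicit Types (x z w : VC) (a b h u v tau : V) (f g : VC -> C) (L : set V).
Local Notation qn := (@qn C E).
Local Notation hs := (@hs R C n rc).
Local Notation ee := (@ee R C n rc E).

Lemma big_root_even (T : Type) (idx : T) (op : Monoid.com_law idx) h h' (F : V -> T) : regular h -> regular h' ->
  (forall a, a \in Phi -> F (- a) = F a) ->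
  \big[op/idx]_(a <- Phi | 0 < dot a h) F a = \big[op/idx]_(a <- Phi | 0 < dot a h') F a.
Proof.
move=> hr hr' Fe; rewrite (bigID (fun a => 0 < dot a h')) [RHS](bigID (fun a => 0 < dot a h)) /=.
congr (op _ _); first by apply: eq_bigl => a; rewrite andbC.
rewrite (big_root_opp HPhi) [LHS]big_seq_cond [RHS]big_seq_cond; apply: eq_big => a.
  case aP: (a \in Phi) => //=; rewrite !dotNl !oppr_gt0; move: (hr a aP) (hr' a aP).
  by case: (ltrgt0P (dot a h)); case: (ltrgt0P (dot a h')).
by move=> /andP[aP _]; exact: Fe.
Qed.

Lemma rhoh_mD (m' m'' m0 : V -> nat) h : (forall a, a \in Phi -> m0 a = (m' a + m'' a)%N) ->
  rhoh m0 h = rhoh m' h + rhoh m'' h.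
Proof.
move=> e; rewrite -scalerDr -big_split /RootSystems.rhoh; congr (_ *: _); rewrite big_seq_cond [RHS]big_seq_cond.
by apply: eq_bigr => a /andP[aP _]; rewrite e // natrD scalerDl.
Qed.

Lemma HN_mD (m' m'' m0 : V -> nat) h : (forall a, a \in Phi -> m0 a = (m' a + m'' a)%N) ->
  HN m0 h = HN m' h + HN m'' h.
Proof.
move=> e; rewrite -mulrDr -big_split /RootSystems.HN; congr (_ * _); rewrite big_seq [RHS]big_seq.
by apply: eq_bigr => a aP; rewrite e // natrD mulrDl.
Qed.

Context (m_pos : forall a, a \in Phi -> (0 < m a)%N).
Local Notation m1 := (fun a => (m a - 1)%N).
Local Notation one := (fun=> 1%N).
Local Notation mp := (fun a => (m a).+1).

Lemma m1_refl a b : a \in Phi -> b \in Phi -> m1 (a *m refl_mx b) = m1 a.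
Proof. by move=> aP bP /=; rewrite m_refl. Qed.

Lemma mp_refl a b : a \in Phi -> b \in Phi -> mp (a *m refl_mx b) = mp a.
Proof. by move=> aP bP /=; rewrite m_refl. Qed.

Lemma one_refl a b : a \in Phi -> b \in Phi -> (one : V -> nat) (a *m refl_mx b) = (one : V -> nat) a.
Proof. by []. Qed.

Lemma m_m1 a : a \in Phi -> m a = (m1 a + 1)%N.
Proof. by move=> /m_pos; rewrite /= => h; rewrite subnK. Qed.

Lemma mp_m a : a \in Phi -> mp a = (m a + 1)%N.
Proof. by move=> _; rewrite addn1. Qed.

(** The product [m_a - u][m_a + u] with u = (a^vee, z), expanded so that it involves only e_a =
    q^{2u} and is visibly even in a. *)
Definition ff a z := E (2 * (m a)%:R) + E (- (2 * (m a)%:R)) - ee a z - (ee a z)^-1.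

Lemma ffN a z : a \in Phi -> ff (- a) z = ff a z.
Proof. by move=> aP; rewrite /ff (eeN HE) invrK (m_opp HPhi m_refl aP); ring. Qed.

Lemma ffE a z : qn ((m a)%:R - dot (cv (coroot a)) z) * qn ((m a)%:R + dot (cv (coroot a)) z) = ff a z.
Proof.
rewrite /ff /DualOperator.ee /ExponentialSums.EE -(qexpN HE); set u := dot _ z; set k : C := (m a)%:R.
have := qn_mul HE (2 * k) (- (2 * u)); rewrite (_ : (2 * k + - (2 * u)) / 2 = k - u); last by field.
rewrite (_ : (2 * k - - (2 * u)) / 2 = k + u); last by field.
by move=> ->; rewrite opprK; ring.
Qed.

Section Chamber.
Context (h0 : V) (h0r : regular h0).

Definition Pz z := \prod_(a <- Phi | 0 < dot a h0) ff a z.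

Lemma Pz_refl b z (j : int) : b \in Phi -> Gam (coroot b) z -> Pz (z + hs b j) = Pz (z + hs b (- j)).
Proof.
move=> bP Gz; rewrite /Pz (big_root_refl HPhi _ _ _ bP) /=.
rewrite (eq_bigl (fun a => 0 < dot a (h0 *m refl_mx b))); last first.
  by move=> a; rewrite refl_dot // (root_neq0 HPhi bP).
rewrite (big_root_even _ (regular_refl HPhi bP h0r) h0r); last first.
  by move=> a aP; rewrite mulNmx ffN // (root_refl HPhi).
rewrite big_seq_cond [RHS]big_seq_cond; apply: eq_bigr => a /andP[aP _].
rewrite /ff m_refl //; have := ee_reflect HE HPhi (- j) aP bP Gz; rewrite opprK => ->.
by [].
Qed.

Lemma Pz_zero b z : b \in Phi -> Gam (coroot b) z -> Pz (z + hs b (m b)) = 0.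
Proof.
move=> bP Gz; have bb : ff b (z + hs b (m b)) = 0.
  rewrite /ff (ee_self HE HPhi _ bP Gz) rmorphM /= -!(qexpN HE) -pmulrn; ring.
have [b0|b0] := boolP (0 < dot b h0).
  by rewrite /Pz (big_rootD1 _ _ bP b0) /= bb mul0r.
have b0' : 0 < dot (- b) h0 by rewrite dotNl oppr_gt0 lt_neqAle (h0r bP) leNgt.
have bP' : - b \in Phi by rewrite (rootN HPhi).
by rewrite /Pz (big_rootD1 _ _ bP' b0') /= ffN // bb mul0r.
Qed.

(** Multiplication raises the level by one: for s < m_a the factor is symmetric and f supplies the
    condition; for s = m_a the factor vanishes at both points. *)
Lemma Pz_QI f : QIf m1 f -> QIf m (fun z => Pz z * f z).
Proof.
move=> q b s z bP /andP[s1 sm] Gz; have e1 := Pz_refl s bP Gz; rewrite -hsN in e1.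
change (Pz (z + hs b s) * f (z + hs b s) = Pz (z - hs b s) * f (z - hs b s)).
move: sm; rewrite leq_eqVlt => /orP[/eqP sm|sm].
  by rewrite -e1 sm (Pz_zero bP Gz) !mul0r.
rewrite e1; congr (_ * _); apply: (q b s z bP) => //.
by rewrite s1 /= subn1 -ltnS prednK // m_pos.
Qed.

Local Notation Bq := (@Bq R n Phi).

Lemma ff_bsum a : a \in Phi -> bsum 0 (Bq (fun h => `|dot (coroot a) h|)) (ff a).
Proof.
move=> aP; have L0 : Bq (fun h => `|dot (coroot a) h|) 0 by split=> [|h]; [exact: Qv0|rewrite dot0l].
have b0 := @bsum_const R C n rc E HE _ (E (2 * (m a)%:R) + E (- (2 * (m a)%:R))) L0.
have b1 := @bsum_exp R C n rc E 0 (Bq (fun h => `|dot (coroot a) h|)) 1 (coroot a)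
    (conj (Qv_coroot aP) (fun h => ler_norm _)).
have b2 : bsum 0 (Bq (fun h => `|dot (coroot a) h|)) (fun z => 1 * EE (0 + cv (- coroot a)) z).
  apply: bsum_exp; split; first exact/QvN/Qv_coroot.
  by move=> h; rewrite dotNl -normrN ler_norm.
apply: bsum_ext (bsumB (bsumB b0 b1) b2) => z; rewrite !add0r !mul1r /ff /DualOperator.ee cvN (EENl HE); ring.
Qed.

Lemma Pz_bsum : bsum 0 (Bq (fun h => 2 * HN one h)) Pz.
Proof.
have : bsum 0 (Bq (fun h => \sum_(a <- [seq a <- Phi | 0 < dot a h0]) `|dot (coroot a) h|)) (fun z => \prod_(a <- [seq a <- Phi | 0 < dot a h0]) ff a z).
  have : {subset [seq a <- Phi | 0 < dot a h0] <= Phi} by move=> a; rewrite mem_filter => /andP[].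
  elim: [seq _ <- _ | _] => [|a s IH] sP.
    apply: bsum_ext (@bsum_const R C n rc E HE _ 1 _) => [z|]; first by rewrite big_nil.
    by split=> [|h]; [exact: Qv0|rewrite dot0l big_nil].
  have := Bq_mul HE (ff_bsum (sP a (mem_head _ _))) (IH (fun b bs => sP b (mem_behead (s := a :: s) bs))).
  move=> /(_ _ (fun h => lexx _)) H; apply: bsum_ext (bsumS _ H) => [z|u [Qu hu]]; first by rewrite big_cons.
  by split=> // h; rewrite big_cons.
move=> H; apply: bsum_ext (bsumS _ H) => [z|u [Qu hu]]; first by rewrite big_filter.
split=> // h; apply: le_trans (hu h) _.
rewrite big_filter (HN_split HPhi one_refl h h0r) mulVKf ?pnatr_eq0 //.
by apply: ler_sum => a _; rewrite mul1r.
Qed.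

Lemma Pz_top h : regular h -> topc h 0 Pz (2 *: rhoh one h) ((-1) ^+ size [seq a <- Phi | 0 < dot a h0]).
Proof.
move=> hr; have -> : (-1) ^+ size [seq a <- Phi | 0 < dot a h0] = (-1) ^+ size [seq a <- Phi | 0 < dot a h] :> C.
  by congr (_ ^+ _); rewrite !size_filter -!sum1_count; exact: big_root_even.
have -> : 2 *: rhoh one h = \sum_(a <- [seq a <- Phi | 0 < dot a h]) coroot a.
  rewrite /RootSystems.rhoh scalerA mulfV ?pnatr_eq0 // scale1r big_filter.
  by apply: eq_bigr => a _; rewrite scale1r.
have : topc h 0 (fun z => \prod_(a <- [seq a <- Phi | 0 < dot a h]) ff a z)
   (\sum_(a <- [seq a <- Phi | 0 < dot a h]) coroot a) ((-1) ^+ size [seq a <- Phi | 0 < dot a h]); last first.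
  apply: topc_ext => z; rewrite big_filter; apply: big_root_even => // a aP; exact: ffN.
have tff a : a \in Phi -> 0 < dot a h -> topc h 0 (ff a) (coroot a) (-1).
  move=> aP ah; have a0 := root_neq0 HPhi aP.
  have t1 := @topc_exp R C n rc E h 0 (coroot a) (-1).
  have t2 := @topc_const R C n rc E HE h (E (2 * (m a)%:R) + E (- (2 * (m a)%:R))).
  have t3 := @topc_exp R C n rc E h 0 (- coroot a) (-1).
  have ca : 0 < dot (coroot a) h by rewrite coroot_gt0.
  have t2' : topc h 0 (fun=> E (2 * (m a)%:R) + E (- (2 * (m a)%:R))) (coroot a) 0 by apply: (topcW t2); rewrite dot0l.
  have t3' : topc h 0 (fun z => -1 * EE (0 + cv (- coroot a)) z) (coroot a) 0.
    by apply: (topcW t3); rewrite dotNl -subr_gt0 opprK addr_gt0.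
  have := topcD (topcD t1 t2') t3'; rewrite !addr0; apply: topc_ext => z.
  by rewrite !add0r /ff /DualOperator.ee cvN (EENl HE); ring.
have : {subset [seq a <- Phi | 0 < dot a h] <= [pred a | (a \in Phi) && (0 < dot a h)]}.
  by move=> a; rewrite mem_filter inE andbC.
elim: [seq _ <- _ | _] => [|a s IH] sP.
  by have := @topc_const R C n rc E HE h 1; rewrite big_nil; apply: topc_ext => z; rewrite big_nil.
have /andP[aP ah] := sP a (mem_head _ _).
have := topcM HE (tff a aP ah) (IH (fun b bs => sP b (mem_behead (s := a :: s) bs))).
by rewrite big_cons /= exprS; apply: topc_ext => z; rewrite big_cons.
Qed.

End Chamber.

End Shift.

End ShiftFactor.
Import ShiftFactor.

(** * Construction of the shift operator by a linear system *)

Module ShiftConstruction.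

Section ShiftOperator.
Context {R : realType} {C : numClosedFieldType} {n : nat} {rc : {rmorphism R -> C}}.
Context {E : C -> C} (HE : qexponential E).
Context {Phi : {fset 'rV[R]_n}} (HPhi : reduced_irreducible_root_system Phi).
Context (m : 'rV[R]_n -> nat).
Context (m_refl : forall a b, a \in Phi -> b \in Phi -> m (a *m refl_mx b) = m a).
Local Notation V := ('rV[R]_n).
Local Notation VC := ('rV[C]_n).
Local Notation cv := (cv rc).
Local Notation EE := (@EE C n E).
Local Notation bsum := (@bsum R C n rc E).
Local Notation csum := (@csum R C n rc E).
Local Notation topc := (@topc R C n rc E).
Local Notation Qv := (@Qv R n Phi).
Local Notation QI := (@QI R C n rc E Phi).
Local Notation nonres := (@nonres R C n rc E Phi).
Local Notation rhoh := (@rhoh R n Phi).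
Local Notation HN := (@HN R n Phi).
Local Notation regular := (@regular R n Phi).
Local Notation Om := (@Om R n Phi).
Local Notation gener := (@gener R C n rc E).
Implicit Types (x z w : VC) (a b h u v tau : V) (f g : VC -> C) (L : set V).

Local Notation LQ := (@LQ R n Phi).
Local Notation ph := (@ph R C n rc E Phi).
Local Notation hs := (@hs R C n rc).

Context (m_pos : forall a, a \in Phi -> (0 < m a)%N).
Local Notation m1 := (fun a => (m a - 1)%N).
Local Notation one := (fun=> 1%N).
Local Notation mp := (fun a => (m a).+1).
Local Notation m1_refl := (m1_refl m_refl).
Local Notation one_refl := (@one_refl R n Phi).

Definition ba_ok m' S (N : V -> VC -> C) (H : VC -> C) x := [/\ H x != 0, nonres x S, QI m' x S (fun nu => N nu x / H x) &
  forall h, regular h -> N (rhoh m' h) x / H x = ph m' h x].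

Section Construction.
Context (h0 : V) (h0r : regular h0).
Context (S : seq V) (uS : uniq S) (SP : forall nu, (nu \in S) <-> Om m 1 h0 nu).
Context (Nf : V -> VC -> C) (Hf : VC -> C) (bN : forall nu, bsum 0 LQ (Nf nu)) (bH : bsum 0 LQ Hf).
Context (S1 : seq V) (uS1 : uniq S1) (S1P : forall nu, (nu \in S1) <-> Om m1 1 h0 nu).
Context (Nf1 : V -> VC -> C) (Hf1 : VC -> C) (bN1 : forall nu, bsum 0 LQ (Nf1 nu)) (bH1 : bsum 0 LQ Hf1).
Context (Z : seq V) (uZ : uniq Z) (ZP : forall nu, (nu \in Z) <-> Om one 1 h0 nu).
Context (T : seq V) (uT : uniq T) (TP : forall nu, (nu \in T) <-> Om mp 1 h0 nu).
Local Notation psi := (@bafun R C n rc E S Nf Hf).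
Local Notation psi1 := (@bafun R C n rc E S1 Nf1 Hf1).
Local Notation Pz := (@Pz R C n rc E Phi m h0).
Local Notation coef := (fun x nu => Nf nu x / Hf x).
Local Notation coef1 := (fun x nu => Nf1 nu x / Hf1 x).

Lemma rhoh_mp h : rhoh mp h = rhoh m h + rhoh one h.
Proof. exact: (rhoh_mD (m' := m) (m'' := one) h (@mp_m R n Phi m)). Qed.

Lemma HN_mp h : HN mp h = HN m h + HN one h.
Proof. exact: (HN_mD (m' := m) (m'' := one) h (@mp_m R n Phi m)). Qed.

Lemma rhoh_m1 h : rhoh m h = rhoh m1 h + rhoh one h.
Proof. exact: (rhoh_mD (m' := m1) (m'' := one) h (m_m1 m_pos)). Qed.

Lemma HN_m1 h : HN m h = HN m1 h + HN one h.
Proof. exact: (HN_mD (m' := m1) (m'' := one) h (m_m1 m_pos)). Qed.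

Lemma two_varrho_Qv : Qv (rhoh one h0 + rhoh one h0).
Proof.
rewrite -mulr2n -scaler_nat /RootSystems.rhoh scalerA mulfV ?pnatr_eq0 // scale1r big_seq_cond.
by apply: Qv_sum => a /andP[aP _]; rewrite scale1r; exact: Qv_coroot.
Qed.

Lemma SZ_T nu mu : nu \in S -> mu \in Z -> nu + mu \in T.
Proof.
move=> /SP [Q1 b1] /ZP [Q2 b2]; apply/TP; split.
  by rewrite rhoh_mp opprD addrACA; exact: QvD.
by move=> h; rewrite mul1r HN_mp dotDl; have := b1 h; have := b2 h; rewrite !mul1r => ? ?; exact: lerD.
Qed.

Lemma T_bound nu h : nu \in T -> dot nu h <= HN m h + HN one h.
Proof. by move=> /TP [_ /(_ h)]; rewrite mul1r HN_mp. Qed.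

Lemma Z_T nu : Qv (nu - rhoh m h0 - rhoh one h0) -> (forall h, dot (nu - rhoh m h0) h <= HN one h) ->
  nu - rhoh m h0 \in Z.
Proof. by move=> Q1 b1; apply/ZP; split=> // h; rewrite mul1r. Qed.

(** The support lies in N_{m-1} + 2 N_1 = N_{m+1}; the class modulo the coroot lattice is right
    because twice the vertex of N_1 is a sum of coroots. *)
Lemma P_coef : exists (Bs : seq V) (pc : V -> C), [/\ forall beta nu, beta \in Bs -> nu \in S1 -> nu + beta \in T &
  forall x z, Pz z * psi1 x z = csum x T (fun mu => (\sum_(beta <- Bs) pc beta *
    (if mu - beta \in S1 then Nf1 (mu - beta) x else 0)) / Hf1 x) z].
Proof.
have [Bs [pc [uB BP _ PE]]] := bsum_csum (@Pz_bsum R C n rc E HE Phi HPhi m h0 h0r).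
have BT beta nu : beta \in Bs -> nu \in S1 -> nu + beta \in T.
  move=> /BP [Qb bb] /S1P [Q1 b1]; apply/TP; split.
    rewrite rhoh_mp rhoh_m1 (_ : nu + beta - _ = (nu - rhoh m1 h0) + beta + - (rhoh one h0 + rhoh one h0)).
      by apply: QvD; [exact: QvD|exact/QvN/two_varrho_Qv].
    by rewrite !opprD !addrA; congr (_ + _ + _); rewrite addrAC.
  move=> h; rewrite mul1r HN_mp HN_m1 dotDl; have := b1 h; have := bb h; rewrite mul1r; lra.
exists Bs, pc; split=> // x z; rewrite PE /ExponentialSums.csum mulr_suml.
rewrite (eq_big_seq (fun beta => \sum_(mu <- T) pc beta * tr S1 (coef1 x) beta mu * EE (x + cv mu) z)); last first.
  move=> beta bB; rewrite add0r -mulrA [EE _ _ * _](EE_csum_tr HE x (coef1 x) (tau := beta) z uS1 uT) => [|nu nS].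
    by rewrite /ExponentialSums.csum mulr_sumr; apply: eq_bigr => mu _; rewrite mulrA.
  exact: BT.
rewrite exchange_big /=; apply: eq_bigr => mu _; rewrite -mulr_suml; congr (_ * _).
rewrite mulr_suml; apply: eq_bigr => beta _; rewrite /tr; case: ifP => _; by [rewrite mulrA|rewrite mulr0 mul0r].
Qed.

Section Coefficients.
Context (Bs : seq V) (pc : V -> C).
Context (PE : forall x z, Pz z * psi1 x z = csum x T (fun mu => (\sum_(beta <- Bs) pc beta *
    (if mu - beta \in S1 then Nf1 (mu - beta) x else 0)) / Hf1 x) z).

Definition gnum mu x := \sum_(beta <- Bs) pc beta * (if mu - beta \in S1 then Nf1 (mu - beta) x else 0).

Local Notation k := (size Z).
Local Notation zz i := (nth 0 Z i).

(* Row [i], column [j]: coefficient of psi_m at [x + zz i], seen at the exponent [rhoh m h0 + zz j];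
   the coefficients of the shift operator solve the corresponding linear system. *)
Definition Mx x : 'M[C]_k := \matrix_(i < k, j < k)
  if rhoh m h0 + zz j - zz i \in S then Nf (rhoh m h0 + zz j - zz i) (x + cv (zz i)) else 0.

Definition gvec x : 'rV[C]_k := \row_j gnum (rhoh m h0 + zz j) x.

(** Cramer's rule through the adjugate, with numerator and denominator [Bd] kept apart as
    exponential sums in x. The factor [Hf] appears because [Mx] contains only the numerators of the
    coefficients of psi_m. *)
Definition Bn nu x := \sum_(i < k | zz i == nu) Hf (x + cv (zz i)) * (gvec x *m \adj (Mx x)) 0 i.

Definition Bd x := \det (Mx x) * Hf1 x.

Definition bb nu x := Bn nu x / Bd x.

Lemma gnum_bsum mu : bsum 0 LQ (gnum mu).
Proof.
apply: bsum_sum => beta _; apply: bsumZ; case: (boolP (mu - beta \in S1)) => _; [exact: bN1|exact: bsum0].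
Qed.

Lemma Mx_bsum i j : bsum 0 LQ (fun x => Mx x i j).
Proof.
have H : bsum 0 LQ (fun x => if rhoh m h0 + zz j - zz i \in S then Nf (rhoh m h0 + zz j - zz i) (x + cv (zz i)) else 0).
  case: (boolP (rhoh m h0 + zz j - zz i \in S)) => _; [exact: (bsum_shift0 HE _ (bN _))|exact: bsum0].
by apply: bsum_ext H => x; rewrite mxE.
Qed.

Lemma Bd_bsum : bsum 0 LQ Bd.
Proof.
apply: (bsumM HE _ bH1 (@LQD _ _ _)).
by apply: (bsum_det HE (@LQ0 _ _ _) (@LQD _ _ _)) => i j; exact: Mx_bsum.
Qed.

Lemma Bn_bsum nu : bsum 0 LQ (Bn nu).
Proof.
apply: bsum_sum => i _; apply: (bsumM HE _ _ (@LQD _ _ _)); first exact: (bsum_shift0 HE _ bH).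
have H : bsum 0 LQ (fun x => \sum_(j < k) gnum (rhoh m h0 + zz j) x * (\adj (Mx x)) j i).
  apply: bsum_sum => j _; apply: (bsumM HE (gnum_bsum _) _ (@LQD _ _ _)).
  have H : bsum 0 LQ (fun x => (-1) ^+ (i + j) * \det (row' i (col' j (Mx x)))).
    apply: bsumZ; apply: (bsum_det HE (@LQ0 _ _ _) (@LQD _ _ _)) => i' j'.
    by apply: bsum_ext (Mx_bsum (lift i i') (lift j j')) => x; rewrite !mxE.
  by apply: bsum_ext H => x; rewrite !mxE.
by apply: bsum_ext H => x; rewrite mxE; apply: eq_bigr => j _; rewrite [gvec _ _ _]mxE.
Qed.

Lemma Bn_out nu x : nu \notin Z -> Bn nu x = 0.
Proof.
move=> nZ; rewrite /Bn big1 // => i /eqP e; case/negP: nZ; by rewrite -e mem_nth.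
Qed.

Definition op_ok x := [/\ forall nu, nu \in Z -> ba_ok m S Nf Hf (x + cv nu), ba_ok m1 S1 Nf1 Hf1 x,
  forall nu, nu \in Z -> ph m h0 (x + cv nu) != 0 & nonres x T].

Lemma op_ok_generic : gener LQ (ba_ok m S Nf Hf) -> gener LQ (ba_ok m1 S1 Nf1 Hf1) -> gener LQ op_ok.
Proof.
move=> g g1.
apply: (@gener_mono R C n rc E LQ (fun x => (forall nu, nu \in Z -> ba_ok m S Nf Hf (x + cv nu)) /\ (ba_ok m1 S1 Nf1 Hf1 x /\
  ((forall nu, nu \in Z -> ph m h0 (x + cv nu) != 0) /\ nonres x T)))); first by move=> x [? [? [? ?]]].
apply: (gener_and HE (@LQD _ _ _)).
  by apply: (gener_seq HE (@LQ0 _ _ _) (@LQD _ _ _)) => nu _; exact: (gener_shift HE _ g).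
apply: (gener_and HE (@LQD _ _ _) g1); apply: (gener_and HE (@LQD _ _ _)); last exact: (nonres_generic HE HPhi).
apply: (gener_seq HE (@LQ0 _ _ _) (@LQD _ _ _)) => nu _; exact: (gener_shift HE _ (ph_generic HE HPhi m h0)).
Qed.

Lemma same_chamber h (U : seq V) : regular h -> exists h', [/\ regular h', {in U &, injective (fun u => dot u h')} &
  forall a, a \in Phi -> (0 < dot a h') = (0 < dot a h)].
Proof.
move=> hr; have [h' [hr' hi hc]] := perturb_generic HPhi h (enum_fset Phi) U.
exists h'; split=> // a aP; apply/idP/idP => [ah|]; last exact: hc.
rewrite lt_def hr //= leNgt; apply/negP => neg; have := hc (- a).
by rewrite (rootN HPhi) !dotNl !oppr_gt0 neg => /(_ aP isT); rewrite ltNge (ltW ah).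
Qed.

(** Triangular for the height in a direction of the chamber of [h0]: psi_m at x + nu has highest
    exponent rho^vee + nu, so an entry vanishes when its column exponent is higher than its row
    exponent. The diagonal entries are nonzero leading coefficients. *)
Lemma Mx_unit x : op_ok x -> \det (Mx x) != 0.
Proof.
move=> [okZ _ phZ _]; apply/negP => /det0P [v v0 vM].
have [h [hr hi hs]] := same_chamber Z h0r.
have [i0 vi0] : exists i, v 0 i != 0.
  apply: contrapT => H; case/eqP: v0; apply/rowP => i; rewrite mxE; apply/eqP.
  by apply: contraT => vi; case: H; exists i.
have i0s : i0 \in [seq i <- enum 'I_k | v 0 i != 0] by rewrite mem_filter vi0 mem_enum.
have [j] := seq_argmax (fun i : 'I_k => dot (zz i) h) i0s; rewrite mem_filter => /andP[vj _] jmax.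
have := congr1 (fun u : 'rV_k => u 0 j) vM; rewrite !mxE (bigD1 j) //= big1 => [|i ij].
  rewrite addr0 mxE addrK (rhoh_S HPhi m_refl h0r SP h0r) => /eqP; rewrite mulf_eq0 (negPf vj) /=.
  have zj : zz j \in Z by rewrite mem_nth.
  have [Hx _ _ vx] := okZ _ zj; have := vx h0 h0r => /(canRL (divfK Hx)) ->.
  by rewrite mulf_eq0 (negPf Hx) (negPf (phZ _ zj)).
have [->|vi] := eqVneq (v 0 i) 0; first by rewrite mul0r.
rewrite mxE; case: ifP => // inS; rewrite ?mulr0 //; exfalso.
have := S_bound SP h inS; rewrite (HN_rhoh HPhi m_refl hr) (rhoh_ext m hs) dotBl dotDl.
rewrite -addrA gerDl subr_le0 => le1.
have le2 : dot (zz i) h <= dot (zz j) h by apply: jmax; rewrite mem_filter vi mem_enum.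
have /eqP : zz i = zz j by apply: hi; rewrite ?mem_nth //; apply/eqP; rewrite eq_le le1 le2.
by rewrite nth_uniq // => /eqP /val_inj e; case/eqP: ij.
Qed.

Definition residual x mu := \sum_(nu <- Z) bb nu x * tr S (coef (x + cv nu)) nu mu - gnum mu x / Hf1 x.

Lemma residual_csum x z : \sum_(nu <- Z) bb nu x * psi (x + cv nu) z - Pz z * psi1 x z = csum x T (residual x) z.
Proof.
rewrite PE /residual.
rewrite (eq_big_seq (fun nu => \sum_(mu <- T) bb nu x * tr S (coef (x + cv nu)) nu mu * EE (x + cv mu) z)); last first.
  move=> nu nZ; rewrite /bafun (csum_tr x (coef (x + cv nu)) z uS uT (fun u uS0 => SZ_T uS0 nZ)).
  by rewrite /ExponentialSums.csum mulr_sumr; apply: eq_bigr => mu _; rewrite mulrA.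
rewrite exchange_big /= /ExponentialSums.csum -sumrB; apply: eq_bigr => mu _.
by rewrite [RHS]mulrBl; congr (_ - _); rewrite mulr_suml.
Qed.

Lemma residual_system x mu : op_ok x -> mu \in Z -> residual x (rhoh m h0 + mu) = 0.
Proof.
move=> ok mZ; have D0 := Mx_unit ok; have [okZ [H1 _ _ _] _ _] := ok.
have jk : (index mu Z < k)%N by rewrite index_mem.
pose j := Ordinal jk; have zj : zz j = mu by rewrite nth_index.
have := congr1 (fun u : 'rV_k => u 0 j) (esym (mulmxA (gvec x) (\adj (Mx x)) (Mx x))).
rewrite mul_adj_mx mul_mx_scalar !mxE zj => e.
apply/eqP; rewrite /residual subr_eq0; apply/eqP; apply: (mulfI D0); rewrite [RHS]mulrA -e [RHS]mulr_suml [LHS]mulr_sumr.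
rewrite (big_nth 0) big_mkord; apply: eq_bigr => i _; have zi : zz i \in Z by rewrite mem_nth.
have [Hi _ _ _] := okZ _ zi.
have -> : bb (zz i) x = Hf (x + cv (zz i)) * (gvec x *m \adj (Mx x)) 0 i / (\det (Mx x) * Hf1 x).
  rewrite /bb /Bn (bigD1 i) //= big1 ?addr0 // => i' /andP[/eqP e1 i'i]; case/eqP: i'i; apply/val_inj.
  by apply/eqP; rewrite /= -(nth_uniq 0 _ _ uZ) //; apply/eqP.
rewrite [Mx x i j]mxE zj /tr; case: ifP => _; last by rewrite !mulr0 mul0r.
move: D0 H1 Hi; move: (\det _) (Hf1 x) (Hf _) ((_ *m _) 0 i) => D H1 Hi g D0 H10 Hi0.
by field; rewrite D0 H10 Hi0.
Qed.

(** For the top exponent v, convexity puts v - rho_h + N_m inside N_m + N_1, hence v - rho_h in N_1.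
    So v is one of the exponents at which the linear system was solved. *)
Lemma residual_zero x mu : op_ok x -> mu \in T -> residual x mu = 0.
Proof.
move=> ok muT; apply/eqP; apply: contraT => dmu; exfalso.
have [okZ [H1 _ q1 _] _ nrT] := ok.
have qR : QI m x T (residual x).
  apply: (QIf_QI HE HPhi); apply: QIf_ext (residual_csum x) _.
  have qP := Pz_QI HE HPhi m_refl m_pos h0r (QI_QIf HE q1).
  move=> a s z aP sm Gz; congr (_ - _); last exact: (qP a s z aP sm Gz).
  rewrite big_seq [RHS]big_seq; apply: eq_bigr => nu nZ; congr (_ * _).
  by have [_ _ q _] := okZ nu nZ; exact: (QI_QIf HE q aP sm Gz).
have [h [hr hi hs]] := same_chamber T h0r.
have [v [vT dv vmax]] := csum_top uT hi (ex_intro2 (fun nu => nu \in T) (fun nu => residual x nu != 0) mu muT dmu).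
have vle u : u \in T -> residual x u != 0 -> dot u h <= dot v h.
  by move=> uT1 du; have [->//|uv] := eqVneq u v; exact: ltW (vmax u uT1 du uv).
suff d0 : residual x v = 0 by rewrite d0 eqxx in dv.
rewrite -(subrK (rhoh m h0) v) addrC; apply: (residual_system ok).
apply: Z_T.
  by have /TP [] := vT; rewrite rhoh_mp opprD addrA.
move=> h'; rewrite -(lerD2r (HN m h')) [HN one h' + _]addrC -(rhoh_ext m hs).
apply: (QI_convexity HE HPhi m_refl uT qR nrT hr vT dv vle) => u uT1 _; exact: T_bound.
Qed.

Lemma op_main x z : op_ok x -> \sum_(nu <- Z) bb nu x * psi (x + cv nu) z = Pz z * psi1 x z.
Proof.
move=> ok; apply/eqP; rewrite -subr_eq0 residual_csum; apply/eqP.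
by rewrite /ExponentialSums.csum big_seq big1 // => mu muT; rewrite (residual_zero ok muT) mul0r.
Qed.

Lemma rhoh_Z h : regular h -> rhoh one h \in Z.
Proof. exact: (rhoh_S HPhi one_refl h0r ZP). Qed.

(** Only the shift by the vertex of N_1 reaches the vertex of N_{m+1} in the direction h; on the
    other side the sign is the top coefficient of [Pz]. *)
Lemma op_lead x h : op_ok x -> regular h -> bb (rhoh one h) x * ph m h (x + cv (rhoh one h)) =
  (-1) ^+ size [seq a <- Phi | 0 < dot a h0] * ph m1 h x.
Proof.
move=> ok hr; have [okZ [H1 _ _ v1] _ _] := ok.
have [h' [hr' hi hs]] := same_chamber (Z ++ T ++ S1) hr.
have hiZ : {in Z &, injective (fun u => dot u h')} by move=> u w uZ1 wZ1; apply: hi; rewrite !mem_cat ?uZ1 ?wZ1.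
have hiT : {in T &, injective (fun u => dot u h')} by move=> u w uT1 wT1; apply: hi; rewrite !mem_cat ?uT1 ?wT1 orbT.
have e1 m' : rhoh m' h' = rhoh m' h by exact: rhoh_ext.
have e2 m' : ph m' h' x = ph m' h x by exact: ph_ext.
have vZ := rhoh_Z hr; set vr := rhoh one h in vZ *.
pose mu := rhoh m h + vr.
have muT : mu \in T by apply: SZ_T vZ; exact: (rhoh_S HPhi m_refl h0r SP hr).
have dmu : dot mu h' = HN m h' + HN one h'.
  by rewrite /mu dotDl -(e1 m) /vr -(e1 one) -(HN_rhoh HPhi m_refl hr') -(HN_rhoh HPhi one_refl hr').
have gl : gnum mu x / Hf1 x = (-1) ^+ size [seq a <- Phi | 0 < dot a h0] * ph m1 h x.
  have tT c : topc h' x (csum x T c) mu (c mu).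
    apply: (@topc_csum_in R C n rc E h' x T c mu uT muT) => u uT1 _ ne; rewrite lt_neqAle dmu T_bound // andbT -dmu.
    by apply: contraNneq ne => e; apply/eqP; exact: hiT.
  have r1 := rhoh_S HPhi m1_refl h0r S1P hr'.
  have t1 : topc h' x (psi1 x) (rhoh m1 h') (coef1 x (rhoh m1 h')).
    apply: (@topc_csum_in R C n rc E h' x S1 (coef1 x) (rhoh m1 h') uS1 r1) => u uS' _ ne.
    rewrite lt_neqAle -(HN_rhoh HPhi m1_refl hr') (S_bound S1P) // andbT (HN_rhoh HPhi m1_refl hr').
    by apply: contraNneq ne => e; apply/eqP; apply: hi; rewrite // !mem_cat ?uS' ?r1 !orbT.
  have := topcM HE (Pz_top HE HPhi m_refl h0r hr') t1; rewrite v1 // e2.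
  have -> : 2 *: rhoh one h' + rhoh m1 h' = mu.
    by rewrite !e1 /mu rhoh_m1 /vr scaler_nat mulr2n addrC addrA.
  move/(topc_ext (PE x)) => tP; exact: (topc_inj HE (tT _) tP).
have := residual_zero ok muT; rewrite /residual gl => /eqP; rewrite subr_eq0 => /eqP <-.
rewrite (bigD1_seq vr) //= big_seq_cond big1 ?addr0.
  rewrite /tr /mu addrK (rhoh_S HPhi m_refl h0r SP hr); congr (_ * _).
  by have [_ _ _ ->] := okZ _ vZ.
move=> nu /andP[nZ nv]; rewrite /tr; case: ifP => inS; last by rewrite mulr0.
have := S_bound SP h' inS; rewrite dotBl dmu.
have zb : dot nu h' <= HN one h' by have /ZP [_ /(_ h')] := nZ; rewrite mul1r.
move=> le1; case/eqP: nv; apply: hiZ => //; apply/eqP; rewrite eq_le.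
have -> : dot vr h' = HN one h' by rewrite /vr -(e1 one) -(HN_rhoh HPhi one_refl hr').
by rewrite zb /=; move: le1; rewrite -addrA gerDl subr_le0.
Qed.

End Coefficients.

End Construction.

End ShiftOperator.

End ShiftConstruction.
Import ShiftConstruction.

(** * From the action on psi to identities of operators *)

Module OperatorIntertwining.

Section Intertwining.
Context {R : realType} {C : numClosedFieldType} {n : nat} {rc : {rmorphism R -> C}}.
Context {E : C -> C} (HE : qexponential E).
Context {Phi : {fset 'rV[R]_n}} (HPhi : reduced_irreducible_root_system Phi).
Context (m : 'rV[R]_n -> nat).
Context (m_refl : forall a b, a \in Phi -> b \in Phi -> m (a *m refl_mx b) = m a).
Local Notation V := ('rV[R]_n).
Local Notation VC := ('rV[C]_n).
Local Notation cv := (cv rc).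
Local Notation EE := (@EE C n E).
Local Notation csum := (@csum R C n rc E).
Local Notation QIf := (@QIf R C n rc E Phi).
Local Notation QI := (@QI R C n rc E Phi).
Local Notation nonres := (@nonres R C n rc E Phi).
Local Notation rhoh := (@rhoh R n Phi).
Local Notation HN := (@HN R n Phi).
Local Notation regular := (@regular R n Phi).
Local Notation Om := (@Om R n Phi).
Local Notation gener := (@gener R C n rc E).
Implicit Types (x z w : VC) (a b h u v tau : V) (f g : VC -> C) (L : set V).

Local Notation LQ := (@LQ R n Phi).
Local Notation wprod := (@wprod C E).
Local Notation ph := (@ph R C n rc E Phi).
Local Notation rhor := (@rhor R n Phi).
Local Notation hs := (@hs R C n rc).

Local Notation ba_ok := (@ba_ok R C n rc E Phi).
Local Notation bafun := (@bafun R C n rc E).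
Local Notation mac_coef := (@mac_coef R C n rc E Phi).

(** A difference operator with its coefficients frozen at x: a finite combination of evaluations at
    x + u, u in [D]. Composites are compared pointwise in x in this form. *)
Definition fop x (D : seq V) (F : (VC -> C) -> C) := exists2 s : seq (C * V), forall p, p \in s -> p.2 \in D &
  forall f, F f = \sum_(p <- s) p.1 * f (x + cv p.2).

Lemma fop_ev x D u : u \in D -> fop x D (fun f => f (x + cv u)).
Proof.
by move=> uD; exists [:: (1, u)] => [p|f]; [rewrite inE => /eqP ->|rewrite big_seq1 mul1r].
Qed.

Lemma fop_add x D F G : fop x D F -> fop x D G -> fop x D (fun f => F f + G f).
Proof.
move=> [s sD sE] [t tD tE]; exists (s ++ t) => [p|f]; last by rewrite big_cat sE tE.
by rewrite mem_cat => /orP[/sD|/tD].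
Qed.

Lemma fop_scale x D F (a : C) : fop x D F -> fop x D (fun f => a * F f).
Proof.
move=> [s sD sE]; exists [seq (a * p.1, p.2) | p <- s] => [_ /mapP [p ps ->]|f]; first exact: (sD p ps).
by rewrite sE big_map mulr_sumr; apply: eq_bigr => p _; rewrite mulrA.
Qed.

Lemma fop_ext x D F G : (forall f, F f = G f) -> fop x D F -> fop x D G.
Proof. by move=> e [s sD sE]; exists s => // f; rewrite -e. Qed.

Lemma fop_sub x D F G : fop x D F -> fop x D G -> fop x D (fun f => F f - G f).
Proof.
by move=> hF hG; apply: fop_ext (fop_add hF (fop_scale (-1) hG)) => f; rewrite mulN1r.
Qed.

Lemma fop_sum x D (s : seq V) (F : V -> (VC -> C) -> C) : (forall u, u \in s -> fop x D (F u)) ->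
  fop x D (fun f => \sum_(u <- s) F u f).
Proof.
elim: s => [|u s IH] H; first by exists [::] => // f; rewrite !big_nil.
apply: fop_ext (fop_add (H u (mem_head _ _)) (IH _)) => [f|v vs]; first by rewrite big_cons.
by apply: H; rewrite inE vs orbT.
Qed.

Section Fixed.
Context (h0 : V) (h0r : regular h0).
Context (S : seq V) (uS : uniq S) (SP : forall nu, (nu \in S) <-> Om m 1 h0 nu).
Context (Nf : V -> VC -> C) (Hf : VC -> C).
Local Notation psi := (bafun S Nf Hf).

(** Among the shifts with nonzero coefficient, the highest one u for the chamber of [h0] is alone in
    reaching the exponent rho^vee + u, where psi at x + u has the nonzero coefficient [ph]. *)
Lemma fop_zero x D F : fop x D F -> (forall u, u \in D -> ba_ok m S Nf Hf (x + cv u) /\ ph m h0 (x + cv u) != 0) ->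
  (forall z, F (fun y => psi y z) = 0) -> forall f, F f = 0.
Proof.
move=> [s sD sE] okD F0.
pose D' := undup D; pose e u := \sum_(p <- s | p.2 == u) p.1.
have gE (G : V -> C) : \sum_(p <- s) p.1 * G p.2 = \sum_(u <- D') e u * G u.
  rewrite /e (eq_bigr (fun u => \sum_(p <- s) (if p.2 == u then p.1 * G u else 0))); last first.
    by move=> u _; rewrite mulr_suml big_mkcond.
  rewrite exchange_big big_seq [RHS]big_seq; apply: eq_bigr => p ps.
  rewrite (bigD1_seq p.2) ?undup_uniq ?mem_undup ?sD //= eqxx big1 ?addr0 // => u ne.
  by rewrite eq_sym (negPf ne).
have FE f : F f = \sum_(u <- D') e u * f (x + cv u) by rewrite sE (gE (fun u => f (x + cv u))).
suff e0 u : u \in D' -> e u = 0 by move=> f; rewrite FE big_seq big1 // => u /e0 ->; rewrite mul0r.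
move=> uD; apply/eqP; apply: contraT => eu; exfalso.
pose T := undup [seq nu + v | nu <- S, v <- D'].
have uT : uniq T by exact: undup_uniq.
have ST v nu : v \in D' -> nu \in S -> nu + v \in T.
  by move=> vD nS; rewrite mem_undup; apply/allpairsP; exists (nu, v).
have [h [hr hi hs]] := same_chamber HPhi (S ++ D') h0r.
have hiD : {in D' &, injective (fun u => dot u h)} by move=> v w vD wD; apply: hi; rewrite mem_cat ?vD ?wD orbT.
have hiS : {in S &, injective (fun u => dot u h)} by move=> v w vD wD; apply: hi; rewrite mem_cat ?vD ?wD.
have [v [vD ev vmax]] := csum_top (undup_uniq D) hiD (ex_intro2 (fun u => u \in D') (fun u => e u != 0) u uD eu).
have [[Hx _ _ vx] phv] := okD v (etrans (esym (mem_undup D v)) vD).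
have rS := rhoh_S HPhi m_refl h0r SP hr.
pose dd mu := \sum_(w <- D') e w * tr S (fun nu => Nf nu (x + cv w) / Hf (x + cv w)) w mu.
have dz mu : mu \in T -> dd mu = 0.
  apply: (@csum_eq0 R C n rc E HE x T dd uT) => z; apply: etrans (F0 z); rewrite FE.
  rewrite [RHS](eq_big_seq (fun w : V => \sum_(mu <- T) e w * tr S (fun nu => Nf nu (x + cv w) / Hf (x + cv w)) w mu * EE (x + cv mu) z)); last first.
    move=> w wD; rewrite /MacdonaldEigen.bafun (csum_tr x _ z uS uT (fun nu nS => ST w nu wD nS)) /ExponentialSums.csum mulr_sumr.
    by apply: eq_bigr => mu' _; rewrite mulrA.
  by rewrite exchange_big; apply: eq_bigr => mu' _; rewrite mulr_suml.
have := dz (rhoh m h + v) (ST v _ vD rS); rewrite /dd (bigD1_seq v) ?undup_uniq //= big_seq_cond big1 ?addr0.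
  rewrite /tr addrK rS vx // (ph_ext m _ hs) => /eqP.
  by rewrite mulf_eq0 (negPf ev) (negPf phv).
move=> w /andP[wD wv]; have [->|ew] := eqVneq (e w) 0; first by rewrite mul0r.
rewrite /tr; case: ifP => inS; last by rewrite mulr0.
have := S_bound SP h inS; rewrite (HN_rhoh HPhi m_refl hr) dotBl dotDl -addrA gerDl subr_le0.
by rewrite leNgt vmax.
Qed.

(** Both sums are placed in the union of their supports; the difference vanishes at one vertex, and
    [QI_vertex] does the rest. *)
Lemma ba_unique x T c : ba_ok m S Nf Hf x -> uniq T -> (forall nu h, nu \in T -> dot nu h <= HN m h) ->
  nonres x (undup (S ++ T)) -> QIf m (csum x T c) -> rhoh m h0 \in T -> c (rhoh m h0) = ph m h0 x ->
  forall z, csum x T c z = psi x z.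
Proof.
move=> [Hx nr q v] uT Tb nrU qT rT cT z; pose U := undup (S ++ T).
have uU : uniq U by exact: undup_uniq.
have ext (S' : seq V) (c' : V -> C) : uniq S' -> {subset S' <= U} -> forall z, csum x S' c' z = csum x U (fun nu => if nu \in S' then c' nu else 0) z.
  move=> uS' sub z'; rewrite (csum_ext x (d := fun nu => if nu \in S' then c' nu else 0)); last by move=> nu /= ->.
  by apply: csum_supp => // [nu /sub -> //|nu _ /negPf ->].
have SU : {subset S <= U} by move=> nu nS; rewrite mem_undup mem_cat nS.
have TU : {subset T <= U} by move=> nu nS; rewrite mem_undup mem_cat nS orbT.
rewrite /MacdonaldEigen.bafun (ext T c uT TU) (ext S _ uS SU).
pose d nu := (if nu \in T then c nu else 0) - (if nu \in S then Nf nu x / Hf x else 0).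
have dE z' : csum x U (fun nu => if nu \in T then c nu else 0) z' - csum x U (fun nu => if nu \in S then Nf nu x / Hf x else 0) z' = csum x U d z'.
  by rewrite /ExponentialSums.csum -sumrB; apply: eq_bigr => nu _; rewrite mulrBl.
have qd : QI m x U d.
  apply: (QIf_QI HE HPhi); apply: QIf_ext dE _ => a s w aP sm Gw.
  by rewrite -!ext // (qT a s w aP sm Gw) (QI_QIf HE q aP sm Gw).
have Ub nu h : nu \in U -> dot nu h <= HN m h.
  by rewrite mem_undup mem_cat => /orP[/(S_bound SP)|/Tb].
have d0 : d (rhoh m h0) = 0 by rewrite /d rT (rhoh_S HPhi m_refl h0r SP h0r) cT v // subrr.
apply/eqP; rewrite -subr_eq0 dE; apply/eqP; rewrite /ExponentialSums.csum big_seq big1 // => nu nU.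
have [->|dn] := eqVneq (d nu) 0; first by rewrite mul0r.
have := QI_vertex HE HPhi m_refl uU Ub qd nrU (ex_intro2 (fun nu => nu \in U) (fun nu => d nu != 0) nu nU dn) h0r.
by rewrite d0 eqxx.
Qed.

Section Operator.
Context (p : V) (Wp : seq V).
Context (m1 : V -> nat) (psi1 : VC -> VC -> C) (P : VC -> C).
Context (Z : seq V) (b : V -> VC -> C).
Local Notation Eo := (@Eo R C n rc E Wp).

Definition Dop m' f x := \sum_(tau <- Wp) mac_coef m' tau x * (f (x + cv tau) - f x) +
  (\sum_(tau <- Wp) E (2 * rc (dot (rhor m' h0) tau))) * f x.

Definition Sop f x := \sum_(nu <- Z) b nu x * f (x + cv nu).

Lemma intertwining : gener LQ (ba_ok m S Nf Hf) ->
  gener LQ (fun x => forall z, Dop m (fun y => psi y z) x = Eo z * psi x z) ->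
  gener LQ (fun x => forall z, Dop m1 (fun y => psi1 y z) x = Eo z * psi1 x z) ->
  gener LQ (fun x => forall z, Sop (fun y => psi y z) x = P z * psi1 x z) ->
  gener LQ (fun x => forall f, Dop m1 (Sop f) x = Sop (Dop m f) x).
Proof.
move=> gok ge ge1 gS; pose D := Z ++ [seq nu + tau | nu <- Z, tau <- Wp].
have gall (Q : VC -> Prop) (s : seq V) : gener LQ Q -> gener LQ (fun x => forall u, u \in s -> Q (x + cv u)).
  by move=> H; apply: (gener_seq HE (@LQ0 _ _ _) (@LQD _ _ _)) => u _; exact: (gener_shift HE _ H).
have gA P0 Q0 := @gener_and R C n rc E HE LQ (@LQD R n Phi) P0 Q0.
apply: gener_mono (gA _ _ (gall _ D (gA _ _ gok (ph_generic HE HPhi m h0))) (gA _ _ (gall _ Z ge) (gA _ _ ge1 (gA _ _ gS (gall _ Wp gS))))).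
move=> x [okD [eZ [e1 [S0 SW]]]] f; apply/eqP; rewrite -subr_eq0; apply/eqP.
have evZ nu : nu \in Z -> fop x D (fun f => f (x + cv nu)) by move=> nZ; apply: fop_ev; rewrite mem_cat nZ.
have evZW nu tau : nu \in Z -> tau \in Wp -> fop x D (fun f => f (x + cv nu + cv tau)).
  move=> nZ tW; apply: (@fop_ext x D (fun f => f (x + cv (nu + tau)))) => [g|]; first by rewrite cvD addrA.
  by apply: fop_ev; rewrite mem_cat; apply/orP; right; apply/allpairsP; exists (nu, tau).
have fS : fop x D (fun f => Sop f x) by apply: fop_sum => nu nZ; exact/fop_scale/evZ.
apply: (@fop_zero x D (fun f => Dop m1 (Sop f) x - Sop (Dop m f) x)) => //.
  apply: fop_sub.
    apply: fop_add; last exact: fop_scale.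
    apply: fop_sum => tau tW; apply: fop_scale; apply: fop_sub fS.
    apply: fop_sum => nu nZ; apply: fop_scale.
    by apply: fop_ext (evZW nu tau nZ tW) => g; rewrite addrAC.
  apply: fop_sum => nu nZ; apply: fop_scale; apply: fop_add; last exact/fop_scale/evZ.
  apply: fop_sum => tau tW; apply: fop_scale; apply: fop_sub; [exact: evZW|exact: evZ].
move=> z; rewrite {1}/Dop S0.
rewrite (eq_big_seq (fun tau => P z * (mac_coef m1 tau x * (psi1 (x + cv tau) z - psi1 x z)))); last first.
  by move=> tau tW; rewrite (SW tau tW z); ring.
rewrite -mulr_sumr mulrCA -mulrDr -/(Dop m1 (fun y => psi1 y z) x) e1 {1}/Sop.
rewrite (eq_big_seq (fun nu => Eo z * (b nu x * psi (x + cv nu) z))); last first.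
  by move=> nu nZ; rewrite (eZ nu nZ z); ring.
by rewrite -mulr_sumr -/(Sop (fun y => psi y z) x) S0; ring.
Qed.

End Operator.

End Fixed.

Lemma trmx_refl a : (refl_mx a)^T = refl_mx a.
Proof.
apply/matrixP => i j; rewrite !mxE !big_ord1 !mxE (eq_sym j); ring.
Qed.

Lemma ph_refl a h x : a \in Phi -> ph m (h *m refl_mx a) x = ph m h (x *m map_mx rc (refl_mx a)).
Proof.
move=> aP; have a0 := root_neq0 HPhi aP; rewrite /VertexCoefficients.ph (big_root_refl HPhi _ _ _ aP) /=.
rewrite big_seq_cond [RHS]big_seq_cond; apply: eq_big => [b|b /andP[bP _]].
  by case: (b \in Phi) => //=; rewrite refl_isom.
rewrite m_refl //; congr (wprod _ _); rewrite /ExponentialSums.cv map_mxM dot_mulmxl; congr (dot _ (_ *m _)).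
by rewrite -[in RHS](trmx_refl a); apply/matrixP => i j; rewrite !mxE.
Qed.

Lemma ph_weyl (w : 'M[R]_n) h x : weyl Phi w -> ph m (h *m w) x = ph m h (x *m map_mx rc (invmx w)).
Proof.
move=> Ww; elim: Ww h => [|a w' aP Ww IH] h; first by rewrite invmx1 map_mx1 !mulmx1.
have [_ [e1 e2]] := weyl_invmx HPhi Ww; have [_ [e3 e4]] := weyl_invmx HPhi (weylM aP Ww).
have a2 : refl_mx a *m refl_mx a = 1%:M.
  by apply: (root_mx_ext HPhi) => b _; rewrite mulmxA (reflK _ (root_neq0 HPhi aP)) mulmx1.
have -> : invmx (refl_mx a *m w') = invmx w' *m refl_mx a.
  rewrite -[RHS]mulmx1 -e3 !mulmxA -[_ *m refl_mx a *m refl_mx a]mulmxA a2 mulmx1 e2 mul1mx.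
  by [].
by rewrite mulmxA IH ph_refl // map_mxM mulmxA.
Qed.

End Intertwining.

End OperatorIntertwining.
Import OperatorIntertwining.

(** * Exponential sums on complex space: differentiability, density and meromorphy *)

Module ComplexTopology.

Section Topology.
Context {R : realType} {n : nat} (lq : Cplx R).
Local Notation C := (Cplx R).
Local Notation V := ('rV[R]_n).
Local Notation VC := ('rV[C]_n).
Definition rcC : {rmorphism R -> C} := real_complex R.
Local Notation E := (qpow lq).
Local Notation EE := (@EE C n E).
Local Notation bsum := (@bsum R C n rcC E).
Implicit Types (x z w : VC) (f : VC -> C).

Lemma qexponential_qpow (q : C) : q != 0 -> cexp lq = q -> (forall k : nat, (0 < k)%N -> q ^+ k != 1) ->
  qexponential E.
Proof.
move=> q0 qe qn.
have lq0 : lq != 0.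
  apply: contraNneq (qn 1%N isT) => l0; by rewrite -qe l0 cexp0 expr1n.
have ek (k : nat) : cexp (k%:R * lq) = q ^+ k.
  elim: k => [|k IH]; first by rewrite mul0r cexp0.
  by rewrite -natr1 mulrDl mul1r cexpD IH qe exprSr.
split.
- by move=> a b; rewrite /qpow mulrDl cexpD.
- by move=> z z0; have [w wz] := cexp_surj z0; exists (w / lq); rewrite /qpow divfK.
- exists (twopii / lq); first by rewrite mulf_neq0 ?invr_eq0 // twopii_neq0.
  move=> a; split.
    move=> /cexp_eq1 [k kE]; exists k; by rewrite mulrA -kE mulfK.
  by move=> [k ->]; rewrite /qpow mulrA divfK // cexp_twopii.
move=> [k|k].
  rewrite /qpow -pmulrn ek; case: k => // k e; by have := qn k.+1 isT; rewrite e eqxx.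
rewrite /qpow NegzE mulrNz mulNr cexpN -pmulrn ek => /(congr1 GRing.inv); rewrite invrK invr1 => e.
by have := qn k.+1 isT; rewrite e eqxx.
Qed.

Lemma differentiable_dot (u : VC) x : differentiable (fun y : VC => dot u y : C) x.
Proof.
have -> : (fun y : VC => dot u y : C) = \sum_(i < n) (u 0 i *: (fun y : VC => y 0 i : C)).
  apply/funext => y; rewrite dotE fct_sumE; by apply: eq_bigr.
apply: differentiable_sum => i; apply: differentiableZ; exact: differentiable_coord.
Qed.

Lemma differentiable_EE (u : VC) x : differentiable (EE u : VC -> C) x.
Proof.
have -> : (EE u : VC -> C) = (@cexp R : C -> C) \o ((2 * lq) *: (fun y : VC => dot u y : C)).
  by apply/funext => y; rewrite /ExponentialSums.EE /qpow /=; congr cexp; rewrite /GRing.scale /= mulrAC.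
apply: differentiable_comp; last exact: differentiable_cexp.
by apply: differentiableZ; exact: differentiable_dot.
Qed.

Lemma bsum_differentiable L f x : bsum 0 L f -> differentiable f x.
Proof.
move=> [s [_ fE]]; have -> : f = \sum_(i < size s) (nth (0, 0) s i).1 *: (EE (0 + cv rcC (nth (0, 0) s i).2) : VC -> C).
  by apply/funext => y; rewrite fE fct_sumE (big_nth (0, 0)) big_mkord.
apply: differentiable_sum => i; apply: differentiableZ; exact: differentiable_EE.
Qed.

Lemma bsum_open L f : bsum 0 L f -> open [set x | f x != 0].
Proof.
move=> bf; rewrite openE => x /= fx.
exact: (cvgr_neq0 _ (differentiable_continuous (bsum_differentiable x bf)) fx).
Qed.

Lemma shift_continuous (v : VC) : continuous (fun x : VC => x + v).
Proof.
move=> x; apply: (@continuousD C VC VC idfun (cst v) x); first exact: cvg_id.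
exact: cst_continuous.
Qed.

Lemma line_continuous (x v : VC) : continuous (fun t : C => x + t *: v).
Proof.
move=> t; apply: (@continuousD C VC C (cst x) ( *:%R^~ v) t); first exact: cst_continuous.
exact: scalel_continuous.
Qed.

(** On equally spaced points of the segment from x0 in the open set to x1 with f(x1) nonzero, f is
    an exponential sequence. If it vanished at the first [size s] of them, which lie in the open set
    for fine spacing, it would vanish at the M-th, which is x1. *)
Lemma bsum_nonzero_dense (HE : qexponential E) L f : bsum 0 L f -> (exists x, f x != 0) -> dense [set x | f x != 0].
Proof.
move=> [s [_ fE]] [x1 fx1] O [x0 Ox0] oO.
pose w := x1 - x0.
have [M M0 MP] : exists2 M : nat, (0 < M)%N & forall k, (k < size s)%N -> O (x0 + (k%:R / M%:R) *: w).
  have : nbhs (0 : C) ((fun t : C => x0 + t *: w) @^-1` O).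
    by apply: line_continuous; rewrite scale0r addr0; exact: open_nbhs_nbhs.
  move=> /nbhs_ballP [e /= e0 eO]; have eE : e = (complex.Re e)%:C%C by rewrite RRe_real // gtr0_real.
  have r0 : 0 < complex.Re e by rewrite -ltcR -eE.
  pose M := (Num.truncn ((size s)%:R / complex.Re e)).+1.
  exists M => // k ks; apply: eO; rewrite /ball /= sub0r normrN.
  have -> : k%:R / M%:R = ((k%:R / M%:R)%:C)%C :> C by rewrite fmorph_div !rmorph_nat.
  rewrite ger0_norm ?ler0c ?divr_ge0 // eE ltcR ltr_pdivrMr ?ltr0n // mulrC -ltr_pdivrMr //.
  by apply: lt_trans (truncnS_gt _); rewrite ltr_pM2r ?invr_gt0 // ltr_nat.
pose y (p : C * V) := EE (cv rcC p.2) (M%:R^-1 *: w).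
have fk (k : nat) : f (x0 + (k%:R / M%:R) *: w) = \sum_(p <- [seq (p.1 * EE (cv rcC p.2) x0, y p) | p <- s]) p.1 * p.2 ^+ k.
  rewrite fE big_map; apply: eq_bigr => p _ /=; rewrite add0r (EEDr HE) -mulrA; congr (_ * (_ * _)).
  by rewrite -scalerA (EEnat HE).
apply: contrapT => H.
have z0 k : \sum_(p <- [seq (p.1 * EE (cv rcC p.2) x0, y p) | p <- s]) p.1 * p.2 ^+ k = 0.
  apply: expseq_forward => k' k's; rewrite size_map in k's; rewrite -fk.
  apply/eqP; apply: contraT => fn; case: H; exists (x0 + (k'%:R / M%:R) *: w); split=> //; exact: MP.
have := z0 M; rewrite -fk divff ?pnatr_eq0 -?lt0n // scale1r /w addrC subrK => e.
by rewrite e eqxx in fx1.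
Qed.

Lemma gener_generically (HE : qexponential E) L (P : VC -> Prop) : @gener R C n rcC E L P -> generically P.
Proof.
move=> [f [bf nf fP]] O nO oO; have [x [Ox fx]] := bsum_nonzero_dense HE bf nf nO oO.
exists x; split=> //; apply: filterS (open_nbhs_nbhs (conj (bsum_open bf) fx)) => y; exact: fP.
Qed.

Lemma ratio_meromorphic (HE : qexponential E) L L' f g : bsum 0 L f -> bsum 0 L' g -> (exists x, g x != 0) ->
  meromorphic (fun x => f x / g x).
Proof.
move=> bf bg ng p; exists setT, f, g; split=> //.
- by split=> //; exact: openT.
- by move=> x _; exact: bsum_differentiable bf.
- by move=> x _; exact: bsum_differentiable bg.
- move=> x _ B Bx; have [|y [By gy]] := bsum_nonzero_dense HE bg ng (O := B°) _ (@open_interior _ _).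
    by exists x.
  by exists y; split; [split|exact: interior_subset By].
Qed.

Lemma generically_and (P Q : VC -> Prop) : generically P -> generically Q -> generically (fun x => P x /\ Q x).
Proof.
move=> gP gQ O nO oO; have [x [Ox Px]] := gP O nO oO.
have [|y [[Oy Py] Qy]] := gQ (O `&` [set x | P x]°) (ex_intro _ x (conj Ox Px)).
  by apply: openI => //; exact: open_interior.
exists y; split=> //; rewrite (_ : [set _ | _] = [set x | P x] `&` [set x | Q x]) // interiorI; by split.
Qed.

Lemma generically_mono (P Q : VC -> Prop) : (forall x, P x -> Q x) -> generically P -> generically Q.
Proof.
move=> PQ gP O nO oO; have [x [Ox Px]] := gP O nO oO; exists x; split=> //.
by apply: filterS Px.
Qed.

Lemma generically_true (P : VC -> Prop) : (forall x, P x) -> generically P.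
Proof.
move=> H O [x Ox] oO; exists x; split=> //; rewrite (_ : [set _ | _] = setT) ?interiorT //.
by apply/seteqP; split => y _ //=; exact: H.
Qed.

Lemma generically_all (T : eqType) (s : seq T) (P : T -> VC -> Prop) : (forall i, i \in s -> generically (P i)) ->
  generically (fun x => forall i, i \in s -> P i x).
Proof.
elim: s => [|i s IH] H; first exact: generically_true.
apply: generically_mono (generically_and (H i (mem_head _ _)) (IH _)) => [x [h1 h2] j|j js].
  by rewrite inE => /orP[/eqP ->|/h2].
by apply: H; rewrite inE js orbT.
Qed.

Lemma generically_shift (P : VC -> Prop) w : generically P -> generically (fun x => P (x + w)).
Proof.
move=> gP O [x0 Ox0] oO.
have [||y [Oy Py]] := gP ((fun x => x - w) @^-1` O).
- by exists (x0 + w); rewrite /= addrK.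
- by apply: open_comp => // x _; exact: shift_continuous.
exists (y - w); split=> //; have Py' : nbhs (y - w + w) [set x | P x] by rewrite subrK.
exact: (shift_continuous Py').
Qed.

End Topology.

End ComplexTopology.
Import ComplexTopology.

(** * Convex hulls through support functions *)

Module HullCriterion.

Section ConvexHull.
Context {R : realType} {n : nat}.
Local Notation V := ('rV[R]_n).

Lemma dot_sub_sq (h u : V) (s : R) : dot (h - s *: u) (h - s *: u) = dot h h - 2 * (s * dot u h) + s * (s * dot u u).
Proof. by rewrite dotBl !dotBr !dotZl !dotZr (dotC h u); ring. Qed.

Section Points.
Context (k : nat) (p : 'I_k -> V).

Definition simplex : set 'rV[R]_k := [set t | (forall i, 0 <= t 0 i) /\ \sum_i t 0 i = 1].

Lemma simplex_compact : compact simplex.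
Proof.
have cbox : compact [set v : 'rV[R]_k | forall i, `[0, 1]%classic (v ord0 i)].
  by apply: (@rV_compact R k (fun=> `[0, 1]%classic)) => _; exact: segment_compact.
apply: subclosed_compact cbox _; last first.
  move=> t [t0 t1] i /=; rewrite in_itv /= t0 -t1 (bigD1 i) //= lerDl.
  by apply: sumr_ge0 => j _; exact: t0.
have -> : simplex = \bigcap_i ((fun t : 'rV[R]_k => t 0 i) @^-1` [set r | 0 <= r]) `&`
    ((fun t : 'rV[R]_k => \sum_i t 0 i) @^-1` [set 1]).
  apply/seteqP; split => t /= [t0 t1]; split=> //; [by move=> i _; exact: t0|by move=> i; exact: t0].
apply: closedI.
  apply: closed_bigI => i _; apply: closed_comp; last exact: closed_ge.
  by move=> t _; exact: coord_continuous.
apply: closed_comp; last exact: closed_eq.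
move=> t _; apply: differentiable_continuous.
have -> : (fun t : 'rV[R]_k => \sum_i t 0 i) = \sum_i (fun t : 'rV[R]_k => t 0 i).
  by apply/funext => u; rewrite fct_sumE.
by apply: differentiable_sum => i; exact: differentiable_coord.
Qed.

Definition comb (t : 'rV[R]_k) : V := \sum_i t 0 i *: p i.

Lemma dist_continuous (nu : V) : continuous (fun t => dot (nu - comb t) (nu - comb t)).
Proof.
move=> t; apply: differentiable_continuous.
pose g (j : 'I_n) (u : 'rV[R]_k) : R := nu 0 j - \sum_i u 0 i * p i 0 j.
have dg j : differentiable (g j) t.
  have -> : g j = cst (nu 0 j) - \sum_i (p i 0 j *: (fun u : 'rV[R]_k => u 0 i : R)).
    by apply/funext => u; rewrite /g !fctE fct_sumE; congr (_ - _); apply: eq_bigr => i _; rewrite mulrC.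
  apply: differentiableB; first exact: differentiable_cst.
  by apply: differentiable_sum => i; apply: differentiableZ; exact: differentiable_coord.
have -> : (fun t => dot (nu - comb t) (nu - comb t)) = \sum_j (g j * g j).
  apply/funext => u; rewrite fct_sumE dotE; apply: eq_bigr => j _.
  rewrite !mxE summxE /g !fctE; congr (_ * _); congr (_ - _); apply: eq_bigr => i _; by rewrite mxE.
by apply: differentiable_sum => j; apply: differentiableM.
Qed.

(* The point of the hull nearest to nu: if it were not nu itself, the vector joining them would
   separate nu from the hull. *)
Lemma hull_separation (nu : V) : (forall h, exists i, dot nu h <= dot (p i) h) ->
  exists2 t, simplex t & nu = comb t.
Proof.
move=> H; have [i0 _] := H 0.
have s0 : simplex !=set0.
  exists (\row_j (j == i0)%:R); split=> [i|]; first by rewrite mxE ler0n.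
  by rewrite (bigD1 i0) //= mxE eqxx big1 ?addr0 // => i ne; rewrite mxE (negPf ne).
have [c /set_mem [c0 c1] cmin] := EVT_min_rV s0 simplex_compact (continuous_subspaceT (@dist_continuous nu)).
exists c => //; apply/eqP; rewrite -subr_eq0 -dot_sq_eq0; apply: contraT => hn.
set h := nu - comb c in hn; have h0 : 0 < dot h h by rewrite lt_def hn dot_sq_ge0.
have [i hi] := H h; pose u := p i - comb c; pose B := dot u u.
have B0 : 0 <= B by exact: dot_sq_ge0.
have uh : dot h h <= dot u h by rewrite {1}/h /u !dotBl lerD2r.
(* A step towards the i-th point with s <= 1, to stay in the simplex, and s B <= (h, h), so that the
   gain 2 s (u, h) in squared distance outweighs the loss s^2 B. *)
pose s := dot h h / (B + dot h h).
have Bh : 0 < B + dot h h by rewrite ltr_wpDl.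
have sp : 0 < s by rewrite divr_gt0.
have s1 : s <= 1 by rewrite ler_pdivrMr // mul1r lerDr.
have sB : s * B <= dot h h.
  by rewrite mulrAC ler_pdivrMr // ler_pM2l // lerDl ltW.
pose t := \row_j ((1 - s) * c 0 j + s * (j == i)%:R).
have ts : t \in simplex.
  apply/mem_set; split=> [j|]; first by rewrite mxE addr_ge0 //; apply: mulr_ge0; rewrite ?subr_ge0 ?ler0n ?c0 ?(ltW sp).
  rewrite (eq_bigr (fun j => (1 - s) * c 0 j + s * (j == i)%:R)); last by move=> j _; rewrite mxE.
  rewrite big_split /= -!mulr_sumr c1 (bigD1 i) //= eqxx big1 ?addr0 => [|j /negPf -> //].
  by rewrite !mulr1 subrK.
have tE : nu - comb t = h - s *: u.
  have -> : comb t = comb c + s *: u.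
    rewrite /comb (eq_bigr (fun j => (1 - s) *: (c 0 j *: p j) + s *: ((j == i)%:R *: p j))); last first.
      by move=> j _; rewrite mxE [LHS]scalerDl !scalerA.
    rewrite big_split /= -!scaler_sumr.
    have -> : \sum_j (j == i)%:R *: p j = p i.
      by rewrite (bigD1 i) //= eqxx scale1r big1 ?addr0 // => j /negPf ->; rewrite scale0r.
    by rewrite -/(comb c) /u scalerBr scalerBl scale1r addrAC -addrA.
  by rewrite opprD addrA.
have := cmin t ts; rewrite tE -/h dot_sub_sq -/B.
have sB2 : s * (s * B) <= s * dot h h by rewrite ler_pM2l.
have sh : s * dot h h <= s * dot u h by rewrite ler_pM2l.
have shp : 0 < s * dot h h by rewrite mulr_gt0.
by move: sB2 sh shp; set a1 := s * (s * B); set a2 := s * dot h h; set a3 := s * dot u h; lra.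
Qed.

End Points.

Lemma hull_of_bound (A : set V) (nu : V) : finite_set A -> (forall h, exists2 u, A u & dot nu h <= dot u h) ->
  convex_hull A nu.
Proof.
move=> /finite_seqP [s ->] H.
have [h|t [t0 t1] e] := @hull_separation (size s) (fun i => nth 0 s i) nu.
  have [u us le] := H h; have ui : (index u s < size s)%N by rewrite index_mem.
  by exists (Ordinal ui); rewrite /= nth_index.
exists (size s), (fun i => t 0 i), (fun i => nth 0 s i); split=> // i.
by rewrite /= mem_nth.
Qed.

End ConvexHull.

End HullCriterion.
Import HullCriterion.

(** * The operator and its properties over the abstract field *)

Module ShiftExistence.

Section Existence.
Context {R : realType} {C : numClosedFieldType} {n : nat} {rc : {rmorphism R -> C}}.
Context {E : C -> C} (HE : qexponential E).
Context {Phi : {fset 'rV[R]_n}} (HPhi : reduced_irreducible_root_system Phi).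
Context (m : 'rV[R]_n -> nat).
Context (m_refl : forall a b, a \in Phi -> b \in Phi -> m (a *m refl_mx b) = m a).
Local Notation V := ('rV[R]_n).
Local Notation VC := ('rV[C]_n).
Local Notation cv := (cv rc).
Local Notation bsum := (@bsum R C n rc E).
Local Notation csum := (@csum R C n rc E).
Local Notation QIf := (@QIf R C n rc E Phi).
Local Notation rhoh := (@rhoh R n Phi).
Local Notation HN := (@HN R n Phi).
Local Notation regular := (@regular R n Phi).
Local Notation Om := (@Om R n Phi).
Local Notation gener := (@gener R C n rc E).
Implicit Types (x z w : VC) (a b h u v tau : V) (f g : VC -> C) (L : set V).

Local Notation LQ := (@LQ R n Phi).
Local Notation ph := (@ph R C n rc E Phi).

(** Agreement is required for every finite support inside N, not only in the class of rho^vee modulo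
    the coroot lattice: a normalised Baker-Akhiezer function may a priori have any coweight in the
    polytope as exponent. *)
Definition is_ba m' h0 (psi : VC -> VC -> C) := forall T, uniq T -> (forall nu h, nu \in T -> dot nu h <= HN m' h) ->
  rhoh m' h0 \in T -> gener LQ (fun x => forall c, QIf m' (csum x T c) -> c (rhoh m' h0) = ph m' h0 x ->
    forall z, csum x T c z = psi x z).

Context (m_pos : forall a, a \in Phi -> (0 < m a)%N).
Local Notation m1 := (fun a => (m a - 1)%N).
Local Notation one := (fun=> 1%N).
Local Notation Sop := (@Sop R C n rc).
Local Notation Dop := (@Dop R C n rc E Phi).
Local Notation Pz := (@Pz R C n rc E Phi).

Lemma ba_is_ba m' h0 S Nf Hf : (forall a b, a \in Phi -> b \in Phi -> m' (a *m refl_mx b) = m' a) ->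
  regular h0 -> uniq S -> (forall nu, (nu \in S) <-> Om m' 1 h0 nu) ->
  gener LQ (@ba_ok R C n rc E Phi m' S Nf Hf) -> is_ba m' h0 (@bafun R C n rc E S Nf Hf).
Proof.
move=> mr h0r uS SP gok T uT Tb rT.
apply: gener_mono (gener_and HE (@LQD _ _ _) gok (nonres_generic HE HPhi (undup (S ++ T)))) => x [ok nr] c qc cE.
exact: (ba_unique HE HPhi mr h0r uS SP ok uT Tb nr qc rT cE).
Qed.

Lemma shift_operator h0 : regular h0 -> exists (psi psi1 : VC -> VC -> C) (Z : seq V) (Bn : V -> VC -> C) (Bd : VC -> C),
  let b nu x := Bn nu x / Bd x in
  [/\ is_ba m h0 psi /\ is_ba m1 h0 psi1,
      [/\ uniq Z, forall nu, nu \in Z <-> Om one 1 h0 nu & forall nu x, nu \notin Z -> Bn nu x = 0],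
      [/\ forall nu, bsum 0 LQ (Bn nu), bsum 0 LQ Bd & exists x, Bd x != 0],
      gener LQ (fun x => (forall h, regular h -> b (rhoh one h) x * ph m h (x + cv (rhoh one h)) =
        (-1) ^+ size [seq a <- Phi | 0 < dot a h0] * ph m1 h x) /\ ph m h0 (x + cv (rhoh one h0)) != 0) /\
      gener LQ (fun x => forall z, Sop Z b (psi ^~ z) x = Pz m h0 z * psi1 x z) &
      forall p Wp, quasi_or_minuscule Phi p -> uniq Wp -> (forall tau, (tau \in Wp) <-> weyl_orbit Phi p tau) ->
        gener LQ (fun x => forall f, Dop h0 Wp m1 (Sop Z b f) x = Sop Z b (Dop h0 Wp m f) x)].
Proof.
move=> h0r; have m1r := m1_refl m_refl; have mpr := mp_refl m_refl.
have [S [Nf [Hf [uS SP [bN bH] ok val]]]] := @ba_exists R C n rc E HE Phi HPhi m m_refl h0 h0r.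
have [S1 [Nf1 [Hf1 [uS1 S1P [bN1 bH1] ok1 val1]]]] := @ba_exists R C n rc E HE Phi HPhi m1 m1r h0 h0r.
have [Z uZ ZP] := Om_enum HPhi (@one_refl R n Phi) 1 h0.
have [T uT TP] := Om_enum HPhi mpr 1 h0.
have [Bs [pc [_ PE]]] := @P_coef R C n rc E HE Phi HPhi m m_pos h0 h0r S1 uS1 S1P Nf1 Hf1 T uT TP.
have gok : gener LQ (@op_ok R C n rc E Phi m h0 S Nf Hf S1 Nf1 Hf1 Z T) by exact: (op_ok_generic HE HPhi).
exists (@bafun R C n rc E S Nf Hf), (@bafun R C n rc E S1 Nf1 Hf1), Z,
  (@Bn R C n rc Phi m h0 S Nf Hf S1 Nf1 Z Bs pc), (@Bd R C n rc Phi m h0 S Nf Hf1 Z) => b.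
have gmain : gener LQ (fun x => forall z, Sop Z b (@bafun R C n rc E S Nf Hf ^~ z) x = Pz m h0 z * @bafun R C n rc E S1 Nf1 Hf1 x z).
  apply: gener_mono gok => x ok' z; exact: (op_main HE HPhi m_refl m_pos h0r uS SP uZ ZP uT TP PE z ok').
split.
- by split; apply: ba_is_ba.
- by split=> // nu x nZ; exact: Bn_out.
- split=> [nu||]; first exact: (Bn_bsum HE m h0 S bN bH S1 bN1 Z Bs pc nu).
    exact: (Bd_bsum HE m h0 S bN bH1 Z).
  have [x ok'] := gener_ex gok; exists x; rewrite mulf_neq0 //; first exact: (Mx_unit HPhi m_refl h0r SP uZ ok').
  by have [_ [H1 _ _ _] _ _] := ok'.
- split=> //; apply: gener_mono gok => x ok'; split=> [h hr|].
    exact: (op_lead HE HPhi m_refl m_pos h0r uS SP uS1 S1P uZ ZP uT TP PE ok' hr).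
  have [_ _ H _] := ok'; apply: H; exact: (rhoh_Z HPhi h0r ZP h0r).
move=> p Wp hp uW WP.
have e := mac_eigen HE HPhi m_refl hp uW WP h0r uS SP ok val.
have e1 := mac_eigen HE HPhi m1r hp uW WP h0r uS1 S1P ok1 val1.
exact: (intertwining HE HPhi m_refl h0r uS SP ok e e1 gmain).
Qed.

End Existence.

End ShiftExistence.
Import ShiftExistence.

(** * Translation into the terms of the theorem *)

Section Assembly.
Context {R : realType} {n : nat} {lq : Cplx R}.
Local Notation C := (Cplx R).
Local Notation E := (qpow lq).
Context (HE : qexponential E).
Context {Phi : {fset 'rV[R]_n}} (HPhi : reduced_irreducible_root_system Phi).
Local Notation V := ('rV[R]_n).
Local Notation VC := ('rV[C]_n).
Local Notation cv := (cv (@rcC R)).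
Local Notation bsum := (@bsum R C n (@rcC R) E).
Local Notation csum := (@csum R C n (@rcC R) E).
Local Notation EE := (@EE C n E).
Local Notation ph := (@ph R C n (@rcC R) E Phi).
Local Notation rhoh := (@rhoh R n Phi).
Local Notation rhor := (@rhor R n Phi).
Local Notation HN := (@HN R n Phi).
Local Notation regular := (@regular R n Phi).
Local Notation Om := (@Om R n Phi).
Local Notation gener := (@gener R C n (@rcC R) E).
Local Notation Sop := (@Sop R C n (@rcC R)).
Local Notation Dop := (@Dop R C n (@rcC R) E Phi).
Local Notation Pz := (@Pz R C n (@rcC R) E Phi).
Local Notation is_ba := (@is_ba R C n (@rcC R) E Phi).
Local Notation one := (fun=> 1%N).
Implicit Types (x z : VC) (a b h nu v tau : V).

Context (h0 : V) (h0r : regular h0).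
Local Notation Rp := [fset a in Phi | 0 < dot a h0]%fset.

Lemma big_positive (T : Type) (idx : T) (op : Monoid.com_law idx) (F : V -> T) :
  \big[op/idx]_(a <- Rp) F a = \big[op/idx]_(a <- Phi | 0 < dot a h0) F a.
Proof.
rewrite -[RHS]big_filter; apply: perm_big; apply: uniq_perm; rewrite ?fset_uniq ?filter_uniq ?fset_uniq // => a.
by rewrite mem_filter !inE /= andbC.
Qed.

Lemma card_positive : #|` Rp| = size [seq a <- Phi | 0 < dot a h0].
Proof.
apply: perm_size; apply: uniq_perm; rewrite ?fset_uniq ?filter_uniq ?fset_uniq // => a.
by rewrite mem_filter !inE /= andbC.
Qed.

Lemma varrho_rhoh : varrho_vee Rp = rhoh one h0.
Proof. by rewrite /varrho_vee big_positive /RootSystems.rhoh; congr (_ *: _); apply: eq_bigr => a _; rewrite scale1r. Qed.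

Lemma rho_vee_rhoh m : rho_vee Rp m = rhoh m h0.
Proof. by rewrite /rho_vee big_positive. Qed.

Lemma rho_rhor m : rho Rp m = rhor m h0.
Proof. by rewrite /rho big_positive. Qed.

Lemma weyl_orbit_finite v : finite_set (weyl_orbit Phi v).
Proof. exact: finite_image (weyl_finite HPhi). Qed.

Lemma weyl_orbit_enum v : exists2 W, uniq W & forall u : V, u \in W <-> weyl_orbit Phi v u.
Proof.
have /finite_seqP[W e] := weyl_orbit_finite v.
exists (undup W); first exact: undup_uniq.
by move=> u; rewrite mem_undup e.
Qed.

Lemma fsbig_enum (A : set V) (W : seq V) (F : V -> C) : uniq W -> (forall u, u \in W <-> A u) ->
  \sum_(u \in A) F u = \sum_(u <- W) F u.
Proof.
move=> uW WP; have -> : A = [set` W] by apply/seteqP; split => u /= /WP.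
by symmetry; exact: fsbig_seq.
Qed.

Lemma macdonald_Dop p m W (f : VC -> C) x : uniq W -> (forall u, u \in W <-> weyl_orbit Phi p u) ->
  macdonald lq Phi Rp p m f x = Dop h0 W m f x.
Proof.
by move=> uW WP; rewrite /macdonald !(fsbig_enum _ uW WP) rho_rhor.
Qed.

Lemma op_apply_Sop Z (b : V -> VC -> C) (f : VC -> C) x : uniq Z -> (forall nu y, nu \notin Z -> b nu y = 0) ->
  op_apply b f x = Sop Z b f x.
Proof.
move=> uZ bZ; rewrite /op_apply /OperatorIntertwining.Sop -[RHS](fsbig_enum (A := [set` Z])) //.
apply: fsbig_widen => nu /=.
  by apply: contra_notT => nZ; apply/funext => y; rewrite bZ.
by move=> [_ /contrapT ->]; rewrite mul0r.
Qed.

Lemma rhoh_orbit h : regular h -> weyl_orbit Phi (rhoh one h0) (rhoh one h).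
Proof.
move=> hr; have [w hw e] := regular_transitive HPhi h0r hr.
exists w => //=; rewrite -(rhoh_weyl HPhi (@one_refl R n Phi) h0 hw).
by symmetry; exact: rhoh_ext.
Qed.

Lemma Om_hull nu : Om one 1 h0 nu -> convex_hull (weyl_orbit Phi (rhoh one h0)) nu.
Proof.
move=> [_ H]; apply: (hull_of_bound (weyl_orbit_finite _)) => h.
have [g gr e] := HN_attained HPhi (@one_refl R n Phi) h.
exists (rhoh one g); first exact: rhoh_orbit.
by rewrite -e; have := H h; rewrite mul1r.
Qed.

Lemma Om_coweight nu : Om one 1 h0 nu -> coweight_lattice Phi nu.
Proof.
move=> [H _] a ha; have [k e] := Qv_int HPhi H ha; have [j e'] := rhoh_int HPhi (@one_refl R n Phi) h0r ha.
by apply/intrP; exists (k + j); rewrite -(subrK (rhoh one h0) nu) dotDl e e' intrD.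
Qed.

(** Since q^{-X} - q^{-2j + X} = q^{-j} [j - X], Delta is the inverse of the leading coefficient up
    to a power of q. *)
Lemma Delta_neg_ph m x :
  Delta_neg lq Rp m x = (\prod_(a <- Rp) \prod_(1 <= j < (m a).+1) E j%:R) / ph m h0 x.
Proof.
rewrite /Delta_neg /VertexCoefficients.ph !big_positive -prodfV -big_split; apply: eq_bigr => a _ /=.
rewrite /wprod -prodfV -big_split; apply: eq_big_nat => j _ /=.
set X := dot _ _; rewrite /qn -[RHS]invrK invf_div; congr (_^-1).
rewrite mulrBl -!(qexpN HE) -!(qexpD HE); congr (_ - _); congr (E _); ring.
Qed.

(** For each root the factor j = m_a is present at level m and absent at level m - 1; these factors
    make up the power of q in the leading coefficient of S. *)
Lemma prod_E_shift m : (forall a, a \in Phi -> (0 < m a)%N) ->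
  \prod_(a <- Rp) \prod_(1 <= j < (m a).+1) E j%:R =
  E (\sum_(a <- Rp) m a)%:R * \prod_(a <- Rp) \prod_(1 <= j < (m a - 1).+1) E j%:R :> C.
Proof.
move=> m_pos; have -> : E (\sum_(a <- Rp) m a)%:R = \prod_(a <- Rp) E (m a)%:R.
  rewrite natr_sum; apply: (big_morph E (qexpD HE)); exact: qexp0 HE.
rewrite -big_split /= big_seq [RHS]big_seq; apply: eq_bigr => a; rewrite !inE /= => /andP[/m_pos ma _].
by rewrite -{1}(subnK ma) addn1 big_nat_recr //= mulrC -addn1 subnK.
Qed.

Lemma prod_E_neq0 m : \prod_(a <- Rp) \prod_(1 <= j < (m a).+1) E j%:R != 0 :> C.
Proof. by rewrite prodf_seq_neq0; apply/allP => a _ /=; rewrite prodf_seq_neq0; apply/allP => j _; exact: qexp_neq0 HE _. Qed.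

Lemma leading_Delta m (s B : C) x v : (forall a, a \in Phi -> (0 < m a)%N) ->
  ph m h0 (x + cv v) != 0 -> B * ph m h0 (x + cv v) = s * ph (fun a => (m a - 1)%N) h0 x ->
  B = s * E (- (\sum_(a <- Rp) m a)%:R) *
    (Delta_neg lq Rp m (x + cvec v) / Delta_neg lq Rp (fun a => (m a - 1)%N) x).
Proof.
move=> m_pos p0 e; rewrite !Delta_neg_ph prod_E_shift // (qexpN HE).
have e1 := prod_E_neq0 (fun a => (m a - 1)%N); have e2 := qexp_neq0 HE (\sum_(a <- Rp) m a)%:R.
rewrite invf_div; apply: (mulIf p0); rewrite e -[cvec v]/(cv v).
have id (c d p p1 : C) : c != 0 -> d != 0 -> p != 0 -> s * p1 = s / d * (d * c / p * (p1 / c)) * p.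
  by move=> n1 n2 n3; field; rewrite n1 n2 n3.
exact: id.
Qed.

Lemma dot_cv_mulmx v x (w : 'M[R]_n) : dot (cv v) (x *m map_mx (@rcC R) w) = dot (cv (v *m w^T)) x.
Proof. by rewrite /dot trmx_mul mulmxA map_trmx /ExponentialSums.cv map_mxM. Qed.

Lemma gener_weyl (L : set V) (P : VC -> Prop) (w : 'M[R]_n) : weyl Phi w -> gener L P ->
  gener setT (fun x => P (x *m map_mx (@rcC R) (invmx w))).
Proof.
move=> /(weyl_invmx HPhi)[_ [ww _]] [f [[s [sL fE]] [x0 f0] fP]].
have bf : bsum 0 setT f by exists s.
exists (fun x => f (x *m map_mx (@rcC R) (invmx w) + 0)); split.
- by apply: (bsum_comp HE) => // v; exists (v *m (invmx w)^T) => x; exact: dot_cv_mulmx.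
- exists (x0 *m map_mx (@rcC R) w).
  by rewrite -mulmxA -map_mxM ww map_mx1 mulmx1 addr0.
- by move=> x; rewrite addr0; exact: fP.
Qed.

(** Along the positive coroots the point has coordinates m_a/2 - l_a, of absolute value at most
    m_a/2. *)
Lemma polytope_bound m nu h : (forall a b, a \in Phi -> b \in Phi -> m (a *m refl_mx b) = m a) ->
  BA_polytope Rp m nu -> dot nu h <= HN m h.
Proof.
move=> mr [l [lP ->]]; rewrite (HN_split HPhi mr h h0r) /rho_vee dotBl dotZl !dot_suml mulr_sumr -sumrB.
rewrite -big_positive mulr_sumr big_seq [leRHS]big_seq; apply: ler_sum => a aR.
have /andP[l0 lm] := lP a aR; rewrite (dotZl (m a)%:R) (dotZl (l a)); set X := dot (coroot a) h; set M : R := (m a)%:R.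
have -> : 2^-1 * (M * X) - l a * X = (2^-1 * M - l a) * X by ring.
have hl : `|2^-1 * M - l a| <= 2^-1 * M by rewrite ler_norml; apply/andP; split; rewrite /M; lra.
by apply: (le_trans (ler_norm _)); rewrite normrM mulrA ler_wpM2r.
Qed.

Lemma HN_sum_bound m a nu : a \in Phi -> (forall h, dot nu h <= HN m h) -> `|dot nu a| <= \sum_(b <- Phi) HN m b.
Proof.
have HN0 b : 0 <= HN m b by apply: mulr_ge0 => //; apply: sumr_ge0 => c _; rewrite mulr_ge0.
move=> ha H; rewrite (big_rem a) //=; apply: (le_trans _ (ler_wpDr _ _)); first last.
- exact: lexx.
- by apply: sumr_ge0.
rewrite ler_norml; apply/andP; split; last exact: H.
have := H (- a); rewrite dotNr lerNl => h; apply: le_trans h.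
by rewrite lerN2 /RootSystems.HN; under eq_bigr do rewrite dotNr normrN.
Qed.

(** The coweights in the polytope are finitely many by [int_points_enum] and serve as the support in
    [is_ba]; the remaining clauses of the definition are its hypotheses. *)
Lemma normalized_is_ba m (psi psi0 : VC -> VC -> C) :
  (forall a b, a \in Phi -> b \in Phi -> m (a *m refl_mx b) = m a) ->
  is_ba m h0 psi0 -> normalized_BA lq Phi Rp m psi -> generically (fun x => forall z, psi x z = psi0 x z).
Proof.
move=> mr B [psi_ H].
pose A := BA_polytope Rp m `&` coweight_lattice Phi.
have AB nu h : A nu -> dot nu h <= HN m h by case=> + _; exact: polytope_bound.
have [|T uT TP] := @int_points_enum R n Phi HPhi 0 A (\sum_(b <- Phi) HN m b).
  move=> nu a nA ha; split; first by rewrite subr0; have [_ /(_ a ha)/intrP] := nA.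
  by apply: HN_sum_bound => // h; exact: AB.
have rT : rhoh m h0 \in T.
  apply/TP; split; last first.
    by move=> a ha; have [k e] := rhoh_int HPhi mr h0r ha; apply/intrP; exists k.
  exists (fun=> 0); split=> [a _|]; first by rewrite lexx ler0n.
  by rewrite big1 ?subr0 ?rho_vee_rhoh // => a _; rewrite scale0r.
have gB := gener_generically HE (B T uT (fun nu h nT => AB nu h ((TP nu).1 nT)) rT).
apply: generically_mono (generically_and H gB) => x [[e1 e2 e3] hB] z.
have pE z' : psi x z' = csum x T (psi_^~ x) z'.
  by rewrite e1 (csumE HE) /ExponentialSums.EE (fsbig_enum _ uT TP).
rewrite pE; apply: hB.
- move=> a s z' ha hs Gz; rewrite -!pE; exact: e2.
- by rewrite -rho_vee_rhoh e3 big_positive.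
Qed.

Lemma c_factor_Pz m z : c_factor lq Rp m z * c_factor lq Rp m (- z) = Pz m h0 z.
Proof.
rewrite /c_factor -big_split /= big_positive; apply: eq_bigr => a _.
by rewrite dotNr opprK; exact: (@ffE R C n (@rcC R) E HE m a z).
Qed.

End Assembly.

Theorem proposition5p8 (R : realType) (n : nat)
    (q lq : Cplx R) (q_neq0 : q != 0) (q_log : cexp lq = q)
    (q_nroot : forall k : nat, (0 < k)%N -> q ^+ k != 1)
    (Phi Rp : {fset 'rV[R]_n})
    (Phi_root : reduced_irreducible_root_system Phi)
    (Rp_pos : positive_roots Phi Rp)
    (m : 'rV[R]_n -> nat)
    (m_pos : forall a, a \in Phi -> (0 < m a)%N)
    (m_inv : forall a w, a \in Phi -> weyl Phi w -> m (a *m w) = m a) :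
  let m1 := fun a => (m a - 1)%N in
  let varrho := varrho_vee Rp in
  exists b : 'rV[R]_n -> 'rV[Cplx R]_n -> Cplx R,
  let S := op_apply b in
  [/\ difference_operator Phi b,
      forall p, quasi_or_minuscule Phi p ->
        op_eq (macdonald lq Phi Rp p m1 \o S) (S \o macdonald lq Phi Rp p m),
      forall nu, op_support b nu ->
        coroot_lattice Phi (nu - varrho) /\
        convex_hull (weyl_orbit Phi varrho) nu,
      generically (fun x => b varrho x =
        (-1) ^+ #|` Rp| * qpow lq (- (\sum_(a <- Rp) m a)%:R) *
        (Delta_neg lq Rp m (x + cvec varrho) / Delta_neg lq Rp m1 x)) /\
      (forall w, weyl Phi w ->
        generically (fun x => b (varrho *m w) x =
          b varrho (x *m map_mx (real_complex R) (invmx w))))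
    & forall psi_m psi_m1 : 'rV[Cplx R]_n -> 'rV[Cplx R]_n -> Cplx R,
        normalized_BA lq Phi Rp m psi_m ->
        normalized_BA lq Phi Rp m1 psi_m1 ->
        generically (fun x => forall z,
          S (fun y => psi_m y z) x =
          c_factor lq Rp m z * c_factor lq Rp m (- z) * psi_m1 x z)].
Proof.
move=> m1 varrho; rewrite {}/varrho.
have HE := qexponential_qpow q_neq0 q_log q_nroot.
have [h0 [h0r ->]] := Rp_pos.
have m_refl (a c : 'rV[R]_n) : a \in Phi -> c \in Phi -> m (a *m refl_mx c) = m a.
  by move=> ha hc; apply: m_inv => //; exact: weyl_refl.
have [psi [psi1 [Z [Bn [Bd [[bpsi bpsi1] [uZ ZP BnZ] [bBn bBd nBd] [glead gmain] gint]]]]]] :=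
  @shift_operator R (Cplx R) n (@rcC R) (qpow lq) HE Phi Phi_root m m_refl m_pos h0 h0r.
rewrite varrho_rhoh; pose b nu x := Bn nu x / Bd x; exists b.
have bZ nu y : nu \notin Z -> b nu y = 0 by move=> nZ; rewrite /b BnZ // mul0r.
have SE f x : op_apply b f x = OperatorIntertwining.Sop (rc := @rcC R) Z b f x by exact: op_apply_Sop.
have suppZ nu : op_support b nu -> nu \in Z.
  by apply: contra_notT => nZ; apply/funext => y; rewrite bZ.
split.
- split=> [|nu /suppZ/ZP|nu]; last exact: (ratio_meromorphic HE (bBn nu) bBd nBd).
    by apply: (sub_finite_set (B := [set` Z])) => [nu /suppZ|]; last exact: finite_seq.
  exact: Om_coweight.
- move=> p hp; have [W uW WP] := weyl_orbit_enum Phi_root p.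
  apply: generically_mono (gener_generically HE (gint p W hp uW WP)) => x H f /=.
  rewrite (macdonald_Dop h0 _ _ _ uW WP) SE.
  have -> : op_apply b f = OperatorIntertwining.Sop (rc := @rcC R) Z b f by apply/funext => y; exact: SE.
  rewrite [LHS]H; congr (OperatorIntertwining.Sop _ _ _ _); apply/funext => y.
  by rewrite (macdonald_Dop h0 _ _ _ uW WP).
- move=> nu /suppZ/ZP hnu; split; last exact: Om_hull.
  by case: hnu.
- split.
    apply: generically_mono (gener_generically HE glead) => x [H p0].
    rewrite (card_positive h0); exact: (leading_Delta HE m_pos p0 (H h0 h0r)).
  (* By equivariance of [ph] the leading equation for the chamber of [h0 *m w] at x has the same
     right-hand side and the same factor as the one for [h0] at the point moved by the inverse of w;
     cancelling the factor compares the coefficients. *)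
  move=> w hw; have [hi [wi iw]] := weyl_invmx Phi_root hw.
  have gw := gener_generically HE (gener_weyl HE Phi_root hw glead).
  apply: generically_mono (generically_and (gener_generically HE glead) gw) => x [[H _] [H' p0]].
  have gr : RootSystems.regular (Phi := Phi) (h0 *m w) by exact: regular_weyl.
  have := H _ gr; have := H' _ h0r.
  rewrite (rhoh_weyl Phi_root (@one_refl R n Phi) h0 hw) (ph_weyl Phi_root m_refl _ _ hw)
    (ph_weyl Phi_root (m1_refl m_refl) _ _ hw).
  have -> (v : 'rV[R]_n) : (x + ExponentialSums.cv (@rcC R) (v *m w)) *m map_mx (@rcC R) (invmx w) =
    x *m map_mx (@rcC R) (invmx w) + ExponentialSums.cv (@rcC R) v.
    by rewrite mulmxDl /ExponentialSums.cv -map_mxM -mulmxA wi mulmx1.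
  by move=> <- /(mulIf p0).
- move=> psi_m psi_m1 npsi npsi1.
  have g0 := normalized_is_ba HE Phi_root h0r m_refl bpsi npsi.
  have g1 := normalized_is_ba HE Phi_root h0r (m1_refl m_refl) bpsi1 npsi1.
  (* The operator evaluates [psi_m] at the points x + nu, so genericity is imposed at all of
     them. *)
  have gZ : generically (fun x => forall nu, nu \in Z -> forall z, psi_m (x + cvec nu) z = psi (x + cvec nu) z).
    by apply: generically_all => nu _; exact: generically_shift g0.
  apply: generically_mono (generically_and (generically_and gZ g1) (gener_generically HE gmain)) => x [[hZ h1] hm] z.
  rewrite SE (c_factor_Pz HE) h1 -hm /OperatorIntertwining.Sop big_seq [RHS]big_seq; apply: eq_bigr => nu hnu.
  by congr (_ * _); exact: hZ.
Qed.
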